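(* Let $\vartheta$ be a primitive, geometrically compatible and recognisable random substitution, and for $n\in\mathbb N_0$ let $Q_n=Q(\mathbf P^{n,1})$ be the $n$-productivity geometric substitution matrix. Then there is a unique uniformity measure $\mu_{\mathrm u}$ if and only if the sequence $(Q_n)_{n\in\mathbb N_0}$ is ergodic in inverse time. In this case $(Y_\vartheta,T)$ is intrinsically ergodic and its unique measure of maximal entropy is the lift $\widetilde{\mu_{\mathrm u}}$.
   Context: Standing assumptions: $\mathcal A$ finite alphabet; $\vartheta$ a random substitution (letters to non-empty finite sets of non-empty words, extended to words by concatenation), $\vartheta^n$ its $n$-fold composition, $X_\vartheta$ its subshift with shift $S$. Primitive: some marginal (choice $\theta(a)\in\vartheta(a)$) of some $\vartheta^n$ has primitive substitution matrix $M_{ab}=|\theta(b)|_a$. Geometrically compatible: some $\lambda>1$ and positive row vector $L$ with $LM=\lambda L$ for the substitution matrix of every marginal; $L(w)=\sum_aL_a|w|_a$. Recognisable: every $y\in X_\vartheta$ has a unique decomposition $S^{-k}y=\cdots v_{-1}.v_0v_1\cdots$ with $x\in X_\vartheta$, $v_i\in\vartheta(x_i)$, $0\le k<|v_0|$ (then every $\vartheta^n$ is recognisable). $\mathcal M$: shift-invariant Borel probability measures on $X_\vartheta$. The geometric hull $(Y_\vartheta,T)$ is the suspension flow over $(X_\vartheta,S)$ with roof $x\mapsto L_{x_0}$; $\widetilde\mu=(\mu\times\mathrm{Leb})|_{Y_\vartheta}$ normalised is the lift of $\mu\in\mathcal M$. Uniformity measure: for $(y,s)\in Y_\vartheta$ and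 $n\in\mathbb N$, its level-$n$ recognisability data is the unique $(x,t,(v_i))$ with $v_i\in\vartheta^n(x_i)$, $0\le t<L(v_0)$, $(y,s)=T_t(\cdots v_{-1}.v_0v_1\cdots,0)$; for a permutation $\alpha$ of $\vartheta^n(a)$ the shuffle $f_\alpha(y,s)=T_t(\cdots w_{-1}.w_0\cdots,0)$ with $w_i=\alpha(v_i)$ if $x_i=a$, $w_i=v_i$ otherwise; $\mu\in\mathcal M$ is a uniformity measure if $\widetilde\mu\circ f_\alpha=\widetilde\mu$ for all such $n,a,\alpha$. The $n$-productivity distribution is the probability choice $\mathbf P^{n,1}_{v,a}=\#\vartheta^n(v)/\#\vartheta^{n+1}(a)$ for $v\in\vartheta(a)$. For a probability choice $\mathbf P$, $M(\mathbf P)_{ab}=\sum_{v\in\vartheta(b)}\mathbf P_{v,b}|v|_a$ and $Q(\mathbf P)_{ab}=L_aM(\mathbf P)_{ab}/(\lambda L_b)$. A sequence of column-stochastic matrices $(P_n)$ is ergodic in inverse time if for each $n$ there is a probability vector $\pi^n$ with $\lim_{k\to\infty}P_nP_{n+1}\cdots P_{n+k}=\pi^n\mathbf 1^T$. Intrinsically ergodic means there is a unique measure of maximal entropy. *)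

(* Defs.v *)
From HB Require Import structures.
From mathcomp Require Import all_boot all_order all_algebra.
From mathcomp Require Import all_classical all_reals all_analysis.

Set Implicit Arguments.
Unset Strict Implicit.
Unset Printing Implicit Defensive.

Import Order.TTheory GRing.Theory Num.Theory.
Import numFieldNormedType.Exports.
Local Open Scope classical_set_scope.
Local Open Scope ring_scope.

(* 'I_n.+1 is pointed by ord0 (needed for the measurable structures) *)
HB.instance Definition _ (n : nat) := isPointed.Build 'I_n.+1 ord0.

Section RandomSubstitution.
Variable d : nat.

Definition word := seq 'I_d.+1.

(* a random substitution: each letter is sent to a finite set of words,
   represented by a duplicate-free list *)
Definition rsubst := 'I_d.+1 -> seq word.

Definition is_rsubst (th : rsubst) : Prop :=
  forall a, [/\ th a != [::], uniq (th a) & all (fun v => v != [::]) (th a)].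

Definition word_img (S : 'I_d.+1 -> seq word) (w : word) : seq word :=
  foldr (fun a acc => undup [seq u ++ v | u <- S a, v <- acc]) [:: [::]] w.

Fixpoint theta_pow (th : rsubst) (n : nat) : 'I_d.+1 -> seq word :=
  match n with
  | 0 => fun a => [:: [:: a]]
  | n'.+1 => fun a => undup (flatten [seq word_img (theta_pow th n') v | v <- th a])
  end.

Definition marginal (S : 'I_d.+1 -> seq word) (theta : 'I_d.+1 -> word) : Prop :=
  forall a, theta a \in S a.

Definition subst_mx (theta : 'I_d.+1 -> word) (a b : 'I_d.+1) : nat :=
  count_mem a (theta b).

Fixpoint nmx_pow (M : 'I_d.+1 -> 'I_d.+1 -> nat) (k : nat) (i j : 'I_d.+1) : nat :=
  match k with
  | 0 => (i == j : nat)
  | k'.+1 => (\sum_(l < d.+1) nmx_pow M k' i l * M l j)%N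
  end.

Definition primitive_mx (M : 'I_d.+1 -> 'I_d.+1 -> nat) : Prop :=
  exists k, (0 < k)%N /\ forall i j, (0 < nmx_pow M k i j)%N.

Definition primitive_rs (th : rsubst) : Prop :=
  exists n theta, marginal (theta_pow th n) theta /\ primitive_mx (subst_mx theta).

Definition geom_compat {R : realType} (th : rsubst) (lam : R) (L : 'I_d.+1 -> R) :
  Prop :=
  [/\ 1 < lam, (forall a, 0 < L a) &
      forall theta, marginal th theta ->
        forall b, \sum_(a < d.+1) L a * (subst_mx theta a b)%:R = lam * L b].

Definition Lw {R : realType} (L : 'I_d.+1 -> R) (w : word) : R := \sum_(a <- w) L a.

Definition config := int -> 'I_d.+1.

Definition shift (x : config) : config := fun m => x (m + 1)%R.
Definition shiftn (k : int) (x : config) : config := fun m => x (m + k)%R.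

Definition legal (th : rsubst) (w : word) : Prop :=
  exists n a u, u \in theta_pow th n a /\ infix w u.

Definition Xth (th : rsubst) : set config :=
  [set x | forall (i : int) (m : nat),
      legal th [seq x (i + j%:Z)%R | j <- iota 0 m]].

(* z = ... v_(-1) . v_0 v_1 ...  (v_0 starting at position 0) *)
Definition concat_at (v : int -> word) (z : config) : Prop :=
  exists p : int -> int,
    [/\ p 0 = 0,
        (forall i, p (i + 1) = p i + (size (v i))%:Z) &
        forall i (j : nat), (j < size (v i))%N -> Some (z (p i + j%:Z)) = onth (v i) j].

Definition recog_rel (th : rsubst) (y x : config) (k : nat) (v : int -> word) : Prop :=
  [/\ Xth th x, (forall i, v i \in th (x i)), (k < size (v 0))%N &
      concat_at v (shiftn (- k%:Z) y)].

Definition recognisable (th : rsubst) : Prop :=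
  forall y, Xth th y ->
    exists x k v, recog_rel th y x k v /\
      forall x' k' v', recog_rel th y x' k' v' -> [/\ x' = x, k' = k & v' = v].

(* (= Borel sigma-algebra of the product topology on 'I_d.+1^Z)           *)
Definition cylinders : set (set config) :=
  [set C | exists (i : int) (a : 'I_d.+1), C = [set x | x i = a]].

Definition Xsp : measurableType _ := g_sigma_algebraType cylinders.

Definition in_M {R : realType} (th : rsubst) (mu : probability Xsp R) : Prop :=
  mu (Xth th : set Xsp) = 1%E /\
  forall B : set Xsp, measurable B -> mu (shift @^-1` B) = mu B.

Section Hull.
Variable R : realType.

Definition Ysp : measurableType _ := (Xsp * measurableTypeR R)%type.

Definition Yset (th : rsubst) (L : 'I_d.+1 -> R) : set Ysp :=
  [set p | Xth th p.1 /\ 0 <= p.2 < L (p.1 0)].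

Definition Rsum (L : 'I_d.+1 -> R) (x : config) (m : int) : R :=
  match m with
  | Posz n => \sum_(j < n) L (x j%:Z)
  | Negz n => - \sum_(j < n.+1) L (x (- (j.+1)%:Z))
  end.

Definition flow_rel (L : 'I_d.+1 -> R) (p : Ysp) (t : R) (q : Ysp) : Prop :=
  exists m : int, [/\ q.1 = shiftn m p.1, q.2 = p.2 + t - Rsum L p.1 m &
                      0 <= q.2 < L (q.1 0)].

Definition flow_pre (L : 'I_d.+1 -> R) (t : R) (B : set Ysp) : set Ysp :=
  [set p | exists q, flow_rel L p t q /\ B q].

Definition hull_lift (th : rsubst) (L : 'I_d.+1 -> R) (mu : probability Xsp R)
    (B : set Ysp) : \bar R :=
  ((mu \x lebesgue_measure) (B `&` Yset th L) *
   ((fine ((mu \x lebesgue_measure) (Yset th L)))^-1)%:E)%E.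

Definition rdata (th : rsubst) (L : 'I_d.+1 -> R) (n : nat) (p : Ysp)
    (x : config) (t : R) (v : int -> word) : Prop :=
  [/\ Yset th L p, Xth th x, (forall i, v i \in theta_pow th n (x i)),
      0 <= t < Lw L (v 0) &
      exists z, concat_at v z /\ flow_rel L (z, 0) t p].

Definition shuffle_rel (th : rsubst) (L : 'I_d.+1 -> R) (n : nat) (a : 'I_d.+1)
    (alpha : word -> word) (p q : Ysp) : Prop :=
  exists x t v z', [/\ rdata th L n p x t v,
     concat_at (fun i => if x i == a then alpha (v i) else v i) z' &
     flow_rel L (z', 0) t q].

Definition perm_of (S : seq word) (alpha : word -> word) : Prop :=
  {in S, forall v, alpha v \in S} /\ {in S &, injective alpha}.

Definition uniformity (th : rsubst) (L : 'I_d.+1 -> R) (mu : probability Xsp R) : Prop :=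
  in_M th mu /\
  forall n a alpha, perm_of (theta_pow th n a) alpha ->
    forall B : set Ysp, measurable B ->
      hull_lift th L mu [set q | exists2 p, B p & shuffle_rel th L n a alpha p q]
      = hull_lift th L mu B.

Definition unique_uniformity (th : rsubst) (L : 'I_d.+1 -> R) : Prop :=
  exists mu, uniformity th L mu /\
    forall mu', uniformity th L mu' ->
      forall B : set Xsp, measurable B -> mu' B = mu B.

Definition Pprod (th : rsubst) (n : nat) (v : word) (a : 'I_d.+1) : R :=
  (size (word_img (theta_pow th n) v))%:R / (size (theta_pow th n.+1 a))%:R.

Definition Mprob (P : word -> 'I_d.+1 -> R) (th : rsubst) (a b : 'I_d.+1) : R :=
  \sum_(v <- th b) P v b * (count_mem a v)%:R.

Definition Qprod (th : rsubst) (lam : R) (L : 'I_d.+1 -> R) (n : nat) : 'M[R]_d.+1 :=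
  \matrix_(a, b) (L a * Mprob (Pprod th n) th a b / (lam * L b)).

Fixpoint mx_prod_from (P : nat -> 'M[R]_d.+1) (n k : nat) : 'M[R]_d.+1 :=
  match k with
  | 0 => P n
  | k'.+1 => mx_prod_from P n k' *m P (n + k'.+1)%N
  end.

Definition ergodic_inverse_time (P : nat -> 'M[R]_d.+1) : Prop :=
  forall n, exists pi : 'I_d.+1 -> R,
    [/\ (forall i, 0 <= pi i), \sum_(i < d.+1) pi i = 1 &
        forall i j, (fun k => mx_prod_from P n k i j) @ \oo --> pi i].

(* Kolmogorov-Sinai entropy of the flow (= entropy of its time-1 map)  *)
Definition flow_invariant (th : rsubst) (L : 'I_d.+1 -> R) (nu : probability Ysp R) :
  Prop :=
  nu (Yset th L) = 1%E /\
  forall (t : R) (B : set Ysp), measurable B -> nu (flow_pre L t B) = nu B.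

Definition is_partition (k : nat) (xi : 'I_k -> set Ysp) : Prop :=
  [/\ (forall i, measurable (xi i)),
      (forall i j, i != j -> xi i `&` xi j = set0) &
      \bigcup_(i in [set: 'I_k]) xi i = [set: Ysp]].

Definition entf (x : R) : R := if x == 0 then 0 else - (x * ln x).

Definition H_join (L : 'I_d.+1 -> R) (nu : probability Ysp R) (k : nat)
    (xi : 'I_k -> set Ysp) (n : nat) : R :=
  \sum_(f : {ffun 'I_n -> 'I_k})
     entf (fine (nu (\bigcap_(i in [set: 'I_n]) flow_pre L (i%:R) (xi (f i))))).

Definition h_part (L : 'I_d.+1 -> R) (nu : probability Ysp R) (k : nat)
    (xi : 'I_k -> set Ysp) : R :=
  limn (fun n => H_join L nu xi n.+1 / n.+1%:R).

Definition ks_entropy (L : 'I_d.+1 -> R) (nu : probability Ysp R) : \bar R :=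
  ereal_sup [set e | exists k (xi : 'I_k -> set Ysp),
                       is_partition xi /\ e = (h_part L nu xi)%:E].

Definition is_mme (th : rsubst) (L : 'I_d.+1 -> R) (nu : probability Ysp R) : Prop :=
  flow_invariant th L nu /\
  forall nu', flow_invariant th L nu' -> (ks_entropy L nu' <= ks_entropy L nu)%E.

Definition intrinsically_ergodic (th : rsubst) (L : 'I_d.+1 -> R) : Prop :=
  exists nu, is_mme th L nu /\
    forall nu', is_mme th L nu' -> forall B : set Ysp, measurable B -> nu' B = nu B.

End Hull.
End RandomSubstitution.

(* Main.v *)
(* Every point of the hull lies, for each n, in a unique level-n tile (a, v) with
   v in theta^n(a), and almost every point is determined by its tiles of all levels. Hence a
   flow-invariant measure is determined by the probabilities wt n (a, v) of the tiles. Shuffles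
   permute the tiles of a given type, so the uniformity measures are those whose lift is
   type-uniform: wt n (a, v) depends only on n and a. The type frequencies q n of a type-uniform
   measure are probability vectors with q n = Q_n q (n+1), and each such sequence comes from a
   uniformity measure: word frequencies in level-n tiles drawn according to q n converge, and
   their limits define a shift-invariant measure by Kolmogorov extension (here: by reading off
   digits of a uniform point of [0, 1)). By compactness the sequence q is unique if and only if
   (Q_n) is ergodic in inverse time.
   For the entropy, ln #theta^n(a) / (lam^n L_a) tends to a limit h that does not depend on a.
   Comparing the tiles seen along an orbit with an independent model bounds the entropy of an
   invariant measure by h minus the relative entropy, per unit length, of its level-n tiles with
   respect to the uniform distribution on each theta^n(a); counting gives entropy h for
   type-uniform measures. So the measures of maximal entropy are exactly the type-uniform ones. *)
Require Import Defs.
From HB Require Import structures.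
From mathcomp Require Import all_boot all_order all_algebra.
From mathcomp Require Import all_classical all_reals all_analysis.
From mathcomp Require Import measurable_realfun.
From mathcomp Require Import zify ring lra.
Set Implicit Arguments.
Unset Strict Implicit.
Unset Printing Implicit Defensive.
Import Order.TTheory GRing.Theory Num.Theory.
Import numFieldNormedType.Exports.
Local Open Scope classical_set_scope.
Local Open Scope ring_scope.

(** * Inflation words and recognisability *)

(** Geometric compatibility gives all words of [theta_pow th n a] the same length [lam ^+ n * L a],
    so replacing the word of a tile by another one of the same type moves no tile boundary: this is
    why shuffles act on the hull. Flow invariance makes the height inside a tile uniformly
    distributed, so the law of a level-[n] tile reduces to the numbers [wt n (a, v)]. Three
    obstacles shape the rest. The decomposition of a point is unique but not visibly local, so
    measurability of tiles comes from compactness. The image of a measurable set under a shuffle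
    relation is not known to be measurable, so it is squeezed between measurable sets, using that
    [hull_lift] is monotone on arbitrary sets. The entropy of an invariant measure is estimated
    without ergodic decomposition: the upper bound is Gibbs' inequality against an explicit model in
    which the density of a level-[n + m] tile is the product of the level-[n] densities of its
    subtiles, with [m] so large that boundary costs vanish; if nothing is lost at any [n], every
    level is uniform given the types. *)

Class good (d : nat) (R : realType) (th : rsubst d) (lam : R) (L : 'I_d.+1 -> R) : Prop :=
  Good { good_rs : is_rsubst th; good_prim : primitive_rs th;
         good_geom : geom_compat th lam L; good_recog : recognisable th }.

Section Words.
Context {d : nat}.
Implicit Types (S : 'I_d.+1 -> seq (word d)) (w u : word d) (vs : seq (word d)).

Definition tiling S w vs := all2 (fun a v => v \in S a) w vs.

Lemma tiling_size S w vs : tiling S w vs -> size w = size vs.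
Proof. by rewrite /tiling all2E => /andP[/eqP]. Qed.

Lemma tiling_cat S w1 w2 vs1 vs2 : size w1 = size vs1 ->
  tiling S (w1 ++ w2) (vs1 ++ vs2) = tiling S w1 vs1 && tiling S w2 vs2.
Proof. by elim: w1 vs1 => [|a w1 IH] [|v vs1] //= [/IH->]; rewrite andbA. Qed.

Lemma tiling_nth S w vs a i : tiling S w vs -> (i < size w)%N ->
  nth [::] vs i \in S (nth a w i).
Proof.
elim: w vs i => [|b w IH] [|v vs] [|i] //= /andP[hv ht] //.
by rewrite ltnS; exact: IH.
Qed.

Lemma tilingP S w vs a : size w = size vs ->
  (forall i, (i < size w)%N -> nth [::] vs i \in S (nth a w i)) -> tiling S w vs.
Proof.
elim: w vs => [|b w IH] [|v vs] //= [sz] h.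
apply/andP; split; first exact: (h 0%N).
by apply: IH => // i hi; exact: (h i.+1).
Qed.

Lemma word_imgP S w u :
  reflect (exists2 vs, tiling S w vs & u = flatten vs) (u \in word_img S w).
Proof.
apply: (iffP idP).
  elim: w u => [|a w IH] u /=; first by rewrite inE => /eqP->; exists [::].
  rewrite mem_undup => /allpairsP[[v u'] /= [hv hu' ->]].
  by have [vs ht ->] := IH _ hu'; exists (v :: vs) => //=; rewrite hv.
case=> vs; elim: w vs u => [|a w IH] [|v vs] u //=; first by move=> _ ->; rewrite inE.
move=> /andP[hv ht] ->; rewrite mem_undup; apply/allpairsP; exists (v, flatten vs).
by split => //=; exact: IH ht erefl.
Qed.

Lemma word_img_uniq S w : uniq (word_img S w).
Proof. by case: w => //= a w; exact: undup_uniq. Qed.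

Lemma word_img_cat S w1 w2 u1 u2 : u1 \in word_img S w1 -> u2 \in word_img S w2 ->
  u1 ++ u2 \in word_img S (w1 ++ w2).
Proof.
move=> /word_imgP[v1 h1 ->] /word_imgP[v2 h2 ->]; apply/word_imgP.
exists (v1 ++ v2); last by rewrite flatten_cat.
by rewrite tiling_cat ?h1 ?h2 ?(tiling_size h1).
Qed.

Lemma word_img_catE S w1 w2 u : u \in word_img S (w1 ++ w2) ->
  exists u1 u2, [/\ u1 \in word_img S w1, u2 \in word_img S w2 & u = u1 ++ u2].
Proof.
move=> /word_imgP[vs h ->]; have sz := tiling_size h.
exists (flatten (take (size w1) vs)), (flatten (drop (size w1) vs)).
have e : vs = take (size w1) vs ++ drop (size w1) vs by rewrite cat_take_drop.
have sz1 : size w1 = size (take (size w1) vs).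
  by rewrite size_take -sz size_cat; case: ltnP => //; lia.
move: h; rewrite {1}e tiling_cat // => /andP[h1 h2].
split; last by rewrite -flatten_cat -e.
  by apply/word_imgP; exists (take (size w1) vs).
by apply/word_imgP; exists (drop (size w1) vs).
Qed.

Lemma word_img1 S a u : (u \in word_img S [:: a]) = (u \in S a).
Proof.
apply/word_imgP/idP => [[[|v [|v' vs]]] //=|h].
- by rewrite andbT cats0 => h ->.
- by rewrite andbF.
- by exists [:: u] => //=; rewrite ?h ?cats0.
Qed.

Lemma word_img_ne S w : (forall a, S a != [::]) -> exists u, u \in word_img S w.
Proof.
move=> h; exists (flatten [seq head [::] (S a) | a <- w]); apply/word_imgP.
exists [seq head [::] (S a) | a <- w] => //.
elim: w => //= a w ->; rewrite andbT.
by move: (h a); case: (S a) => //= x s _; exact: mem_head.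
Qed.

(** [U] is characterised only by membership, so that the induction hypothesis of [theta_powD] can be
    passed as the assumption. *)
Lemma word_img_comp S T U w u :
  (forall a v, v \in U a <-> exists2 x, x \in T a & v \in word_img S x) ->
  u \in word_img U w <-> exists2 x, x \in word_img T w & u \in word_img S x.
Proof.
move=> hU; elim: w u => [|a w IH] u.
  split=> [|[x]] /=; first by move=> hu; exists [::] => //; rewrite inE.
  by rewrite inE => /eqP->.
rewrite -cat1s; split.
  move=> /word_img_catE[u1 [u2 [h1 h2 ->]]].
  move: h1; rewrite word_img1 => /hU[x1 hx1 hu1].
  have [x2 hx2 hu2] := (IH u2).1 h2.
  exists (x1 ++ x2); last exact: word_img_cat.
  by apply: word_img_cat => //; rewrite word_img1.
move=> [x /word_img_catE[x1 [x2 [h1 h2 ->]]] /word_img_catE[u1 [u2 [hu1 hu2 ->]]]].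
apply: word_img_cat; last by apply/IH; exists x2.
by rewrite word_img1; apply/hU; exists x1 => //; rewrite -word_img1.
Qed.

Lemma word_img_id w u : (u \in word_img (fun a => [:: [:: a]]) w) = (u == w).
Proof.
elim: w u => [|a w IH] u; first by rewrite inE.
apply/idP/eqP.
  rewrite -cat1s => /word_img_catE[u1 [u2 []]]; rewrite word_img1 inE => /eqP->.
  by rewrite IH => /eqP-> ->.
move=> ->; rewrite -cat1s; apply: word_img_cat; last by rewrite IH.
by rewrite word_img1 inE.
Qed.

(** The definition of [theta_pow] peels off one application of [th] at the letter, so induction on
    [m] allows the splitting at any level. *)
Lemma theta_powD (th : rsubst d) n m a u : u \in theta_pow th (n + m) a <->
  exists2 w, w \in theta_pow th m a & u \in word_img (theta_pow th n) w.
Proof.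
elim: m a u => [|m IH] a u.
  rewrite addn0; split=> [hu|[w]] /=; first by exists [:: a]; rewrite ?inE ?word_img1.
  by rewrite inE => /eqP->; rewrite word_img1.
rewrite addnS /= mem_undup; split.
  move=> /flatten_mapP[v hv /(word_img_comp v u IH)[x hx hu]].
  by exists x => //; rewrite mem_undup; apply/flatten_mapP; exists v.
move=> [w]; rewrite mem_undup => /flatten_mapP[v hv hw] hu; apply/flatten_mapP.
by exists v => //; apply/(word_img_comp v u IH); exists w.
Qed.

Lemma theta_pow1 (th : rsubst d) a : theta_pow th 1 a =i th a.
Proof.
move=> u; rewrite /= mem_undup; apply/flatten_mapP/idP => [[v hv]|hu].
  by rewrite word_img_id => /eqP->.
by exists u => //; rewrite word_img_id.
Qed.

Lemma theta_pow_uniq (th : rsubst d) n a : uniq (theta_pow th n a).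
Proof. by case: n => //= n; exact: undup_uniq. Qed.

Lemma Lw_cat (R : realType) (L : 'I_d.+1 -> R) u w : Lw L (u ++ w) = Lw L u + Lw L w.
Proof. by rewrite /Lw big_cat. Qed.

Lemma Lw_nil (R : realType) (L : 'I_d.+1 -> R) : Lw L [::] = 0.
Proof. by rewrite /Lw big_nil. Qed.

Lemma Lw_cons (R : realType) (L : 'I_d.+1 -> R) a w : Lw L (a :: w) = L a + Lw L w.
Proof. by rewrite /Lw big_cons. Qed.

Lemma Lw_tiling (R : realType) (L : 'I_d.+1 -> R) S c w vs :
  (forall a v, v \in S a -> Lw L v = c * L a) -> tiling S w vs ->
  Lw L (flatten vs) = c * Lw L w.
Proof.
move=> h; elim: w vs => [|a w IH] [|v vs] //=; first by rewrite !Lw_nil mulr0.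
by move=> /andP[hv ht]; rewrite Lw_cat Lw_cons mulrDr (h _ _ hv) (IH _ ht).
Qed.

Lemma Lw_word_img (R : realType) (L : 'I_d.+1 -> R) S c w u :
  (forall a v, v \in S a -> Lw L v = c * L a) -> u \in word_img S w ->
  Lw L u = c * Lw L w.
Proof. by move=> h /word_imgP[vs ht ->]; exact: Lw_tiling ht. Qed.

Lemma Lw_count (R : realType) (L : 'I_d.+1 -> R) w :
  Lw L w = \sum_(a < d.+1) L a * (count_mem a w)%:R.
Proof.
elim: w => [|b w IH]; first by rewrite Lw_nil big1 // => a _; rewrite mulr0.
rewrite Lw_cons IH [RHS](eq_bigr (fun a => L a * (b == a)%:R + L a * (count_mem a w)%:R)).
  rewrite big_split /=; congr (_ + _).
  by rewrite (bigD1 b) //= eqxx mulr1 big1 ?addr0 // => a /negbTE; rewrite eq_sym => ->; rewrite mulr0.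
by move=> a _ /=; rewrite natrD mulrDr.
Qed.

(** Geometric compatibility is a condition on marginals; every [v] in [th a] is the value at [a] of
    some marginal, so the condition fixes the length of each single word. *)
Lemma Lw_geom (R : realType) (L : 'I_d.+1 -> R) (lam : R) (th : rsubst d) a v :
  is_rsubst th -> geom_compat th lam L -> v \in th a -> Lw L v = lam * L a.
Proof.
move=> hth [_ _ h] hv.
pose m b := if b == a then v else head [::] (th b).
have hm : marginal th m.
  move=> b; rewrite /m; case: eqP => [->//|_].
  by have [+ _ _] := hth b; case: (th b) => //= x s _; exact: mem_head.
by rewrite -(h m hm a) /subst_mx /m eqxx Lw_count.
Qed.

Lemma legal_infix (th : rsubst d) u w : infix u w -> legal th w -> legal th u.
Proof. by move=> h [n [a [v [hv hw]]]]; exists n, a, v; split => //; exact: infix_trans h hw. Qed.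

End Words.

Section Tiles.
Context {d : nat} {R : realType} {th : rsubst d} {lam : R} {L : 'I_d.+1 -> R}.
Context {Hg : good th lam L}.
Local Notation tp := (theta_pow th).

Lemma lam_gt1 : 1 < lam. Proof. by have [] := good_geom. Qed.
Lemma lam_gt0 : 0 < lam. Proof. exact: lt_trans lam_gt1. Qed.
Lemma lamX_gt0 n : 0 < lam ^+ n. Proof. by rewrite exprn_gt0 ?lam_gt0. Qed.
Lemma L_gt0 a : 0 < L a. Proof. by have [] := good_geom. Qed.
Lemma L_ge0 a : 0 <= L a. Proof. exact/ltW/L_gt0. Qed.

Lemma Lw_ge0 w : 0 <= Lw L w.
Proof. by apply: sumr_ge0 => a _; exact: L_ge0. Qed.

Lemma Lw_gt0 w : w != [::] -> 0 < Lw L w.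
Proof. by case: w => // a w _; rewrite Lw_cons ltr_pwDl ?L_gt0 ?Lw_ge0. Qed.

Lemma tp_Lw n a v : v \in tp n a -> Lw L v = lam ^+ n * L a.
Proof.
elim: n a v => [|n IH] a v /=.
  by rewrite inE => /eqP->; rewrite Lw_cons Lw_nil addr0 mul1r.
rewrite mem_undup => /flatten_mapP[w hw hv].
by rewrite (Lw_word_img IH hv) (Lw_geom good_rs good_geom hw) exprSr mulrA.
Qed.

Lemma tp_nil n a v : v \in tp n a -> v != [::].
Proof.
move=> hv; apply/eqP => e; have := tp_Lw hv; rewrite e Lw_nil => /esym/eqP.
by rewrite mulf_eq0 !gt_eqF ?lamX_gt0 ?L_gt0.
Qed.

Lemma tp_size n a v : v \in tp n a -> (0 < size v)%N.
Proof. by move/tp_nil; rewrite -size_eq0 lt0n. Qed.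

Lemma tp_ne n a : tp n a != [::].
Proof.
elim: n a => [|n IH] a //=.
have [] := good_rs a; case E : (th a) => [//|v s] _ _ _ /=.
have [u hu] := word_img_ne v IH.
apply/eqP => e.
have : u \in undup (word_img (tp n) v ++ flatten [seq word_img (tp n) v | v <- s]).
  by rewrite mem_undup mem_cat hu.
by rewrite e.
Qed.

Lemma tp_mem n a : exists u, u \in tp n a.
Proof. by have [u] := word_img_ne [:: a] (tp_ne n); rewrite word_img1; exists u. Qed.

Lemma tp_count_gt0 n a : (0 < size (tp n a))%N.
Proof. by rewrite lt0n size_eq0 tp_ne. Qed.

Lemma legal_word_img n w u : legal th w -> u \in word_img (tp n) w -> legal th u.
Proof.
move=> [m [a [v [hv /infixP[w1 [w2 e]]]]]] hu.
have [u1 h1] := word_img_ne w1 (tp_ne n); have [u2 h2] := word_img_ne w2 (tp_ne n).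
exists (n + m)%N, a, (u1 ++ u ++ u2); split; last by apply/infixP; exists u1, u2.
by apply/theta_powD; exists v => //; rewrite e; do 2 apply: word_img_cat => //.
Qed.

End Tiles.

(** * Positions in two-sided concatenations *)

Section IntSums.
Variable V : zmodType.
Implicit Types (f : int -> V) (i m : int).

Definition isum f (m : int) : V :=
  match m with
  | Posz n => \sum_(j < n) f j%:Z
  | Negz n => - \sum_(j < n.+1) f (- (j.+1)%:Z)
  end.

Lemma isum0 f : isum f 0 = 0. Proof. exact: big_ord0. Qed.

Lemma isumS f i : isum f (i + 1) = isum f i + f i.
Proof.
case: i => [n|[|n]]; first by rewrite -PoszD addn1 /= big_ord_recr.
  by rewrite /= big_ord0 big_ord_recr big_ord0 /= add0r addNr.
have -> : Negz n.+1 + 1 = Negz n by rewrite !NegzE; lia.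
rewrite /= [in RHS]big_ord_recr /= opprD -addrA.
by rewrite (_ : - Posz n.+2 = Negz n.+1) ?NegzE // addNr addr0.
Qed.

Lemma int_step_eq (g h : int -> V) f : g 0 = h 0 ->
  (forall i, g (i + 1) = g i + f i) -> (forall i, h (i + 1) = h i + f i) -> g =1 h.
Proof.
move=> e0 hg hh; elim/int_ind => [//|n IH|n IH]; first by rewrite -addn1 PoszD hg hh IH.
have e : - (n.+1)%:Z + 1 = - n%:Z by lia.
by apply: (addIr (f (- (n.+1)%:Z))); rewrite -hg -hh e.
Qed.

Lemma isum_uniq f (p : int -> V) : p 0 = 0 -> (forall i, p (i + 1) = p i + f i) -> p =1 isum f.
Proof. by move=> p0 pS; apply: (int_step_eq _ pS (isumS f)); rewrite isum0. Qed.

Lemma isumD f m i : isum f (m + i) = isum f m + isum (fun j => f (j + m)) i.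
Proof.
apply: (@int_step_eq (fun i => isum f (m + i))
  (fun i => isum f m + isum (fun j => f (j + m)) i) (fun j => f (j + m))) => [|j|j].
- by rewrite isum0 !addr0.
- by rewrite addrA isumS [m + j]addrC.
- by rewrite isumS addrA.
Qed.

End IntSums.

Lemma int_cross (P : int -> bool) (a b : int) : P a -> ~~ P b -> a <= b ->
  exists i, [/\ a <= i, i < b, P i & ~~ P (i + 1)].
Proof.
move=> Pa Pb ab; have : exists n : nat, ~~ P (a + n%:Z).
  by exists `|b - a|%N; rewrite (_ : a + _ = b) //; lia.
case/ex_minnP => -[|n] hn hmin; first by rewrite addr0 Pa in hn.
have h : P (a + n%:Z) by apply/negPn/negP => /hmin; rewrite ltnn.
exists (a + n%:Z); split => //; [lia| |by rewrite -addrA -PoszD addn1].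
have : (n.+1 <= `|b - a|)%N by apply: hmin; rewrite (_ : a + _ = b) //; lia.
lia.
Qed.

Section IsumOrder.
Variable R : realDomainType.
Implicit Types (f : int -> R).

Lemma isum_le f : (forall i, 0 <= f i) -> {homo isum f : i j / i <= j}.
Proof.
move=> f0 i j ij; have -> : j = i + `|j - i|%N%:Z by lia.
elim: `|j - i|%N => [|n IH]; first by rewrite addr0.
by rewrite -addn1 PoszD addrA isumS (le_trans IH) // lerDl.
Qed.

Lemma isum_bracket f i j t : (forall i, 0 < f i) ->
  isum f i <= t < isum f (i + 1) -> isum f j <= t < isum f (j + 1) -> i = j.
Proof.
move=> f0 /andP[a b] /andP[a' b'].
have h k l : isum f k <= t -> t < isum f (l + 1) -> k <= l.
  move=> h1 h2; rewrite leNgt; apply/negP => lk.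
  have : isum f (l + 1) <= isum f k by apply: isum_le => [m|]; [exact: ltW|lia].
  by move=> h3; move: (lt_le_trans h2 (le_trans h3 h1)); rewrite ltxx.
by apply/eqP; rewrite eq_le !h.
Qed.

Lemma isum_ge f c : (forall i, c <= f i) -> forall n : nat, c *+ n <= isum f n%:Z.
Proof.
by move=> h n; rewrite /isum -[n in c *+ n]card_ord -sumr_const; apply: ler_sum.
Qed.

Lemma isum_leN f c : (forall i, c <= f i) -> forall n : nat, isum f (- n%:Z) <= - (c *+ n).
Proof.
move=> h [|n]; first by rewrite isum0 mulr0n oppr0.
rewrite -NegzE /isum lerN2 -[X in c *+ X]card_ord -sumr_const; exact: ler_sum.
Qed.

End IsumOrder.

Lemma isum_bracketZ (f : int -> int) t : (forall i, 0 < f i) ->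
  exists i, isum f i <= t < isum f (i + 1).
Proof.
move=> f0; have f1 i : 1 <= f i by have := f0 i; lia.
have [||| i [_ _ h1 h2]] := @int_cross (fun i => isum f i <= t) (- `|t|%N%:Z) (`|t|.+1)%N%:Z.
- apply: le_trans (isum_leN f1 _) _; rewrite natz; lia.
- rewrite -ltNge; apply: lt_le_trans (isum_ge f1 _); rewrite natz; lia.
- lia.
- by exists i; rewrite h1 ltNge.
Qed.

Lemma isum_bracketR (R : realType) (f : int -> R) c t : 0 < c -> (forall i, c <= f i) ->
  exists i, isum f i <= t < isum f (i + 1).
Proof.
move=> c0 f1; have [n hn] : exists n : nat, `|t| < c *+ n.
  exists (Num.truncn (`|t| / c)).+1; rewrite -mulr_natr -ltr_pdivrMl // mulrC.
  by rewrite truncnS_gt.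
have [||| i [_ _ h1 h2]] := @int_cross (fun i => isum f i <= t) (- n%:Z) n%:Z.
- apply: le_trans (isum_leN f1 _) _; rewrite lerNl; apply: le_trans (ltW hn).
  by rewrite -normrN ler_norm.
- by rewrite -ltNge; apply: lt_le_trans (isum_ge f1 _); apply: le_lt_trans hn; exact: ler_norm.
- lia.
- by exists i; rewrite h1 ltNge.
Qed.

Definition seg T (z : int -> T) (i : int) (n : nat) : seq T := [seq z (i + j%:Z) | j <- iota 0 n].
Definition shf T (m : int) (z : int -> T) : int -> T := fun i => z (i + m).

Section Seg.
Variable T : Type.
Implicit Types (z : int -> T).

Lemma size_seg z i n : size (seg z i n) = n.
Proof. by rewrite size_map size_iota. Qed.

Lemma nth_seg x0 z i n j : (j < n)%N -> nth x0 (seg z i n) j = z (i + j%:Z).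
Proof. by move=> h; rewrite (nth_map 0%N) ?size_iota // nth_iota. Qed.

Lemma seg_cat z i n m : seg z i (n + m)%N = seg z i n ++ seg z (i + n%:Z) m.
Proof.
rewrite /seg iotaD map_cat; congr (_ ++ _).
rewrite -[X in iota X](addn0 n) iotaDl -map_comp; apply: eq_map => j /=.
by rewrite PoszD addrA.
Qed.

Lemma seg_shf z m i n : seg (shf m z) i n = seg z (i + m) n.
Proof. by apply: eq_map => j; rewrite /shf addrAC. Qed.

Lemma shf_shf z m m' : shf m (shf m' z) = shf (m + m') z.
Proof. by apply/funext => i; rewrite /shf addrA. Qed.

Lemma shf0 z : shf 0 z = z.
Proof. by apply/funext => i; rewrite /shf addr0. Qed.

End Seg.

Section Concat.
Variable T : Type.
Implicit Types (v : int -> seq T) (z : int -> T).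

Definition pos v : int -> int := isum (fun i => (size (v i))%:Z).

(** Variant of [concat_at] in which the positions are computed by [pos] and not quantified
    existentially; [concat_atP] shows that the two agree. *)
Definition cat_at v z := forall i, seg z (pos v i) (size (v i)) = v i.

Lemma posS v i : pos v (i + 1) = pos v i + (size (v i))%:Z.
Proof. exact: isumS. Qed.

Lemma pos0 v : pos v 0 = 0. Proof. exact: isum0. Qed.

Lemma posD v m i : pos v (m + i) = pos v m + pos (fun j => v (j + m)) i.
Proof. exact: isumD. Qed.

Lemma cat_at_shf v z m : cat_at v z -> cat_at (fun i => v (i + m)) (shf (pos v m) z).
Proof. by move=> h i; rewrite seg_shf addrC -posD addrC h. Qed.

Lemma pos_seg v i n : pos v (i + n%:Z) = pos v i + (size (flatten (seg v i n)))%:Z.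
Proof.
elim: n => [|n IH]; first by rewrite !addr0.
rewrite -[n.+1]addn1 seg_cat flatten_cat size_cat !PoszD addrA posS IH /seg /=.
by rewrite addr0 cats0 addrA.
Qed.

Lemma cat_at_seg v z i n : cat_at v z ->
  seg z (pos v i) (size (flatten (seg v i n))) = flatten (seg v i n).
Proof.
move=> h; elim: n => [|n IH] //.
rewrite -[n.+1]addn1 seg_cat flatten_cat size_cat seg_cat IH -pos_seg; congr (_ ++ _).
by rewrite /seg /= addr0 cats0; exact: h.
Qed.

Section Nonempty.
Variable v : int -> seq T.
Hypothesis hv : forall i, (0 < size (v i))%N.

Lemma pos_loc x : exists i (j : nat), (j < size (v i))%N /\ x = pos v i + j%:Z.
Proof.
have [|i /andP[h1 h2]] := @isum_bracketZ (fun i => (size (v i))%:Z) x.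
  by move=> i; rewrite ltz_nat.
exists i, `|x - pos v i|%N; move: h2; rewrite isumS -/(pos v i) => h2.
by move: h1; rewrite -/(pos v i) => h1; lia.
Qed.

Lemma pos_loc_uniq i j i' j' : (j < size (v i))%N -> (j' < size (v i'))%N ->
  pos v i + j%:Z = pos v i' + j'%:Z -> i = i' /\ j = j'.
Proof.
move=> h h' e; have e1 : i = i'.
  apply: (@isum_bracket _ (fun i => (size (v i))%:Z) _ _ (pos v i + j%:Z)).
  - by move=> k; rewrite ltz_nat.
  - by rewrite isumS -/(pos v i); lia.
  - by rewrite isumS -/(pos v i'); lia.
by split => //; rewrite e1 in e; lia.
Qed.

Lemma pos_ge (n : nat) : n%:Z <= pos v n%:Z.
Proof. by rewrite -[X in X <= _]natz; apply: isum_ge => i; rewrite lez_nat. Qed.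

Lemma pos_leN (n : nat) : pos v (- n%:Z) <= - n%:Z.
Proof. by rewrite -[X in _ <= - X]natz; apply: isum_leN => i; rewrite lez_nat. Qed.

Lemma cat_at_uniq z z' : cat_at v z -> cat_at v z' -> z = z'.
Proof.
move=> h h'; apply/funext => x; have [i [j [hj ->]]] := pos_loc x.
have := congr1 (fun s => nth (z x) s j) (etrans (h i) (esym (h' i))).
by rewrite !nth_seg.
Qed.

Lemma cat_at_exists : exists z, cat_at v z.
Proof.
have /choice[z hz] : forall x, exists a, forall i j,
    (j < size (v i))%N -> x = pos v i + j%:Z -> nth a (v i) j = a.
  move=> x; have [i [j [hj e]]] := pos_loc x.
  have [a ha] : exists a, nth a (v i) j = a.
    case E : (v i) hj => [//|a s] hj; exists (nth a (a :: s) j); exact: set_nth_default.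
  exists a => i' j' hj' e'; have [<- <-] := pos_loc_uniq hj hj' (etrans (esym e) e').
  exact: ha.
exists z => i; apply: (@eq_from_nth _ (z 0)); first by rewrite size_seg.
move=> j; rewrite size_seg => hj; rewrite nth_seg // -[LHS](hz _ i j hj erefl).
exact: set_nth_default.
Qed.

End Nonempty.

End Concat.

(** The [i]-th block starts in [z] where the first of its words does, at [pos v (pos t i)]. *)
Lemma cat_at_flatten T (t : int -> seq (seq T)) v (z : int -> T) :
  cat_at t v -> cat_at v z -> cat_at (fun i => flatten (t i)) z.
Proof.
move=> ht hv.
have e : pos (fun i => flatten (t i)) =1 fun i => pos v (pos t i).
  move=> i; apply/esym/(isum_uniq (p := fun i => pos v (pos t i))); first by rewrite !pos0.
  by move=> j; rewrite posS pos_seg ht.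
move=> i; rewrite e -{2}(ht i); rewrite -[X in size (flatten X)](ht i); exact: cat_at_seg.
Qed.

Lemma concat_atP d (v : int -> word d) (z : config d) : concat_at v z <-> cat_at v z.
Proof.
split=> [[p [p0 pS hp]] i|h].
  rewrite /pos -(isum_uniq p0 pS i); apply: (@eq_from_nth _ ord0); first by rewrite size_seg.
  move=> j; rewrite size_seg => hj; rewrite nth_seg //.
  exact/esym/(@onth_nth _ ord0)/esym/hp.
exists (pos v); split=> [|i|i j hj]; rewrite ?pos0 ?posS //.
have := onthTE (v i) j; rewrite hj; case E : (onth (v i) j) => [a|] // _.
by rewrite -(@onth_nth _ ord0 _ _ _ E) -[in RHS](h i) nth_seg.
Qed.

Lemma shiftnE d k (x : config d) : shiftn k x = shf k x. Proof. by []. Qed.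

Lemma infix_seg (T : eqType) (z : int -> T) (i : int) n (i' : int) n' : i' <= i -> i + n%:Z <= i' + n'%:Z ->
  infix (seg z i n) (seg z i' n').
Proof.
move=> h1 h2; apply/infixP.
pose a := absz (i - i')%R; pose b := absz (i' + n'%:Z - (i + n%:Z))%R.
exists (seg z i' a), (seg z (i + n%:Z) b).
have -> : n' = (a + (n + b))%N by lia.
by rewrite !seg_cat (_ : i' + a%:Z = i) //; lia.
Qed.

(** * Decompositions of all levels *)

Section Levels.
Context {d : nat} {R : realType} {th : rsubst d} {lam : R} {L : 'I_d.+1 -> R}.
Context {Hg : good th lam L}.
Local Notation tp := (theta_pow th).
Local Notation X := (Xth th).
Implicit Types (x y : config d) (v : int -> word d).

(** A level-[n] decomposition of [y] with a tile boundary at position 0; a general decomposition of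
    [y] is an alignment of a shift of [y]. *)
Definition aligned n y x v := [/\ X x, (forall i, v i \in tp n (x i)) & cat_at v y].

Lemma Xth_seg x i m : X x -> legal th (seg x i m).
Proof. exact. Qed.

Lemma Xth_shf k x : X x -> X (shf k x).
Proof. by move=> h i m; have := h (i + k) m; rewrite -/(seg _ _ _) -seg_shf. Qed.

Lemma aligned_size n y x v : aligned n y x v -> forall i, (0 < size (v i))%N.
Proof. by case=> _ h _ i; exact: tp_size (h i). Qed.

Lemma tiling_seg (S : 'I_d.+1 -> seq (word d)) x v i n : (forall i, v i \in S (x i)) ->
  tiling S (seg x i n) (seg v i n).
Proof.
move=> h; apply: (@tilingP _ _ _ _ ord0); first by rewrite !size_seg.
by move=> j; rewrite size_seg => hj; rewrite !nth_seg.
Qed.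

Lemma aligned_seg n y x v i m : aligned n y x v ->
  seg y (pos v i) (size (flatten (seg v i m))) \in word_img (tp n) (seg x i m).
Proof.
case=> _ hv hc; rewrite (cat_at_seg _ _ hc); apply/word_imgP.
by exists (seg v i m) => //; exact: tiling_seg.
Qed.

(** Every window of [y] lies in the image of a window of [x], which is legal. In particular, any
    other choice of words over the same types again gives a point of the subshift. *)
Lemma aligned_X n y x v : aligned n y x v -> X y.
Proof.
move=> h; have hs := aligned_size h; move=> i m; rewrite -/(seg y i m).
have [N hN] : exists N : nat, (`|i| + m <= N)%N by exists (`|i| + m)%N.
have h1 := aligned_seg (- N%:Z) (N + N) h; apply: legal_infix (legal_word_img _ h1).
  have a1 := pos_leN hs N; have a2 := pos_ge hs N.
  have a3 := pos_seg v (- N%:Z) (N + N); rewrite PoszD addrA addNr add0r in a3.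
  by apply: infix_seg; [apply: le_trans a1 _|rewrite -a3; apply: le_trans a2]; lia.
by case: h => hx _ _; exact: Xth_seg.
Qed.

Lemma aligned_shf n y x v m : aligned n y x v ->
  aligned n (shf (pos v m) y) (shf m x) (shf m v).
Proof.
case=> hx hv hc; split=> [|i|]; first exact: Xth_shf.
- exact: hv.
- exact: cat_at_shf.
Qed.

Lemma aligned_anchor n c y x v : aligned n (shf c y) x v ->
  exists i (j : nat), [/\ (j < size (v i))%N, c + pos v i = - j%:Z &
    aligned n (shf (- j%:Z) y) (shf i x) (shf i v)].
Proof.
move=> h; have hs := aligned_size h; have [i [j [hj e]]] := pos_loc hs (- c).
exists i, j; split=> //; first lia.
by have := aligned_shf i h; rewrite shf_shf (_ : pos v i + c = - j%:Z) //; lia.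
Qed.

Lemma recog_aligned y x k v : recog_rel th y x k v <->
  (k < size (v 0))%N /\ aligned 1 (shf (- k%:Z) y) x v.
Proof.
split=> [[hx hv hk hc]|[hk [hx hv hc]]].
  split=> //; split=> // [i|]; [by rewrite theta_pow1|exact/concat_atP].
by split=> // [i|]; [rewrite -theta_pow1|apply/concat_atP].
Qed.

Lemma pos_shf v m i : pos (shf m v) i = pos v (m + i) - pos v m.
Proof. by rewrite posD addrC addrA addNr add0r. Qed.

(** Recognisability normalises the tile that contains position 0. Both decompositions are first
    shifted to that form by [aligned_anchor], so they agree up to a renumbering of the tiles. *)
Lemma aligned1_unique c y x v c' x' v' : X y ->
  aligned 1 (shf c y) x v -> aligned 1 (shf c' y) x' v' ->
  exists m, [/\ x' = shf m x, v' = shf m v & c' = c + pos v m].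
Proof.
move=> hy h h'; have [i [j [hj e1 a1]]] := aligned_anchor h.
have [i' [j' [hj' e1' a1']]] := aligned_anchor h'.
have [x0 [k0 [v0 [_ hu]]]] := good_recog hy.
have [] : [/\ shf i x = x0, j = k0 & shf i v = v0].
  by apply: hu; apply/recog_aligned; rewrite /shf add0r.
move=> ex ej ev.
have [] : [/\ shf i' x' = x0, j' = k0 & shf i' v' = v0].
  by apply: hu; apply/recog_aligned; rewrite /shf add0r.
move=> ex' ej' ev'.
have ex2 : x' = shf (i - i') x.
  have := congr1 (shf (- i')) (etrans ex' (esym ex)).
  by rewrite !shf_shf addNr shf0 [- i' + i]addrC.
have ev2 : v' = shf (i - i') v.
  have := congr1 (shf (- i')) (etrans ev' (esym ev)).
  by rewrite !shf_shf addNr shf0 [- i' + i]addrC.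
exists (i - i'); split=> //.
have := pos_shf v (i - i') i'; rewrite -ev2 subrK => e; lia.
Qed.

Lemma aligned_split n m y x V : aligned (n + m) y x V ->
  exists x1 v (w : int -> word d) (vs : int -> seq (word d)),
  [/\ aligned n y x1 v, aligned m x1 x w, cat_at vs v,
      (forall i, tiling (tp n) (w i) (vs i)) & forall i, V i = flatten (vs i)].
Proof.
case=> hx hV hc.
have /choice[f hf] : forall i, exists p : word d * seq (word d),
    [/\ p.1 \in tp m (x i), tiling (tp n) p.1 p.2 & V i = flatten p.2].
  move=> i; have [w hw /word_imgP[vs ht e]] := (theta_powD th n m (x i) (V i)).1 (hV i).
  by exists (w, vs).
pose w i := (f i).1; pose vs i := (f i).2.
have hw i : w i \in tp m (x i) by case: (hf i).
have ht i : tiling (tp n) (w i) (vs i) by case: (hf i).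
have hVe i : V i = flatten (vs i) by case: (hf i).
have hws i : (0 < size (w i))%N by exact: tp_size (hw i).
have hsz i : size (w i) = size (vs i) := tiling_size (ht i).
have hvs i : (0 < size (vs i))%N by rewrite -hsz.
have [x1 hx1] := cat_at_exists hws; have [v hv] := cat_at_exists hvs.
have epos i : pos w i = pos vs i.
  by rewrite /pos; congr (isum _ i); apply/funext => j; rewrite hsz.
have a2 : aligned m x1 x w by split.
have hv1 j : v j \in tp n (x1 j).
  have [i [r [hr ->]]] := pos_loc hws j.
  rewrite -(nth_seg (x1 j) _ _ hr) hx1 epos.
  rewrite -(nth_seg [::] v (pos vs i) (j := r) (n := size (vs i))) ?hv -?hsz //.
  exact: tiling_nth.
have hvsz i : (0 < size (v i))%N by exact: tp_size (hv1 i).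
have [y' hy'] := cat_at_exists hvsz.
(* The level-[n] words were chosen separately in each large word, so their concatenation [y'] has to
   be identified with [y]; both are concatenations of [V]. *)
have ey : y' = y.
  have hVs i : (0 < size (V i))%N by exact: tp_size (hV i).
  apply: (cat_at_uniq hVs) => //; rewrite (_ : V = fun i => flatten (vs i)); last exact/funext.
  exact: cat_at_flatten hv hy'.
exists x1, v, w, vs; split=> //; split=> //; [exact: aligned_X a2|by rewrite -ey].
Qed.

Lemma aligned_join n m y x1 v x w : aligned n y x1 v -> aligned m x1 x w ->
  aligned (n + m) y x (fun i => flatten (seg v (pos w i) (size (w i)))).
Proof.
move=> [hx1 hv hc] [hx hw hcw].
have hcat : cat_at (fun i => seg v (pos w i) (size (w i))) v.
  move=> i; rewrite size_seg; congr (seg v _ _).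
  by rewrite /pos; congr (isum _ i); apply/funext => j; rewrite size_seg.
split=> // [i|]; last exact: cat_at_flatten hcat hc.
apply/theta_powD; exists (w i) => //; apply/word_imgP.
exists (seg v (pos w i) (size (w i))) => //.
by rewrite -{1}(hcw i); apply: tiling_seg.
Qed.

Lemma aligned0_id y x v : aligned 0 y x v -> x = y /\ v = fun i => [:: y i].
Proof.
case=> hx hv hc; have ev i : v i = [:: x i] by have := hv i; rewrite /= inE => /eqP.
have ep i : pos v i = i.
  apply/esym/(isum_uniq (p := id)) => // j; by rewrite ev.
have exy : x = y.
  by apply/funext => i; have := hc i; rewrite ev ep /seg /= addr0 => -[].
by split=> //; apply/funext => i; rewrite ev exy.
Qed.

Lemma aligned_ex0 n y : X y -> exists c x v, aligned n (shf c y) x v.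
Proof.
elim: n => [|n IH] hy.
  exists 0, y, (fun i => [:: y i]); rewrite shf0; split=> //= [i|i]; first by rewrite inE.
  have -> : pos (fun i => [:: y i]) i = i by apply/esym/(isum_uniq (p := id)).
  by rewrite /seg /= addr0.
have [c [x1 [v h1]]] := IH hy.
have hx1 : X x1 by case: h1.
have [x [k [w [/recog_aligned[hk h2] _]]]] := good_recog hx1.
have h3 := aligned_shf (- k%:Z) h1; rewrite shf_shf in h3.
have h4 := aligned_join h3 h2; rewrite addn1 in h4.
exact: (ex_intro _ _ (ex_intro _ _ (ex_intro _ _ h4))).
Qed.

Lemma aligned_ex n y : X y -> exists (k : nat) x v,
  (k < size (v 0))%N /\ aligned n (shf (- k%:Z) y) x v.
Proof.
move=> /(aligned_ex0 n)[c [x [v /aligned_anchor[i [j [hj _ h]]]]]].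
by exists j, (shf i x), (shf i v); rewrite /shf add0r.
Qed.

(** Recognisability is assumed for [th] only. It passes to all powers: a level-[n + 1] decomposition
    splits into a level-[n] one, unique by induction, and a level-1 decomposition of the sequence of
    its types. *)
Lemma aligned_unique n c y x v c' x' v' : X y ->
  aligned n (shf c y) x v -> aligned n (shf c' y) x' v' ->
  exists m, [/\ x' = shf m x, v' = shf m v & c' = c + pos v m].
Proof.
elim: n c y x v c' x' v' => [|n IH] c y x v c' x' v' hy h h'.
  have [-> ->] := aligned0_id h; have [-> ->] := aligned0_id h'.
  exists (c' - c); split.
  - by rewrite shf_shf subrK.
  - by apply/funext => i; rewrite /shf -addrA subrK.
  - have -> : pos (fun i => [:: shf c y i]) (c' - c) = c' - c.
      by apply/esym/(isum_uniq (p := id)).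
    by rewrite addrC subrK.
rewrite -addn1 in h h'.
have [x1 [u [w [us [a1 a2 b1 b2 b3]]]]] := aligned_split h.
have [x1' [u' [w' [us' [a1' a2' b1' b2' b3']]]]] := aligned_split h'.
have [m [e1 e2 e3]] := IH _ _ _ _ _ _ _ hy a1 a1'.
have hx1 : X x1 by case: a1.
have [m' [f1 f2 f3]] : exists m', [/\ x' = shf m' x, w' = shf m' w & m = 0 + pos w m'].
  by apply: (aligned1_unique hx1); rewrite ?shf0 // -e1.
have epos i : pos w i = pos us i.
  by rewrite /pos; congr (isum _ i); apply/funext => j; rewrite (tiling_size (b2 j)).
have epos' i : pos w' i = pos us' i.
  by rewrite /pos; congr (isum _ i); apply/funext => j; rewrite (tiling_size (b2' j)).
have eV : v = fun i => flatten (us i) by apply/funext.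
have eV' : v' = fun i => flatten (us' i) by apply/funext.
have eus : us' = shf m' us.
  apply/funext => i; rewrite /shf -(b1' i) -(b1 (i + m')) -epos -epos' e2.
  rewrite -(tiling_size (b2' i)) -(tiling_size (b2 (i + m'))) f2 seg_shf pos_shf.
  by rewrite f3 add0r [m' + i]addrC subrK.
exists m'; split=> //; first by rewrite eV' eV eus.
rewrite e3 f3 add0r; congr (_ + _); rewrite epos eV; apply: (isum_uniq (p := fun i => pos u (pos us i))).
  by rewrite !pos0.
by move=> j; rewrite posS pos_seg b1.
Qed.

End Levels.

(** * Compactness and primitivity *)

Section Compactness.

(** An ultrafilter finer than [\oo] selects a value at each coordinate; finitely many coordinates
    are then attained simultaneously at arbitrarily large indices. *)
Lemma finite_valued_compact (T : finType) (f : nat -> int -> T) :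
  exists g, forall m N : nat, exists2 r, (N <= r)%N &
    forall i : int, (`|i| <= m)%N -> f r i = g i.
Proof.
have [U [UF sU]] := @ultraFilterLemma nat \oo _.
have /choice[g hg] : forall i, exists a, U [set r | f r i = a].
  move=> i; apply: contrapT => /forallNP h.
  have : U [set r | forall a : T, ~ f r i = a].
    apply: filter_forall => a; have [|//] := in_ultra_setVsetC [set r | f r i = a] UF.
    by move/h.
  by move=> /filter_ex[r /(_ (f r i))].
exists g => m N.
have hw : U [set r | forall j : 'I_(2 * m).+1, f r (j%:Z - m%:Z) = g (j%:Z - m%:Z)].
  by apply: filter_forall => j; exact: hg.
have hN : U [set r | (N <= r)%N] by apply: sU; exact: nbhs_infty_ge.
have [r [h1 h2]] := filter_ex (filterI hw hN).
exists r => // i hi; have hj : (absz (i + m%:Z)%R < (2 * m).+1)%N by lia.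
have := h1 (Ordinal hj) => /=.
by rewrite (_ : (`|i + m| : int) - m%:Z = i) //; lia.
Qed.

End Compactness.

Section Primitivity.
Context {d : nat} {R : realType} {th : rsubst d} {lam : R} {L : 'I_d.+1 -> R}.
Context {Hg : good th lam L}.
Local Notation tp := (theta_pow th).
Local Notation X := (Xth th).

(** A path of positive entries in the matrix of the marginal is followed, one occurrence at a time;
    the other letters may be substituted arbitrarily, because only one word containing [a] is
    wanted. *)
Lemma prim_occurs : exists K, forall a b, exists2 u, u \in tp K b & a \in u.
Proof.
have [n [theta [hm [k [_ hk]]]]] := @good_prim _ _ _ _ _ Hg.
exists (k * n)%N => a b; move: (hk a b) => {hk}; elim: k b => [|k IH] b /=.
  by case: eqP => // -> _; exists [:: b]; rewrite inE.
rewrite lt0n sum_nat_eq0 negb_forall => /existsP[l /=]; rewrite -lt0n.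
rewrite muln_gt0 => /andP[/IH[u hu au]].
rewrite /subst_mx -has_count has_pred1 => hl.
case/splitPr: hl (hm b) => w1 w2 hw.
have [u1 h1] := word_img_ne w1 (tp_ne (k * n)); have [u2 h2] := word_img_ne w2 (tp_ne (k * n)).
exists (u1 ++ u ++ u2); last by rewrite !mem_cat au orbT.
rewrite mulSn addnC; apply/theta_powD; exists (w1 ++ l :: w2) => //.
apply: word_img_cat => //; rewrite -cat1s; apply: word_img_cat => //.
by rewrite word_img1.
Qed.

Definition Lsum : R := \sum_(a < d.+1) L a.

Lemma L_le_sum a : L a <= Lsum.
Proof. by rewrite /Lsum (bigD1 a) //= lerDl sumr_ge0 // => b _; exact: L_ge0. Qed.

Lemma Lsum_gt0 : 0 < Lsum.
Proof. exact: lt_le_trans (L_gt0 ord0) (L_le_sum _). Qed.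

Lemma Lmin_ex : exists2 c, 0 < c & forall a, c <= L a.
Proof.
pose c := \big[Num.min/L ord0]_(a < d.+1) L a; exists c.
  apply: (@big_ind R (fun x => 0 < x)) => [|x y h1 h2|a _]; last exact: L_gt0.
    exact: L_gt0.
  by rewrite lt_min h1.
by move=> a; apply: bigmin_le_cond.
Qed.

Lemma Lw_le_size w : Lw L w <= Lsum * (size w)%:R.
Proof.
elim: w => [|a w IH]; first by rewrite Lw_nil mulr0.
by rewrite Lw_cons /= -add1n natrD mulrDr mulr1 lerD // L_le_sum.
Qed.

Lemma lamX_large (C : R) : exists N, forall n, (N <= n)%N -> C <= lam ^+ n.
Proof.
(* Bernoulli's inequality. *)
have bern n : 1 + n%:R * (lam - 1) <= lam ^+ n.
  elim: n => [|n IH]; first by rewrite mul0r addr0.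
  have l1 : 1 < lam by exact: lam_gt1.
  rewrite exprS; apply: le_trans (ler_wpM2l (ltW lam_gt0) IH).
  rewrite -[n.+1]addn1 natrD -subr_ge0.
  have -> : lam * (1 + n%:R * (lam - 1)) - (1 + (n%:R + 1%:R) * (lam - 1)) =
    n%:R * (lam - 1) ^+ 2 by ring.
  by rewrite mulr_ge0 // sqr_ge0.
exists (Num.truncn (`|C| / (lam - 1))).+1 => n hn; apply: le_trans (bern n).
have l1 : 0 < lam - 1 by rewrite subr_gt0 lam_gt1.
have h : `|C| / (lam - 1) < n%:R by apply: lt_le_trans (truncnS_gt _) _; rewrite ler_nat.
rewrite ltr_pdivrMr // in h; have := ler_norm C; lra.
Qed.

Lemma tp_size_large (r : nat) : exists N, forall n a v, (N <= n)%N -> v \in tp n a -> (r <= size v)%N.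
Proof.
have [c c0 hc] := Lmin_ex; have [N hN] := lamX_large (r%:R * Lsum / c).
exists N => n a v /hN h /tp_Lw e; have := Lw_le_size v; rewrite e => h2.
rewrite -(ler_nat R) -(ler_pM2l Lsum_gt0); apply: le_trans h2.
rewrite ler_pdivrMr // in h; rewrite mulrC; apply: le_trans h _.
by apply: ler_wpM2l (hc a); rewrite ltW ?lamX_gt0.
Qed.

(** A long inflation word has a letter [b] far from both ends. Some word of [theta_pow th K b]
    contains [a], and images are not shorter than the words they come from, so the context of [a]
    stays long. *)
Lemma legal_surround a (r : nat) : exists u1 u2,
  [/\ legal th (u1 ++ a :: u2), (r <= size u1)%N & (r <= size u2)%N].
Proof.
have [K hK] := prim_occurs; have [N hN] := tp_size_large (r + r).+1.
have [W hW] := tp_mem N ord0.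
have sW := hN N ord0 W (leqnn N) hW.
have [b [W1 [W2 [eW s1 s2]]]] : exists b W1 W2,
    [/\ W = W1 ++ b :: W2, (r <= size W1)%N & (r <= size W2)%N].
  exists (nth ord0 W r), (take r W), (drop r.+1 W); rewrite size_take size_drop.
  rewrite -drop_nth ?cat_take_drop; last lia.
  by split=> //; [case: ifP|]; lia.
have [u hu au] := hK a b.
have [V1 h1] := word_img_ne W1 (tp_ne K); have [V2 h2] := word_img_ne W2 (tp_ne K).
have big w v : v \in word_img (tp K) w -> (size w <= size v)%N.
  move=> /word_imgP[vs ht ->]; elim: w vs ht => [|x w IH] [|y vs] //= /andP[hx ht].
  by rewrite size_cat -[X in (X <= _)%N]add1n leq_add ?IH // (tp_size hx).
case/splitPr: au hu => x1 x2 hu.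
exists (V1 ++ x1), (x2 ++ V2); rewrite !size_cat; split.
- have : legal th W by exists N, ord0, W; rewrite infix_refl.
  move/(@legal_word_img _ _ _ _ _ Hg K _ (V1 ++ (x1 ++ a :: x2) ++ V2)).
  rewrite -!catA /=; apply; rewrite eW; apply: word_img_cat => //.
  rewrite -[b :: W2]cat1s (_ : x1 ++ a :: x2 ++ V2 = (x1 ++ a :: x2) ++ V2); last by rewrite -catA.
  by apply: word_img_cat => //; rewrite word_img1.
- by apply: leq_trans (leq_trans s1 (big _ _ h1)) _; rewrite leq_addr.
- by apply: leq_trans (leq_trans s2 (big _ _ h2)) _; rewrite leq_addl.
Qed.

Lemma Xth_closed (f : nat -> config d) g : (forall m N : nat, exists2 r, (N <= r)%N &
    forall i : int, (`|i| <= m)%N -> f r i = g i) ->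
  (forall r (i : int) (m : nat), (`|i| + m <= r)%N -> legal th (seg (f r) i m)) -> X g.
Proof.
move=> hg hf i m; rewrite -/(seg g i m).
have [r hr e] := hg (`|i| + m)%N (`|i| + m)%N.
have -> : seg g i m = seg (f r) i m; last exact: hf.
apply: (@eq_from_nth _ ord0); rewrite !size_seg // => j hj; rewrite !nth_seg // e //; lia.
Qed.

(** A limit of legal words with [a] at the origin. Recognisability speaks of points of the subshift,
    so a claim about a single inflation word is proved by placing the word in such a point. *)
Lemma letter_in_X a : exists2 x, X x & x 0 = a.
Proof.
have /choice[f hf] : forall r : nat, exists p : word d * word d,
    [/\ legal th (p.1 ++ a :: p.2), (r <= size p.1)%N & (r <= size p.2)%N].
  by move=> r; have [u1 [u2 h]] := legal_surround a r; exists (u1, u2).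
pose w r := (f r).1 ++ a :: (f r).2.
pose F r i : 'I_d.+1 := nth ord0 (w r) (absz ((size (f r).1)%:Z + i)%R).
have [g hg] := finite_valued_compact F; exists g.
  apply: (Xth_closed hg) => r i m hm; have [h1 h2 h3] := hf r.
  apply: legal_infix h1; apply/infixP; pose n := absz ((size (f r).1)%:Z + i)%R.
  exists (take n (w r)), (drop (n + m) (w r)).
  have -> : seg (F r) i m = take m (drop n (w r)).
    have sw : size (w r) = (size (f r).1 + (size (f r).2).+1)%N by rewrite size_cat.
    apply: (@eq_from_nth _ ord0); rewrite size_seg.
      by rewrite size_take size_drop sw; case: ltnP; lia.
    move=> j hj; rewrite nth_seg // nth_take // nth_drop /F; congr (nth _ _ _); lia.
  by rewrite addnC -drop_drop !cat_take_drop.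
have [r _ h] := hg 0%N 0%N; rewrite -h // /F addr0 absz_nat.
by rewrite /w nth_cat ltnn subnn.
Qed.

End Primitivity.

(** * The tile at the origin and its subdivisions *)

Section Labels.
Context {d : nat} {R : realType} {th : rsubst d} {lam : R} {L : 'I_d.+1 -> R}.
Context {Hg : good th lam L}.
Local Notation tp := (theta_pow th).
Local Notation X := (Xth th).
Implicit Types (x y : config d) (v : int -> word d).

(* Type and word of the tile covering position [0], and the index of that position in the word. *)
Definition label := ('I_d.+1 * word d * nat)%type.

Definition islab n y (t : label) := exists x v,
  [/\ aligned (th := th) n (shf (- (t.2)%:Z) y) x v, x 0 = t.1.1, v 0 = t.1.2
    & (t.2 < size t.1.2)%N].

(** The default value is taken exactly outside [Xth th]; its index 0 is not smaller than the size of
    its empty word, so it is never a genuine label. *)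
Definition lab n y : label := xget (ord0, [::], 0%N) [set t | islab n y t].

Lemma islab_uniq n y t t' : X y -> islab n y t -> islab n y t' -> t = t'.
Proof.
case: t t' => [[a w] k] [[a' w'] k'] hy [x [v [/= h <- <- hk]]] [x' [v' [/= h' <- <- hk']]].
have [m [e1 e2 e3]] := aligned_unique hy h h'.
have hs := aligned_size (Hg := Hg) h.
have [] : 0 = m /\ k = k'.
  apply: (pos_loc_uniq hs) => //; first by rewrite e2 /shf add0r in hk'.
  rewrite pos0; lia.
by move=> e0 <-; rewrite e1 e2 -e0 !shf0.
Qed.

Lemma lab_ex n y : X y -> islab n y (lab n y).
Proof.
move=> hy; rewrite /lab; case: xgetP => [t -> //|]; have [k [x [v [hk h]]]] := aligned_ex n hy.
by move/(_ (x 0, v 0, k)); case; exists x, v.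
Qed.

Lemma lab_eq n y t : X y -> islab n y t -> lab n y = t.
Proof. by move=> hy; apply: islab_uniq => //; exact: lab_ex. Qed.

Lemma labP n y t : X y -> (lab n y = t) <-> islab n y t.
Proof. by move=> hy; split=> [<-|]; [exact: lab_ex|exact: lab_eq]. Qed.

Lemma islab_mem n y t : islab n y t -> t.1.2 \in tp n t.1.1.
Proof. by case: t => [[a w] k] [x [v [[_ h _] /= <- <- _]]]; exact: h. Qed.

Lemma islab_lt n y t : islab n y t -> (t.2 < size t.1.2)%N.
Proof. by case=> x [v []]. Qed.

Lemma islab_seg n y t : islab n y t -> seg y (- (t.2)%:Z) (size t.1.2) = t.1.2.
Proof.
case: t => [[a w] k] [x [v [[_ _ h] /= _ <- _]]].
by have := h 0; rewrite pos0 seg_shf add0r.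
Qed.

Lemma islab_shift n y a w k (i : int) j : islab n y (a, w, k) -> k%:Z + i = j%:Z ->
  (j < size w)%N -> islab n (shf i y) (a, w, j).
Proof.
move=> [x [v [/= h ha hw hk]]] e hj; exists x, v; split=> //=.
by rewrite shf_shf (_ : - j%:Z + i = - k%:Z) //; lia.
Qed.

Lemma islab_next n y a w k : islab n y (a, w, k) ->
  exists a' w', islab n (shf ((size w)%:Z - k%:Z) y) (a', w', 0%N).
Proof.
move=> [x [v [/= h ha hw hk]]]; have := aligned_shf 1 h.
rewrite -[1]add0r posS pos0 add0r shf_shf hw => h'; exists (shf 1 x 0), (shf 1 v 0).
exists (shf 1 x), (shf 1 v); split=> //=; first by rewrite oppr0 shf_shf add0r.
by rewrite /shf; exact: (aligned_size h).
Qed.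

Lemma islab_aligned n y x v : aligned (th := th) n y x v -> islab n y (x 0, v 0, 0%N).
Proof. by move=> h; exists x, v; split=> //=; rewrite ?oppr0 ?shf0 //; exact: aligned_size h 0. Qed.

Definition subtiling n m a (V : word d) (ts : seq ('I_d.+1 * word d)) :=
  [/\ unzip1 ts \in tp m a, tiling (tp n) (unzip1 ts) (unzip2 ts) & V = flatten (unzip2 ts)].

Lemma subtiling_ex n m a V : V \in tp (n + m) a -> exists ts, subtiling n m a V ts.
Proof.
move=> /theta_powD[w hw /word_imgP[vs ht ->]]; exists (zip w vs).
by rewrite /subtiling unzip1_zip ?unzip2_zip ?(tiling_size ht).
Qed.

Lemma subtiling_mem n m a V ts : subtiling n m a V ts -> V \in tp (n + m) a.
Proof.
case=> h1 h2 ->; apply/theta_powD; exists (unzip1 ts) => //; apply/word_imgP.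
by exists (unzip2 ts).
Qed.

Lemma subtiling_nth n m a V ts i t0 : subtiling n m a V ts -> (i < size ts)%N ->
  (nth t0 ts i).2 \in tp n (nth t0 ts i).1.
Proof.
move=> [_ h _] hi; have := @tiling_nth _ _ _ _ t0.1 i h; rewrite size_map => /(_ hi).
by rewrite (nth_map t0) // (nth_map t0).
Qed.

Lemma tiling_size_gt0 n w vs : tiling (tp n) w vs -> (0 < size w)%N -> (0 < size (flatten vs))%N.
Proof. by case: w vs => // a w [|v vs] //= /andP[/tp_size h _] _; rewrite size_cat ltn_addr. Qed.

Lemma subtiling_islab n m y a V K ts0 : islab (n + m) y (a, V, K) ->
  exists ts i k, [/\ subtiling n m a V ts, (i < size ts)%N,
    K = (size (flatten (unzip2 (take i ts))) + k)%N &
    islab n y (nth ts0 ts i, k)].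
Proof.
move=> [x [Vs [/= h hxa hV hK]]].
have [x1 [v [w [vs [a1 a2 b1 b2 b3]]]]] := aligned_split h.
have hs := aligned_size (Hg := Hg) a1.
have [i0 [k [hk e]]] := pos_loc hs K%:Z.
have e2 : pos v (size (vs 0))%:Z = (size V)%:Z.
  by have := pos_seg v 0 (size (vs 0)); rewrite add0r pos0 add0r -{2}(pos0 vs) b1 -b3 hV => ->.
have i0ge : 0 <= i0.
  rewrite leNgt; apply/negP => i0lt.
  have : pos v (i0 + 1) <= pos v 0 by apply: isum_le => [j|]; lia.
  by rewrite pos0 posS; lia.
have i0lt : i0 < (size (vs 0))%:Z.
  rewrite ltNge; apply/negP => le.
  have : pos v (size (vs 0))%:Z <= pos v i0 by apply: isum_le => // j.
  by rewrite e2; lia.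
have ei : i0 = (absz i0)%:Z by lia.
have hwsz : size (w 0) = size (vs 0) by exact: tiling_size (b2 0).
have hi : (absz i0 < size (zip (w 0) (vs 0)))%N by rewrite size_zip hwsz minnn; lia.
have hw0 j : (j < size (w 0))%N -> x1 j%:Z = nth (x 0) (w 0) j.
  move=> hj; case: a2 => _ _ /(_ 0); rewrite pos0 => <-.
  by rewrite nth_seg ?size_seg // add0r.
have hv0 j : (j < size (w 0))%N -> v j%:Z = nth [::] (vs 0) j.
  move=> hj; rewrite -(b1 0) pos0 nth_seg ?add0r //; by rewrite -hwsz.
exists (zip (w 0) (vs 0)), (absz i0), k; split=> //.
- rewrite /subtiling unzip1_zip ?unzip2_zip ?hwsz //; split; rewrite -?b3 -?hV //.
  by rewrite -hxa; case: a2.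
- have := pos_seg v 0 (absz i0); rewrite add0r pos0 add0r -ei.
  rewrite /unzip2 map_take -/(unzip2 _) unzip2_zip ?hwsz //.
  have -> : seg v 0 (absz i0) = take (absz i0) (vs 0).
    rewrite -(b1 0) pos0 /seg -map_take take_iota; congr (map _ (iota _ _)).
    by rewrite /minn; case: ltnP => //; lia.
  by lia.
exists (shf i0 x1), (shf i0 v); split=> /=.
- by have := aligned_shf i0 a1; rewrite shf_shf (_ : pos v i0 - K%:Z = - k%:Z) //; lia.
- rewrite (set_nth_default (x 0, [::])) // nth_zip //= /shf add0r ei hw0 //.
  by rewrite size_zip hwsz minnn in hi; rewrite hwsz.
- rewrite (set_nth_default (x 0, [::])) // nth_zip //= /shf add0r ei hv0 //.
  by rewrite size_zip hwsz minnn in hi; rewrite hwsz.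
- rewrite (set_nth_default (x 0, [::])) // nth_zip //= -hv0; first by rewrite -ei.
  by rewrite size_zip hwsz minnn in hi; rewrite hwsz.
Qed.

(* Two subdivisions of one tile, placed at the origin of the same point of [X],
   would give that point two level-[n] decompositions. *)
Lemma subtiling_uniq n m a V ts ts' : subtiling n m a V ts -> subtiling n m a V ts' -> ts = ts'.
Proof.
move=> h h'; have [x hx hx0] := letter_in_X a.
have /choice[W hW] : forall i, exists w, w \in tp m (x i) by move=> i; exact: tp_mem.
(* Away from index 0 both constructions use the same arbitrary words [W] and [Z], so the two points
   built below have the same concatenation. *)
pose x1 u := fun i : int => if i == 0 then u else W i.
have hW1 t : subtiling n m a V t -> forall i, x1 (unzip1 t) i \in tp m (x i).
  by case=> ht _ _ i; rewrite /x1; case: eqP => [->|_]; rewrite ?hx0.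
have /choice[Z hZ] : forall i, exists vs, tiling (tp n) (W i) vs.
  by move=> i; have [u /word_imgP[vs hvs _]] := word_img_ne (W i) (tp_ne n); exists vs.
pose v1 u := fun i : int => if i == 0 then u else Z i.
have hZ1 t : subtiling n m a V t ->
    forall i, tiling (tp n) (x1 (unzip1 t) i) (v1 (unzip2 t) i).
  by case=> _ ht _ i; rewrite /x1 /v1; case: eqP.
have hsz t : subtiling n m a V t -> forall i, (0 < size (x1 (unzip1 t) i))%N.
  by move=> ht i; exact: tp_size (hW1 t ht i).
have hvsz t : subtiling n m a V t -> forall i, (0 < size (v1 (unzip2 t) i))%N.
  by move=> ht i; rewrite -(tiling_size (hZ1 t ht i)); exact: hsz.
have build t : subtiling n m a V t -> exists u v y,
  [/\ aligned (th := th) n y u v, aligned (th := th) m u x (x1 (unzip1 t)),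
     cat_at (v1 (unzip2 t)) v & cat_at (fun i => if i == 0 then V else flatten (Z i)) y].
  move=> ht; have [u hu] := cat_at_exists (hsz t ht).
  have [v hv] := cat_at_exists (hvsz t ht).
  have au : aligned (th := th) m u x (x1 (unzip1 t)) by split=> //; exact: hW1.
  have epos i : pos (x1 (unzip1 t)) i = pos (v1 (unzip2 t)) i.
    by rewrite /pos; congr (isum _ i); apply/funext => j; rewrite (tiling_size (hZ1 t ht j)).
  have hvu j : v j \in tp n (u j).
    have [i [r [hr ->]]] := pos_loc (hsz t ht) j.
    rewrite -(nth_seg (u j) _ _ hr) hu epos.
    have hr' := hr; rewrite (tiling_size (hZ1 t ht i)) in hr'.
    rewrite -(nth_seg [::] v (pos (v1 (unzip2 t)) i) hr') hv.
    exact: tiling_nth (hZ1 t ht i) hr.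
  have [y hy] := cat_at_exists (fun i => tp_size (hvu i)).
  exists u, v, y; split=> //; first by split=> //; exact: aligned_X au.
  have := cat_at_flatten hv hy; congr cat_at; apply/funext => i; rewrite /v1.
  by case: eqP => // _; case: ht.
have [u [v [y [c1 c2 c3 c4]]]] := build ts h.
have [u' [v' [y' [c1' c2' c3' c4']]]] := build ts' h'.
have ey : y' = y.
  apply: cat_at_uniq c4' c4 => i; case: eqP => _.
    by have := subtiling_mem h; exact: tp_size.
  by apply: tiling_size_gt0 (hZ i) _; exact: tp_size (hW i).
have hy : X y by exact: aligned_X c1.
have [m0 [e1 e2 e3]] : exists m0, [/\ u' = shf m0 u, v' = shf m0 v & 0 = 0 + pos v m0].
  by apply: (aligned_unique hy); [rewrite shf0; exact: c1|rewrite shf0 -ey; exact: c1'].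
have m00 : m0 = 0.
  have hs := aligned_size (Hg := Hg) c1.
  have [] // := pos_loc_uniq hs (hs 0) (hs m0).
  by rewrite pos0 !addr0 e3 add0r.
rewrite m00 !shf0 in e1 e2; rewrite e1 in c2'; rewrite e2 in c3'.
have hu : X u by exact: aligned_X c2.
have [m1 [f1 f2 f3]] : exists m1, [/\ x = shf m1 x, x1 (unzip1 ts') = shf m1 (x1 (unzip1 ts))
    & 0 = 0 + pos (x1 (unzip1 ts)) m1].
  by apply: (aligned_unique hu); [rewrite shf0; exact: c2|rewrite shf0; exact: c2'].
have m10 : m1 = 0.
  have hs := aligned_size (Hg := Hg) c2.
  have [] // := pos_loc_uniq hs (hs 0) (hs m1).
  by rewrite pos0 !addr0 f3 add0r.
rewrite m10 shf0 in f2.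
have g1 : unzip1 ts' = unzip1 ts by have := congr1 (@^~ 0) f2; rewrite /x1 eqxx.
have g2 : unzip2 ts' = unzip2 ts.
  have := c3 0; have := c3' 0; rewrite !pos0 /v1 eqxx => <- <-.
  by rewrite !size_map -(size_map fst ts) -(size_map fst ts') -/(unzip1 _) g1.
by rewrite -(zip_unzip ts) -(zip_unzip ts') g1 g2.
Qed.

End Labels.

Lemma seq_compact (T : eqType) (s : seq T) (f : nat -> int -> T) :
  (forall r i, f r i \in s) -> exists g, forall m N : nat, exists2 r, (N <= r)%N &
    forall i : int, (`|i| <= m)%N -> f r i = g i.
Proof.
move=> hf; pose f' r i : 'I_(size s).+1 := inord (index (f r i) s).
have [g' hg] := finite_valued_compact f'; exists (fun i => nth (f 0%N i) s (g' i)) => m N.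
have [r hr h] := hg m N; exists r => // i hi; rewrite -h //.
have hin := hf r i; rewrite inordK ?nth_index // ltnS ltnW // index_mem //.
Qed.

(** * Measurability of tiles in the subshift *)

Section WindowMeasurable.
Context {d : nat}.
Implicit Types (x y : config d).

Lemma measurable_config_at (i : int) a : measurable ([set x | x i = a] : set (Xsp d)).
Proof. by apply: sub_sigma_algebra; exists i, a. Qed.

Lemma measurable_window (P : word d -> Prop) i n :
  measurable ([set x | P (seg x i n)] : set (Xsp d)).
Proof.
elim: n i P => [|n IH] i P.
  have [h|h] := pselect (P [::]).
    have -> : ([set x | P (seg x i 0)] : set (Xsp d)) = setT by apply/seteqP; split.
    exact: measurableT.
  have -> : ([set x | P (seg x i 0)] : set (Xsp d)) = set0 by apply/seteqP; split.
  exact: measurable0.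
have -> : [set x | P (seg x i n.+1)] =
    \bigcup_(a in [set: 'I_d.+1]) ([set x | x i = a] `&` [set x | P (a :: seg x (i + 1) n)]).
  have e x : seg x i n.+1 = x i :: seg x (i + 1) n.
    by rewrite -[n.+1]add1n seg_cat /seg /= addr0.
  apply/seteqP; split=> [x /=|x [a _ [/= <-]]]; last by rewrite /= e.
  by rewrite e => h; exists (x i).
apply: fin_bigcup_measurable => // a _; apply: measurableI; first exact: measurable_config_at.
exact: (IH (i + 1) (fun w => P (a :: w))).
Qed.

Lemma measurable_shf k : measurable_fun setT (shf k : Xsp d -> Xsp d).
Proof.
apply: (@measurability _ _ (Xsp d) (Xsp d) _ _ (@cylinders d)) => //.
move=> _ [_ [i [a ->]] <-]; rewrite setTI.
have -> : shf k @^-1` [set x : Xsp d | x i = a] = [set x | x (i + k) = a] by [].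
exact: measurable_config_at.
Qed.

Lemma measurable_Xth (th : rsubst d) : measurable (Xth th : set (Xsp d)).
Proof.
have -> : (Xth th : set (Xsp d)) = \bigcap_(k in [set: nat]) \bigcap_(m in [set: nat])
    ([set x | legal th (seg x k%:Z m)] `&` [set x | legal th (seg x (- k%:Z) m)]).
  apply/seteqP; split=> [x h k _ m _|x h i m]; first by split; exact: h.
  have [h1 h2] := h (absz i) I m I; rewrite -/(seg x i m).
  by have [e|e] : i = (absz i)%:Z \/ i = - (absz i)%:Z by [lia]; rewrite e.
apply: bigcap_measurableType => k _; apply: bigcap_measurableType => m _.
by apply: measurableI; exact: measurable_window.
Qed.

End WindowMeasurable.

Section LabelMeasurable.
Context {d : nat} {R : realType} {th : rsubst d} {lam : R} {L : 'I_d.+1 -> R}.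
Context {Hg : good th lam L}.
Local Notation tp := (theta_pow th).
Local Notation X := (Xth th).
Implicit Types (x y : config d) (v : int -> word d).

Definition labset n (t : label) : set (Xsp d) := [set y | X y /\ lab (th := th) n y = t].

(** The points that the window of radius [r] does not distinguish from [labset n t]. No single
    radius is claimed to suffice; only the intersection over all [r] is used. *)
Definition labwin n (t : label) (r : nat) : set (Xsp d) :=
  [set y | exists y', labset n t y' /\ seg y' (- r%:Z) (2 * r).+1 = seg y (- r%:Z) (2 * r).+1].

Lemma seg_agree (T : Type) (z z' : int -> T) (i : int) n :
  (forall j : int, i <= j < i + n%:Z -> z j = z' j) -> seg z i n = seg z' i n.
Proof.
move=> h; apply/eq_in_map => j; rewrite mem_iota add0n => /andP[_ hj].
by apply: h; lia.
Qed.

Lemma seg_eq (T : Type) (z z' : int -> T) (i : int) n : seg z i n = seg z' i n ->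
  forall j : int, i <= j < i + n%:Z -> z j = z' j.
Proof.
move=> h j hj; have hj' : (absz (j - i)%R < n)%N by lia.
have := congr1 (fun s => nth (z j) s (absz (j - i)%R)) h; rewrite !nth_seg //.
by rewrite (_ : i + _ = j) //; lia.
Qed.

Lemma aligned_limit n (y x : nat -> config d) (v : nat -> int -> word d) y0 x0 v0 :
  (forall r, aligned (th := th) n (y r) (x r) (v r)) ->
  (forall r (i : int), (`|i| <= r)%N -> y r i = y0 i) ->
  (forall m N : nat, exists2 r, (N <= r)%N &
    forall i : int, (`|i| <= m)%N -> x r i = x0 i /\ v r i = v0 i) ->
  aligned (th := th) n y0 x0 v0.
Proof.
move=> ha hy hl; have hv0 i : v0 i \in tp n (x0 i).
  have [r _ h] := hl `|i|%N 0%N; have [<- <-] := h i (leqnn _).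
  by case: (ha r).
split=> //.
  apply: (@Xth_closed _ _ x) => [m N|r i m _].
    by have [r hr h] := hl m N; exists r => // i /h[].
  by case: (ha r) => + _ _; exact.
move=> i; pose m := `|i|.+1%N.
(* The index must be large enough for [y r] and [y0] to agree on all positions of the [i]-th tile of
   the limit. *)
have [r hr h] := hl m (absz (pos v0 i)%R + size (v0 i))%N.
have e : forall j : int, (`|j| <= `|i|)%N -> pos v0 j = pos (v r) j.
  move=> j hj; rewrite /pos /isum; case: j hj => [k|k] hk.
    by apply: eq_bigr => l _; have [|_ ->] := h l%:Z; rewrite /m //; have := ltn_ord l; lia.
  by congr (- _); apply: eq_bigr => l _; have [|_ ->] := h (- l.+1%:Z); rewrite /m //; have := ltn_ord l; lia.
have [_ evi] := h i (leqnSn _).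
case: (ha r) => _ _ /(_ i); rewrite -e // evi => <-; rewrite size_seg.
by apply/seg_agree => j hj; rewrite hy //; lia.
Qed.

(* Labellings of points agreeing with [y] on growing windows accumulate, by compactness, at a labelling of [y]. *)
Lemma labsetE n t : labset n t = X `&` \bigcap_(r in [set: nat]) labwin n t r.
Proof.
apply/seteqP; split=> [y [hy ht]|y [hy h]]; first by split=> // r _; exists y.
have /choice[y' hy'] : forall r, exists y', [/\ X y', lab (th := th) n y' = t &
    seg y' (- r%:Z) (2 * r).+1 = seg y (- r%:Z) (2 * r).+1].
  by move=> r; have [y' [[h1 h2] h3]] := h r I; exists y'.
have /choice[D hD] : forall r, exists p : config d * (int -> word d),
    [/\ aligned (th := th) n (shf (- t.2%:Z) (y' r)) p.1 p.2, p.1 0 = t.1.1, p.2 0 = t.1.2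
      & (t.2 < size t.1.2)%N].
  by move=> r; have [h1 h2 _] := hy' r; have [x [v]] := (labP n t h1).1 h2; exists (x, v).
pose tiles := [seq (a, w : word d) | a <- enum 'I_d.+1, w <- tp n a].
(* The decompositions belong to points shifted by [k], which costs [k] letters of the window of
   agreement; hence the index [r + k]. *)
pose k := t.2; pose F r i := ((D (r + k)%N).1 i, (D (r + k)%N).2 i).
have hF r i : F r i \in tiles.
  apply/allpairsPdep; exists ((D (r + k)%N).1 i), ((D (r + k)%N).2 i).
  by rewrite mem_enum; split=> //; case: (hD (r + k)%N) => -[_ + _] _ _ _; exact.
have [g hg] := seq_compact hF.
split=> //; apply: lab_eq => //.
have [r0 _ h0] := hg 0%N 0%N.
have g0 : g 0 = t.1 by rewrite -h0 // /F; case: (hD (r0 + k)%N) => _ -> -> _; case: (t.1).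
exists (fun i => (g i).1), (fun i => (g i).2); rewrite g0; split=> //; last by case: (hD 0%N).
apply: (@aligned_limit n (fun r => shf (- k%:Z) (y' (r + k)%N))
  (fun r => (D (r + k)%N).1) (fun r => (D (r + k)%N).2)).
- by move=> r; case: (hD (r + k)%N).
- move=> r i hi; have [_ _ /seg_eq e] := hy' (r + k)%N; rewrite /shf e //; lia.
- by move=> m N; have [r hr e] := hg m N; exists r => // i /e <-.
Qed.

Lemma measurable_labwin n t r : measurable (labwin n t r).
Proof.
by apply: (@measurable_window _ (fun w => exists y', labset n t y' /\
  seg y' (- r%:Z) (2 * r).+1 = w)).
Qed.

Lemma measurable_labset n t : measurable (labset n t).
Proof.
rewrite labsetE; apply: measurableI; first exact: measurable_Xth.
by apply: bigcap_measurableType => r _; exact: measurable_labwin.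
Qed.

End LabelMeasurable.

(** * The suspension flow and its invariant measures *)

Section Flow.
Context {d : nat} {R : realType} {th : rsubst d} {lam : R} {L : 'I_d.+1 -> R}.
Context {Hg : good th lam L}.
Local Notation tp := (theta_pow th).
Local Notation X := (Xth th).
Local Notation Y := (Yset th L).
Implicit Types (x y : config d) (p q r : Ysp d R) (t : R).

Lemma RsumE x m : Rsum L x m = isum (fun i => L (x i)) m.
Proof. by case: m. Qed.

Lemma flow_ex p t : exists q, flow_rel L p t q.
Proof.
have [c c0 hc] := Lmin_ex (Hg := Hg).
have [m /andP[h1 h2]] := isum_bracketR (p.2 + t) c0 (fun i => hc (p.1 i)).
exists (shiftn m p.1, p.2 + t - Rsum L p.1 m), m; split=> //=.
by rewrite RsumE subr_ge0 h1 ltrBlDl /= /shiftn add0r -isumS.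
Qed.

Lemma flow_uniq p t q q' : flow_rel L p t q -> flow_rel L p t q' -> q = q'.
Proof.
move=> [m [e1 e2 h]] [m' [e1' e2' h']]; have em : m = m'.
  apply: (@isum_bracket _ (fun i => L (p.1 i)) _ _ (p.2 + t)) => [i||]; first exact: L_gt0.
  - by move: h; rewrite e1 e2 RsumE subr_ge0 ltrBlDl isumS /shiftn add0r.
  - by move: h'; rewrite e1' e2' RsumE subr_ge0 ltrBlDl isumS /shiftn add0r.
by rewrite (surjective_pairing q) (surjective_pairing q') e1 e2 e1' e2' em.
Qed.

Lemma flow_Y p t q : X p.1 -> flow_rel L p t q -> Y q.
Proof. by move=> hp [m [e1 e2 h]]; split=> //; rewrite e1; exact: Xth_shf. Qed.

Lemma flow_add p t q t' r : flow_rel L p t q -> flow_rel L q t' r -> flow_rel L p (t + t') r.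
Proof.
move=> [m [e1 e2 h]] [m' [e1' e2' h']]; exists (m + m'); split=> //.
  by rewrite e1' e1 !shiftnE shf_shf addrC.
rewrite e2' e2 !RsumE isumD e1 /shiftn; ring.
Qed.

Lemma flow_0 p : 0 <= p.2 < L (p.1 0) -> flow_rel L p 0 p.
Proof. by exists 0; split=> //; rewrite ?shiftnE ?shf0 // RsumE isum0 addr0 subr0. Qed.

Definition flow p t : Ysp d R := xget p [set q | flow_rel L p t q].

Lemma flowP p t : flow_rel L p t (flow p t).
Proof. by rewrite /flow; case: xgetP => [q -> //|h]; have [q hq] := flow_ex p t; case: (h q hq). Qed.

Lemma flow_eq p t q : flow_rel L p t q -> flow p t = q.
Proof. by move=> h; exact: flow_uniq (flowP p t) h. Qed.

Lemma flowY p t : Y p -> Y (flow p t).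
Proof. by case=> hp _; exact: flow_Y hp (flowP p t). Qed.

Lemma flowD p t t' : flow p (t + t') = flow (flow p t) t'.
Proof. by apply: flow_eq; apply: flow_add; exact: flowP. Qed.

Lemma flow0 p : Y p -> flow p 0 = p.
Proof. by case=> _ h; apply: flow_eq; exact: flow_0. Qed.

Lemma flow_preE t (B : set (Ysp d R)) : flow_pre L t B = [set p | B (flow p t)].
Proof.
apply/seteqP; split=> p /=; first by case=> q [/flow_eq ->].
by move=> h; exists (flow p t); split=> //; exact: flowP.
Qed.

Definition tile n p : 'I_d.+1 * word d := (lab (th := th) n p.1).1.
Definition tidx n p : nat := (lab (th := th) n p.1).2.
(** Distance from the left end of the level-[n] tile to the origin of [p]; at level 0 it is the
    height [p.2]. *)
Definition tm n p : R := p.2 + Lw L (take (tidx n p) (tile n p).2).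
Definition len n (a : 'I_d.+1) : R := lam ^+ n * L a.
Definition tlen n p : R := len n (tile n p).1.

Lemma len_gt0 n a : 0 < len n a.
Proof. by rewrite mulr_gt0 ?lamX_gt0 ?L_gt0. Qed.

Lemma labE n p : lab (th := th) n p.1 = (tile n p, tidx n p).
Proof. by rewrite /tile /tidx; case: (lab _ _). Qed.

Lemma tile_islab n p : X p.1 -> islab (th := th) n p.1 (tile n p, tidx n p).
Proof. by rewrite -labE => /lab_ex. Qed.

Lemma tile_mem n p : X p.1 -> (tile n p).2 \in tp n (tile n p).1.
Proof. by move/(tile_islab n)/islab_mem. Qed.

Lemma tile_Lw n p : X p.1 -> Lw L (tile n p).2 = tlen n p.
Proof. by move=> h; rewrite (tp_Lw (tile_mem n h)). Qed.

Lemma tidx_lt n p : X p.1 -> (tidx n p < size (tile n p).2)%N.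
Proof. by move/(tile_islab n)/islab_lt. Qed.

Lemma isum_seg x i n : isum (fun i => L (x i)) (i + n%:Z) =
  isum (fun i => L (x i)) i + Lw L (seg x i n).
Proof.
elim: n => [|n IH]; first by rewrite /seg /= Lw_nil !addr0.
rewrite -[n.+1]addn1 PoszD addrA isumS IH seg_cat Lw_cat /seg /= Lw_cons Lw_nil !addr0.
by rewrite addrA.
Qed.

Lemma Lw_take_S w k : (k < size w)%N ->
  Lw L (take k.+1 w) = Lw L (take k w) + L (nth ord0 w k).
Proof. by move=> h; rewrite (take_nth ord0) // -cats1 Lw_cat Lw_cons Lw_nil addr0. Qed.

Lemma Lw_take_le w k k' : (k <= k')%N -> Lw L (take k w) <= Lw L (take k' w).
Proof.
move=> h; rewrite -(subnKC h) takeD Lw_cat lerDl; exact: Lw_ge0.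
Qed.

Lemma islab_nth n y a w k j : islab (th := th) n y (a, w, k) -> (j < size w)%N ->
  y (j%:Z - k%:Z) = nth ord0 w j.
Proof. by move=> /islab_seg /= h hj; rewrite -h nth_seg // addrC. Qed.

Lemma islab_Rsum n y a w k j : islab (th := th) n y (a, w, k) -> (j <= size w)%N ->
  Rsum L y (j%:Z - k%:Z) = Lw L (take j w) - Lw L (take k w).
Proof.
move=> h hj; have hs := islab_seg h; have hk := islab_lt h; rewrite /= in hs hk.
have e i : (i <= size w)%N -> isum (fun i => L (y i)) (- k%:Z + i%:Z) =
    isum (fun i => L (y i)) (- k%:Z) + Lw L (take i w).
  move=> hi; rewrite isum_seg; congr (_ + Lw L _).
  by rewrite -hs /seg -map_take take_iota (minn_idPl hi).
have := e k (ltnW hk); rewrite addNr isum0 => e0.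
by rewrite RsumE addrC e //; lra.
Qed.

Lemma tm_bounds n p : Y p -> 0 <= tm n p < tlen n p.
Proof.
move=> [hx /andP[h1 h2]]; have hl := tile_islab n hx; have hk := tidx_lt n hx.
rewrite addr_ge0 ?Lw_ge0 //= -tile_Lw // -[in X in _ < X](take_size (tile n p).2).
apply: lt_le_trans (Lw_take_le _ hk); rewrite /tm Lw_take_S // [X in X < _]addrC ltrD2l.
have := hl; rewrite [tile n p in X in islab _ _ X]surjective_pairing => hl'.
by have := islab_nth hl' hk; rewrite subrr => <-.
Qed.

Lemma tile_move n p t : Y p -> 0 <= tm n p + t < tlen n p ->
  tile n (flow p t) = tile n p /\ tm n (flow p t) = tm n p + t.
Proof.
move=> hy /andP[h1 h2]; have [hx hs] := hy; have hl := tile_islab n hx.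
set w := (tile n p).2; set a := (tile n p).1; set k := tidx n p.
have hl' : islab (th := th) n p.1 (a, w, k) by rewrite -surjective_pairing.
have [j [hj hj1 hj2]] : exists j, [/\ (j < size w)%N, Lw L (take j w) <= tm n p + t &
    tm n p + t < Lw L (take j.+1 w)].
  have : exists j, tm n p + t < Lw L (take j w) by exists (size w); rewrite take_size tile_Lw.
  case/ex_minnP => -[|j]; first by rewrite take0 Lw_nil ltNge h1.
  move=> hj hmin; exists j; split=> //; last by rewrite leNgt; apply/negP => /hmin; rewrite ltnn.
  by rewrite ltnNge; apply/negP => h; have := hmin (size w); rewrite take_size tile_Lw // h2 => /(_ isT); lia.
pose i : int := j%:Z - k%:Z.
have eR : Rsum L p.1 i = Lw L (take j w) - Lw L (take k w).
  by apply: (islab_Rsum hl'); exact: ltnW.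
have etm : tm n p = p.2 + Lw L (take k w) by [].
have hf : flow_rel L p t (shiftn i p.1, p.2 + t - Rsum L p.1 i).
  exists i; split=> //=; rewrite /shiftn add0r (islab_nth hl' hj) eR.
  by rewrite Lw_take_S // in hj2; apply/andP; split; lra.
have hls : islab (th := th) n (shf i p.1) (a, w, j).
  by apply: (islab_shift hl') => //; rewrite /i; lia.
have el : lab (th := th) n (shf i p.1) = (a, w, j).
  by apply/labP => //; exact: Xth_shf.
rewrite (flow_eq hf) /tile /tm /tidx /tile /= shiftnE el /=; split; first by rewrite -surjective_pairing.
by rewrite eR -[(lab n p.1).2]/k -[(lab n p.1).1.2]/w; lra.
Qed.

Lemma tile_next n p : Y p -> tm n (flow p (tlen n p - tm n p)) = 0.
Proof.
move=> hy; have [hx hs] := hy; have hl := tile_islab n hx.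
set w := (tile n p).2; set a := (tile n p).1; set k := tidx n p.
have hl' : islab (th := th) n p.1 (a, w, k) by rewrite -surjective_pairing.
have [a' [w' hn]] := islab_next hl'.
set i : int := (size w)%:Z - k%:Z in hn.
have eR : Rsum L p.1 i = tlen n p - Lw L (take k w).
  by rewrite (islab_Rsum hl') // take_size tile_Lw.
have el : lab (th := th) n (shf i p.1) = (a', w', 0%N).
  by apply/labP => //; exact: Xth_shf.
have hf : flow_rel L p (tlen n p - tm n p) (shiftn i p.1, 0).
  by exists i; split=> //=; [rewrite eR /tm -/w -/k; lra|rewrite lexx L_gt0].
by rewrite (flow_eq hf) /tm /tidx /tile /= shiftnE el /= take0 Lw_nil addr0.
Qed.

(** The last hypothesis prevents a second boundary from being crossed, whatever the type of the next
    tile. *)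
Lemma tile_cross n p t : Y p -> tlen n p <= tm n p + t ->
  (forall a, tm n p + t - tlen n p < len n a) ->
  tm n (flow p t) = tm n p + t - tlen n p.
Proof.
move=> hy h1 h2; have -> : t = (tlen n p - tm n p) + (t - (tlen n p - tm n p)) by lra.
rewrite flowD; set q := flow p _; have hq : Y q by exact: flowY.
have e0 : tm n q = 0 by exact: tile_next.
have [|_ ->] := @tile_move n q (t - (tlen n p - tm n p)) hq; last by rewrite e0; lra.
by rewrite e0 add0r; apply/andP; split; [lra|have := h2 (tile n q).1; rewrite /tlen; lra].
Qed.

Definition subs n m (T : 'I_d.+1 * word d) : seq ('I_d.+1 * word d) :=
  xget [::] [set ts | subtiling (th := th) n m T.1 T.2 ts].

Lemma subsP n m T : T.2 \in tp (n + m) T.1 -> subtiling (th := th) n m T.1 T.2 (subs n m T).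
Proof.
by rewrite /subs => /subtiling_ex[ts hts]; case: xgetP => [_ -> //|/(_ ts)].
Qed.

Lemma subsE n m T ts : subtiling (th := th) n m T.1 T.2 ts -> subs n m T = ts.
Proof. by move=> h; exact: (subtiling_uniq (subsP (subtiling_mem h)) h). Qed.

Definition slen n (ts : seq ('I_d.+1 * word d)) : R := \sum_(T <- ts) len n T.1.

Lemma slen_Lw n ts : {in ts, forall T, T.2 \in tp n T.1} -> slen n ts = Lw L (flatten (unzip2 ts)).
Proof.
elim: ts => [|T ts IH] h; first by rewrite /slen big_nil Lw_nil.
rewrite /slen big_cons -/(slen n ts) IH /= ?Lw_cat ?(tp_Lw (h T _)) ?mem_head // => T' hT'.
by apply: h; rewrite in_cons hT' orbT.
Qed.

Lemma subtiling_all n m a V ts : subtiling (th := th) n m a V ts ->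
  {in ts, forall T, T.2 \in tp n T.1}.
Proof.
move=> h T hT; rewrite -(nth_index T hT); apply: (subtiling_nth T h).
by rewrite index_mem.
Qed.

Lemma slen_cat n s1 s2 : slen n (s1 ++ s2) = slen n s1 + slen n s2.
Proof. by rewrite /slen big_cat. Qed.

Lemma slen_subtiling n m a V ts : subtiling (th := th) n m a V ts -> slen n ts = len (n + m) a.
Proof.
move=> h; rewrite slen_Lw; last exact: subtiling_all h.
have := subtiling_mem h => /tp_Lw; case: h => _ _ <- ->.
by rewrite /len.
Qed.

Lemma slen_ge0 n ts : 0 <= slen n ts.
Proof. by apply: sumr_ge0 => T _; exact/ltW/len_gt0. Qed.

Lemma tile_sub n m p T0 : X p.1 -> let ts := subs n m (tile (n + m) p) in
  exists i, [/\ (i < size ts)%N, tile n p = nth T0 ts i &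
    tm (n + m) p = slen n (take i ts) + tm n p].
Proof.
move=> hx ts; have := tile_islab (n + m) hx.
rewrite [X in islab _ _ (X, _)]surjective_pairing => hl.
have [ts' [i [k [h1 h2 h3 h4]]]] := subtiling_islab T0 hl.
have ets : ts = ts' by exact: subsE.
have e : lab (th := th) n p.1 = (nth T0 ts' i, k) by apply/labP.
exists i; rewrite ets; split=> //; first by rewrite /tile e.
have hall := subtiling_all h1.
rewrite slen_Lw => [|T hT]; last by apply: hall; exact: mem_take hT.
have -> : tm n p = p.2 + Lw L (take k (nth T0 ts' i).2) by rewrite /tm /tidx /tile e.
have eV : flatten (unzip2 ts') = flatten (unzip2 (take i ts')) ++ flatten (unzip2 (drop i ts')).
  by rewrite -flatten_cat /unzip2 -map_cat cat_take_drop.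
rewrite /tm h3; case: h1 => _ _ ->; rewrite eV takeD.
rewrite take_size_cat // drop_size_cat // Lw_cat (drop_nth T0) //= takel_cat; first lra.
exact: ltnW (islab_lt h4).
Qed.

End Flow.

Section RealProb.
Context dd (T : measurableType dd) (R : realType) (P : probability T R).
Implicit Types A B : set T.

Definition pr A : R := fine (P A).

Lemma prE A : measurable A -> P A = (pr A)%:E.
Proof. by move=> mA; rewrite /pr fineK // fin_num_measure. Qed.

Lemma pr_ge0 A : 0 <= pr A.
Proof. by rewrite /pr fine_ge0. Qed.

Lemma pr0 : pr set0 = 0. Proof. by rewrite /pr measure0. Qed.

Lemma prT : pr setT = 1. Proof. by rewrite /pr probability_setT. Qed.

Lemma pr_le A B : measurable A -> measurable B -> A `<=` B -> pr A <= pr B.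
Proof. by move=> mA mB AB; rewrite -lee_fin -!prE // le_measure // inE. Qed.

Lemma pr_le1 A : measurable A -> pr A <= 1.
Proof. by move=> mA; rewrite -lee_fin -prE // probability_le1. Qed.

Lemma prU A B : measurable A -> measurable B -> A `&` B = set0 ->
  pr (A `|` B) = pr A + pr B.
Proof.
move=> mA mB AB; apply: EFin_inj; rewrite EFinD -!prE //; last exact: measurableU.
exact: measureU.
Qed.

Lemma prC A : measurable A -> pr (~` A) = 1 - pr A.
Proof.
move=> mA; rewrite -prT -(setvU A) prU ?setICl //; last exact: measurableC.
by rewrite addrK.
Qed.

Lemma prDI A B : measurable A -> measurable B -> pr A = pr (A `\` B) + pr (A `&` B).
Proof.
move=> mA mB; rewrite -prU; [|exact: measurableD|exact: measurableI|].
  by rewrite setUC setUIDK.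
by rewrite setDE setIACA setICl setI0.
Qed.

Lemma prU_le A B : measurable A -> measurable B -> pr (A `|` B) <= pr A + pr B.
Proof.
move=> mA mB; have -> : A `|` B = (A `\` B) `|` B by rewrite setUDl setDv setD0.
rewrite prU //; [|exact: measurableD|by rewrite setDKI].
by rewrite lerD2r; apply: pr_le => //; exact: measurableD.
Qed.

Lemma pr_fibers (K : eqType) (s : seq K) A (f : T -> K) : uniq s ->
  (forall p, A p -> f p \in s) -> measurable A ->
  (forall k, measurable (A `&` [set p | f p = k])) ->
  pr A = \sum_(k <- s) pr (A `&` [set p | f p = k]).
Proof.
elim: s A => [|k s IH] A us hs mA mf.
  by rewrite big_nil (_ : A = set0) ?pr0 //; apply/seteqP; split=> // p /hs.
move: us => /= /andP[ks us]; rewrite big_cons (prDI mA (mf k)) addrC; congr (_ + _).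
  by rewrite setIA setIid.
have e : A `\` (A `&` [set p | f p = k]) = A `&` [set p | f p <> k].
  by apply/seteqP; split=> p [h1 h2]; split=> // h3; [apply: h2|case: h3].
have mA' : measurable (A `&` [set p | f p <> k]) by rewrite -e; exact: measurableD.
rewrite e (IH _ us) //.
- apply: eq_big_seq => k' hk'; congr pr.
  apply/seteqP; split=> p [] /=; first by move=> [h1 _].
  by move=> h1 h2; split=> //; split=> // h3; rewrite -h3 h2 hk' in ks.
- by move=> p [/hs + hk]; rewrite in_cons => /orP[/eqP|].
- move=> k'; have -> : A `&` [set p | f p <> k] `&` [set p | f p = k'] =
      A `&` [set p | f p <> k] `&` (A `&` [set p | f p = k']).
    by apply/seteqP; split=> p /=; tauto.
  exact: measurableI.
Qed.

End RealProb.

Section CountableFibers.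

Lemma measurable_prop dd (T : measurableType dd) (Q : Prop) : measurable [set _ : T | Q].
Proof.
have [h|h] := pselect Q.
  have -> : [set _ : T | Q] = setT by apply/seteqP; split.
  exact: measurableT.
have -> : [set _ : T | Q] = set0 by apply/seteqP; split.
exact: measurable0.
Qed.

(** Used with [f] a label or a tile: a set described through the tile of [p] is measurable once each
    of its slices with the tile fixed is. *)
Lemma measurable_countable dd (T : measurableType dd) (K : countType) (f : T -> K) (P : K -> set T) :
  (forall k, measurable [set p | f p = k]) -> (forall k, measurable (P k)) ->
  measurable [set p | P (f p) p].
Proof.
move=> hf hP; have -> : [set p | P (f p) p] = \bigcup_(k in [set: K]) ([set p | f p = k] `&` P k).
  by apply/seteqP; split=> [p h|p [k _ [/= <-]]] //; exists (f p).
by apply: countable_bigcupT_measurable => [|k]; [exact: countableP|exact: measurableI].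
Qed.

End CountableFibers.

Section Measurability.
Context {d : nat} {R : realType} {th : rsubst d} {lam : R} {L : 'I_d.+1 -> R}.
Context {Hg : good th lam L}.
Local Notation tp := (theta_pow th).
Local Notation X := (Xth th).
Local Notation Y := (Yset th L).
Implicit Types (x y : config d) (p q r : Ysp d R) (t : R).

Lemma measurable_fst_pre (A : set (Xsp d)) : measurable A -> measurable [set p : Ysp d R | A p.1].
Proof.
move=> mA; have := @measurable_fst _ _ (Xsp d) (measurableTypeR R) measurableT A mA.
by rewrite setTI.
Qed.

Lemma measurable_labset_pre n (k : label) : measurable [set y : Xsp d | lab (th := th) n y = k].
Proof.
have h : [set y : Xsp d | lab (th := th) n y = k] =
    labset (th := th) n k `|` (~` X `&` [set _ | k = (ord0, [::], 0%N)]).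
  apply/seteqP; split=> y /=; last first.
    case=> [[]//|[hy ->]]; rewrite /lab; case: xgetP => // k' _ [x [v [h _ _ _]]].
    by case: hy; have := Xth_shf (k'.2)%:Z (aligned_X (Hg := Hg) h); rewrite shf_shf addrN shf0.
  move=> e; have [hy|hy] := pselect (X y); [by left|right; split=> //].
  rewrite -e /lab; case: xgetP => // k' _ [x [v [h _ _ _]]].
  by case: hy; have := Xth_shf (k'.2)%:Z (aligned_X (Hg := Hg) h); rewrite shf_shf addrN shf0.
rewrite h; apply: measurableU; first exact: measurable_labset.
apply: measurableI; first by apply: measurableC; exact: measurable_Xth.
exact: measurable_prop.
Qed.

Lemma measurable_snd_add (c : R) : measurable_fun setT (fun p : Ysp d R => p.2 + c).
Proof.
apply: measurable_funD; last exact: measurable_cst.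
exact: (@measurable_snd _ _ (Xsp d) (measurableTypeR R)).
Qed.

Lemma measurable_tm n : measurable_fun setT (tm (th := th) (L := L) n).
Proof.
move=> _ B mB; rewrite setTI.
apply: (@measurable_countable _ _ _ (fun p : Ysp d R => lab (th := th) n p.1)
  (fun k => [set p | B (p.2 + Lw L (take k.2 k.1.2))])) => k.
  exact: (measurable_fst_pre (measurable_labset_pre n k)).
by have := measurable_snd_add (Lw L (take k.2 k.1.2)) measurableT mB; rewrite setTI.
Qed.

Lemma measurable_tile n T : measurable [set p : Ysp d R | tile (th := th) n p = T].
Proof.
apply: (@measurable_countable _ _ _ (fun p : Ysp d R => lab (th := th) n p.1)
  (fun k => [set p | k.1 = T])) => k.
  exact: (measurable_fst_pre (measurable_labset_pre n k)).
exact: measurable_prop.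
Qed.

Lemma measurable_letter (i : int) (Q : 'I_d.+1 -> set (Ysp d R)) :
  (forall a, measurable (Q a)) -> measurable [set p : Ysp d R | Q (p.1 i) p].
Proof.
move=> hQ; apply: (@measurable_countable _ _ _ (fun p : Ysp d R => p.1 i)) => // a.
exact: (measurable_fst_pre (@measurable_config_at d i a)).
Qed.

Lemma measurable_snd_itv (i : interval R) : measurable [set p : Ysp d R | p.2 \in i].
Proof.
have := @measurable_snd _ _ (Xsp d) (measurableTypeR R) measurableT [set` i] (measurable_itv _).
by rewrite setTI.
Qed.

Lemma measurable_Yset : measurable (Y : set (Ysp d R)).
Proof.
have -> : Y = [set p | X p.1] `&` [set p | p.2 \in `[0, L (p.1 0)[].
  by apply/seteqP; split=> p []; rewrite /= in_itv.
apply: measurableI; first by apply: measurable_fst_pre; exact: measurable_Xth.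
by apply: (@measurable_letter 0 (fun a => [set p | p.2 \in `[0, L a[])) => a; exact: measurable_snd_itv.
Qed.

Lemma measurable_Rsum m : measurable_fun setT (fun p : Ysp d R => Rsum L p.1 m).
Proof.
have h (i : int) : measurable_fun setT (fun p : Ysp d R => L (p.1 i)).
  move=> _ B mB; rewrite setTI.
  apply: (@measurable_letter i (fun a => [set p | B (L a)])) => a.
  exact: measurable_prop.
case: m => n /=; first by apply: measurable_sum.
by apply: measurable_funN; apply: measurable_sum.
Qed.

Lemma measurable_flow t : measurable_fun setT (fun p => flow (L := L) p t).
Proof.
move=> _ B mB; rewrite setTI.
pose G m p : Ysp d R := (shf m p.1, p.2 + t - Rsum L p.1 m).
have mG m : measurable_fun setT (G m).
  apply: measurable_fun_pair.
    by apply: measurableT_comp; [exact: measurable_shf|exact: measurable_fst].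
  apply: measurable_funB; last exact: measurable_Rsum.
  exact: measurable_snd_add.
pose rng := [set q : Ysp d R | q.2 \in `[0, L (q.1 0)[].
have mrng : measurable rng.
  by apply: (@measurable_letter 0 (fun a => [set p | p.2 \in `[0, L a[])) => a; exact: measurable_snd_itv.
have -> : (fun p => flow (L := L) p t) @^-1` B = \bigcup_(m in [set: int]) (G m @^-1` (B `&` rng)).
  apply/seteqP; split=> p /=.
    have [m [e1 e2 h]] := flowP (L := L) p t; move=> hB; exists m => //=.
    have -> : G m p = flow (L := L) p t by rewrite [RHS]surjective_pairing e1 e2.
    by split=> //; rewrite /rng /= in_itv.
  move=> [m _ [hB]]; rewrite /rng /= in_itv /= => hr.
  have -> : flow (L := L) p t = G m p by apply: flow_eq; exists m.
  by [].
apply: countable_bigcupT_measurable => [|m]; first exact: countableP.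
by rewrite -[X in measurable X]setTI; apply: mG => //; exact: measurableI.
Qed.

Definition cell n T (J : set R) : set (Ysp d R) :=
  Y `&` [set p | tile (th := th) n p = T] `&` [set p | J (tm (th := th) (L := L) n p)].

Lemma measurable_cell n T (J : set (measurableTypeR R)) : measurable J -> measurable (cell n T J).
Proof.
move=> mJ; apply: measurableI.
  by apply: measurableI; [exact: measurable_Yset|exact: measurable_tile].
by have := measurable_tm n measurableT mJ; rewrite setTI.
Qed.

Definition tiles n : seq ('I_d.+1 * word d) :=
  [seq (a, w) | a <- enum 'I_d.+1, w <- tp n a].

Lemma mem_tiles n T : (T \in tiles n) = (T.2 \in tp n T.1).
Proof.
case: T => a w; apply/allpairsPdep/idP => [[a' [w' [_ h [-> ->]]]] //|h].
by exists a, w; rewrite mem_enum.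
Qed.

Lemma tiles_uniq n : uniq (tiles n).
Proof.
apply: allpairs_uniq_dep => [|a _|]; [exact: enum_uniq|exact: theta_pow_uniq|].
by move=> [a w] [a' w'] _ _ /= [-> ->].
Qed.

Lemma sum_tiles n (F : 'I_d.+1 * word d -> R) :
  \sum_(T <- tiles n) F T = \sum_(a < d.+1) \sum_(w <- tp n a) F (a, w).
Proof. by rewrite /tiles big_allpairs_dep /= big_enum. Qed.

Lemma tile_tiles n p : X p.1 -> tile (th := th) n p \in tiles n.
Proof. by move=> h; rewrite mem_tiles; exact: tile_mem. Qed.

End Measurability.

(** Cauchy's functional equation on an interval: nonnegativity gives monotonicity, and [F] is
    squeezed between its values at the multiples of [l / n.+1]. *)
Lemma additive_linear (R : realType) (F : R -> R) l : 0 < l ->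
  (forall x y, 0 <= x -> 0 <= y -> x + y <= l -> F (x + y) = F x + F y) ->
  (forall x, 0 <= x <= l -> 0 <= F x) ->
  forall x, 0 <= x <= l -> F x = x / l * F l.
Proof.
move=> l0 hadd hpos; have hmul (k : nat) x : 0 <= x -> k%:R * x <= l -> F (k%:R * x) = k%:R * F x.
  move=> x0; elim: k => [_|k IH].
    by have := hadd 0 0 (lexx _) (lexx _); rewrite !mul0r addr0 => /(_ (ltW l0)); lra.
  rewrite -[k.+1]addn1 natrD !mulrDl !mul1r => h.
  have kx : 0 <= k%:R * x by rewrite mulr_ge0.
  by rewrite hadd // IH //; lra.
have mono x y : 0 <= x -> x <= y -> y <= l -> F x <= F y.
  move=> x0 xy yl; rewrite -(subrK x y) addrC hadd ?subr_ge0 //; last by rewrite addrC subrK.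
  by rewrite lerDl hpos // subr_ge0 xy /=; lra.
have fl0 : 0 <= F l by rewrite hpos // lexx ltW.
move=> x /andP[x0 xl]; apply/eqP; rewrite -subr_eq0 -normr_le0 leNgt; apply/negP => D0.
(* [D] is the supposed deviation from linearity; [n] makes the oscillation [F l / n.+1] over one
   mesh interval smaller than [D]. *)
set D := `|_| in D0; have [n hn] : exists n : nat, F l < D * n.+1%:R.
  exists (Num.truncn (F l / D)); rewrite mulrC -ltr_pdivrMr //.
  exact: truncnS_gt.
suff : D * n.+1%:R <= F l by rewrite leNgt hn.
have n0 : 0 < n.+1%:R :> R by rewrite ltr0n.
pose e := l / n.+1%:R; have e0 : 0 < e by rewrite divr_gt0.
have el : n.+1%:R * e = l by rewrite /e mulrC divfK // gt_eqF.
have Fe : n.+1%:R * F e = F l by rewrite -hmul ?el // ltW.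
have xl' : x < l.
  rewrite lt_neqAle xl andbT; apply/eqP => exl.
  by move: D0; rewrite /D exl divff ?gt_eqF // mul1r subrr normr0 ltxx.
pose k := Num.truncn (x / e).
have xe0 : 0 <= x / e by rewrite divr_ge0 // ltW.
have /andP[k1 k2] := truncn_itv xe0; rewrite -/k in k1 k2.
have kx : k%:R * e <= x by rewrite -ler_pdivlMr.
have xk : x < k.+1%:R * e by rewrite -ltr_pdivrMr.
have kn : (k < n.+1)%N.
  rewrite -(ltr_nat R); apply: le_lt_trans k1 _; rewrite ltr_pdivrMr // el //.
have kl : k.+1%:R * e <= l by rewrite -el ler_pM2r // ler_nat.
have kl0 : k%:R * e <= l by exact: le_trans kx xl.
have a1 : k%:R * F e <= F x.
  by rewrite -hmul ?(ltW e0) //; apply: mono => //; rewrite mulr_ge0 // ltW.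
have a2 : F x <= k.+1%:R * F e by rewrite -hmul ?(ltW e0) //; apply: mono => //; exact: ltW.
have Fe0 : 0 <= F e.
  by rewrite -(pmulr_rge0 _ n0) Fe.
have ex : x / l * F l = (x / e) * F e.
  rewrite -Fe -{1}el invfM mulrA; field.
  by rewrite !gt_eqF.
have b1 : k%:R * F e <= x / l * F l by rewrite ex ler_wpM2r.
have b2 : x / l * F l <= k.+1%:R * F e by rewrite ex ler_wpM2r // ltW.
rewrite -Fe mulrC ler_wpM2l //.
rewrite ler_norml; move: a2 b2; rewrite -[k.+1]addn1 natrD mulrDl mul1r => a2 b2.
by apply/andP; split; lra.
Qed.

Section Law.
Context dd (T : measurableType dd) (R : realType) (P : probability T R).
Context (A : set T) (f : T -> measurableTypeR R).

(** The image under [f] of [P] restricted to [A], packaged as a measure so that uniqueness of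
    measures on the line applies. *)
Definition law (mA : measurable A) (mf : measurable_fun setT f) (J : set (measurableTypeR R)) :=
  P (A `&` f @^-1` J).

Variables (mA : measurable A) (mf : measurable_fun setT f).

Let law0 : law mA mf set0 = 0%E.
Proof. by rewrite /law preimage_set0 setI0 measure0. Qed.

Let law_ge0 J : (0 <= law mA mf J)%E.
Proof. exact: measure_ge0. Qed.

Let law_additive : semi_sigma_additive (law mA mf).
Proof.
move=> F mF tF mU; rewrite /law preimage_bigcup setI_bigcupr.
have mpre J : measurable J -> measurable (A `&` f @^-1` J).
  by move=> mJ; apply: measurableI => //; rewrite -[X in measurable X]setTI; exact: mf.
apply: measure_semi_sigma_additive; first by move=> n; exact: mpre.
  apply/trivIsetP => /= i j _ _ ij; rewrite setIACA -preimage_setI.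
  by move/trivIsetP : tF => /(_ _ _ I I ij) ->; rewrite preimage_set0 setI0.
by rewrite -setI_bigcupr -preimage_bigcup; exact: mpre.
Qed.

HB.instance Definition _ := isMeasure.Build _ _ _ (law mA mf) law0 law_ge0 law_additive.

End Law.

(** The half-lines [[x, +oo[] are stable under intersection and generate the Borel sets. *)
Lemma law_eq dd (T : measurableType dd) (R : realType) (P P' : probability T R)
    (A A' : set T) (f f' : T -> measurableTypeR R) :
  measurable A -> measurable A' -> measurable_fun setT f -> measurable_fun setT f' ->
  (forall x, P (A `&` [set p | x <= f p]) = P' (A' `&` [set p | x <= f' p])) ->
  forall J : set (measurableTypeR R), measurable J -> P (A `&` f @^-1` J) = P' (A' `&` f' @^-1` J).
Proof.
move=> mA mA' mf mf' h J mJ.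
pose G : set (set (measurableTypeR R)) := @RGenCInfty.G R.
pose g (k : nat) : set (measurableTypeR R) := `[- k%:R, +oo[%classic.
apply: (@measure_unique _ _ (measurableTypeR R) G g _ _ _ _ (law P mA mf) (law P' mA' mf')) => //.
- exact: RGenCInfty.measurableE.
- move=> _ _ [x ->] [y ->]; exists (Num.max x y); apply/seteqP; split=> z /=;
    by rewrite !in_itv /= !andbT ge_max => /andP.
- by move=> k; eexists.
- apply/seteqP; split=> // x _; exists (Num.truncn `|x|).+1 => //=.
  rewrite /g /= in_itv /= andbT lerNl; apply: (le_trans _ (ltW (truncnS_gt _))).
  by rewrite -normrN ler_norm.
- move=> _ [x ->]; rewrite /= /law.
  by have := h x; congr (_ = _); congr (_ (_ `&` _)); apply/seteqP; split=> p /=; rewrite in_itv /= andbT.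
- move=> k; rewrite /= /law; apply: (@le_lt_trans _ _ (P setT)); last by rewrite probability_setT ltry.
  apply: le_measure; rewrite ?inE //; apply: measurableI => //.
  by rewrite -[X in measurable X]setTI; apply: mf => //; exact: measurable_itv.
Qed.

(** * Weights of tiles under an invariant measure *)

Section InvariantMeasure.
Context {d : nat} {R : realType} {th : rsubst d} {lam : R} {L : 'I_d.+1 -> R}.
Context {Hg : good th lam L}.
Local Notation tp := (theta_pow th).
Local Notation X := (Xth th).
Local Notation Y := (Yset th L).
Local Notation tile := (tile (R := R) (th := th)).
Local Notation tm := (tm (th := th) (L := L)).
Local Notation cell := (cell (th := th) (L := L)).
Local Notation flow := (flow (L := L)).
Local Notation len := (len (lam := lam) (L := L)).
Implicit Types (p q r : Ysp d R) (t : R).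

Variable nu : probability (Ysp d R) R.
Hypothesis Hnu : flow_invariant th L nu.
Local Notation P := (pr nu).

Lemma measurable_flow_pre t (B : set (Ysp d R)) : measurable B -> measurable [set p | B (flow p t)].
Proof. by move=> mB; have := measurable_flow (Hg := Hg) t measurableT mB; rewrite setTI. Qed.

Lemma pr_flow t (B : set (Ysp d R)) : measurable B -> P [set p | B (flow p t)] = P B.
Proof. by move=> mB; rewrite /pr -flow_preE; case: Hnu => _ ->. Qed.

Lemma prY (A : set (Ysp d R)) : measurable A -> P (A `&` Y) = P A.
Proof.
have mY : measurable Y by exact: measurable_Yset.
move=> mA; rewrite [RHS](prDI nu mA mY) [X in _ = X + _](_ : _ = 0) ?add0r //.
apply: le_anti; rewrite pr_ge0 andbT.
have := prC nu mY; rewrite {2}/pr; case: Hnu => -> _; rewrite subrr => <-.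
by apply: pr_le; [exact: measurableD|exact: measurableC|move=> p []].
Qed.

Lemma prY_eq (A B : set (Ysp d R)) : measurable A -> measurable B ->
  A `&` Y = B `&` Y -> P A = P B.
Proof. by move=> mA mB e; rewrite -prY // e prY. Qed.

Definition icell n T x y := cell n T [set t | x <= t < y].

Lemma measurable_icell n T x y : measurable (icell n T x y).
Proof.
apply: measurable_cell; have := measurable_itv (R := R) `[x, y[.
by congr measurable; apply/seteqP; split=> z /=; rewrite in_itv.
Qed.

(** Both slices lie inside the tile, so the flow by [h] carries one onto the other. *)
Lemma icell_shift n T x y h : 0 <= x -> y <= len n T.1 -> 0 <= x + h -> y + h <= len n T.1 ->
  P (icell n T x y) = P (icell n T (x + h) (y + h)).
Proof.
move=> x0 yl xh yh; rewrite -(pr_flow h (measurable_icell n T (x + h) (y + h))).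
apply: prY_eq; [exact: measurable_icell|by apply: measurable_flow_pre; exact: measurable_icell|].
apply/seteqP; split=> p [] /=.
  move=> [[hy hT] /= /andP[h1 h2]] _; split=> //.
  have [|e1 e2] := @tile_move _ _ _ _ _ Hg n p h hy.
    by rewrite /tlen hT; apply/andP; split; lra.
  split; first by split; [exact: flowY|rewrite /= e1].
  by rewrite /= e2; apply/andP; split; lra.
move=> [[hy' hT] /= /andP[h1 h2]] hy; split=> //.
have [|e1 e2] := @tile_move _ _ _ _ _ Hg n (flow p h) (- h) hy'.
  by rewrite /tlen hT; apply/andP; split; lra.
rewrite -flowD subrr flow0 // in e1 e2.
split; first by split=> //=; rewrite e1.
by rewrite /= e2; apply/andP; split; lra.
Qed.

(** The probability that the origin lies in a tile [T]. It is weighted by length: the number of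
    tiles [T] per unit length is [wt n T / len n T.1]. *)
Definition wt n T : R := P (cell n T setT).

Lemma icell_full n T : icell n T 0 (len n T.1) = cell n T setT.
Proof.
apply/seteqP; split=> p /= [[hy hT] h]; split=> //=.
by rewrite -hT; exact: tm_bounds.
Qed.

(** By [icell_shift] the measure of a slice depends on its thickness alone, and it is additive in
    the thickness; so the height inside a tile is uniformly distributed. *)
Lemma icell_law n T x y : 0 <= x -> x <= y -> y <= len n T.1 ->
  P (icell n T x y) = (y - x) / len n T.1 * wt n T.
Proof.
move=> x0 xy yl; have l0 : 0 < len n T.1 by exact: len_gt0.
have := @icell_shift n T x y (- x); rewrite subrr => -> //; try lra.
rewrite /wt -icell_full; apply: (@additive_linear R (fun z => P (icell n T 0 z))) => //.
- move=> u v u0 v0 uv; have := @icell_shift n T 0 v u; rewrite add0r [v + u]addrC => -> //; try lra.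
  rewrite -prU; [|exact: measurable_icell|exact: measurable_icell|].
    congr P; apply/seteqP; split=> p /=.
      move=> [hT /= /andP[h1 h2]]; have [h|h] := ltP (tm n p) u; [left|right]; split=> //=.
        by rewrite h1.
      by rewrite h.
    by case=> -[hT /= /andP[h1 h2]]; split=> //=; apply/andP; split; lra.
  apply/seteqP; split=> p //= [[_ /= /andP[h1 h2]] [_ /= /andP[h3 h4]]]; lra.
- by move=> z _; exact: pr_ge0.
- by rewrite subr_ge0 xy /=; lra.
Qed.

Lemma wt_ge0 n T : 0 <= wt n T. Proof. exact: pr_ge0. Qed.

Lemma wt_out n T : T.2 \notin tp n T.1 -> wt n T = 0.
Proof.
move=> h; rewrite /wt (_ : cell n T setT = set0) ?pr0 //.
apply/seteqP; split=> // p [[[hx _] /= hT] _].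
by move: h; rewrite -hT tile_mem.
Qed.

Lemma sum_wt n : \sum_(T <- tiles (th := th) n) wt n T = 1.
Proof.
have mY : measurable Y by exact: measurable_Yset.
have <- : P Y = 1 by rewrite /pr; case: Hnu => ->.
rewrite (@pr_fibers _ _ _ _ _ (tiles (th := th) n) Y (tile n) (tiles_uniq n)) //.
- apply: eq_bigr => T _; rewrite /wt /cell; congr P.
  by apply/seteqP; split=> p /=; tauto.
- by move=> p [hx _]; exact: tile_tiles.
- by move=> T; apply: measurableI => //; exact: measurable_tile.
Qed.

Lemma slen_take_S n ts i T0 : (i < size ts)%N ->
  slen (lam := lam) (L := L) n (take i.+1 ts) = slen (lam := lam) (L := L) n (take i ts) + len n (nth T0 ts i).1.
Proof. by move=> h; rewrite (take_nth T0) // -cats1 slen_cat /slen big_seq1. Qed.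

Lemma slen_take_le n ts i j : (i <= j)%N ->
  slen (lam := lam) (L := L) n (take i ts) <= slen (lam := lam) (L := L) n (take j ts).
Proof. by move=> h; rewrite -(subnKC h) takeD slen_cat lerDl; exact: slen_ge0. Qed.

Lemma slen_bracket n ts i j t : (i < size ts)%N -> (j < size ts)%N ->
  slen (lam := lam) (L := L) n (take i ts) <= t < slen (lam := lam) (L := L) n (take i.+1 ts) ->
  slen (lam := lam) (L := L) n (take j ts) <= t < slen (lam := lam) (L := L) n (take j.+1 ts) -> i = j.
Proof.
move=> hi hj /andP[a b] /andP[a' b']; apply/eqP; rewrite eqn_leq; apply/andP; split;
  rewrite leqNgt; apply/negP => h.
- have := slen_take_le n ts h; rewrite leNgt => /negP; apply; lra.
- have := slen_take_le n ts h; rewrite leNgt => /negP; apply; lra.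
Qed.

(** Inside a supertile [T], each occurrence of [U] in the subdivision fills the fraction
    [len n U.1 / len (n + m) T.1] of the heights, and heights are uniform. *)
Lemma wt_sub n m U : wt n U = \sum_(T <- tiles (th := th) (n + m))
  wt (n + m) T * ((count_mem U (subs (th := th) n m T))%:R * len n U.1 / len (n + m) T.1).
Proof.
have mU : measurable (cell n U setT) by exact: measurable_cell.
rewrite /wt (@pr_fibers _ _ _ _ _ (tiles (th := th) (n + m)) _ (tile (n + m)) (tiles_uniq (n + m))) //;
  [|by move=> p [[[hx _] _] _]; exact: tile_tiles
   |by move=> T; apply: measurableI => //; exact: measurable_tile].
apply: eq_big_seq => T hT; rewrite mem_tiles in hT.
set A := _ `&` _; have mA : measurable A by apply: measurableI => //; exact: measurable_tile.
pose ts := subs (th := th) n m T; have hts := subsP hT; rewrite -/ts in hts.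
pose Q p i := [/\ (i < size ts)%N, tile n p = nth U ts i &
    tm (n + m) p = slen (lam := lam) (L := L) n (take i ts) + tm n p].
(* The rank of the level-[n] tile of [p] in its supertile; fixing it turns the cell of [U] into a
   slice of the cell of [T]. *)
pose f p := xget 0%N [set i | Q p i].
have hf p : Y p -> tile (n + m) p = T -> Q p (f p).
  move=> [hx _] e; rewrite /f; case: xgetP => [i -> //|/(_ _)]; have [i [h1 h2 h3]] := tile_sub n m U hx.
  by move/(_ i); case; split; rewrite /ts -e.
have hQ p i : Y p -> Q p i ->
    slen (lam := lam) (L := L) n (take i ts) <= tm (n + m) p < slen (lam := lam) (L := L) n (take i.+1 ts).
  move=> hy [h1 h2 h3]; have := tm_bounds (Hg := Hg) n hy; rewrite /tlen h2 (slen_take_S _ U) // h3.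
  by move=> /andP[a b]; apply/andP; split; lra.
have e i : (i < size ts)%N -> A `&` [set p | f p = i] =
    if nth U ts i == U then icell (n + m) T (slen (lam := lam) (L := L) n (take i ts))
       (slen (lam := lam) (L := L) n (take i.+1 ts)) else set0.
  move=> hi; case: eqP => hU; apply/seteqP; split=> p /=.
  - move=> [[[[hy h1] _] /= h2] h3]; have := hf p hy h2; rewrite h3 => hq.
    by split; [split|exact: hQ].
  - move=> [[hy /= h2] /= h3]; have hq := hf p hy h2.
    have ef : f p = i by apply: (slen_bracket _ hi _ h3); [case: hq|exact: hQ].
    by move: hq; rewrite ef => -[_ h4 _]; split=> //; split=> //; split=> //; split=> //=; rewrite h4.
  - move=> [[[[hy /= h1] _] /= h2] h3]; have := hf p hy h2; rewrite h3 => -[_ h4 _].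
    by apply: hU; rewrite -h4.
  - by [].
rewrite (@pr_fibers _ _ _ _ _ (iota 0 (size ts)) A f (iota_uniq _ _)) //; last first.
- move=> i; have [hi|hi] := ltnP i (size ts).
    by rewrite e //; case: ifP => _; [exact: measurable_icell|exact: measurable0].
  have -> : A `&` [set p | f p = i] = set0.
    apply/seteqP; split=> // p [[[[hy _] _] /= h2] /= h3].
    by have [] := hf p hy h2; rewrite h3 ltnNge hi.
  exact: measurable0.
- move=> p [[[hy _] _] /= h2]; rewrite mem_iota add0n; by case: (hf p hy h2).
rewrite (eq_big_seq (fun i => (nth U ts i == U)%:R * (wt (n + m) T * (len n U.1 / len (n + m) T.1)))).
  have cnt : (\sum_(i <- iota 0 (size ts)) (nth U ts i == U))%N = count_mem U ts.
    rewrite -sum1_count [RHS](big_nth U) [RHS]big_mkcond /= /index_iota subn0.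
    by apply: eq_bigr => i _; case: eqP.
  by rewrite -big_distrl /= -natr_sum cnt -/ts -/(wt (n + m) T); ring.
move=> i; rewrite mem_iota add0n => /= hi; rewrite e //; case: eqP => hU; last by rewrite pr0 mul0r.
rewrite mul1r icell_law; last first.
- by rewrite -(slen_subtiling hts) -[X in _ <= slen _ X](take_size ts) slen_take_le.
- by rewrite slen_take_le.
- exact: slen_ge0.
by rewrite (slen_take_S _ U) // hU addrC addKr mulrC.
Qed.

End InvariantMeasure.

(** Given the tile, the height is uniform on an interval whose length depends only on the type. Two
    measures and two tiles are allowed: uniqueness compares measures on one tile, shuffle invariance
    compares tiles under one measure. *)
Lemma cell_eq (d : nat) (R : realType) (th : rsubst d) (lam : R) (L : 'I_d.+1 -> R)
    (Hg : good th lam L) (nu nu' : probability (Ysp d R) R) n T T' :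
  flow_invariant th L nu -> flow_invariant th L nu' -> T.1 = T'.1 ->
  wt (th := th) (L := L) nu n T = wt (th := th) (L := L) nu' n T' ->
  forall J : set (measurableTypeR R), measurable J ->
  nu (cell (th := th) (L := L) n T J) = nu' (cell (th := th) (L := L) n T' J).
Proof.
move=> h h' e ew J mJ.
have mc U : measurable (Yset th L `&` [set p | tile (th := th) n p = U]).
  by apply: measurableI; [exact: measurable_Yset|exact: measurable_tile].
apply: (law_eq (mc T) (mc T') (measurable_tm n) (measurable_tm n)) => // x.
have mx U : measurable (Yset th L `&` [set p | tile (th := th) n p = U] `&`
    [set p | x <= tm (th := th) (L := L) n p]).
  have := @measurable_cell _ _ _ _ _ Hg n U `[x, +oo[%classic (measurable_itv _).
  by congr measurable; apply/seteqP; split=> p /=; rewrite /cell /= in_itv /= andbT.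
rewrite !prE //; congr (_%:E).
have [xl|xl] := leP x (len (lam := lam) (L := L) n T.1); last first.
  have E U : U.1 = T.1 -> Yset th L `&` [set p | tile (th := th) n p = U] `&`
      [set p | x <= tm (th := th) (L := L) n p] = set0.
    move=> eU; apply/seteqP; split=> // p [[hy /= hT] /= hx].
    by have := tm_bounds (Hg := Hg) n hy; rewrite /tlen hT eU => /andP[_]; lra.
  by rewrite !E // !pr0.
have E U : U.1 = T.1 -> Yset th L `&` [set p | tile (th := th) n p = U] `&`
    [set p | x <= tm (th := th) (L := L) n p] =
    icell (th := th) (L := L) n U (Num.max 0 x) (len (lam := lam) (L := L) n T.1).
  move=> eU; apply/seteqP; split=> p /= [[hy hT] hx]; split=> //=; have := tm_bounds (Hg := Hg) n hy;
    rewrite /tlen hT eU => /andP[h1 h2]; first by rewrite ge_max h1 hx.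
  by move: hx => /= /andP[]; rewrite ge_max => /andP[].
have m0 : Num.max 0 x <= len (lam := lam) (L := L) n T.1.
  by rewrite ge_max xl andbT; exact/ltW/len_gt0.
rewrite !E ?e // !(icell_law (Hg := Hg)) //; rewrite -?e ?ew ?le_max ?lexx //.
Qed.

(** * Counting inflation words *)

Lemma fin_argmax (R : realType) (n : nat) (f : 'I_n.+1 -> R) : exists a, forall b, f b <= f a.
Proof.
by exists [arg max_(i > ord0) f i]%O => b; case: (Order.TotalTheory.arg_maxP) => // i _; apply.
Qed.

Lemma fin_argmin (R : realType) (n : nat) (f : 'I_n.+1 -> R) : exists a, forall b, f a <= f b.
Proof.
have [a h] := fin_argmax (fun i => - f i); exists a => b; have := h b; lra.
Qed.

Section Counting.
Context {d : nat} {R : realType} {th : rsubst d} {lam : R} {L : 'I_d.+1 -> R}.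
Context {Hg : good th lam L}.
Local Notation tp := (theta_pow th).
Local Notation len := (len (lam := lam) (L := L)).
Local Notation tilet := ('I_d.+1 * word d)%type.

(** All choices of one level-[n] word over each letter of [w], kept as lists so that sums over them
    factor into products over the letters. *)
Fixpoint tilelists n (w : word d) : seq (seq tilet) :=
  if w is a :: w' then [seq (a, v) :: ts | v <- tp n a, ts <- tilelists n w'] else [:: [::]].

Lemma mem_tilelists n w ts :
  (ts \in tilelists n w) = (unzip1 ts == w) && tiling (tp n) w (unzip2 ts).
Proof.
elim: w ts => [|a w IH] ts /=; first by rewrite inE; case: ts.
apply/allpairsP/idP => [[[v ts'] /= [hv hts ->]]|].
  by move: hts; rewrite IH /= eqseq_cons eqxx /= => /andP[-> ->]; rewrite hv.
case: ts => [|[b v] ts] //=; rewrite eqseq_cons => /andP[/andP[/eqP-> h] /andP[hv ht]].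
by exists (v, ts); rewrite IH h ht.
Qed.

Lemma tilelists_uniq n w : uniq (tilelists n w).
Proof.
elim: w => //= a w IH; apply: allpairs_uniq; rewrite ?theta_pow_uniq //.
by move=> [v ts] [v' ts'] _ _ /= [-> ->].
Qed.

Lemma sum_tilelists_cons n a w (G : seq tilet -> R) : \sum_(ts <- tilelists n (a :: w)) G ts =
  \sum_(v <- tp n a) \sum_(ts <- tilelists n w) G ((a, v) :: ts).
Proof. by rewrite /= big_allpairs_dep. Qed.

Lemma prod_tilelists n w (g : tilet -> R) : \sum_(ts <- tilelists n w) \prod_(T <- ts) g T =
  \prod_(a <- w) \sum_(v <- tp n a) g (a, v).
Proof.
elim: w => [|a w IH]; first by rewrite /= big_seq1 !big_nil.
rewrite sum_tilelists_cons big_cons -IH big_distrl /=; apply: eq_bigr => v _.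
by rewrite big_distrr; apply: eq_bigr => ts _; rewrite big_cons.
Qed.

Lemma size_tilelists n w : size (tilelists n w) = (\prod_(a <- w) size (tp n a))%N.
Proof. by elim: w => [|a w IH] /=; rewrite ?big_nil // size_allpairs IH big_cons. Qed.

Lemma Lw_prefix (u u' v v' : word d) : Lw L u = Lw L u' -> u ++ v = u' ++ v' -> u = u'.
Proof.
elim: u u' => [|a u IH] [|a' u'] //=.
- move=> e _; have := Lw_gt0 (Hg := Hg) (w := a' :: u') isT.
  by rewrite -e Lw_nil ltxx.
- move=> e _; have := Lw_gt0 (Hg := Hg) (w := a :: u) isT.
  by rewrite e Lw_nil ltxx.
- rewrite !Lw_cons => e [ea ev]; rewrite ea in e *; rewrite (IH u') //.
  exact: addrI e.
Qed.

(** The letters of [w] prescribe the geometric lengths of the pieces, so the concatenation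
    determines the cut points. *)
Lemma flatten_tilelists_inj n w :
  {in tilelists n w &, injective (fun ts : seq tilet => flatten (unzip2 ts))}.
Proof.
move=> ts ts'; rewrite !mem_tilelists => /andP[/eqP e1 h1] /andP[/eqP e2 h2] /= e.
suff : unzip2 ts = unzip2 ts' by move=> e3; rewrite -(zip_unzip ts) -(zip_unzip ts') e1 e2 e3.
move: {ts ts' e1 e2} (unzip2 ts) (unzip2 ts') h1 h2 e => vs vs'.
elim: w vs vs' => [|a w IH] [|v vs] [|v' vs'] //= /andP[hv h] /andP[hv' h'] e.
have ev : v = v' by apply: Lw_prefix e; rewrite (tp_Lw hv) (tp_Lw hv').
rewrite ev in e *; congr (_ :: _); apply: IH => //.
by move: e => /eqP; rewrite eqseq_cat // => /andP[_ /eqP].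
Qed.

Lemma size_word_img n w : size (word_img (tp n) w) = (\prod_(a <- w) size (tp n a))%N.
Proof.
rewrite -size_tilelists -(size_map (fun ts : seq tilet => flatten (unzip2 ts))).
apply: perm_size; apply: uniq_perm; first exact: word_img_uniq.
  by rewrite map_inj_in_uniq ?tilelists_uniq //; exact: flatten_tilelists_inj.
move=> u; apply/word_imgP/mapP => [[vs h ->]|[ts]].
  have sz := tiling_size h; exists (zip w vs); rewrite ?unzip2_zip ?sz //.
  by rewrite mem_tilelists unzip1_zip ?unzip2_zip ?sz // eqxx.
by rewrite mem_tilelists => /andP[_ h] ->; exists (unzip2 ts).
Qed.

(** Subdivision is a bijection from [tp (n + m) a] to the pairs of a word [w] in [tp m a] and a
    choice of tiles over it; that every such choice is the subdivision of its own concatenation is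
    [subtiling_uniq]. *)
Lemma sum_subs n m a (G : seq tilet -> R) :
  \sum_(V <- tp (n + m) a) G (subs (th := th) n m (a, V)) =
  \sum_(w <- tp m a) \sum_(ts <- tilelists n w) G ts.
Proof.
rewrite -(big_map (fun V => subs (th := th) n m (a, V)) xpredT) -big_allpairs_dep.
apply: perm_big; apply: uniq_perm.
- rewrite map_inj_in_uniq ?theta_pow_uniq // => V V' hV hV' e.
  have [_ _ /= ->] := subsP (T := (a, V)) hV.
  by have [_ _ /= ->] := subsP (T := (a, V')) hV'; rewrite e.
- apply: allpairs_uniq_dep => [|w _|]; [exact: theta_pow_uniq|exact: tilelists_uniq|].
  move=> _ _ /allpairsPdep[w [ts [_ h ->]]] /allpairsPdep[w' [ts' [_ h' ->]]] /= e.
  move: h h'; rewrite !mem_tilelists => /andP[/eqP <- _] /andP[/eqP <- _].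
  by rewrite e.
- move=> ts; apply/mapP/allpairsPdep => [[V hV ->]|[w [ts' [hw hts ->]]]].
    have [h1 h2 h3] := subsP (T := (a, V)) hV.
    exists (unzip1 (subs (th := th) n m (a, V))), (subs (th := th) n m (a, V)); split=> //.
    by rewrite mem_tilelists eqxx.
  move: hts; rewrite mem_tilelists => /andP[/eqP e h].
  have hs : subtiling (th := th) n m a (flatten (unzip2 ts')) ts' by rewrite /subtiling e.
  exists (flatten (unzip2 ts')); first exact: subtiling_mem hs.
  by rewrite (subsE (T := (a, _)) hs).
Qed.

Lemma sum1_sizeR (I : Type) (s : seq I) : \sum_(i <- s) 1 = (size s)%:R :> R.
Proof. by rewrite -sum1_size natr_sum. Qed.

Lemma size_tpD n m a : size (tp (n + m) a) = (\sum_(w <- tp m a) \prod_(b <- w) size (tp n b))%N.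
Proof.
apply/eqP; rewrite -(eqr_nat R); apply/eqP.
have := sum_subs n m a (fun _ => 1); rewrite sum1_sizeR => ->.
rewrite natr_sum; apply: eq_bigr => w _.
by rewrite sum1_sizeR size_tilelists.
Qed.

Definition lnN n a : R := ln (size (tp n a))%:R.

Lemma N_gt0 n a : 0 < (size (tp n a))%:R :> R.
Proof. by rewrite ltr0n tp_count_gt0. Qed.

Lemma lnN_ge0 n a : 0 <= lnN n a.
Proof. by apply: ln_ge0; rewrite ler1n tp_count_gt0. Qed.

Lemma ln_prodN n w : ln (\prod_(b <- w) (size (tp n b))%:R) = \sum_(b <- w) lnN n b.
Proof.
elim: w => [|a w IH]; first by rewrite !big_nil ln1.
rewrite !big_cons lnM ?IH // posrE ?N_gt0 //.
by apply: prodr_gt0 => b _; exact: N_gt0.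
Qed.

Lemma lnN_super n m a u : u \in tp m a -> \sum_(b <- u) lnN n b <= lnN (n + m) a.
Proof.
have prod_gt0 : 0 < \prod_(b <- u) (size (tp n b))%:R :> R.
  by apply: prodr_gt0 => b _; exact: N_gt0.
move=> hu; rewrite -ln_prodN ler_ln ?posrE ?N_gt0 //.
rewrite size_tpD -natr_prod ler_nat (bigD1_seq u) //=; last exact: theta_pow_uniq.
exact: leq_addr.
Qed.

Lemma lnN_sub n m a M : (forall u, u \in tp m a -> \sum_(b <- u) lnN n b <= M) ->
  lnN (n + m) a <= lnN m a + M.
Proof.
move=> h; have -> : lnN m a + M = ln ((size (tp m a))%:R * expR M).
  by rewrite lnM ?posrE ?N_gt0 ?expR_gt0 // expRK.
rewrite ler_ln ?posrE ?mulr_gt0 ?N_gt0 ?expR_gt0 //.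
rewrite size_tpD natr_sum -[X in _ <= X * _]sum1_sizeR mulr_suml.
rewrite big_seq [X in _ <= X]big_seq; apply: ler_sum => u hu; rewrite mul1r natr_prod.
rewrite -[X in X <= _]lnK; last by rewrite posrE; apply: prodr_gt0 => b _; exact: N_gt0.
by rewrite ler_expR ln_prodN h.
Qed.

Lemma sum_len n m a u : u \in tp m a -> \sum_(b <- u) len n b = len (n + m) a.
Proof.
move=> hu; rewrite -mulr_sumr -[\sum_(b <- u) L b]/(Lw L u) (tp_Lw hu) /len exprD; ring.
Qed.

(** With [s n a = lnN n a / len n a], the minimum over [a] increases with [n] ([lnN_super]), and the
    maximum grows by at most [c / lam ^+ n.+1] ([lnN_sub]), so all ratios are bounded; [h] is the
    supremum of the minima. By primitivity the type with the largest ratio occurs in some word of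
    [tp K a] for every [a], and so raises the minimum [K] levels higher: the spread of the ratios is
    controlled by the distance of the minimum from [h]. *)
Lemma growth_rate : exists h : R, 0 <= h /\ forall e, 0 < e -> exists N, forall n a, (N <= n)%N ->
  (h - e) * len n a <= lnN n a <= (h + e) * len n a.
Proof.
have l0 n a : 0 < len n a by exact: len_gt0.
pose s n a := lnN n a / len n a.
have hs n a : lnN n a = s n a * len n a by rewrite divfK // gt_eqF.
have /choice[b hb] : forall n, exists b, forall c, s n b <= s n c.
  by move=> n; exact: fin_argmin.
have /choice[t ht] : forall n, exists t, forall c, s n c <= s n t.
  by move=> n; exact: fin_argmax.
have low n m a u c : u \in tp m a -> c \in u ->
    s n (b n) * len (n + m) a + (s n c - s n (b n)) * len n c <= lnN (n + m) a.
  move=> hu hc; apply: le_trans (lnN_super n hu); rewrite -(sum_len n hu).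
  rewrite mulr_sumr (big_rem c) //= [X in _ <= X](big_rem c) //= hs.
  have : \sum_(y <- rem c u) s n (b n) * len n y <= \sum_(y <- rem c u) lnN n y.
    by apply: ler_sum => y _; rewrite hs ler_wpM2r // ltW.
  by lra.
have Bmono n : s n (b n) <= s n.+1 (b n.+1).
  rewrite /s ler_pdivlMr // -addn1; have [u hu] := tp_mem 1 (b (n + 1)%N).
  have [c hc] : exists c, c \in u.
    by case: u hu => [/(tp_nil (Hg := Hg))//|c u' _]; exists c; rewrite mem_head.
  apply: le_trans (low _ _ _ _ _ hu hc); rewrite lerDl mulr_ge0 ?subr_ge0 //.
  exact: ltW.
have Bmono2 n m : (n <= m)%N -> s n (b n) <= s m (b m).
  by move=> nm; rewrite -(subnKC nm); elim: (m - n)%N => [|k IH]; rewrite ?addn0 // addnS (le_trans IH).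
have lg1 : 1 < lam by exact: lam_gt1.
have lg0 : 0 < lam by exact: lam_gt0.
have [c0 hc0] := fin_argmax (fun a => lnN 1 a / L a).
set c := lnN 1 c0 / L c0 in hc0.
have cge0 : 0 <= c by rewrite divr_ge0 ?lnN_ge0 // ltW // L_gt0.
have up n : s n.+1 (t n.+1) <= s n (t n) + c / lam ^+ n.+1.
  rewrite {1}/s ler_pdivrMr //; set a := t n.+1.
  rewrite -[X in lnN X]addn1.
  apply: le_trans (@lnN_sub n 1 a (s n (t n) * len n.+1 a) _) _.
    move=> u hu; have <- : \sum_(y <- u) len n y = len n.+1 a by rewrite (sum_len n hu) addn1.
    rewrite mulr_sumr; apply: ler_sum => y _.
    by rewrite hs ler_wpM2r // ltW.
  rewrite mulrDl [X in X <= _]addrC lerD2l.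
  have -> : c / lam ^+ n.+1 * len n.+1 a = c * L a.
    by rewrite /len; field; rewrite gt_eqF // lamX_gt0.
  by rewrite -ler_pdivrMr // L_gt0.
(* [k / lam ^+ n] is the sum of the terms [c / lam ^+ j] over all [j > n]. *)
pose k := c / (lam - 1).
have k0 : 0 <= k by rewrite divr_ge0 // subr_ge0 ltW.
have Dmono n : s n (t n) + k / lam ^+ n <= s 0 (t 0%N) + k.
  elim: n => [|n IH]; first by rewrite expr0 divr1.
  apply: le_trans IH; apply: le_trans (lerD (up n) (lexx _)) _.
  rewrite -addrA lerD2l -mulrDl exprSr invfM mulrA mulrAC.
  apply: ler_wpM2r; first by rewrite invr_ge0 ltW // lamX_gt0.
  rewrite ler_pdivrMr // /k -subr_ge0.
  have -> : c / (lam - 1) * lam - (c + c / (lam - 1)) = 0; last by [].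
  by field; rewrite subr_eq0 gt_eqF.
have Bub n : s n (b n) <= s 0%N (t 0%N) + k.
  apply: le_trans (Dmono n); apply: le_trans (hb n (t n)) _.
  by rewrite lerDl divr_ge0 // ltW // lamX_gt0.
pose E := [set s n (b n) | n in [set: nat]].
have hE : has_sup E.
  by split; [exists (s 0%N (b 0%N)), 0%N|exists (s 0%N (t 0%N) + k) => _ [n _ <-]].
pose h := sup E.
have hB n : s n (b n) <= h by apply: sup_upper_bound => //; exists n.
exists h; split.
  by apply: le_trans (hB 0%N); rewrite /s divr_ge0 ?lnN_ge0 // ltW.
have [K hK] := prim_occurs (Hg := Hg).
have [cm cm0 hcm] := Lmin_ex (Hg := Hg).
(* A lower bound for [len n b / len (n + K) a], the share of length that one tile of level [n] takes
   in a tile of level [n + K], valid for all types and all [n]. *)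
pose w := cm / (lam ^+ K * Lsum (L := L)).
have ls0 : 0 < Lsum (L := L) by exact: Lsum_gt0.
have lK : 0 < lam ^+ K by exact: lamX_gt0.
have w0 : 0 < w by rewrite divr_gt0 ?mulr_gt0.
have gap n : w * (s n (t n) - s n (b n)) <= h - s n (b n).
  apply: le_trans (lerB (hB (n + K)%N) (lexx _)); set a := b (n + K)%N.
  have [u hu tu] := hK (t n) a.
  have := low n K a u (t n) hu tu; rewrite hs => hl.
  rewrite -(ler_pM2r (l0 (n + K)%N a)) mulrBl.
  have dpos : 0 <= s n (t n) - s n (b n) by rewrite subr_ge0.
  have : w * (s n (t n) - s n (b n)) * len (n + K) a <= (s n (t n) - s n (b n)) * len n (t n).
    rewrite [w * _]mulrC -mulrA ler_wpM2l // /w /len exprD.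
    have -> : cm / (lam ^+ K * Lsum (L := L)) * (lam ^+ n * lam ^+ K * L a) =
        lam ^+ n * (cm * (L a / Lsum (L := L))).
      by field; rewrite !gt_eqF // mulr_gt0.
    apply: ler_wpM2l; first exact/ltW/lamX_gt0.
    apply: le_trans (hcm (t n)); rewrite ger_pMr // ler_pdivrMr // mul1r.
    exact: L_le_sum.
  by lra.
move=> e e0; have we0 : 0 < Num.min e (w * e) by rewrite lt_min e0 mulr_gt0.
have [_ [N _ <-] hN] := sup_adherent we0 hE; rewrite -/h in hN.
exists N => n a hn; have h1 := lt_le_trans hN (Bmono2 _ _ hn).
have [m1 m2] : Num.min e (w * e) <= e /\ Num.min e (w * e) <= w * e.
  by split; rewrite ge_min lexx ?orbT.
rewrite hs !ler_pM2r //; have a1 := hb n a; have a2 := ht n a; have a3 := gap n; have a4 := hB n.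
have a5 : s n (t n) - s n (b n) <= e by rewrite -(ler_pM2l w0); lra.
by apply/andP; split; lra.
Qed.

End Counting.

(** * Entropy of observables *)

Section FiniteEntropy.
Context {R : realType}.

Lemma entf_ge0 (x : R) : 0 <= x <= 1 -> 0 <= entf x.
Proof.
move=> /andP[x0 x1]; rewrite /entf; case: eqVneq => // _.
by rewrite oppr_ge0 mulr_ge0_le0 // ln_le0.
Qed.

(** The inequality [ln x <= x - 1] at [x = r / (p * S)]; summation gives Gibbs' inequality for a
    weight [r] of total mass [S], which enters as [ln S]. *)
Lemma entf_term (p r S : R) : 0 <= p -> 0 < S -> 0 <= r -> (0 < p -> 0 < r) ->
  entf p <= - (p * ln r) + p * ln S + r / S - p.
Proof.
move=> p0 S0 r0 h; rewrite /entf; case: eqVneq => [->|pn0].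
  by have : 0 <= r / S by [rewrite divr_ge0 // ltW]; rewrite !mul0r; lra.
have {p0}p0 : 0 < p by rewrite lt_neqAle eq_sym pn0.
have {h}r0' := h p0; have q0 : 0 < r / (p * S) by rewrite divr_gt0 ?mulr_gt0.
have : ln (r / (p * S)) <= r / (p * S) - 1.
  by have := @le_ln1Dx R (r / (p * S) - 1); rewrite (addrC 1) subrK; apply; lra.
rewrite ln_div ?posrE ?mulr_gt0 // lnM ?posrE // => hl.
have := ler_wpM2l (ltW p0) hl; rewrite !mulrDr !mulrN mulr1.
have -> : p * (r / (p * S)) = r / S by field; rewrite !gt_eqF.
by rewrite mulrDr; lra.
Qed.

Lemma gibbs (J : finType) (p r : J -> R) : (forall j, 0 <= p j) -> \sum_j p j = 1 ->
  (forall j, 0 <= r j) -> (forall j, 0 < p j -> 0 < r j) ->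
  \sum_j entf (p j) <= - (\sum_j p j * ln (r j)) + ln (\sum_j r j).
Proof.
move=> p0 p1 r0 h; set S := \sum_j r j.
have S0 : 0 < S.
  have [j hj] : exists j, 0 < p j.
    apply: contrapT => /forallNP hn; move: p1; rewrite big1 => [/eqP|j _].
      by rewrite eq_sym oner_eq0.
    by apply/le_anti; rewrite p0 andbT leNgt; apply/negP; exact: hn.
  by rewrite /S (bigD1 j) //= ltr_pwDl ?h // sumr_ge0.
apply: le_trans (ler_sum _ (fun j _ => entf_term (p0 j) S0 (r0 j) (h j))) _.
rewrite !big_split /= !sumrN -mulr_suml p1 -mulr_suml -/S divff ?gt_eqF // mul1r.
by rewrite -addrA subrr addr0.
Qed.

Lemma entfD (x y : R) : 0 <= x -> 0 <= y -> entf (x + y) <= entf x + entf y.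
Proof.
move=> x0 y0; have [->|xn] := eqVneq x 0; first by rewrite add0r /entf eqxx add0r.
have [->|yn] := eqVneq y 0; first by rewrite addr0 /entf eqxx addr0.
have xp : 0 < x by rewrite lt_neqAle eq_sym xn.
have yp : 0 < y by rewrite lt_neqAle eq_sym yn.
rewrite /entf (negbTE xn) (negbTE yn) gt_eqF ?addr_gt0 // mulrDl opprD.
by apply: lerD; rewrite lerN2; apply: ler_wpM2l => //; rewrite ler_ln ?posrE ?addr_gt0 ?lerDl ?lerDr // ltW.
Qed.

Lemma entf_sum (J : Type) (s : seq J) (Q : pred J) (p : J -> R) : (forall j, 0 <= p j) ->
  entf (\sum_(j <- s | Q j) p j) <= \sum_(j <- s | Q j) entf (p j).
Proof.
move=> p0; elim: s => [|j s IH]; first by rewrite !big_nil /entf eqxx.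
rewrite !big_cons; case: (Q j) => //; apply: le_trans (entfD _ _) _ => //.
  exact: sumr_ge0.
by rewrite lerD2l.
Qed.

End FiniteEntropy.

Lemma fekete (R : realType) (a : nat -> R) : (forall n, 0 <= a n) ->
  (forall m n, a (m + n)%N <= a m + a n) -> cvgn (fun n => a n.+1 / n.+1%:R).
Proof.
move=> a0 asub; pose u n := a n.+1 / n.+1%:R.
have u0 n : 0 <= u n by rewrite divr_ge0.
pose E := [set u n | n in [set: nat]].
have hE : has_inf E by split; [exists (u 0%N), 0%N|exists 0 => _ [n _ <-]].
apply/cvg_ex; exists (inf E); apply/cvgrPdist_le => e e0.
have e2 : 0 < e / 2 by rewrite divr_gt0.
have [_ [k _ <-] hk] := inf_adherent e2 hE.
have amul q r : a (q * k.+1 + r)%N <= q%:R * a k.+1 + a r.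
  elim: q => [|q IH]; first by rewrite mul0n mul0r add0r.
  rewrite mulSn -addnA -[q.+1]add1n natrD mulrDl mul1r -addrA.
  by apply: le_trans (asub _ _) _; rewrite lerD2l.
pose M := \sum_(r < k.+1) a r.
have hM r : (r < k.+1)%N -> a r <= M.
  by move=> h; rewrite /M (bigD1 (Ordinal h)) //= lerDl sumr_ge0.
have M0 : 0 <= M by apply: sumr_ge0.
near=> n.
have inf_le : inf E <= u n by apply: ge_inf; [case: hE|exists n].
rewrite ler_distlC; apply/andP; split; first by rewrite lerBlDr (le_trans inf_le) // lerDl ltW.
suff : u n <= u k + e / 2 by move=> h; rewrite -/(u n); lra.
have n0 : 0 < n.+1%:R :> R by rewrite ltr0n.
rewrite /u ler_pdivrMr // {1}(divn_eq n.+1 k.+1).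
apply: le_trans (amul _ _) _; rewrite mulrDl; apply: lerD.
  rewrite /u mulrC -mulrA ler_wpM2l // mulrC ler_pdivlMr ?ltr0n // -natrM ler_nat.
  exact: leq_trunc_div.
apply: le_trans (hM _ (ltn_pmod _ _)) _ => //.
rewrite mulrC -ler_pdivrMr //; near: n.
exists (Num.truncn (M / (e / 2))).+1 => // n /= hn.
by apply/ltW; apply: lt_le_trans (truncnS_gt _) _; rewrite ler_nat leqW.
Unshelve. all: by end_near. Qed.

Section Observables.
Context dd (T : measurableType dd) (R : realType) (P : probability T R).

Definition obs (J : Type) (X : T -> J) := forall j, measurable [set p | X p = j].

Definition pm (J : Type) (X : T -> J) (j : J) : R := pr P [set p | X p = j].

Lemma obs_comp (J : finType) (K : Type) (X : T -> J) (h : J -> K) : obs X -> obs (fun p => h (X p)).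
Proof.
move=> hX k; have -> : [set p | h (X p) = k] = \bigcup_(j in [set j | h j = k]) [set p | X p = j].
  by apply/seteqP; split=> [p /= e|p [j /= <- <-]] //; exists (X p).
by apply: fin_bigcup_measurable.
Qed.

Lemma obs_pair (J K : Type) (X : T -> J) (Y : T -> K) : obs X -> obs Y -> obs (fun p => (X p, Y p)).
Proof.
move=> hX hY [j k]; have -> : [set p | (X p, Y p) = (j, k)] = [set p | X p = j] `&` [set p | Y p = k].
  by apply/seteqP; split=> p /= [-> ->].
exact: measurableI.
Qed.

Lemma obs_ffun (I : finType) (J : Type) (X : I -> T -> J) :
  (forall i, obs (X i)) -> obs (fun p => [ffun i => X i p]).
Proof.
move=> hX f; have -> : [set p | [ffun i => X i p] = f] =
    \bigcap_(i in [set: I]) [set p | X i p = f i].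
  apply/seteqP; split=> [p /= <- i _|p h]; first by rewrite /= ffunE.
  by apply/ffunP => i; rewrite ffunE; exact: h.
by apply: fin_bigcap_measurable => // i _; exact: hX.
Qed.

Lemma obs_set (J : finType) (X : T -> J) (Q : J -> Prop) : obs X -> measurable [set p | Q (X p)].
Proof.
move=> hX; have -> : [set p | Q (X p)] = \bigcup_(j in [set j | Q j]) [set p | X p = j].
  by apply/seteqP; split=> [p /= e|p [j /= h e]]; [exists (X p)|rewrite /= e].
by apply: fin_bigcup_measurable.
Qed.

Lemma pm_ge0 (J : Type) (X : T -> J) j : 0 <= pm X j.
Proof. exact: pr_ge0. Qed.

Lemma pm_le1 (J : Type) (X : T -> J) j : obs X -> pm X j <= 1.
Proof. by move=> h; apply: pr_le1. Qed.

Lemma pr_obs (J : finType) (X : T -> J) A : obs X -> measurable A ->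
  pr P A = \sum_j pr P (A `&` [set p | X p = j]).
Proof.
move=> hX mA; rewrite (@pr_fibers _ _ _ P _ (enum J) A X (enum_uniq _)) //.
- by rewrite big_enum.
- by move=> p _; rewrite mem_enum.
- by move=> j; exact: measurableI.
Qed.

Lemma pm_sum (J : finType) (X : T -> J) : obs X -> \sum_j pm X j = 1.
Proof.
move=> hX; rewrite -(prT P) (pr_obs hX) //; apply: eq_bigr => j _.
by rewrite setTI.
Qed.

Lemma pm_comp (J : finType) (K : eqType) (X : T -> J) (h : J -> K) k : obs X ->
  pm (fun p => h (X p)) k = \sum_(j | h j == k) pm X j.
Proof.
move=> hX; rewrite /pm (pr_obs hX) //; last exact: (obs_comp h hX).
rewrite [RHS]big_mkcond /=; apply: eq_bigr => j _; case: eqP => e.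
  by congr pr; apply/seteqP; split=> p /=; [case|move=> h1; rewrite h1].
rewrite (_ : _ `&` _ = set0) ?pr0 //; apply/seteqP; split=> // p [/= h1 h2].
by apply: e; rewrite -h2.
Qed.

Lemma pm_expect (J K : finType) (X : T -> J) (h : J -> K) (phi : K -> R) : obs X ->
  \sum_j pm X j * phi (h j) = \sum_k pm (fun p => h (X p)) k * phi k.
Proof.
move=> hX; rewrite (partition_big h xpredT) //=; apply: eq_bigr => k _.
rewrite (pm_comp _ _ hX) mulr_suml; apply: eq_bigr => j /eqP ->; by [].
Qed.

Definition Hf (J : finType) (X : T -> J) : R := \sum_j entf (pm X j).

Lemma Hf_ge0 (J : finType) (X : T -> J) : obs X -> 0 <= Hf X.
Proof. by move=> h; apply: sumr_ge0 => j _; apply: entf_ge0; rewrite pm_ge0 pm_le1. Qed.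

Lemma Hf_comp (J K : finType) (X : T -> J) (h : J -> K) : obs X -> Hf (fun p => h (X p)) <= Hf X.
Proof.
move=> hX; rewrite /Hf [X in _ <= X](partition_big h xpredT) //=; apply: ler_sum => k _.
by rewrite (pm_comp _ _ hX); apply: entf_sum => j; exact: pm_ge0.
Qed.

Lemma Hf_gibbs (J : finType) (X : T -> J) (r : J -> R) : obs X -> (forall j, 0 <= r j) ->
  (forall j, 0 < pm X j -> 0 < r j) ->
  Hf X <= - (\sum_j pm X j * ln (r j)) + ln (\sum_j r j).
Proof. by move=> hX; apply: gibbs => [j|]; [exact: pm_ge0|exact: pm_sum]. Qed.

Lemma pm_fst_gt0 (J K : finType) (X : T -> J) (h : J -> K) j : obs X ->
  0 < pm X j -> 0 < pm (fun p => h (X p)) (h j).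
Proof.
move=> hX h0; apply: lt_le_trans h0 _; apply: pr_le => //; first exact: (obs_comp h hX).
by move=> p /= ->.
Qed.

Lemma Hf_self (J : finType) (X : T -> J) : Hf X = - \sum_j pm X j * ln (pm X j).
Proof.
rewrite /Hf -sumrN; apply: eq_bigr => j _; rewrite /entf; case: eqP => [->|] //.
by rewrite mul0r oppr0.
Qed.

(** Gibbs' inequality against the product of the two marginal laws. *)
Lemma Hf_pair (J K : finType) (X : T -> J) (Y : T -> K) : obs X -> obs Y ->
  Hf (fun p => (X p, Y p)) <= Hf X + Hf Y.
Proof.
move=> hX hY; have hZ := obs_pair hX hY; set Z := fun p => (X p, Y p) in hZ *.
have zf z : 0 < pm Z z -> 0 < pm X z.1 by move=> h; exact: (pm_fst_gt0 fst hZ h).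
have zs z : 0 < pm Z z -> 0 < pm Y z.2 by move=> h; exact: (pm_fst_gt0 snd hZ h).
apply: le_trans (@Hf_gibbs _ Z (fun z => pm X z.1 * pm Y z.2) hZ _ _) _.
- by move=> z; rewrite mulr_ge0 ?pm_ge0.
- by move=> z hz; rewrite mulr_gt0 ?zf ?zs.
have -> : \sum_(z : J * K) pm X z.1 * pm Y z.2 = 1.
  rewrite -(pair_bigA _ (fun j k => pm X j * pm Y k)) /=.
  by under eq_bigr => j _ do rewrite -mulr_sumr (pm_sum hY) mulr1; exact: pm_sum.
rewrite ln1 addr0 (Hf_self X) (Hf_self Y) -opprD lerN2.
rewrite -(pm_expect fst (fun j => ln (pm X j)) hZ) -(pm_expect snd (fun j => ln (pm Y j)) hZ).
rewrite -big_split /= le_eqVlt; apply/orP; left; apply/eqP; apply: eq_bigr => z _.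
have [e|/negP h] := boolP (pm Z z == 0); first by rewrite (eqP e) !mul0r addr0.
have h0 : 0 < pm Z z by rewrite lt_neqAle pm_ge0 andbT eq_sym; apply/negP.
by rewrite -mulrDr lnM ?posrE ?zf ?zs.
Qed.

Lemma Hf_lower (J : finType) (X : T -> J) c : obs X -> 0 < c -> (forall j, pm X j <= c) ->
  - ln c <= Hf X.
Proof.
move=> hX c0 hc; rewrite Hf_self lerN2 -[ln c]mul1r -(pm_sum hX) mulr_suml.
apply: ler_sum => j _; have [->|h] := eqVneq (pm X j) 0; first by rewrite !mul0r.
have h0 : 0 < pm X j by rewrite lt_neqAle pm_ge0 andbT eq_sym.
by rewrite ler_wpM2l ?pm_ge0 // ler_ln ?posrE.
Qed.

Variable phi : nat -> T -> T.
Hypothesis phiD : forall i j p, phi (i + j) p = phi j (phi i p).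
Hypothesis mphi : forall i (B : set T), measurable B -> measurable [set p | B (phi i p)].
Hypothesis pphi : forall i (B : set T), measurable B -> pr P [set p | B (phi i p)] = pr P B.

Lemma obs_phi (J : Type) (X : T -> J) i : obs X -> obs (fun p => X (phi i p)).
Proof. by move=> hX j; exact: (mphi i (hX j)). Qed.

Lemma pm_phi (J : Type) (X : T -> J) i j : obs X -> pm (fun p => X (phi i p)) j = pm X j.
Proof. by move=> hX; exact: (pphi i (hX j)). Qed.

Definition names (J : Type) (X : T -> J) n (p : T) : {ffun 'I_n -> J} := [ffun i : 'I_n => X (phi i p)].

Lemma obs_names (J : Type) (X : T -> J) n : obs X -> obs (names X n).
Proof. by move=> hX; apply: obs_ffun => i; exact: obs_phi. Qed.

Definition Hn (J : finType) (X : T -> J) n : R := Hf (names X n).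

Lemma Hn_subadd (J : finType) (X : T -> J) m n : obs X -> Hn X (m + n) <= Hn X m + Hn X n.
Proof.
move=> hX; have hm := @obs_names _ X m hX; have hn := @obs_names _ X n hX.
have hn' := obs_phi m hn.
pose h (z : {ffun 'I_m -> J} * {ffun 'I_n -> J}) : {ffun 'I_(m + n) -> J} :=
  [ffun i : 'I_(m + n) => match fintype.split i with inl j => z.1 j | inr j => z.2 j end].
have e p : names X (m + n) p = h (names X m p, names X n (phi m p)).
  apply/ffunP => i; rewrite !ffunE; case: (splitP i) => j ->; rewrite ffunE //.
  by rewrite phiD.
rewrite {1}/Hn (_ : names X (m + n) = fun p => h (names X m p, names X n (phi m p))); last exact/funext.
apply: le_trans (Hf_comp h (obs_pair hm hn')) _; apply: le_trans (Hf_pair hm hn') _.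
rewrite lerD2l /Hn /Hf; apply: ler_sum => j _.
by rewrite (pm_phi m j hn).
Qed.

Lemma Hn_cvg (J : finType) (X : T -> J) : obs X -> cvgn (fun n => Hn X n.+1 / n.+1%:R).
Proof.
move=> hX; apply: (@fekete R (Hn X)) => [n|m n]; last exact: Hn_subadd.
by apply: Hf_ge0; exact: obs_names.
Qed.

(* The names of [g] are determined by those of [s] up to [K] choices, and [f] differs
   from [g] rarely, so an independent model for [s] bounds the entropy of [f]. *)
Lemma Hn_bound k (S : finType) (f g : T -> 'I_k) (s : T -> S) (r0 : S -> R) (dl : R)
    (A : set T) n (K : nat) :
  obs f -> obs g -> obs s -> (forall B, measurable B -> pr P (B `&` A) = pr P B) ->
  (forall a, 0 <= r0 a) -> (forall a, 0 < pm s a -> 0 < r0 a) -> 0 < dl ->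
  (0 < K)%N ->
  (forall w : {ffun 'I_n -> S},
     (#|[pred G : {ffun 'I_n -> 'I_k} | `[< exists p, [/\ A p, names s n p = w & names g n p = G] >]]| <= K)%N) ->
  Hn f n <= ln K%:R + n%:R * (ln (1 + k%:R * dl) + ln (\sum_a r0 a)
    - \sum_a pm s a * ln (r0 a) - pr P [set p | f p <> g p] * ln dl).
Proof.
move=> hf hg hs hA r00 r0p dl0 K0 hK.
have hF := @obs_names _ f n hf; have hG := @obs_names _ g n hg; have hS := @obs_names _ s n hs.
have hZ := obs_pair (obs_pair hF hS) hG.
set Z := fun p => (names f n p, names s n p, names g n p) in hZ.
pose ach (w : {ffun 'I_n -> S}) (G : {ffun 'I_n -> 'I_k}) :=
  `[< exists p, [/\ A p, names s n p = w & names g n p = G] >].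
pose chi (b c : 'I_k) : R := if b == c then 1 else dl.
have chi0 b c : 0 < chi b c by rewrite /chi; case: eqP.
(* The model: the symbols of [s] are independent with weights [r0], the name of [g] may be any one
   achievable together with them, and the name of [f] departs from it independently at each time,
   with weight [dl] for every wrong symbol. *)
pose r (z : {ffun 'I_n -> 'I_k} * {ffun 'I_n -> S} * {ffun 'I_n -> 'I_k}) : R :=
  (\prod_i r0 (z.1.2 i)) * (ach z.1.2 z.2)%:R * \prod_i chi (z.1.1 i) (z.2 i).
have r_ge0 z : 0 <= r z.
  by rewrite /r !mulr_ge0 ?ler0n //; apply: prodr_ge0 => i _; rewrite ?r00 // ltW.
have sup z : 0 < pm Z z -> [/\ ach z.1.2 z.2 & forall i, 0 < r0 (z.1.2 i)].
  move=> hz; split.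
    have : pr P ([set p | Z p = z] `&` A) != 0 by rewrite hA ?gt_eqF.
    move=> hne; apply/asboolP; apply: contrapT => /forallNP hno.
    move: hne; rewrite (_ : _ `&` _ = set0) ?pr0 ?eqxx //; apply/seteqP; split=> // p [/= e hp].
    by apply: (hno p); rewrite -e.
  move=> i; apply: r0p; rewrite -(pm_phi i _ hs).
  have := pm_fst_gt0 (fun z : {ffun 'I_n -> 'I_k} * {ffun 'I_n -> S} * {ffun 'I_n -> 'I_k} => z.1.2 i) hZ hz.
  by rewrite (_ : (fun p => (Z p).1.2 i) = fun p => s (phi i p)) //; apply/funext => p; rewrite /= ffunE.
have lnr z : 0 < pm Z z -> ln (r z) = \sum_i ln (r0 (z.1.2 i)) + \sum_i ln (chi (z.1.1 i) (z.2 i)).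
  have lnprod (I : finType) (F : I -> R) : (forall i, 0 < F i) -> ln (\prod_i F i) = \sum_i ln (F i).
    move=> F0; suff : 0 < \prod_i F i /\ ln (\prod_i F i) = \sum_i ln (F i) by case.
    elim/big_rec2: _ => [|i x y _ [y0 e]]; first by rewrite ln1.
    by rewrite mulr_gt0 // lnM ?posrE // e.
  move=> /sup[a h]; rewrite /r a mulr1 lnM ?posrE ?prodr_gt0 // !lnprod //.
have rpos z : 0 < pm Z z -> 0 < r z.
  by move=> /sup[a h]; rewrite /r a mulr1 mulr_gt0 // prodr_gt0.
(* Summing out the name of [f] gives at most [1 + k%:R * dl] per time, summing out the name of [g]
   gives the number [K] of choices, and the names of [s] then give the power of [\sum_a r0 a]. *)
have hsum : \sum_z r z <= K%:R * (1 + k%:R * dl) ^+ n * (\sum_a r0 a) ^+ n.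
  rewrite -(pair_bigA _ (fun z1 z2 => r (z1, z2))) /=.
  rewrite -(pair_bigA _ (fun F w => \sum_G r (F, w, G))) /= exchange_big /=.
  have hw w : \sum_F \sum_G r (F, w, G) <= (\prod_i r0 (w i)) * (K%:R * (1 + k%:R * dl) ^+ n).
    rewrite exchange_big /=.
    apply: (@le_trans _ _ (\sum_(G : {ffun 'I_n -> 'I_k}) (\prod_i r0 (w i)) * ((ach w G)%:R * (1 + k%:R * dl) ^+ n))).
      apply: ler_sum => G _; rewrite /r /= -mulr_sumr -mulrA.
      apply: ler_wpM2l; first by apply: prodr_ge0.
      apply: ler_wpM2l; first exact: ler0n.
      rewrite -(bigA_distr_bigA (fun i b => chi b (G i))) /=.
      rewrite -[n in X in _ <= X]card_ord -prodr_const; apply: ler_prod => i _.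
      apply/andP; split; first by apply: sumr_ge0 => b _; exact: ltW.
      rewrite (bigD1 (G i)) //= {1}/chi eqxx lerD2l.
      apply: (@le_trans _ _ (\sum_(b : 'I_k | b != G i) dl)).
        by apply: ler_sum => b /negbTE h; rewrite /chi h.
      rewrite sumr_const mulr_natl -[X in _ *+ X <= _]/(#|_|) ler_wpMn2l ?ltW //.
      by rewrite -[X in (_ <= X)%N]card_ord max_card.
    rewrite -mulr_sumr -mulr_suml; apply: ler_wpM2l; first by apply: prodr_ge0.
    apply: ler_wpM2r.
      by apply: exprn_ge0; rewrite addr_ge0 // mulr_ge0 // ltW.
    rewrite -natr_sum ler_nat; apply: leq_trans (hK w); rewrite -sum1_card [X in (_ <= X)%N]big_mkcond /=.
    by apply: leq_sum => G _; rewrite inE -/(ach w G); case: (ach w G).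
  apply: le_trans (ler_sum _ (fun w _ => hw w)) _; rewrite -mulr_suml mulrC.
  apply: ler_wpM2l.
    by rewrite mulr_ge0 // exprn_ge0 // addr_ge0 // mulr_ge0 // ltW.
  by rewrite -(bigA_distr_bigA (fun (i : 'I_n) a => r0 a)) /= prodr_const card_ord.
have hF1 : Hn f n <= Hf Z by exact: (Hf_comp (fun z : {ffun 'I_n -> 'I_k} * {ffun 'I_n -> S} * {ffun 'I_n -> 'I_k} => z.1.1) hZ).
apply: le_trans hF1 _; apply: le_trans (Hf_gibbs hZ r_ge0 rpos) _.
have rs0 : 0 < \sum_z r z.
  have [z hz] : exists z, 0 < pm Z z.
    apply: contrapT => /forallNP hn; have := pm_sum hZ; rewrite big1 => [/eqP|z _].
      by rewrite eq_sym oner_eq0.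
    by apply/le_anti; rewrite pm_ge0 andbT leNgt; apply/negP; exact: hn.
  by rewrite (bigD1 z) //= ltr_pwDl ?rpos // sumr_ge0.
have a0 : 0 < \sum_a r0 a.
  have [a ha] : exists a, 0 < pm s a.
    apply: contrapT => /forallNP hn; have := pm_sum hs; rewrite big1 => [/eqP|a _].
      by rewrite eq_sym oner_eq0.
    by apply/le_anti; rewrite pm_ge0 andbT leNgt; apply/negP; exact: hn.
  by rewrite (bigD1 a) //= ltr_pwDl ?r0p // sumr_ge0.
have b0 : 0 < 1 + k%:R * dl by rewrite ltr_pwDl // mulr_ge0 // ltW.
have lnS : ln (\sum_z r z) <= ln K%:R + n%:R * ln (1 + k%:R * dl) + n%:R * ln (\sum_a r0 a).
  have K0R : 0 < K%:R :> R by rewrite ltr0n.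
  have A0 := exprn_gt0 n b0; have B0 := exprn_gt0 n a0.
  have <- : ln (K%:R * (1 + k%:R * dl) ^+ n * (\sum_a r0 a) ^+ n) =
      ln K%:R + n%:R * ln (1 + k%:R * dl) + n%:R * ln (\sum_a r0 a).
    by rewrite !lnM ?posrE ?mulr_gt0 // !lnXn // !mulr_natl.
  by rewrite ler_ln ?posrE // !mulr_gt0.
have eE : \sum_z pm Z z * ln (r z) = n%:R * (\sum_a pm s a * ln (r0 a)) + n%:R * (pr P [set p | f p <> g p] * ln dl).
  have -> : \sum_z pm Z z * ln (r z) =
      \sum_(i < n) \sum_z pm Z z * ln (r0 (z.1.2 i)) + \sum_(i < n) \sum_z pm Z z * ln (chi (z.1.1 i) (z.2 i)).
    rewrite exchange_big [X in _ + X]exchange_big -big_split; apply: eq_bigr => z _ /=.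
    have [e|h] := eqVneq (pm Z z) 0; first by rewrite e mul0r !big1 ?addr0 // => i _; rewrite mul0r.
    by rewrite lnr ?mulrDr ?mulr_sumr // lt_neqAle pm_ge0 eq_sym h.
  congr (_ + _).
    rewrite -[n in RHS]card_ord mulr_natl -sumr_const; apply: eq_bigr => i _.
    rewrite (pm_expect (fun z : {ffun 'I_n -> 'I_k} * {ffun 'I_n -> S} * {ffun 'I_n -> 'I_k} => z.1.2 i) (fun a => ln (r0 a)) hZ); apply: eq_bigr => a _; congr (_ * _).
    by rewrite -(pm_phi i a hs); congr (pr _ _); apply/seteqP; split=> p /=; rewrite ffunE.
  rewrite -[n in RHS]card_ord mulr_natl -sumr_const; apply: eq_bigr => i _.
  pose lc (a : bool) : R := if a then 0 else ln dl.
  transitivity (\sum_z pm Z z * lc (z.1.1 i == z.2 i)).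
    by apply: eq_bigr => z _; rewrite /chi /lc; case: eqP; rewrite ?ln1.
  rewrite (pm_expect (fun z : {ffun 'I_n -> 'I_k} * {ffun 'I_n -> S} * {ffun 'I_n -> 'I_k} => z.1.1 i == z.2 i) lc hZ) big_bool /= mulr0 add0r.
  congr (_ * _); have mne : measurable [set p | f p <> g p].
    exact: (@obs_set _ (fun p => (f p, g p)) (fun z => z.1 <> z.2) (obs_pair hf hg)).
  rewrite -(pphi i mne); congr (pr _ _); apply/seteqP; split=> p /=; rewrite !ffunE.
    by move=> /negbT/eqP.
  by move/eqP/negbTE.
rewrite eE; lra.
Qed.

End Observables.

(** * Approximation by level-n cells *)

Lemma Ysp_sigma_ind (d : nat) (R : realType) (Q : set (Ysp d R) -> Prop) :
  (forall B, Q B -> Q (~` B)) ->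
  (forall F : nat -> set (Ysp d R), (forall n, Q (F n)) -> Q (\bigcup_n F n)) ->
  (forall i a, Q [set p | p.1 i = a]) -> (forall e : R, Q [set p | e <= p.2]) ->
  forall B, measurable B -> Q B.
Proof.
move=> hC hU h1 h2; have h0 : Q set0.
  (* [Q set0] is not among the assumptions; the empty set arises as the complement of the union of a
     generator and its complement. *)
  pose F n : set (Ysp d R) := if n is 0%N then [set p | p.1 0 = ord0] else ~` [set p | p.1 0 = ord0].
  have := hC _ (hU F (fun n => match n with 0%N => h1 0 ord0 | _.+1 => hC _ (h1 0 ord0) end)).
  congr Q; apply/seteqP; split=> // p; apply; have [e|e] := pselect (p.1 0 = ord0).
    by exists 0%N.
  by exists 1%N.
have sQ : sigma_algebra setT Q.
  by split=> // A /hC; rewrite setTD.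
have pre (T : Type) (f : Ysp d R -> T) : sigma_algebra setT [set A | Q (f @^-1` A)].
  split=> [|A|F hF] /=; first by rewrite preimage_set0.
    by rewrite setTD preimage_setC; exact: hC.
  by rewrite preimage_bigcup; exact: hU.
move=> B; apply: smallest_sub => //; rewrite subUset; split=> _ [A mA <-]; rewrite setTI.
- have := @smallest_sub _ _ _ _ (pre _ fst) _ A mA; apply.
  by move=> _ [i [a ->]]; exact: h1.
- have := @smallest_sub _ _ (@RGenCInfty.G R) _ (pre _ snd).
  move=> /(_ _ A); apply; first by move=> _ [x ->] /=; have := h2 x; congr Q; apply/seteqP; split=> p /=; rewrite in_itv /= andbT.
  have e := RGenCInfty.measurableE R.
  have : (@ocitv R).-sigma.-measurable A by [].
  by rewrite e.
Qed.

Section SimpleSets.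
Context {d : nat} {R : realType}.
Local Notation tilet := ('I_d.+1 * word d)%type.

(* [F T] depends on its argument only through its position relative to the thresholds [E]. *)
Definition simple (K : Type) (E : seq R) (F : tilet -> R -> K) :=
  forall T t t', (forall e, e \in E -> (e <= t) = (e <= t')) -> F T t = F T t'.

Lemma simple_measurable (K : Type) E (F : tilet -> R -> K) T k : simple E F ->
  measurable ([set t | F T t = k] : set (measurableTypeR R)).
Proof.
move=> hF; pose vec (t : measurableTypeR R) : {ffun 'I_(size E) -> bool} :=
  [ffun i : 'I_(size E) => nth 0 E i <= t].
have ovec : obs vec.
  apply: obs_ffun => i b; have := measurable_itv (R := R) `[nth 0 E i, +oo[.
  case: b => h; first by move: h; congr measurable; apply/seteqP; split=> t /=; rewrite in_itv /= andbT.
  move: (measurableC h); congr measurable; apply/seteqP; split=> t /=; rewrite in_itv /= andbT.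
    by move/negP/negbTE.
  by move=> ->.
have := @obs_set _ _ _ vec (fun v => exists2 t', vec t' = v & F T t' = k) ovec.
congr measurable; apply/seteqP; split=> t /=; last by exists t.
case=> t' e <-; apply: hF => x hx; have hi : (index x E < size E)%N by rewrite index_mem.
by have := congr1 (fun v : {ffun 'I_(size E) -> bool} => v (Ordinal hi)) e; rewrite !ffunE /= nth_index.
Qed.

End SimpleSets.

Section Approximation.
Context {d : nat} {R : realType} {th : rsubst d} {lam : R} {L : 'I_d.+1 -> R}.
Context {Hg : good th lam L}.
Local Notation tp := (theta_pow th).
Local Notation X := (Xth th).
Local Notation Y := (Yset th L).
Local Notation tile := (tile (R := R) (th := th)).
Local Notation tm := (tm (th := th) (L := L)).
Local Notation len := (len (lam := lam) (L := L)).
Local Notation tlen := (tlen (th := th) (lam := lam) (L := L)).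
Local Notation tilet := ('I_d.+1 * word d)%type.
Implicit Types (p q : Ysp d R).

(** The index [tidx] read off from tile and height alone: the number of letters of the tile that end
    at or before height [t]. *)
Definition kidx (T : tilet) (t : R) : nat :=
  count (fun j => Lw L (take j.+1 T.2) <= t) (iota 0 (size T.2)).

Lemma count_ltn k n : (k <= n)%N -> count (fun j => (j < k)%N) (iota 0 n) = k.
Proof.
move=> h; rewrite -{1}(subnKC h) iotaD count_cat add0n.
rewrite (@eq_in_count _ _ predT) ?count_predT ?size_iota.
  rewrite (@eq_in_count _ _ pred0) ?count_pred0 ?addn0 // => j.
  by rewrite mem_iota => /andP[h1 _] /=; rewrite ltnNge h1.
by move=> j; rewrite mem_iota => /andP[_ ->].
Qed.

Lemma kidxE n p : Y p -> kidx (tile n p) (tm n p) = tidx (th := th) n p.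
Proof.
move=> hy; have [hx /andP[h1 h2]] := hy; have hk := tidx_lt (Hg := Hg) n hx.
rewrite /kidx -[RHS](count_ltn (ltnW hk)); apply: eq_count => j /=.
have hl := tile_islab (Hg := Hg) n hx; rewrite [X in islab _ _ (X, _)]surjective_pairing in hl.
have := islab_nth hl hk; rewrite subrr => e.
rewrite /tm; have [hj|hj] := ltnP j (tidx (th := th) n p).
  by have := @Lw_take_le _ _ _ _ _ Hg (tile n p).2 _ _ hj; lra.
have := @Lw_take_le _ _ _ _ _ Hg (tile n p).2 (tidx (th := th) n p).+1 j.+1; rewrite ltnS => /(_ hj).
rewrite Lw_take_S // -e => h3; apply/negbTE; rewrite -ltNge; lra.
Qed.

Definition prefs n : seq R := [seq Lw L (take j.+1 T.2) | T <- tiles (th := th) n, j <- iota 0 (size T.2)].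

Lemma kidx_simple n T t t' : T \in tiles (th := th) n ->
  (forall e, e \in prefs n -> (e <= t) = (e <= t')) -> kidx T t = kidx T t'.
Proof.
move=> hT h; apply: eq_in_count => j hj; apply: h.
by apply/allpairsPdep; exists T, j.
Qed.

(** Points close to an end of their level-[n] tile, which may then fail to show the coordinates near
    the origin. *)
Definition fault n (r : R) : set (Ysp d R) := [set p | tm n p < r \/ tlen n p - tm n p <= r].

Lemma measurable_fault n r : measurable (fault n r).
Proof.
have -> : fault n r = [set p | tm n p < r \/ tlen n p <= tm n p + r].
  by apply/seteqP; split=> p [] h; [left|right; lra|left|right; lra].
apply: (@measurable_countable _ _ _ (tile n)
  (fun T => [set p | tm n p < r \/ len n T.1 <= tm n p + r])) => T; first exact: measurable_tile.
apply: measurableU.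
  have := @measurable_tm _ _ _ _ _ Hg n measurableT _ (measurable_itv (R := R) `]-oo, r[).
  by rewrite setTI; congr measurable; apply/seteqP; split=> p /=; rewrite in_itv.
have := @measurable_tm _ _ _ _ _ Hg n measurableT _ (measurable_itv (R := R) `[len n T.1 - r, +oo[).
by rewrite setTI; congr measurable; apply/seteqP; split=> p /=; rewrite in_itv /= andbT lerBlDr.
Qed.

Definition letterF n (i : int) (a : 'I_d.+1) (T : tilet) (t : R) : bool :=
  (T \in tiles (th := th) n) && [exists j : 'I_(size T.2), ((j : nat)%:Z == (kidx T t)%:Z + i) && (nth ord0 T.2 j == a)].

Lemma letterF_simple n i a : simple (prefs n) (letterF n i a).
Proof.
move=> T t t' h; rewrite /letterF; case: (boolP (T \in _)) => //= hT.
by rewrite (kidx_simple hT h).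
Qed.

(** A letter has length at most [Lsum], so a tile extending farther than [Lsum] times [|i| + 1] on
    both sides covers position [i]. *)
Lemma letterF_ok n i a p : Y p -> ~ fault n (Lsum (L := L) * (`|i|%N.+1)%:R) p ->
  letterF n i a (tile n p) (tm n p) <-> p.1 i = a.
Proof.
move=> hy hf; have [hx _] := hy; have hk := tidx_lt (Hg := Hg) n hx.
have hl := tile_islab (Hg := Hg) n hx; rewrite [X in islab _ _ (X, _)]surjective_pairing in hl.
set w := (tile n p).2 in hk hl *; set k := tidx (th := th) n p in hk hl *.
have S0 : 0 < Lsum (L := L) by exact: Lsum_gt0.
have b1 : 0 <= k%:Z + i.
  rewrite leNgt; apply/negP => hi; apply: hf; left.
  have hki : (k < `|i|)%N by lia.
  have ltk : tm n p < Lw L (take k.+1 w).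
    rewrite ltNge; apply/negP => h.
    have : (k.+1 <= kidx (tile n p) (tm n p))%N.
      rewrite /kidx -/w -[X in (X <= _)%N](count_ltn (k := k.+1) (n := size w)) //.
      by apply: sub_count => j /= hj; apply: le_trans h; exact: Lw_take_le.
    by rewrite kidxE // ltnn.
  apply: lt_le_trans ltk _; apply: le_trans (@Lw_le_size _ _ _ _ _ Hg _) _.
  rewrite ler_wpM2l ?(ltW S0) // ler_nat size_take_min; apply: leq_trans (geq_minl _ _) _; lia.
have b2 : k%:Z + i < (size w)%:Z.
  rewrite ltNge; apply/negP => hi; apply: hf; right.
  have e1 : tlen n p = Lw L (take k w) + Lw L (drop k w) by rewrite -Lw_cat cat_take_drop tile_Lw.
  have : Lw L (drop k w) <= Lsum (L := L) * `|i|%N.+1%:R.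
    apply: le_trans (@Lw_le_size _ _ _ _ _ Hg _) _.
    by rewrite ler_wpM2l ?(ltW S0) // ler_nat size_drop; lia.
  have : 0 <= p.2 by case: hy => _ /andP[].
  by rewrite e1 /tm -/w -/k; lra.
have hj : (absz (k%:Z + i)%R < size w)%N by lia.
have hn := islab_nth hl hj.
rewrite (_ : _ - k%:Z = i) in hn; last lia.
rewrite /letterF tile_tiles //= kidxE // -/k -/w hn; split.
  move=> /existsP[j /andP[/eqP ej /eqP <-]]; congr (nth _ _ _); lia.
by move=> e; apply/existsP; exists (Ordinal hj) => /=; rewrite -e eqxx andbT; apply/eqP; lia.
Qed.

Definition heightF n (x : R) (T : tilet) (t : R) : bool :=
  (T \in tiles (th := th) n) && (x + Lw L (take (kidx T t) T.2) <= t).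

Lemma heightF_simple n x :
  simple (prefs n ++ [seq x + Lw L (take j T.2) | T <- tiles (th := th) n, j <- iota 0 (size T.2).+1]) (heightF n x).
Proof.
move=> T t t' h; rewrite /heightF; case: (boolP (T \in _)) => //= hT.
have e : kidx T t = kidx T t'.
  by apply: (kidx_simple hT) => y hy; apply: h; rewrite mem_cat hy.
rewrite -e; apply: h; rewrite mem_cat; apply/orP; right.
apply/allpairsPdep; exists T, (kidx T t); split=> //.
by rewrite mem_iota add0n ltnS; apply: leq_trans (count_size _ _) _; rewrite size_iota.
Qed.

Lemma heightF_ok n x p : Y p -> heightF n x (tile n p) (tm n p) <-> x <= p.2.
Proof.
move=> hy; have [hx _] := hy; rewrite /heightF tile_tiles //= kidxE // /tm.
by rewrite lerD2r.
Qed.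

Variables P1 P2 : probability (Ysp d R) R.
Hypothesis Y1 : pr P1 Y = 1.
Hypothesis Y2 : pr P2 Y = 1.
Hypothesis small1 : forall r e, 0 < e -> exists N, forall n, (N <= n)%N -> pr P1 (fault n r) <= e.
Hypothesis small2 : forall r e, 0 < e -> exists N, forall n, (N <= n)%N -> pr P2 (fault n r) <= e.

Definition cellset n (F : tilet -> R -> bool) : set (Ysp d R) := [set p | F (tile n p) (tm n p)].

Lemma measurable_cellset n E F : simple E F -> measurable (cellset n F).
Proof.
move=> hF; apply: (@measurable_countable _ _ _ (tile n) (fun T => [set p | F T (tm n p)])) => T.
  exact: measurable_tile.
have := @measurable_tm _ _ _ _ _ Hg n measurableT _ (simple_measurable T true hF).
by rewrite setTI.
Qed.

Definition symd (A B : set (Ysp d R)) : set (Ysp d R) := [set p | ~ (A p <-> B p)].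

Lemma measurable_symd A B : measurable A -> measurable B -> measurable (symd A B).
Proof.
move=> mA mB; have -> : symd A B = (A `\` B) `|` (B `\` A).
  apply/seteqP; split=> p /=; rewrite /symd /=.
    move=> h; have [a|a] := pselect (A p); have [b|b] := pselect (B p); [|by left|by right|].
      by exfalso; apply: h.
    by exfalso; apply: h.
  by case=> -[a b] [h1 h2]; auto.
by apply: measurableU; exact: measurableD.
Qed.

(** The same cell set has to serve both measures, because [cells_determine] compares them through
    it. *)
Definition approx (B : set (Ysp d R)) := measurable B /\ forall e, 0 < e ->
  exists N, forall n, (N <= n)%N -> exists E F, [/\ simple E F,
    pr P1 (symd B (cellset n F)) <= e & pr P2 (symd B (cellset n F)) <= e].

Lemma approx_generator B (En : nat -> seq R) (Fn : nat -> tilet -> R -> bool) r : measurable B ->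
  (forall n, simple (En n) (Fn n)) ->
  (forall n p, Y p -> ~ fault n r p -> Fn n (tile n p) (tm n p) <-> B p) -> approx B.
Proof.
move=> mB hS h; split=> // e e0; have [N1 h1] := small1 r e0; have [N2 h2] := small2 r e0.
exists (maxn N1 N2) => n; rewrite geq_max => /andP[n1 n2]; exists (En n), (Fn n).
have mS : measurable (symd B (cellset n (Fn n))) by apply: measurable_symd => //; exact: measurable_cellset.
have mY : measurable Y by exact: measurable_Yset.
have mF : measurable (fault n r) by exact: measurable_fault.
have sub (P : probability (Ysp d R) R) : pr P Y = 1 -> pr P (symd B (cellset n (Fn n))) <= pr P (fault n r).
  move=> hY; have hC : pr P (~` Y) = 0 by rewrite prC // hY subrr.
  apply: (@le_trans _ _ (pr P (fault n r `|` ~` Y))).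
    apply: pr_le => //; first by apply: measurableU => //; exact: measurableC.
    move=> p hp; have [hy|hy] := pselect (Y p); [left|by right].
    by apply: contrapT => hf; apply: hp; split=> /h; apply.
  by apply: le_trans (prU_le _ _ _) _ => //; [exact: measurableC|rewrite hC addr0].
split=> //; [by apply: le_trans (sub P1 Y1) _; exact: h1|by apply: le_trans (sub P2 Y2) _; exact: h2].
Qed.

Lemma symd_sub A A' B B' : symd (A `|` A') (B `|` B') `<=` symd A B `|` symd A' B'.
Proof.
move=> p h; have [h1|h1] := pselect (symd A B p); [by left|right=> h2; apply: h].
have {}h1 : A p <-> B p by apply: contrapT.
by split=> -[a|a]; [left; apply/h1|right; apply/h2|left; apply/h1|right; apply/h2].
Qed.

Lemma approxU A B : approx A -> approx B -> approx (A `|` B).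
Proof.
move=> [mA hA] [mB hB]; split=> [|e e0]; first exact: measurableU.
have e2 : 0 < e / 2 by rewrite divr_gt0.
have [N1 h1] := hA _ e2; have [N2 h2] := hB _ e2.
exists (maxn N1 N2) => n; rewrite geq_max => /andP[n1 n2].
have [E [F [s1 a1 a2]]] := h1 n n1; have [E' [F' [s2 b1 b2]]] := h2 n n2.
have s : simple (E ++ E') (fun T t => F T t || F' T t).
  move=> T t t' h; rewrite (s1 T t t') ?(s2 T t t') // => x hx; apply: h; rewrite mem_cat hx ?orbT //.
exists (E ++ E'), (fun T t => F T t || F' T t).
have mc1 := measurable_cellset n s1; have mc2 := measurable_cellset n s2.
have ec : cellset n (fun T t => F T t || F' T t) = cellset n F `|` cellset n F'.
  by apply/seteqP; split=> p /= /orP.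
have sub (P : probability (Ysp d R) R) : pr P (symd A (cellset n F)) <= e / 2 ->
    pr P (symd B (cellset n F')) <= e / 2 ->
    pr P (symd (A `|` B) (cellset n (fun T t => F T t || F' T t))) <= e.
  move=> p1 p2; have m1 := measurable_symd mA mc1; have m2 := measurable_symd mB mc2.
  apply: (@le_trans _ _ (pr P (symd A (cellset n F) `|` symd B (cellset n F')))).
    apply: pr_le; [|exact: measurableU|by rewrite ec; exact: symd_sub].
    by rewrite ec; apply: measurable_symd; exact: measurableU.
  by apply: le_trans (prU_le P m1 m2) _; lra.
by split=> //; apply: sub.
Qed.

Lemma approxC B : approx B -> approx (~` B).
Proof.
move=> [mB hB]; split=> [|e e0]; first exact: measurableC.
have [N h] := hB e e0; exists N => n hn; have [E [F [s a1 a2]]] := h n hn.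
exists E, (fun T t => ~~ F T t); have ec : symd (~` B) (cellset n (fun T t => ~~ F T t)) = symd B (cellset n F).
  apply/seteqP; split=> p; rewrite /symd /cellset /= => h1 h2; apply: h1; split.
  - by move=> b; apply/negP => f; apply: b; apply/h2.
  - by move=> /negP f b; apply: f; apply/h2.
  - by move=> b; apply: contrapT => /negP f; move: b; apply/h2.
  - by move=> f; apply: contrapT => b; move/h2: b; rewrite f.
by split=> [T t t' /s ->||] //; rewrite ec.
Qed.

Lemma pr_tail (P : probability (Ysp d R) R) (F : nat -> set (Ysp d R)) e : (forall n, measurable (F n)) -> 0 < e ->
  exists n, pr P (\bigcup_i F i `\` \bigcup_(i in [set i | (i < n)%N]) F i) <= e.
Proof.
move=> mF e0; pose G n := \bigcup_(i in [set i | (i < n)%N]) F i.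
have mG n : measurable (G n) by apply: bigcup_measurable => i _.
have mU : measurable (\bigcup_i F i) by exact: bigcupT_measurable.
have eU : \bigcup_n G n = \bigcup_i F i.
  apply/seteqP; split=> p; first by case=> n _ [i _ h]; exists i.
  by case=> i _ h; exists i.+1 => //; exists i => /=.
have hc : P \o G @ \oo --> P (\bigcup_n G n).
  apply: nondecreasing_cvg_mu => //; first by rewrite eU.
  move=> m n mn; apply/subsetPset => p [i /= hi h]; exists i => //=; exact: leq_trans hi mn.
have hc' : (pr P (G n)) @[n --> \oo] --> pr P (\bigcup_i F i).
  rewrite -eU; apply: fine_cvg; rewrite -prE ?eU // -eU; exact: hc.
have /cvgrPdist_le/(_ e e0)[n _ /(_ n (leqnn n)) hn] := hc'.
exists n; have := prDI P mU (mG n); rewrite -/(G n) (_ : _ `&` G n = G n); last first.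
  by apply/seteqP; split=> p; [case|move=> [i hi h]; split; [exists i|exists i]].
by move=> e1; move: hn; rewrite ler_norml => /andP[_]; lra.
Qed.

Lemma approx_bigcup (F : nat -> set (Ysp d R)) : (forall n, approx (F n)) -> approx (\bigcup_n F n).
Proof.
move=> hF; have mF n : measurable (F n) by case: (hF n).
have mU : measurable (\bigcup_i F i) by exact: bigcupT_measurable.
split=> // e e0; have e2 : 0 < e / 2 by rewrite divr_gt0.
have [n1 h1] := pr_tail P1 mF e2; have [n2 h2] := pr_tail P2 mF e2.
pose G n := \bigcup_(i in [set i | (i < n)%N]) F i.
have mG n : measurable (G n) by apply: bigcup_measurable => i _.
have hG n : approx (G n).
  elim: n => [|n IH].
    split=> // e' e'0; exists 0%N => n _; exists [::], (fun _ _ => false).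
    rewrite (_ : symd _ _ = set0) ?pr0; first by split=> //; exact: ltW.
    by apply/seteqP; split=> // p; rewrite /symd /= => h; apply: h; split=> // -[].
  have -> : G n.+1 = G n `|` F n.
    apply/seteqP; split=> p.
      move=> [i /=]; rewrite ltnS leq_eqVlt => /orP[/eqP-> h|hi h]; [by right|by left; exists i].
    by move=> [[i /= hi h]|h]; [exists i => //=; exact: ltnW|exists n => /=].
  exact: approxU.
pose m := maxn n1 n2; have [_ hm] := hG m; have [N hN] := hm _ e2; exists N => n hn.
have [E [F' [s a1 a2]]] := hN n hn; exists E, F'; have mc := measurable_cellset n s.
have sub (P : probability (Ysp d R) R) k : (k <= m)%N -> pr P (\bigcup_i F i `\` G k) <= e / 2 ->
    pr P (symd (G m) (cellset n F')) <= e / 2 -> pr P (symd (\bigcup_i F i) (cellset n F')) <= e.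
  move=> km q1 q2; apply: (@le_trans _ _ (pr P ((\bigcup_i F i `\` G k) `|` symd (G m) (cellset n F')))).
    apply: pr_le; [exact: measurable_symd|apply: measurableU; [exact: measurableD|exact: measurable_symd]|].
    move=> p h; have [g|g] := pselect (G m p).
      right=> h'; apply: h; split=> [_|_]; first exact/h'.
      by case: g => i _ hi; exists i.
    have [u|u] := pselect ((\bigcup_i F i) p).
      by left; split=> // -[i /= hi h']; apply: g; exists i => //=; exact: leq_trans hi km.
    right=> h'; apply: h; split=> // c; exfalso; apply: g; exact/h'.
  apply: le_trans (prU_le P _ _) _; [exact: measurableD|exact: measurable_symd|lra].
by split=> //; [apply: (sub P1 n1); rewrite ?leq_maxl|apply: (sub P2 n2); rewrite ?leq_maxr].
Qed.

Lemma approx_all B : measurable B -> approx B.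
Proof.
apply: Ysp_sigma_ind; [exact: approxC|exact: approx_bigcup|move=> i a|move=> x].
- apply: (@approx_generator _ prefs (fun n => letterF n i a) (Lsum (L := L) * (`|i|%N.+1)%:R)).
  + exact: (measurable_fst_pre (@measurable_config_at d i a)).
  + by move=> n; exact: letterF_simple.
  + by move=> n p; exact: letterF_ok.
- apply: (@approx_generator _ (fun n => prefs n ++ [seq x + Lw L (take j T.2) | T <- tiles (th := th) n, j <- iota 0 (size T.2).+1])
    (fun n => heightF n x) 0).
  + have := measurable_snd_itv (d := d) `[x, +oo[.
    by congr measurable; apply/seteqP; split=> p /=; rewrite in_itv /= andbT.
  + by move=> n; exact: heightF_simple.
  + by move=> n p hy _; exact: heightF_ok.
Qed.

(** Agreement on cell sets is asked only from level [n0] on: a shuffle of level [n0] is controlled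
    on tiles of that level and above. The measures need full mass on [Y] and small faults, so the
    lemma also applies to the image of an invariant measure under a shuffle. *)
Lemma cells_determine n0 : (forall n E F, (n0 <= n)%N -> simple E F -> pr P1 (cellset n F) = pr P2 (cellset n F)) ->
  forall B, measurable B -> pr P1 B = pr P2 B.
Proof.
move=> h B mB; apply/eqP; rewrite -subr_eq0 -normr_le0; apply/ler_addgt0Pr => e e0; rewrite add0r.
have e2 : 0 < e / 2 by rewrite divr_gt0.
have [_ /(_ _ e2)[N0 hN0]] := approx_all mB; pose N := maxn N0 n0.
have [E [F [s a1 a2]]] := hN0 N (leq_maxl _ _).
have mc := measurable_cellset N s; have eq := h N E F (leq_maxr _ _) s.
have dist (P : probability (Ysp d R) R) : pr P (symd B (cellset N F)) <= e / 2 ->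
    `|pr P B - pr P (cellset N F)| <= e / 2.
  move=> hp; have ms := measurable_symd mB mc.
  have b1 : pr P B <= pr P (cellset N F) + pr P (symd B (cellset N F)).
    apply: le_trans (prU_le P mc ms); apply: pr_le => //; first exact: measurableU.
    move=> p b; have [c|c] := pselect (cellset N F p); [by left|right=> h'; apply: c; exact/h'].
  have b2 : pr P (cellset N F) <= pr P B + pr P (symd B (cellset N F)).
    apply: le_trans (prU_le P mB ms); apply: pr_le => //; first exact: measurableU.
    move=> p c; have [b|b] := pselect (B p); [by left|right=> h'; apply: b; exact/h'].
  by rewrite ler_norml; apply/andP; split; lra.
have := dist P1 a1; have := dist P2 a2; rewrite eq !ler_norml => /andP[x1 x2] /andP[x3 x4].
by apply/andP; split; lra.
Qed.

End Approximation.

Lemma prU_big dd (T : measurableType dd) (R : realType) (P : probability T R) (I : Type) (s : seq I)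
    (A : I -> set T) : (forall i, measurable (A i)) ->
  measurable (\big[setU/set0]_(i <- s) A i) /\ pr P (\big[setU/set0]_(i <- s) A i) <= \sum_(i <- s) pr P (A i).
Proof.
move=> mA; elim: s => [|i s [m IH]]; first by rewrite !big_nil pr0.
rewrite !big_cons; split; first exact: measurableU.
by apply: le_trans (prU_le P (mA i) m) _; rewrite lerD2l.
Qed.

Section InvariantApproximation.
Context {d : nat} {R : realType} {th : rsubst d} {lam : R} {L : 'I_d.+1 -> R}.
Context {Hg : good th lam L}.
Local Notation tp := (theta_pow th).
Local Notation Y := (Yset th L).
Local Notation tile := (tile (R := R) (th := th)).
Local Notation tm := (tm (th := th) (L := L)).
Local Notation len := (len (lam := lam) (L := L)).
Local Notation fault := (fault (th := th) (lam := lam) (L := L)).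
Local Notation wt := (wt (th := th) (L := L)).
Local Notation tilet := ('I_d.+1 * word d)%type.
Implicit Types (nu : probability (Ysp d R) R).

(** By [icell_law] the two end slices of a tile carry a share of at most [2 * r / len n a] of its
    weight, and tile lengths tend to infinity. *)
Lemma fault_small nu : flow_invariant th L nu ->
  forall r e, 0 < e -> exists N, forall n, (N <= n)%N -> pr nu (fault n r) <= e.
Proof.
move=> Hnu r' e e0; have [c c0 hc] := Lmin_ex (Hg := Hg).
pose r := Num.max r' 1; have r0 : 0 < r by rewrite lt_max ltr01 orbT.
(* The first threshold makes every tile longer than [r], the second makes the share of the two ends
   at most [e]. *)
have [N hN] := lamX_large (Hg := Hg) (Num.max (2 * r / c) (2 * r / (e * c))).
exists N => n /hN; rewrite ge_max => /andP[h1 h2].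
have lc a : lam ^+ n * c <= len n a by rewrite /len ler_wpM2l // ltW // lamX_gt0.
have rl a : r < len n a.
  apply: lt_le_trans (lc a); rewrite -ltr_pdivrMr //; apply: lt_le_trans h1.
  by rewrite ltr_pM2r ?invr_gt0 //; lra.
have mf : measurable (fault n r') by exact: measurable_fault.
have mY : measurable Y by exact: measurable_Yset.
rewrite -(prY Hnu mf) (@pr_fibers _ _ _ _ _ (tiles (th := th) n) _ (tile n) (tiles_uniq n)); last first.
- move=> T; apply: measurableI; [exact: measurableI|exact: measurable_tile].
- exact: measurableI.
- by move=> p [_ [hx _]]; exact: tile_tiles.
apply: (@le_trans _ _ (\sum_(T <- tiles (th := th) n) e * wt nu n T)); last first.
  by rewrite -mulr_sumr (sum_wt (Hg := Hg)) // mulr1.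
apply: ler_sum => T _; have l0 := lt_trans r0 (rl T.1).
pose A := icell (th := th) (L := L) n T 0 r; pose B := icell (th := th) (L := L) n T (len n T.1 - r) (len n T.1).
have mA : measurable A by exact: measurable_icell.
have mB : measurable B by exact: measurable_icell.
apply: (@le_trans _ _ (pr nu (A `|` B))).
  apply: pr_le; [|exact: measurableU|].
    by apply: measurableI; [exact: measurableI|exact: measurable_tile].
  have rr : r' <= r by rewrite le_max lexx.
  move=> p [[hf hy] /= hT]; have := tm_bounds (Hg := Hg) n hy; rewrite /tlen hT => /andP[b1 b2].
  by move: hf; rewrite /fault /= /tlen hT => -[h|h]; [left|right]; split=> //=; apply/andP; split; lra.
have pA : pr nu A = r / len n T.1 * wt nu n T.
  by have := icell_law (Hg := Hg) Hnu (n := n) (T := T) (lexx 0) (ltW r0) (ltW (rl T.1)); rewrite subr0.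
have pB : pr nu B = r / len n T.1 * wt nu n T.
  have b1 : 0 <= len n T.1 - r by rewrite subr_ge0 ltW ?rl.
  have b2 : len n T.1 - r <= len n T.1 by rewrite gerBl ltW.
  have := icell_law (Hg := Hg) Hnu (n := n) (T := T) b1 b2 (lexx _).
  by rewrite opprB [X in X / _]addrC subrK.
apply: le_trans (prU_le _ mA mB) _; rewrite pA pB.
rewrite -mulrDl; apply: ler_wpM2r; first exact: wt_ge0.
rewrite -mulrDl ler_pdivrMr //; have := lc T.1; move: h2; rewrite ler_pdivrMr ?mulr_gt0 // => h2 h3.
have : e * (lam ^+ n * c) <= e * len n T.1 by rewrite ler_wpM2l // ltW.
by lra.
Qed.

Lemma flow_invariant_full nu : flow_invariant th L nu -> pr nu Y = 1.
Proof. by case=> h _; rewrite /pr h. Qed.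

Lemma cellset_fibers nu n E F : flow_invariant th L nu -> simple E F ->
  pr nu (cellset (th := th) (L := L) n F) =
  \sum_(T <- tiles (th := th) n) pr nu (cell (th := th) (L := L) n T [set t | F T t]).
Proof.
move=> h hF; have mF := measurable_cellset (Hg := Hg) n hF.
have mY : measurable Y by exact: measurable_Yset.
rewrite -(prY h mF) (@pr_fibers _ _ _ _ _ (tiles (th := th) n) _ (tile n) (tiles_uniq n)).
- apply: eq_bigr => T _; congr pr; apply/seteqP; split=> p /=.
    by move=> [[hF' hy] hT]; split; [split|rewrite /= -hT].
  by move=> [[hy hT] /=]; rewrite -hT.
- by move=> p [_ [hx _]]; exact: tile_tiles.
- exact: measurableI.
- by move=> T; apply: measurableI; [exact: measurableI|exact: measurable_tile].
Qed.

Lemma wt_determine nu nu' : flow_invariant th L nu -> flow_invariant th L nu' ->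
  (forall n T, wt nu n T = wt nu' n T) -> forall B, measurable B -> nu B = nu' B.
Proof.
move=> h h' e B mB; rewrite !prE //; congr (_%:E).
apply: (cells_determine (Hg := Hg) (flow_invariant_full h) (flow_invariant_full h') (fault_small h) (fault_small h') (n0 := 0)) => //.
move=> n E F _ hF; rewrite !(cellset_fibers _ _ hF) //; apply: eq_bigr => T _; rewrite /pr; congr fine.
by apply: cell_eq => //; exact: (simple_measurable T true hF).
Qed.

Lemma obs_simple (K : Type) n E (G : tilet -> R -> K) : simple E G -> obs (fun p => G (tile n p) (tm n p)).
Proof.
move=> hG k; apply: (@measurable_countable _ _ _ (tile n) (fun T => [set p | G T (tm n p) = k])) => T.
  exact: measurable_tile.
by have := @measurable_tm _ _ _ _ _ Hg n measurableT _ (simple_measurable T k hG); rewrite setTI.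
Qed.

(** Each class of [f] is approximated by a cell set up to [e / k%:R], and [G] picks a class whose
    cell set contains the given tile and height; it can be wrong only on the union of the symmetric
    differences. *)
Lemma partition_approx nu k (f : Ysp d R -> 'I_k) : flow_invariant th L nu -> obs f ->
  forall e, 0 < e -> exists N, forall n, (N <= n)%N -> exists E (G : tilet -> R -> 'I_k), simple E G /\
    pr nu [set p | f p <> G (tile n p) (tm n p)] <= e.
Proof.
move=> h hf e e0; have [i0 _] : exists i : 'I_k, True by exists (f point).
have k0 : 0 < k%:R :> R by rewrite ltr0n; apply: leq_ltn_trans (ltn_ord i0).
have ek : 0 < e / k%:R by exact: divr_gt0.
have happ i := approx_all (Hg := Hg) (flow_invariant_full h) (flow_invariant_full h) (fault_small h) (fault_small h) (hf i).
have /choice[N hN] : forall i : 'I_k, exists N, forall n, (N <= n)%N -> exists E F, simple E F /\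
    pr nu (symd [set p | f p = i] (cellset (th := th) (L := L) n F)) <= e / k%:R.
  move=> i; have [_ /(_ _ ek)[N hN]] := happ i; exists N => n /hN[E [F [s a _]]].
  by exists E, F.
exists (\max_i N i) => n hn; have {hN}hN i := hN i n (leq_trans (leq_bigmax i) hn).
have {hN}[E hN] := choice hN; have {hN}[F hN] := choice hN.
have hG : simple (flatten [seq E i | i <- enum 'I_k]) (fun T t => odflt i0 [pick i | F i T t]).
  move=> T t t' ht; congr (odflt i0 _); apply: eq_pick => i; have [s _] := hN i; apply: s => x hx.
  by apply: ht; apply/flatten_mapP; exists i; rewrite ?mem_enum.
exists (flatten [seq E i | i <- enum 'I_k]), (fun T t => odflt i0 [pick i | F i T t]); split=> //.
pose A i := symd [set p | f p = i] (cellset (th := th) (L := L) n (F i)).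
have mA i : measurable (A i).
  by have [s _] := hN i; apply: measurable_symd; [exact: hf|exact: (measurable_cellset (Hg := Hg) n s)].
have [mU hU] := prU_big nu (enum 'I_k) mA.
have sub : [set p | f p <> odflt i0 [pick i | F i (tile n p) (tm n p)]] `<=` \big[setU/set0]_(i <- enum 'I_k) A i.
  rewrite -bigcup_seq => p /= hp; apply: contrapT => hno.
  have {hno}hA i : f p = i <-> F i (tile n p) (tm n p).
    by apply: contrapT => hi; apply: hno; exists i; rewrite //= mem_enum.
  apply: hp; case: pickP => [i /hA|/(_ (f p)) /negbT/negP] //=; case; exact/hA.
apply: (@le_trans _ _ (pr nu (\big[setU/set0]_(i <- enum 'I_k) A i))); last first.
  apply: le_trans hU _; apply: (@le_trans _ _ (\sum_(i <- enum 'I_k) e / k%:R)).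
    by apply: ler_sum => i _; case: (hN i).
  by rewrite big_const_seq count_predT size_enum_ord iter_addr_0 -(mulr_natr (e / k%:R)) divfK // gt_eqF.
apply: pr_le => //; have [s] : exists s, simple s (fun T t => odflt i0 [pick i | F i T t]) by eexists; exact: hG.
move=> /(obs_simple n) hs.
exact: (@obs_set _ _ _ (fun p => (f p, odflt i0 [pick i | F i (tile n p) (tm n p)])) (fun z => z.1 <> z.2) (obs_pair hf hs)).
Qed.

End InvariantApproximation.

(** * Entropy of invariant measures *)

Lemma big_count_mem (R : realType) (I : eqType) (s tl : seq I) (F : I -> R) : uniq tl -> {subset s <= tl} ->
  \sum_(i <- s) F i = \sum_(i <- tl) (count_mem i s)%:R * F i.
Proof.
move=> ut; elim: s => [|x s IH] hs.
  by rewrite big_nil big1 // => i _; rewrite mul0r.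
rewrite big_cons IH => [|y hy]; last by apply: hs; rewrite in_cons hy orbT.
under [RHS]eq_bigr => i _ do rewrite /= natrD mulrDl.
rewrite big_split /=; congr (_ + _); rewrite (bigD1_seq x) //=; last by apply: hs; rewrite mem_head.
rewrite eqxx mul1r big1 ?addr0 // => i /negbTE; rewrite eq_sym => ->.
by rewrite mul0r.
Qed.

Section Deficit.
Context {d : nat} {R : realType} {th : rsubst d} {lam : R} {L : 'I_d.+1 -> R}.
Context {Hg : good th lam L}.
Local Notation tp := (theta_pow th).
Local Notation len := (len (lam := lam) (L := L)).
Local Notation tilet := ('I_d.+1 * word d)%type.
Variable nu : probability (Ysp d R) R.
Hypothesis Hnu : flow_invariant th L nu.
Local Notation wt := (wt (th := th) (L := L) nu).

Definition qt n (b : 'I_d.+1) : R := \sum_(v <- tp n b) wt n (b, v).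

(** The density of the law of a tile given its type, relative to the uniform law on [tp n T.1]. The
    value 1 on types of probability zero makes [sum_gden] hold for every type. *)
Definition gden n (T : tilet) : R :=
  if qt n T.1 == 0 then 1 else (size (tp n T.1))%:R * wt n T / qt n T.1.

(* The entropy lost by the tiles of level [n] not being uniformly distributed given their type. *)
Definition deficit n : R := \sum_(T <- tiles (th := th) n) wt n T / len n T.1 * ln (gden n T).

Lemma qt_ge0 n b : 0 <= qt n b.
Proof. by apply: sumr_ge0 => v _; exact: wt_ge0. Qed.

Lemma sum_gden n b : \sum_(v <- tp n b) gden n (b, v) = (size (tp n b))%:R.
Proof.
rewrite /gden /=; have [e|h] := eqVneq (qt n b) 0; first by rewrite sum1_sizeR.
by rewrite -mulr_suml -mulr_sumr -/(qt n b) mulfK.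
Qed.

Lemma gden_ge0 n T : 0 <= gden n T.
Proof.
rewrite /gden; case: eqP => // _.
by rewrite divr_ge0 ?mulr_ge0 ?wt_ge0 ?qt_ge0.
Qed.

Lemma wt_le_qt n T : wt n T <= qt n T.1.
Proof.
have [h|h] := boolP (T.2 \in tp n T.1); last by rewrite wt_out // qt_ge0.
rewrite /qt (bigD1_seq T.2) ?theta_pow_uniq //= -surjective_pairing lerDl sumr_ge0 // => v _.
exact: wt_ge0.
Qed.

Lemma gden_gt0 n T : 0 < wt n T -> 0 < gden n T.
Proof.
move=> h; have q0 := lt_le_trans h (wt_le_qt n T).
by rewrite /gden gt_eqF // divr_gt0 // mulr_gt0 // N_gt0.
Qed.

(** The terms added to [wt n T * ln (gden n T)] cancel when summed over a type; with them every
    summand is nonnegative, and zero only at the uniform value. *)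
Lemma deficit_term n T : T \in tiles (th := th) n ->
  let D := wt n T * ln (gden n T) - wt n T + qt n T.1 / (size (tp n T.1))%:R in
  0 <= D /\ (D = 0 -> wt n T = qt n T.1 / (size (tp n T.1))%:R).
Proof.
move=> hT D; have N0 : 0 < (size (tp n T.1))%:R :> R by exact: N_gt0.
have [e|h] := eqVneq (wt n T) 0.
  by rewrite /D e mul0r sub0r oppr0 add0r divr_ge0 ?qt_ge0 ?ltW.
have w0 : 0 < wt n T by rewrite lt_neqAle eq_sym h wt_ge0.
have q0 := lt_le_trans w0 (wt_le_qt n T); have g0 := gden_gt0 w0.
have eg : qt n T.1 / (size (tp n T.1))%:R = wt n T / gden n T.
  by rewrite /gden gt_eqF //; field; rewrite !gt_eqF.
have eD : D = wt n T * (ln (gden n T) - 1 + (gden n T)^-1) by rewrite /D eg; ring.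
have i0 : 0 < (gden n T)^-1 by rewrite invr_gt0.
have key : ln (gden n T)^-1 <= (gden n T)^-1 - 1.
  by have := @le_ln1Dx R ((gden n T)^-1 - 1); rewrite (addrC 1) subrK; apply; lra.
rewrite lnV ?posrE // in key; split; first by rewrite eD mulr_ge0 ?wt_ge0 //; lra.
rewrite eD => /eqP; rewrite mulf_eq0 (negbTE h) /= => /eqP e.
suff -> : wt n T = wt n T / gden n T by rewrite eg.
suff -> : gden n T = 1 by rewrite divr1.
have [l0|ne] := eqVneq (ln (gden n T)) 0; first by rewrite -[LHS]lnK ?posrE // l0 expR0.
have := @expR_gt1Dx R (- ln (gden n T)); rewrite oppr_eq0 => /(_ ne).
by rewrite expRN lnK ?posrE //; lra.
Qed.

Lemma deficit_sum n : deficit n = \sum_(T <- tiles (th := th) n)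
  (wt n T * ln (gden n T) - wt n T + qt n T.1 / (size (tp n T.1))%:R) / len n T.1.
Proof.
rewrite /deficit !sum_tiles; apply: eq_bigr => a _.
transitivity ((\sum_(v <- tp n a) (wt n (a, v) * ln (gden n (a, v)) - wt n (a, v) +
    qt n a / (size (tp n a))%:R)) / len n a); last by rewrite mulr_suml.
rewrite big_split /= sumrB.
have -> : \sum_(v <- tp n a) qt n a / (size (tp n a))%:R = qt n a.
  rewrite big_const_seq count_predT iter_addr_0 -(mulr_natr (qt n a / _)) divfK // gt_eqF //.
  exact: N_gt0.
by rewrite -/(qt n a) subrK mulr_suml; apply: eq_bigr => v _; rewrite mulrAC.
Qed.

Lemma deficit_ge0 n : 0 <= deficit n.
Proof.
rewrite deficit_sum big_seq; apply: sumr_ge0 => T hT.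
by have [h _] := deficit_term hT; rewrite divr_ge0 // ltW // len_gt0.
Qed.

Lemma deficit_uniform n a v v' : deficit n <= 0 -> v \in tp n a -> v' \in tp n a ->
  wt n (a, v) = wt n (a, v').
Proof.
move=> h hv hv'; have e : deficit n = 0 by apply/le_anti; rewrite h deficit_ge0.
have all0 u : u \in tp n a -> wt n (a, u) = qt n a / (size (tp n a))%:R.
  move=> hu; have hT : (a, u) \in tiles (th := th) n by rewrite mem_tiles.
  have [_ /=] := deficit_term hT; apply.
  move: e; rewrite deficit_sum big_seq => /eqP; rewrite psumr_eq0 => [/allP /(_ _ hT)|T hT'].
    rewrite hT /= mulf_eq0 invr_eq0 (gt_eqF (len_gt0 _ _)) orbF => /eqP //.
  by have [h1 _] := deficit_term hT'; rewrite divr_ge0 // ltW // len_gt0.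
by rewrite !all0.
Qed.

(** A model law of supertiles given their type, of total mass 1 by [sum_rho]: its density relative
    to the uniform law is the product of the level-[n] densities of the subtiles. *)
Definition rho n m (T : tilet) : R :=
  (\prod_(U <- subs (th := th) n m T) gden n U) / (size (tp (n + m) T.1))%:R.

Lemma rho_ge0 n m T : 0 <= rho n m T.
Proof. by rewrite divr_ge0 // prodr_ge0 // => U _; exact: gden_ge0. Qed.

Lemma sum_rho n m a : \sum_(V <- tp (n + m) a) rho n m (a, V) = 1.
Proof.
rewrite /rho /= -mulr_suml (sum_subs n m a (fun ts => \prod_(U <- ts) gden n U)).
under eq_bigr => w _ do rewrite prod_tilelists.
under eq_bigr => w _ do under eq_bigr => b _ do rewrite sum_gden.
rewrite size_tpD natr_sum (eq_bigr (fun w => (\prod_(b <- w) size (tp n b))%:R)).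
  by rewrite divff // -natr_sum -size_tpD gt_eqF // N_gt0.
by move=> w _; rewrite natr_prod.
Qed.

Lemma wt_subs_gt0 n m T U : 0 < wt (n + m) T -> T \in tiles (th := th) (n + m) ->
  U \in subs (th := th) n m T -> 0 < wt n U.
Proof.
move=> h hT hU; rewrite (wt_sub (Hg := Hg) Hnu n m U) (bigD1_seq T) ?tiles_uniq //=.
apply: ltr_pwDl; last first.
  apply: sumr_ge0 => T' _; have l0 k a : 0 <= len k a by exact/ltW/len_gt0.
  by rewrite mulr_ge0 ?wt_ge0 // divr_ge0 // mulr_ge0 // ler0n.
rewrite mulr_gt0 // divr_gt0 ?len_gt0 // mulr_gt0 ?len_gt0 // ltr0n -has_count.
by apply/hasP; exists U => /=.
Qed.

Lemma rho_gt0 n m T : 0 < wt (n + m) T -> T \in tiles (th := th) (n + m) -> 0 < rho n m T.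
Proof.
move=> h hT; rewrite divr_gt0 ?N_gt0 // big_seq prodr_gt0 // => U hU.
by apply: gden_gt0; exact: wt_subs_gt0 h hT hU.
Qed.

Lemma ln_prod (I : eqType) (s : seq I) (F : I -> R) : {in s, forall i, 0 < F i} ->
  ln (\prod_(i <- s) F i) = \sum_(i <- s) ln (F i).
Proof.
elim: s => [|i s IH] h; first by rewrite !big_nil ln1.
rewrite !big_cons -IH => [|j hj]; last by apply: h; rewrite in_cons hj orbT.
rewrite lnM ?posrE ?h ?mem_head // big_seq prodr_gt0 // => j hj.
by apply: h; rewrite in_cons hj orbT.
Qed.

(** By [wt_sub], the subtiles [U] of the supertiles seen per unit length have frequency
    [wt n U / len n U.1], so the logarithms of their densities add up to the level-[n] deficit,
    whatever [m] is. *)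
Lemma sum_ln_rho n m : \sum_(T <- tiles (th := th) (n + m)) wt (n + m) T / len (n + m) T.1 * ln (rho n m T) =
  deficit n - \sum_(T <- tiles (th := th) (n + m)) wt (n + m) T * (lnN (R := R) (th := th) (n + m) T.1 / len (n + m) T.1).
Proof.
have count_sum (F : tilet -> R) T : T \in tiles (th := th) (n + m) ->
    \sum_(U <- subs (th := th) n m T) F U =
    \sum_(U <- tiles (th := th) n) (count_mem U (subs (th := th) n m T))%:R * F U.
  rewrite mem_tiles => /subsP /subtiling_all hT; apply: big_count_mem; first exact: tiles_uniq.
  by move=> U /hT; rewrite mem_tiles.
transitivity (\sum_(T <- tiles (th := th) (n + m)) (\sum_(U <- tiles (th := th) n)
   wt (n + m) T * ((count_mem U (subs (th := th) n m T))%:R * len n U.1 / len (n + m) T.1) * (ln (gden n U) / len n U.1)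
   - wt (n + m) T * (lnN (R := R) (th := th) (n + m) T.1 / len (n + m) T.1))).
  apply: eq_big_seq => T hT; have [e|h] := eqVneq (wt (n + m) T) 0.
    by rewrite e !mul0r big1 ?subrr // => U _; rewrite !mul0r.
  have w0 : 0 < wt (n + m) T by rewrite lt_neqAle eq_sym h wt_ge0.
  have g0 : {in subs (th := th) n m T, forall U, 0 < gden n U}.
    by move=> U hU; apply: gden_gt0; exact: wt_subs_gt0 w0 hT hU.
  rewrite /rho ln_div ?posrE ?N_gt0 //; last by rewrite big_seq prodr_gt0.
  rewrite mulrBr; congr (_ - _); last by rewrite /lnN; field; rewrite gt_eqF // len_gt0.
  rewrite ln_prod // (count_sum (fun U => ln (gden n U))) // mulr_sumr; apply: eq_bigr => U _.
  by field; rewrite !gt_eqF // len_gt0.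
rewrite sumrB; congr (_ - _); rewrite exchange_big /=; apply: eq_bigr => U _.
by rewrite -mulr_suml -(wt_sub (Hg := Hg) Hnu n m U) mulrA mulrAC.
Qed.

End Deficit.

Lemma ln_le_linear (R : realType) (k x : R) : 0 < k -> 0 < x -> ln x <= k * x - ln k.
Proof.
move=> k0 x0; have := ln_sublinear (mulr_gt0 k0 x0); rewrite lnM ?posrE //; lra.
Qed.

Lemma lnK_small (R : realType) (A B : nat) (e : R) : (0 < A)%N -> 0 < e ->
  exists M, forall m, (M <= m)%N -> ln (A * (m * B).+1)%:R <= e * m%:R.
Proof.
move=> A0 e0; pose k := e / 2 / (A * B.+1)%:R.
have AB0 : 0 < (A * B.+1)%:R :> R by rewrite ltr0n muln_gt0 A0.
have k0 : 0 < k by rewrite !divr_gt0.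
exists (maxn 1 (Num.truncn (`|ln k| / (e / 2))).+1) => m; rewrite geq_max => /andP[m1 m2].
apply: le_trans (ln_le_linear k0 _) _; first by rewrite ltr0n muln_gt0 A0.
have h1 : k * (A * (m * B).+1)%:R <= e / 2 * m%:R.
  apply: (@le_trans _ _ (k * ((A * B.+1)%:R * m%:R))).
    rewrite ler_wpM2l ?(ltW k0) // -natrM ler_nat -mulnA leq_mul2l.
    by apply/orP; right; rewrite mulSn [(B * m)%N]mulnC; lia.
  by rewrite mulrA divfK // gt_eqF.
have h2 : `|ln k| <= e / 2 * m%:R.
  rewrite mulrC -ler_pdivrMr ?divr_gt0 //; apply: (le_trans (ltW (truncnS_gt _))).
  by rewrite ler_nat.
by have := ler_norm (- ln k); rewrite normrN; lra.
Qed.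

Lemma sum_option (R : realType) (I : finType) (F : option I -> R) :
  \sum_x F x = F None + \sum_i F (Some i).
Proof.
rewrite (bigD1 None) //=; congr (_ + _).
rewrite [RHS](eq_bigl (fun i => Some i != None)) //.
rewrite (reindex_omap Some id) //=; first by apply: eq_bigl => i; rewrite eqxx.
by case.
Qed.

(** The sets of thresholds below [t] and below [t'] are nested, so equal cardinality makes them
    equal. *)
Lemma count_le_inj (R : realType) (s : seq R) (t t' : R) :
  count (fun e => e <= t) s = count (fun e => e <= t') s ->
  forall e, e \in s -> (e <= t) = (e <= t').
Proof.
wlog tt' : t t' / t <= t' => [h|].
  move=> ec e he; have [/h|/ltW /h] := leP t t'; first exact.
  by move=> ->.
elim: s => // x s IH /= ec e; rewrite in_cons.
have mon : (count (fun e : R => (e <= t)%R) s <= count (fun e : R => (e <= t')%R) s)%N.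
  by apply: sub_count => y /= hy; exact: le_trans hy tt'.
have mx : ((x <= t)%R <= (x <= t')%R)%N by case: (leP x t) => // hx; rewrite (le_trans hx tt').
have [e1 e2] : ((x <= t)%R : nat) = (x <= t')%R /\
    count (fun e : R => (e <= t)%R) s = count (fun e : R => (e <= t')%R) s by lia.
case/orP => [/eqP->|]; last exact: IH.
by move: e1; case: (x <= t); case: (x <= t').
Qed.

Lemma subr_chain (V : zmodType) (a b c a' b' c' : V) : a - b = a' - b' -> b - c = b' - c' -> a - c = a' - c'.
Proof. by move=> e1 e2; rewrite -(subrKA b) -(subrKA b' a') e1 e2. Qed.

(** * Upper bound for the entropy by Gibbs' inequality *)

Section UpperEntropy.
Context {d : nat} {R : realType} {th : rsubst d} {lam : R} {L : 'I_d.+1 -> R}.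
Context {Hg : good th lam L}.
Local Notation tp := (theta_pow th).
Local Notation Y := (Yset th L).
Local Notation tile := (tile (R := R) (th := th)).
Local Notation tm := (tm (th := th) (L := L)).
Local Notation tlen := (tlen (th := th) (lam := lam) (L := L)).
Local Notation flow := (flow (L := L)).
Local Notation len := (len (lam := lam) (L := L)).
Local Notation tilet := ('I_d.+1 * word d)%type.
Implicit Types (p q : Ysp d R).

Definition phi (i : nat) p := flow p i%:R.

Lemma phiS i p : phi i.+1 p = flow (phi i p) 1.
Proof. by rewrite /phi -flowD -natr1. Qed.

Lemma phi0 p : Y p -> phi 0 p = p.
Proof. exact: flow0. Qed.

Lemma phi_add i j p : phi (i + j) p = phi j (phi i p).
Proof. by rewrite /phi natrD flowD. Qed.

Lemma phiY i p : Y p -> Y (phi i p).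
Proof. exact: flowY. Qed.

Definition tnum N := size (tiles (th := th) N).

(* Records a tile of level [N] at the only integer time at which it has been entered for less than one unit. *)
Definition entry N p : option 'I_(tnum N) :=
  if tm N p < 1 then insub (index (tile N p) (tiles (th := th) N)) else None.

Lemma entry_simple N : simple [:: (1 : R)] (fun (T : tilet) (t : R) =>
  if t < 1 then insub (index T (tiles (th := th) N)) else None : option 'I_(tnum N)).
Proof. by move=> T t t' /(_ 1 (mem_head _ _)); rewrite !ltNge => ->. Qed.

Lemma obs_entry N : obs (entry N).
Proof. exact: (obs_simple (Hg := Hg) N (@entry_simple N)). Qed.

Lemma entry_Some N p : Y p -> tm N p < 1 -> exists2 i : 'I_(tnum N), entry N p = Some i & tnth (in_tuple (tiles (th := th) N)) i = tile N p.
Proof.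
move=> [hx _] h; rewrite /entry h; have hT := tile_tiles (Hg := Hg) N hx.
have hi : (index (tile N p) (tiles (th := th) N) < tnum N)%N by rewrite index_mem.
by exists (Ordinal hi); [rewrite insubT|rewrite (tnth_nth (tile N p)) /= nth_index].
Qed.

(** Tiles are longer than 1, so at most one boundary is crossed in unit time; the new value of
    [entry] tells whether this happened and, if so, into which tile. The heights of [p] and [q] may
    differ, but they change by the same amount. *)
Lemma entry_step N p q : (forall a, 1 < len N a) -> Y p -> Y q -> tile N p = tile N q ->
  entry N (flow p 1) = entry N (flow q 1) ->
  tile N (flow p 1) = tile N (flow q 1) /\
  tm N (flow p 1) - tm N p = tm N (flow q 1) - tm N q.
Proof.
move=> hl hp hq eT; have etl : tlen N p = tlen N q by rewrite /tlen eT.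
have stay r : Y r -> tm N r + 1 < tlen N r ->
    [/\ tile N (flow r 1) = tile N r, tm N (flow r 1) = tm N r + 1 & entry N (flow r 1) = None].
  move=> hr h; have /andP[t0 _] := tm_bounds (Hg := Hg) N hr.
  have [|e1 e2] := tile_move (Hg := Hg) (n := N) (t := 1) hr; first by apply/andP; split; lra.
  split=> //; rewrite /entry e2 ltNge [X in ~~ X](_ : _ = true) //; lra.
have cross r : Y r -> tlen N r <= tm N r + 1 -> tm N (flow r 1) = tm N r + 1 - tlen N r /\
    exists2 i, entry N (flow r 1) = Some i & tnth (in_tuple (tiles (th := th) N)) i = tile N (flow r 1).
  move=> hr h; have /andP[_ t1] := tm_bounds (Hg := Hg) N hr.
  have e : tm N (flow r 1) = tm N r + 1 - tlen N r.
    by apply: (tile_cross (Hg := Hg)) => // a; have := hl a; lra.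
  split=> //; apply: entry_Some; first exact: flowY.
  by rewrite e; lra.
have [h1|h1] := ltP (tm N p + 1) (tlen N p); have [h2|h2] := ltP (tm N q + 1) (tlen N q).
- have [e1 e2 _] := stay p hp h1; have [e3 e4 _] := stay q hq h2 => _.
  by rewrite e1 e3 e2 e4 eT; split=> //; lra.
- have [_ _ ->] := stay p hp h1; by have [_ [i -> _]] := cross q hq h2.
- have [_ _ ->] := stay q hq h2; by have [_ [i -> _]] := cross p hp h1.
- have [e1 [i e2 e3]] := cross p hp h1; have [e4 [j e5 e6]] := cross q hq h2.
  by rewrite e2 e5 => -[ij]; rewrite -e3 -e6 ij; split=> //; rewrite e1 e4 etl; lra.
Qed.

Lemma entry_names N M p q : (forall a, 1 < len N a) -> Y p -> Y q -> tile N p = tile N q ->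
  names phi (entry N) M p = names phi (entry N) M q ->
  forall i, (i < M)%N -> tile N (phi i p) = tile N (phi i q) /\
    tm N (phi i p) - tm N p = tm N (phi i q) - tm N q.
Proof.
move=> hl hp hq eT en; elim=> [|i IH] hi; first by rewrite (phi0 hp) (phi0 hq) !subrr.
have [e1 e2] := IH (ltnW hi); rewrite !phiS.
have [|e3 e4] := entry_step hl (phiY i hp) (phiY i hq) e1.
  by have := congr1 (fun f : {ffun 'I_M -> option 'I_(tnum N)} => f (Ordinal hi)) en; rewrite !ffunE /= !phiS.
by split=> //; exact: subr_chain e4 e2.
Qed.

(** Once the first tile is known, the entries fix the sequence of tiles, and the heights up to one
    common translation. The name of [G] then changes only when the initial height passes one of
    [M * size E] thresholds. *)
Lemma names_count k N M E (G : tilet -> R -> 'I_k) (w : {ffun 'I_M -> option 'I_(tnum N)}) :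
  (forall a, 1 < len N a) -> simple E G ->
  (#|[pred H : {ffun 'I_M -> 'I_k} | `[< exists p, [/\ Y p, names phi (entry N) M p = w &
     names phi (fun p => G (tile N p) (tm N p)) M p = H] >]]| <= tnum N * (M * size E).+1)%N.
Proof.
move=> hl hG; set A := [pred H | _].
have [/card0_eq A0|] := eqVneq #|A| 0%N; first by rewrite eq_card0.
have [p0 _] : exists p : Ysp d R, True by exists point.
rewrite -lt0n => /card_gt0P[H0 /asboolP[p1 [hp1 _ _]]].
have t0 : (0 < tnum N)%N.
  by have [hx _] := hp1; have := tile_tiles (Hg := Hg) N hx; rewrite /tnum; case: (tiles _).
pose wit H := xget p0 [set p | [/\ Y p, names phi (entry N) M p = w &
     names phi (fun p => G (tile N p) (tm N p)) M p = H]].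
have hwit H : H \in A -> [/\ Y (wit H), names phi (entry N) M (wit H) = w &
     names phi (fun p => G (tile N p) (tm N p)) M (wit H) = H].
  by move=> /asboolP[p hp]; rewrite /wit; case: xgetP => [x -> //|/(_ p)].
(* A reference point for each first tile. The heights of any other point with the same entries
   differ from its heights by a constant, so all thresholds of [E] can be pulled back to time 0
   along its orbit. *)
pose rep T := xget p0 [set p | [/\ Y p, names phi (entry N) M p = w & tile N p = T]].
have hrep p : Y p -> names phi (entry N) M p = w ->
    [/\ Y (rep (tile N p)), names phi (entry N) M (rep (tile N p)) = w & tile N (rep (tile N p)) = tile N p].
  by move=> y1 n1; rewrite /rep; case: xgetP => [x -> //|/(_ p)]; case.
pose thr T := [seq e - (tm N (phi i (rep T)) - tm N (rep T)) | e <- E, i <- iota 0 M].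
have sthr T : size (thr T) = (M * size E)%N by rewrite size_allpairs size_iota mulnC.
pose c T t := count (fun e => e <= t) (thr T).
have hc T t : (c T t < (M * size E).+1)%N by rewrite ltnS -(sthr T); exact: count_size.
have hi H : (index (tile N (wit H)) (tiles (th := th) N) < (tnum N).+1)%N by rewrite ltnS index_size.
pose code H : 'I_(tnum N) * 'I_(M * size E).+1 :=
  (insubd (Ordinal t0) (index (tile N (wit H)) (tiles (th := th) N)),
   Ordinal (hc (tile N (wit H)) (tm N (wit H)))).
have : {in A &, injective code}.
  move=> H H' hH hH' [e1 e2]; have [y1 n1 g1] := hwit H hH; have [y2 n2 g2] := hwit H' hH'.
  have eT : tile N (wit H) = tile N (wit H').
    have i1 : tile N (wit H) \in tiles (th := th) N by case: y1 => hx _; exact: tile_tiles.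
    have i2 : tile N (wit H') \in tiles (th := th) N by case: y2 => hx _; exact: tile_tiles.
    move: e1 => /(congr1 val); rewrite !val_insubd !index_mem i1 i2.
    by move=> e; rewrite -(nth_index (tile N (wit H)) i1) e nth_index.
  have [y3 n3 eT3] := hrep (wit H) y1 n1.
  rewrite /c -eT in e2; have hthr := count_le_inj e2.
  rewrite -g1 -g2; apply/ffunP => i; rewrite !ffunE.
  have [a1 b1] := entry_names hl y1 y3 (esym eT3) (etrans n1 (esym n3)) (ltn_ord i).
  have [a2 b2] := entry_names hl y2 y3 (etrans (esym eT) (esym eT3)) (etrans n2 (esym n3)) (ltn_ord i).
  rewrite a1 a2; apply: hG => e he.
  have /hthr : e - (tm N (phi i (rep (tile N (wit H)))) - tm N (rep (tile N (wit H)))) \in thr (tile N (wit H)).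
    by apply/allpairsP; exists (e, nat_of_ord i) => /=; rewrite mem_iota ltn_ord he.
  by rewrite !lerBlDr -{1}b1 -b2 !(addrC (tm N (wit _))) !subrK.
by move/leq_card_in; rewrite card_prod !card_ord.
Qed.

End UpperEntropy.

Section UpperBound.
Context {d : nat} {R : realType} {th : rsubst d} {lam : R} {L : 'I_d.+1 -> R}.
Context {Hg : good th lam L}.
Local Notation tp := (theta_pow th).
Local Notation Y := (Yset th L).
Local Notation tile := (tile (R := R) (th := th)).
Local Notation tm := (tm (th := th) (L := L)).
Local Notation len := (len (lam := lam) (L := L)).
Local Notation tilet := ('I_d.+1 * word d)%type.
Local Notation phi := (phi (L := L)).
Local Notation entry := (entry (th := th) (L := L)).

Variable nu : probability (Ysp d R) R.
Hypothesis Hnu : flow_invariant th L nu.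
Local Notation wt := (wt (th := th) (L := L) nu).

Lemma mphi i (B : set (Ysp d R)) : measurable B -> measurable [set p | B (phi i p)].
Proof. exact: measurable_flow_pre. Qed.

Lemma pphi i (B : set (Ysp d R)) : measurable B -> pr nu [set p | B (phi i p)] = pr nu B.
Proof. exact: pr_flow. Qed.

Local Notation tl N i := (tnth (in_tuple (tiles (th := th) N)) i).

Lemma pm_entry N i : (forall a, 1 < len N a) -> pm nu (entry N) (Some i) = wt N (tl N i) / len N (tl N i).1.
Proof.
move=> hl; set T := tl N i; have oe : obs (entry N) by exact: obs_entry.
have -> : pm nu (entry N) (Some i) = pr nu (icell (th := th) (L := L) N T 0 1).
  apply: (prY_eq Hnu) => //; first exact: measurable_icell.
  apply/seteqP; split=> p [] /=.
    move=> e hy; split=> //; have : tm N p < 1 by move: e; rewrite /entry; case: ifP.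
    move=> h; have [j ej eT] := entry_Some (Hg := Hg) hy h.
    have /andP[t0 _] := tm_bounds (Hg := Hg) N hy.
    move: e; rewrite ej => -[eij]; split; first by split=> //=; rewrite -eT eij.
    by rewrite /= t0.
  move=> [[hy /= eT] /= /andP[_ h]] _; split=> //; have [j ej eT'] := entry_Some (Hg := Hg) hy h.
  have inj : injective (tnth (in_tuple (tiles (th := th) N))) by apply/tuple_uniqP; exact: tiles_uniq.
  by rewrite ej; congr Some; apply: inj; rewrite eT' eT.
have l1 := hl T.1; have := icell_law (Hg := Hg) Hnu (n := N) (T := T) (lexx 0) ler01 (ltW l1).
by rewrite subr0 => ->; rewrite mul1r mulrC.
Qed.

Variable h : R.
Hypothesis hgrow : forall e, 0 < e -> exists N, forall n a, (N <= n)%N ->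
  (h - e) * len n a <= lnN (R := R) (th := th) n a <= (h + e) * len n a.

(** [Hn_bound] with weight 1 for no entry and [eta * rho] for the entry into a supertile. The factor
    [rho] contributes the growth rate minus the deficit; the five errors (wrong symbols possible,
    wrong symbols present, total weight, price of [eta], growth rate) are at most [e / 8] each, and
    the logarithm of the number of names is sublinear in time. *)
Lemma entropy_upper k (f : Ysp d R -> 'I_k) n : obs f ->
  limn (fun m => Hn nu phi f m.+1 / m.+1%:R) <= h - deficit (th := th) (lam := lam) (L := L) nu n.
Proof.
move=> hf; apply/ler_addgt0Pr => e e0.
have k0 : 0 < k%:R :> R by rewrite ltr0n; apply: leq_ltn_trans (ltn_ord (f point)).
have e8 : 0 < e / 8 by rewrite divr_gt0.
(* [dl] is fixed first, so that permitting wrong symbols costs at most [e / 8] per time; the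
   approximation error [e1] is then chosen against [- ln dl]. *)
pose dl : R := Num.min (1 / 2) (e / 8 / k%:R).
have dl0 : 0 < dl by rewrite lt_min !divr_gt0.
have dl1 : dl <= 1 / 2 by rewrite ge_min lexx.
have dlk : k%:R * dl <= e / 8.
  by rewrite mulrC -ler_pdivlMr // ge_min lexx orbT.
have ldl : 0 <= - ln dl by rewrite oppr_ge0 ln_le0 //; lra.
pose e1 := e / 8 / (- ln dl + 1).
have e10 : 0 < e1 by rewrite divr_gt0 //; lra.
have e1l : e1 * - ln dl <= e / 8.
  by rewrite /e1 mulrAC ler_pdivrMr; [rewrite ler_pM2l //; lra|lra].
(* By [sum_rho] the supertiles have total weight [eta * d.+1%:R = e / 8], which is added to the
   weight 1 of [None]. *)
pose eta : R := e / 8 / d.+1%:R.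
have eta0 : 0 < eta by rewrite divr_gt0.
have [N1 h1] := partition_approx (Hg := Hg) Hnu hf e10.
have [N2 h2] := hgrow e8.
have [c c0 hc] := Lmin_ex (Hg := Hg).
(* The first threshold makes all supertiles longer than 1, the second makes the price [- ln eta] of
   an entry at most [e / 8] per unit length. *)
have [N3 h3] := lamX_large (Hg := Hg) (Num.max (2 / c) (`|ln eta| / (e / 8) / c)).
pose m := maxn N1 (maxn N2 N3); pose N := (n + m)%N.
have mN x : (x <= m)%N -> (x <= N)%N by move=> hx; exact: leq_trans hx (leq_addl _ _).
have {}h1 := h1 N (mN _ (leq_maxl _ _)).
have {}h2 a := h2 N a (mN _ (leq_trans (leq_maxl _ _) (leq_maxr _ _))).
have {h3} := h3 N (mN _ (leq_trans (leq_maxr _ _) (leq_maxr _ _))).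
rewrite ge_max => /andP[h3 h4].
have lc a : lam ^+ N * c <= len N a by rewrite /len ler_wpM2l // ltW // lamX_gt0.
have len1 a : 1 < len N a.
  by apply: lt_le_trans (lc a); move: h3; rewrite ler_pdivrMr //; lra.
have leta a : - ln eta / len N a <= e / 8.
  rewrite ler_pdivrMr ?len_gt0 // mulrC -ler_pdivrMr //; apply: le_trans (lc a); rewrite -ler_pdivrMr //.
  apply: le_trans h4; rewrite ler_pM2r ?invr_gt0 // ler_pM2r ?invr_gt0 //.
  by have := ler_norm (- ln eta); rewrite normrN.
have [E [G [hG hfg]]] := h1.
pose r0 (x : option 'I_(tnum (th := th) N)) : R := if x is Some i then eta * rho (th := th) (L := L) nu n m (tl N i) else 1.
have hg := obs_simple (Hg := Hg) N hG.
have hs : obs (entry N) by exact: obs_entry.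
have mY : measurable Y by exact: measurable_Yset.
have r00 x : 0 <= r0 x.
  by case: x => [i|] //=; rewrite mulr_ge0 ?(ltW eta0) // rho_ge0.
have wpos i : 0 < wt N (tl N i) -> 0 < rho (th := th) (L := L) nu n m (tl N i).
  by move=> hw; apply: (rho_gt0 (Hg := Hg)) => //; exact: mem_tnth.
have l0 a : 0 < len N a by exact: len_gt0.
have r0p x : 0 < pm nu (entry N) x -> 0 < r0 x.
  case: x => [i|] //=; rewrite pm_entry // => hw; rewrite mulr_gt0 // wpos //.
  by move: hw; rewrite pmulr_lgt0 ?invr_gt0.
have sumr0 : ln (\sum_x r0 x) <= e / 8.
  rewrite sum_option /= -(big_tnth _ _ (tiles (th := th) N) xpredT (fun T => eta * rho (th := th) (L := L) nu n m T)).
  rewrite -mulr_sumr sum_tiles (eq_bigr (fun _ => 1)) => [|a _]; last exact: sum_rho.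
  rewrite sumr_const card_ord divfK ?gt_eqF //; apply: le_ln1Dx.
  by lra.
have sw : \sum_(T <- tiles (th := th) N) wt N T = 1 by exact: sum_wt.
have sume : - (\sum_x pm nu (entry N) x * ln (r0 x)) <= e / 8 + (h + e / 8) - deficit (th := th) (lam := lam) (L := L) nu n.
  rewrite sum_option /= ln1 mulr0 add0r.
  have -> : \sum_(i < tnum (th := th) N) pm nu (entry N) (Some i) * ln (eta * rho (th := th) (L := L) nu n m (tl N i)) =
      \sum_(T <- tiles (th := th) N) wt N T / len N T.1 * ln eta + \sum_(T <- tiles (th := th) N) wt N T / len N T.1 * ln (rho (th := th) (L := L) nu n m T).
    rewrite -big_split /= [RHS]big_tnth; apply: eq_bigr => i _; rewrite pm_entry //.
    have [->|hw] := eqVneq (wt N (tl N i)) 0; first by rewrite !mul0r addr0.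
    by rewrite lnM ?posrE ?mulrDr // wpos // lt_neqAle eq_sym hw wt_ge0.
  rewrite (sum_ln_rho (Hg := Hg) Hnu n m) -/N.
  have a1 : - \sum_(T <- tiles (th := th) N) wt N T / len N T.1 * ln eta <= e / 8.
    rewrite (_ : e / 8 = \sum_(T <- tiles (th := th) N) e / 8 * wt N T); last by rewrite -mulr_sumr sw mulr1.
    rewrite -sumrN; apply: ler_sum => T _; rewrite -mulrN mulrAC -mulrA [X in X <= _]mulrC.
    by apply: ler_wpM2r (leta _); exact: wt_ge0.
  have a2 : \sum_(T <- tiles (th := th) N) wt N T * (lnN (R := R) (th := th) N T.1 / len N T.1) <= h + e / 8.
    rewrite (_ : h + e / 8 = \sum_(T <- tiles (th := th) N) (h + e / 8) * wt N T); last by rewrite -mulr_sumr sw mulr1.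
    apply: ler_sum => T _.
    rewrite mulrC; apply: ler_wpM2r; first exact: wt_ge0.
    by rewrite ler_pdivrMr //; case/andP: (h2 T.1).
  by lra.
have dlp : - pr nu [set p | f p <> G (tile N p) (tm N p)] * ln dl <= e / 8.
  by rewrite mulNr -mulrN; apply: le_trans e1l; exact: ler_wpM2r ldl _ _ hfg.
have K0 : (0 < tnum (th := th) N)%N.
  rewrite lt0n size_eq0; apply/eqP => t0; move: sw; rewrite t0 big_nil => /esym/eqP.
  by rewrite oner_eq0.
have [M0 hM0] := lnK_small (size E) K0 e8.
have bound M : Hn nu phi f M <= ln (tnum (th := th) N * (M * size E).+1)%:R +
    M%:R * (h - deficit (th := th) (lam := lam) (L := L) nu n + e / 8 * 5).
  apply: le_trans (Hn_bound (K := tnum (th := th) N * (M * size E).+1) mphi pphi hf hg hs (A := Y) _ r00 r0p dl0 _ _) _.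
  - by move=> B mB; exact: prY.
  - by rewrite muln_gt0 K0.
  - by move=> w; exact: names_count.
  rewrite lerD2l ler_wpM2l //.
  have := @le_ln1Dx R (k%:R * dl); have : 0 <= k%:R * dl by rewrite mulr_ge0 // ltW.
  by move=> b1 /(_ _) b2; have := b2; lra.
apply: limr_le; first exact: (Hn_cvg (phi_add (L := L)) mphi pphi).
exists M0 => // M /= hM; rewrite ler_pdivrMr ?ltr0n //.
have := bound M.+1; have := hM0 M.+1 (leq_trans hM (leqnSn _)); have := ler0n R M.+1.
move: (Hn _ _ _ _) (ln _) (M.+1%:R) => x y z z0 b1 b2; have := mulr_ge0 (ltW e0) z0; nra.
Qed.

End UpperBound.

(** * Lower bound for the entropy of type-uniform measures *)

Lemma count_initial (P : pred nat) n j : (forall i k, (i <= k)%N -> P k -> P i) -> (j < n)%N ->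
  P j = (j < count P (iota 0 n))%N.
Proof.
move=> hP; elim: n j => // n IH j; rewrite ltnS -[n.+1]addn1 iotaD count_cat /= addn0 add0n => hj.
have [Pn|Pn] := boolP (P n).
  have -> : count P (iota 0 n) = n.
    rewrite -[RHS](size_iota 0 n); apply/eqP; rewrite -all_count; apply/allP => i.
    by rewrite mem_iota add0n => /andP[_ /ltnW hi]; exact: hP hi Pn.
  by rewrite addn1 ltnS hj; exact: hP hj Pn.
rewrite addn0; move: hj; rewrite leq_eqVlt => /orP[/eqP->|]; last exact: IH.
rewrite (negbTE Pn) ltnNge; apply/esym/negbTE; rewrite negbK.
by have := count_size P (iota 0 n); rewrite size_iota.
Qed.

(** The vector of indicators is a finite observable; summing over its values replaces the integral
    of the function that counts the sets containing a point. *)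
Lemma pr_multiplicity dd (T : measurableType dd) (R : realType) (P : probability T R) (I : eqType) (s : seq I)
    (A : I -> set T) (C : set T) (B : R) : (forall i, measurable (A i)) -> measurable C ->
  (forall i, A i `<=` C) -> (forall p, C p -> (count (fun i => `[< A i p >]) s)%:R <= B) ->
  \sum_(i <- s) pr P (A i) <= B * pr P C.
Proof.
move=> mA mC AC hB; pose K := size s.
pose A' (i : 'I_K) := A (tnth (in_tuple s) i).
pose vec (p : T) : {ffun 'I_K -> bool} := [ffun i => `[< A' i p >]].
have ovec : obs vec.
  apply: obs_ffun => i -[].
    by have := mA (tnth (in_tuple s) i); congr measurable; apply/seteqP; split=> p /=; [move/asboolP|move=> h; apply/asboolP].
  have := measurableC (mA (tnth (in_tuple s) i)).
  congr measurable; apply/seteqP; split=> p /=; first by move=> h; apply/asboolPn.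
  by move/asboolPn.
rewrite big_tnth (pr_obs P ovec mC) mulr_sumr.
have -> : \sum_(i < K) pr P (A' i) = \sum_(z : {ffun 'I_K -> bool}) (\sum_i z i)%:R * pr P (C `&` [set p | vec p = z]).
  transitivity (\sum_(i < K) \sum_(z : {ffun 'I_K -> bool}) (z i)%:R * pr P (C `&` [set p | vec p = z])).
    apply: eq_bigr => i _; rewrite (pr_obs P ovec (mA _)); apply: eq_bigr => z _.
    case e : (z i); rewrite ?mul1r ?mul0r.
      congr pr; apply/seteqP; split=> p [] /=; first by move=> /AC.
      by move=> _ ez; split=> //; move: e; rewrite -ez ffunE => /asboolP.
    rewrite -(pr0 P); congr pr; apply/seteqP; split=> // p [/= h ez].
    by move: e; rewrite -ez ffunE => /asboolP.
  by rewrite exchange_big /=; apply: eq_bigr => z _; rewrite -mulr_suml natr_sum.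
apply: ler_sum => z _; have [e|/set0P[p [hp ez]]] := eqVneq (C `&` [set p | vec p = z]) set0.
  by rewrite e pr0 !mulr0.
apply: ler_wpM2r; first exact: pr_ge0.
apply: le_trans (hB p hp); rewrite ler_nat -sum1_count [X in (_ <= X)%N]big_tnth [X in (_ <= X)%N]big_mkcond /=.
by apply: leq_sum => i _; rewrite -ez ffunE /A'; case: asboolP.
Qed.

Section SubtileNames.
Context {d : nat} {R : realType} {th : rsubst d} {lam : R} {L : 'I_d.+1 -> R}.
Context {Hg : good th lam L}.
Local Notation tp := (theta_pow th).
Local Notation len := (len (lam := lam) (L := L)).
Local Notation slen := (slen (lam := lam) (L := L)).
Local Notation tilet := ('I_d.+1 * word d)%type.
Variables n m : nat.
Hypothesis len1 : forall a, 1 < len n a.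

(** The left end of the [j]-th level-[n] subtile in a supertile with type word [u]; it does not
    depend on the words of the subtiles. *)
Definition start (u : word d) (j : nat) : R := lam ^+ n * Lw L (take j u).

Lemma start_slen (ts : seq tilet) j : slen n (take j ts) = start (unzip1 ts) j.
Proof.
rewrite /start -map_take /slen; elim: (take j ts) => [|T s IH] /=.
  by rewrite big_nil Lw_nil mulr0.
by rewrite big_cons Lw_cons IH mulrDr.
Qed.

Lemma start_le u i j : (i <= j)%N -> start u i <= start u j.
Proof. by move=> h; rewrite ler_wpM2l ?(ltW (lamX_gt0 n)) // (Lw_take_le (Hg := Hg)). Qed.

Lemma startS u j : (j < size u)%N -> start u j.+1 = start u j + len n (nth ord0 u j).
Proof. by move=> h; rewrite /start Lw_take_S // mulrDr. Qed.

Definition cnt u x := count (fun j => start u j <= x) (iota 0 (size u)).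

Lemma cntP u x j : (j < size u)%N -> (start u j <= x) = (j < cnt u x)%N.
Proof.
move=> h; apply: (count_initial (P := fun j => start u j <= x)) => // i k ik.
by apply: le_trans; exact: start_le.
Qed.

Lemma cnt_size u x : (cnt u x <= size u)%N.
Proof. by rewrite -[X in (_ <= X)%N](size_iota 0) count_size. Qed.

Lemma cnt_mono u x y : x <= y -> (cnt u x <= cnt u y)%N.
Proof. by move=> h; apply: sub_count => j /= hj; exact: le_trans hj h. Qed.

Lemma cntS u x : (cnt u (x + 1)%R <= (cnt u x).+1)%N.
Proof.
rewrite leqNgt; apply/negP => h; set c := cnt u x in h.
have hc : (c.+1 < size u)%N by apply: leq_trans h (cnt_size _ _).
have h1 : start u c.+1 <= x + 1 by rewrite cntP.
have : start u c <= x.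
  by move: h1; rewrite startS ?(ltnW hc) //; have := len1 (nth ord0 u c); lra.
by rewrite cntP ?(ltnW hc) // ltnn.
Qed.

(** A grid that begins at [t - 1], because [entry] looks back by one unit: at height [t + i%:R],
    which is [ticks t i.+1], it shows the subtile that starts after [ticks t i]. *)
Definition ticks (t : R) i := t - 1 + i%:R.

Lemma ticksS t i : ticks t i.+1 = ticks t i + 1.
Proof. by rewrite /ticks -natr1 addrA. Qed.

Definition subentry (ts : seq tilet) t i : option tilet :=
  let u := unzip1 ts in let c := cnt u (ticks t i) in
  if (c < cnt u (ticks t i.+1))%N then Some (nth (ord0, [::]) ts c) else None.

Definition window (ts : seq tilet) t M :=
  drop (cnt (unzip1 ts) (ticks t 0)) (take (cnt (unzip1 ts) (ticks t M)) ts).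

Lemma ticks_mono t i j : (i <= j)%N -> ticks t i <= ticks t j.
Proof. by move=> h; rewrite lerD2l ler_nat. Qed.

(** Subtiles are longer than 1, so each unit step starts at most one of them ([cntS]), and no
    subtile of the window is missed. *)
Lemma window_names ts t M : window ts t M = pmap id [seq subentry ts t i | i <- iota 0 M].
Proof.
elim: M => [|M IH]; first by rewrite /window drop_oversize // size_take_min geq_minl.
rewrite -[M.+1]addn1 iotaD map_cat pmap_cat -IH /= add0n addn1 /subentry /window.
set u := unzip1 ts; set c0 := cnt u (ticks t 0); set c := cnt u (ticks t M); set c' := cnt u (ticks t M.+1).
have cc : (c <= c')%N by apply: cnt_mono; exact: ticks_mono.
have c0c : (c0 <= c)%N by apply: cnt_mono; exact: ticks_mono.
have c'c : (c' <= c.+1)%N by rewrite /c' ticksS cntS.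
have sz : size u = size ts by rewrite size_map.
have c's : (c' <= size ts)%N by rewrite -sz cnt_size.
case: ltnP => h /=; last by rewrite cats0 (_ : c' = c) //; apply/eqP; rewrite eqn_leq h.
have -> : c' = c.+1 by apply/eqP; rewrite eqn_leq c'c.
have cs : (c < size ts)%N by exact: leq_trans h c's.
by rewrite (take_nth (ord0, [::])) // drop_rcons // ?size_takel ?cats1 // ltnW.
Qed.

Lemma slen_window ts t M C : 0 <= t -> t + M%:R <= slen n ts -> (forall a, len n a <= C) ->
  M%:R - C <= slen n (window ts t M).
Proof.
move=> t0 tM hC; rewrite /window; set u := unzip1 ts; set c0 := cnt u _; set c := cnt u _.
have sz : size u = size ts by rewrite size_map.
have C1 : 1 < C by apply: lt_le_trans (hC ord0); exact: len1.
have c0c : (c0 <= c)%N by apply: cnt_mono; exact: ticks_mono.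
have e : slen n (take c ts) = slen n (take c0 ts) + slen n (drop c0 (take c ts)).
  by rewrite -slen_cat -[X in X ++ _](take_takel ts c0c) cat_take_drop.
have b1 : slen n (take c0 ts) <= t - 1 + C.
  rewrite start_slen -/u; have hs := cnt_size u (ticks t 0); rewrite -/c0 in hs.
  case: (posnP c0) => [->|c00]; first by rewrite /start take0 Lw_nil mulr0; lra.
  have hc : (c0.-1 < size u)%N by rewrite prednK.
  have := cntP (ticks t 0) hc; rewrite -/c0 prednK // leqnn => h.
  rewrite -(prednK c00) startS //; move: h; rewrite /ticks addr0.
  by have := hC (nth ord0 u c0.-1); lra.
have b2 : t - 1 + M%:R <= slen n (take c ts).
  have hs := cnt_size u (ticks t M); rewrite -/c in hs.
  have [hc|hc] := ltnP c (size u).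
    by have := cntP (ticks t M) hc; rewrite -/c ltnn start_slen -/u leNgt => /negbFE/ltW.
  by rewrite take_oversize -?sz //; lra.
lra.
Qed.

(** Links the observable with combinatorics: what [entry] shows while the orbit stays in one
    supertile is determined by the supertile and the initial height. *)
Lemma subentry_point p i t : Yset th L p -> tm (th := th) (L := L) (n + m) p = ticks t i.+1 ->
  omap (fun j => tnth (in_tuple (tiles (th := th) n)) j) (entry (th := th) (L := L) n p) =
  subentry (subs (th := th) n m (tile (th := th) (n + m) p)) t i.
Proof.
move=> hy et; have [hx _] := hy; set ts := subs _ _ _.
have [k [hk e1 e2]] := tile_sub (Hg := Hg) n m (ord0, [::]) hx; rewrite -/ts in hk e1 e2.
have sz : size (unzip1 ts) = size ts by rewrite size_map.
have hku : (k < size (unzip1 ts))%N by rewrite sz.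
have /andP[t0 t1] := tm_bounds (Hg := Hg) n hy.
have ek : nth ord0 (unzip1 ts) k = (tile (th := th) n p).1 by rewrite (nth_map (ord0, [::])) // -e1.
rewrite et start_slen ticksS in e2.
have c1 : cnt (unzip1 ts) (ticks t i.+1) = k.+1.
  apply/eqP; rewrite eqn_leq -(cntP _ hku) ticksS; apply/andP; split; last lra.
  rewrite leqNgt; apply/negP => h; have hk1 : (k.+1 < size (unzip1 ts))%N by exact: leq_trans h (cnt_size _ _).
  by move: h; rewrite -(cntP _ hk1) startS // ek; rewrite /tlen in t1; lra.
rewrite /subentry c1 ltnS; have [h|h] := ltP (tm (th := th) (L := L) n p) 1.
  have [j -> /= ->] := entry_Some (Hg := Hg) hy h.
  have -> : cnt (unzip1 ts) (ticks t i) = k; last by rewrite leqnn -e1.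
  apply/eqP; rewrite eqn_leq; apply/andP; split.
    by rewrite leqNgt -(cntP _ hku) -ltNge; lra.
  case: k hk e1 e2 hku ek c1 => // k hk e1 e2 hku ek c1; have hk' := ltnW hku.
  by rewrite -(cntP _ hk'); move: e2; rewrite startS //; have := len1 (nth ord0 (unzip1 ts) k); lra.
rewrite /entry ltNge h /= ifF //; apply/negbTE; rewrite -ltnNge -(cntP _ hku); lra.
Qed.

End SubtileNames.

Section LowerBound.
Context {d : nat} {R : realType} {th : rsubst d} {lam : R} {L : 'I_d.+1 -> R}.
Context {Hg : good th lam L}.
Local Notation tp := (theta_pow th).
Local Notation Y := (Yset th L).
Local Notation tile := (tile (R := R) (th := th)).
Local Notation tm := (tm (th := th) (L := L)).
Local Notation tlen := (tlen (th := th) (lam := lam) (L := L)).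
Local Notation fault := (fault (th := th) (lam := lam) (L := L)).
Local Notation len := (len (lam := lam) (L := L)).
Local Notation slen := (slen (lam := lam) (L := L)).
Local Notation tilet := ('I_d.+1 * word d)%type.
Local Notation phi := (phi (L := L)).
Local Notation entry := (entry (th := th) (L := L)).
Local Notation subentry := (subentry (lam := lam) (L := L)).
Local Notation window := (window (lam := lam) (L := L)).
Local Notation cnt := (cnt (lam := lam) (L := L)).

Lemma tiling_all n (ts : seq tilet) : {in ts, forall T, T.2 \in tp n T.1} -> tiling (tp n) (unzip1 ts) (unzip2 ts).
Proof.
elim: ts => //= T ts IH h; rewrite h ?mem_head //=; apply: IH => T' hT'.
by apply: h; rewrite in_cons hT' orbT.
Qed.

Lemma tiling_all_inv n (ts : seq tilet) : tiling (tp n) (unzip1 ts) (unzip2 ts) -> {in ts, forall T, T.2 \in tp n T.1}.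
Proof.
elim: ts => //= T ts IH /andP[h1 h2] T'; rewrite in_cons => /orP[/eqP->//|]; exact: IH.
Qed.

Variables (n : nat) (g C : R).
Hypothesis len1 : forall a, 1 < len n a.
Hypothesis lenC : forall a, len n a <= C.
Hypothesis g0 : 0 <= g.
Hypothesis hgN : forall a, g * len n a <= lnN (R := R) (th := th) n a.

Lemma window_split (ts : seq tilet) t M : let c := cnt n (unzip1 ts) (ticks t 0) in
  ts = take c ts ++ window n ts t M ++ drop (c + size (window n ts t M)) ts.
Proof.
move=> c; set c' := cnt n (unzip1 ts) (ticks t M).
have cc : (c <= c')%N by apply: cnt_mono; exact: ticks_mono.
have c's : (c' <= size ts)%N by have := cnt_size (lam := lam) (L := L) n (unzip1 ts) (ticks t M); rewrite size_map.
rewrite /window -/c -/c' size_drop size_takel // subnKC //.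
by rewrite catA -[X in X ++ drop c _](take_takel ts cc) cat_take_drop cat_take_drop.
Qed.

(* Replacing the subtiles inside the window by arbitrary ones of the same types is injective on words. *)
Lemma window_count m a t M (W : nat -> option tilet) : 0 <= t -> t + M%:R <= len (n + m) a ->
  (count (fun V => [forall i : 'I_M, subentry n (subs (th := th) n m (a, V)) t i == W i]) (tp (n + m) a))%:R
    * expR (g * (M%:R - C)) <= (size (tp (n + m) a))%:R :> R.
Proof.
move=> t0 tM; set Q := fun V => _; pose S := [seq V <- tp (n + m) a | Q V].
rewrite -size_filter -/S; pose Fw := pmap id [seq W i | i <- iota 0 M].
pose sb V := subs (th := th) n m (a, V); pose c0 V := cnt n (unzip1 (sb V)) (ticks t 0).
have hS V : V \in S -> subtiling (th := th) n m a V (sb V) /\ window n (sb V) t M = Fw.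
  rewrite mem_filter => /andP[/forallP hQ hV]; split; first exact: (subsP (T := (a, V))).
  rewrite (window_names (Hg := Hg) len1) /Fw; congr pmap; apply/eq_in_map => i; rewrite mem_iota add0n => /= hi.
  exact/eqP/(hQ (Ordinal hi)).
have hsp V : V \in S -> sb V = take (c0 V) (sb V) ++ Fw ++ drop (c0 V + size Fw) (sb V).
  by move=> hV; have [_ <-] := hS V hV; exact: window_split.
pose ntl V F' := take (c0 V) (sb V) ++ F' ++ drop (c0 V + size Fw) (sb V).
pose ins V (F' : seq tilet) := flatten (unzip2 (ntl V F')).
have hF F' : F' \in tilelists (th := th) n (unzip1 Fw) -> unzip1 F' = unzip1 Fw /\ {in F', forall T, T.2 \in tp n T.1}.
  rewrite mem_tilelists => /andP[/eqP e]; rewrite -e => h; split=> //.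
  exact: tiling_all_inv h.
have hu V F' : V \in S -> F' \in tilelists (th := th) n (unzip1 Fw) -> unzip1 (ntl V F') = unzip1 (sb V).
  move=> hV /hF[e _]; rewrite [in RHS](hsp V hV) /ntl /unzip1 !map_cat.
  by rewrite -/(unzip1 F') e.
have hst V F' : V \in S -> F' \in tilelists (th := th) n (unzip1 Fw) -> subtiling (th := th) n m a (ins V F') (ntl V F').
  move=> hV hF'; have [hs _] := hS V hV; have hall := subtiling_all hs; case: (hs) => h1 _ _.
  split=> //; first by rewrite hu.
  apply: tiling_all => T; rewrite !mem_cat => /or3P[/mem_take|/(proj2 (hF _ hF'))|/mem_drop] //; exact: hall.
(* [subtiling_uniq] recovers the list of subtiles from the word. Types are unchanged by the
   insertion, hence so is the number [c0] of subtiles before the window, and both the window and its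
   surroundings can be read off. *)
have inj : {in S & tilelists (th := th) n (unzip1 Fw), forall V F', forall V2 F2, V2 \in S ->
    F2 \in tilelists (th := th) n (unzip1 Fw) -> ins V F' = ins V2 F2 -> V = V2 /\ F' = F2}.
  move=> V F' hV hF' V2 F2 hV2 hF2 e.
  have h1 := hst V F' hV hF'; have h2 := hst V2 F2 hV2 hF2; rewrite -e in h2.
  have en := subtiling_uniq (Hg := Hg) h1 h2.
  have ec : c0 V = c0 V2 by rewrite /c0 -(hu V F') // en hu.
  have sF : size F' = size Fw by have := congr1 size (proj1 (hF _ hF')); rewrite !size_map.
  have sF2 : size F2 = size Fw by have := congr1 size (proj1 (hF _ hF2)); rewrite !size_map.
  have ss : size (take (c0 V) (sb V)) = size (take (c0 V2) (sb V2)).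
    have sz : size (sb V) = size (sb V2) by rewrite -!(size_map fst) -/(unzip1 _) -(hu V F') // en hu.
    by rewrite !size_take_min ec sz.
  move: en => /eqP; rewrite /ntl eqseq_cat // => /andP[/eqP e1]; rewrite eqseq_cat ?sF ?sF2 // => /andP[/eqP e2 /eqP e3].
  split=> //; have [[_ _ ->] _] := hS V hV; have [[_ _ ->] _] := hS V2 hV2.
  by rewrite (hsp V hV) (hsp V2 hV2) e1 e3.
have [->|Sn] := eqVneq S [::]; first by rewrite mul0r.
have [V0 hV0] : exists V, V \in S by move: Sn; case: (S) => [|V s] // _; exists V; rewrite mem_head.
have lF : M%:R - C <= slen n Fw.
  have [hs <-] := hS V0 hV0; apply: (slen_window (Hg := Hg)) => //.
  by rewrite (slen_subtiling (Hg := Hg) hs).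
have hprod : expR (g * (M%:R - C)) <= (size (tilelists (th := th) n (unzip1 Fw)))%:R.
  have p0 : 0 < \prod_(b <- unzip1 Fw) (size (tp n b))%:R :> R by apply: prodr_gt0 => b _; exact: N_gt0.
  rewrite size_tilelists natr_prod -[X in _ <= X]lnK ?posrE // ler_expR ln_prodN.
  apply: (@le_trans _ _ (g * slen n Fw)); first exact: ler_wpM2l.
  by rewrite /slen big_map mulr_sumr; apply: ler_sum.
apply: (@le_trans _ _ ((size S)%:R * (size (tilelists (th := th) n (unzip1 Fw)))%:R)).
  by rewrite ler_wpM2l.
rewrite -natrM ler_nat -(size_allpairs ins); apply: uniq_leq_size.
  apply: allpairs_uniq => [||[V F'] [V2 F2] /=]; [by rewrite filter_uniq // theta_pow_uniq|exact: tilelists_uniq|].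
  move=> /allpairsP[[V' F''] /= [h1 h2 [-> ->]]] /allpairsP[[V2' F2''] /= [h3 h4 [-> ->]]] e.
  by have [-> ->] := inj _ _ h1 h2 _ _ h3 h4 e.
by move=> u /allpairsP[[V F'] /= [hV hF' ->]]; exact: subtiling_mem (hst V F' hV hF').
Qed.

Variable nu : probability (Ysp d R) R.
Hypothesis Hnu : flow_invariant th L nu.
Local Notation wt := (wt (th := th) (L := L) nu).

(* For a lift this is equivalent to invariance under all shuffles. *)
Definition type_uniform := forall k a v v', v \in tp k a -> v' \in tp k a -> wt k (a, v) = wt k (a, v').

Hypothesis TU : type_uniform.

(** Away from the faults of level [N] the orbit piece stays in one supertile, whose word is uniform
    given its type; [window_count] bounds the proportion of words that show [w]. The faults have
    measure at most [e], which is arbitrary. *)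
Lemma names_pr_le M (w : {ffun 'I_M -> option 'I_(tnum (th := th) n)}) :
  pm nu (names phi (entry n) M) w <= expR (- (g * (M%:R - C))).
Proof.
apply/ler_addgt0Pr => e e0; set A := [set p | names phi (entry n) M p = w].
have oe : obs (entry n) by exact: obs_entry.
have mA : measurable A by exact: (obs_names (@mphi _ _ _ _ _ Hg) oe w).
have [m0 hm0] := fault_small (Hg := Hg) Hnu (M%:R + 1) e0.
pose m := m0; have {}hm0 := hm0 (n + m)%N (leq_addl _ _); set N := (n + m)%N in hm0.
have mF : measurable (fault N (M%:R + 1)) by exact: measurable_fault.
have mY : measurable Y by exact: measurable_Yset.
pose W i : option tilet := if insub i is Some j then omap (fun k => tnth (in_tuple (tiles (th := th) n)) k) (w j) else None.
pose J (T : tilet) : set (measurableTypeR R) := [set t | [&& 0 <= t, t + M%:R < len N T.1 &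
  [forall i : 'I_M, subentry n (subs (th := th) n m T) t i == W i]]].
have mJ T : measurable (J T).
  pose u := unzip1 (subs (th := th) n m T).
  pose E := [:: 0; len N T.1 - M%:R] ++ [seq start (lam := lam) (L := L) n u j + 1 - i%:R | j <- iota 0 (size u), i <- iota 0 M.+1].
  apply: (@simple_measurable d R _ E (fun _ t => [&& 0 <= t, t + M%:R < len N T.1 &
    [forall i : 'I_M, subentry n (subs (th := th) n m T) t i == W i]]) T true).
  move=> _ t t' ht; have hc i : (i <= M)%N -> cnt n u (ticks t i) = cnt n u (ticks t' i).
    move=> hi; apply: eq_in_count => j hj.
    have e1 x : (start (lam := lam) (L := L) n u j <= ticks x i) = (start (lam := lam) (L := L) n u j + 1 - i%:R <= x).
      by rewrite /ticks; apply/idP/idP; lra.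
    rewrite !e1; apply: ht; rewrite mem_cat; apply/orP; right; apply/allpairsP.
    by exists (j, i); split=> //; rewrite mem_iota.
  congr [&& _, _ & _].
  - by apply: ht; rewrite mem_head.
  - by rewrite !ltNge -!lerBlDr; congr (~~ _); apply: ht; rewrite !in_cons eqxx orbT.
  - by apply: eq_forallb => i; rewrite /subentry -/u !hc // ltnW.
have mB := measurableD (measurableI _ _ mA mY) mF; set B := _ `\` _ in mB.
have step1 : pr nu B <= expR (- (g * (M%:R - C))).
  rewrite (@pr_fibers _ _ _ _ _ (tiles (th := th) N) B (tile N) (tiles_uniq N)) //; last first.
  - by move=> T; apply: measurableI => //; exact: measurable_tile.
  - by move=> p [[_ [hx _]] _]; exact: tile_tiles.
  apply: (@le_trans _ _ (\sum_(T <- tiles (th := th) N) pr nu (cell (th := th) (L := L) N T (J T)))).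
    apply: ler_sum => T _; apply: pr_le.
    - by apply: measurableI => //; exact: measurable_tile.
    - exact: measurable_cell.
    move=> p [[[/= hA hy] /= hf] hT]; split=> //=; have /andP[t0 t1] := tm_bounds (Hg := Hg) N hy.
    have tM : tm N p + M%:R < len N T.1.
      rewrite ltNge; apply/negP => h; apply: hf; right; rewrite /tlen hT; lra.
    rewrite /J /= t0 tM /=; apply/forallP => i; apply/eqP.
    rewrite /W (valK i) -hA ffunE.
    have iM : i%:R <= M%:R :> R by rewrite ler_nat ltnW.
    have [|e1 e2] := tile_move (Hg := Hg) (n := N) (t := i%:R) hy.
      by rewrite /tlen hT; apply/andP; split; [rewrite addr_ge0|lra].
    have et : tm N (phi i p) = ticks (tm N p) i.+1 by rewrite /phi e2 /ticks -natr1; lra.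
    by rewrite (subentry_point (Hg := Hg) len1 (phiY (Hg := Hg) i hy) et) -/N /phi e1 hT.
  have q1 : \sum_(a < d.+1) qt (th := th) (L := L) nu N a = 1 by rewrite -(sum_wt (Hg := Hg) Hnu N) sum_tiles.
  rewrite sum_tiles -[X in _ <= X](mulr1 (expR _)) -[X in _ * X]q1 mulr_sumr; apply: ler_sum => a _; have [V0 hV0] := tp_mem N a.
  (* By type-uniformity all words of type [a] may be replaced by one word [V0]: the sets become
     subsets of a single cell, and only their multiplicity at each height matters. *)
  have -> : \sum_(V <- tp N a) pr nu (cell (th := th) (L := L) N (a, V) (J (a, V))) =
      \sum_(V <- tp N a) pr nu (cell (th := th) (L := L) N (a, V0) (J (a, V))).
    by apply: eq_big_seq => V hV; rewrite /pr; congr fine; apply: cell_eq => //; exact: TU.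
  have -> : qt (th := th) (L := L) nu N a = (size (tp N a))%:R * wt N (a, V0).
    rewrite /qt (eq_big_seq (fun _ => wt N (a, V0))) => [|V hV]; last exact: TU.
    by rewrite big_const_seq count_predT iter_addr_0 mulr_natl.
  rewrite mulrA [expR _ * _]mulrC.
  apply: pr_multiplicity; [by move=> V; exact: measurable_cell|exact: measurable_cell|by move=> V p []|].
  move=> p hp; rewrite expRN ler_pdivlMr ?expR_gt0 //.
  have [hJ|hJ] := boolP [&& 0 <= tm N p & tm N p + M%:R < len N a]; last first.
    rewrite (@eq_count _ _ pred0) ?count_pred0 ?mul0r // => V; apply/asboolPn => -[_ /= /and3P[j1 j2 _]].
    by move/negP: hJ; apply; rewrite j1 j2.
  case/andP: hJ => j1 /ltW j2; apply: le_trans (window_count W j1 j2); apply: ler_wpM2r; first exact: expR_ge0.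
  by rewrite ler_nat; apply: sub_count => V /= /asboolP[_ /= /and3P[]].
rewrite /pm -/A -(prY Hnu mA) (prDI nu (measurableI _ _ mA mY) mF); apply: lerD => //.
by apply: le_trans hm0; apply: pr_le; [by apply: measurableI => //; exact: measurableI|exact: mF|by move=> p []].
Qed.

Lemma Hn_lower M : g * (M%:R - C) <= Hn nu phi (entry n) M.
Proof.
rewrite -[X in X <= _]expRK -(opprK (g * _)) expRN lnV ?posrE ?expR_gt0 //.
apply: Hf_lower; [|exact: expR_gt0|by move=> w; exact: names_pr_le].
by apply: obs_names; [exact: mphi|exact: obs_entry].
Qed.

Lemma entropy_lower : exists k (f : Ysp d R -> 'I_k), obs f /\
  g <= limn (fun m => Hn nu phi f m.+1 / m.+1%:R).
Proof.
pose f p := enum_rank (entry n p); exists _, f.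
have oe : obs (entry n) by exact: obs_entry.
have hf : obs f by exact: obs_comp.
split=> //; apply/ler_addgt0Pr => e e0; rewrite -lerBlDr.
apply: limr_ge; first exact: (Hn_cvg (phi_add (L := L)) (@mphi _ _ _ _ _ Hg) (pphi (Hg := Hg) Hnu)).
exists (Num.truncn (`|g * C| / e)).+1 => // M /= hM; rewrite ler_pdivlMr ?ltr0n //.
have le : Hn nu phi (entry n) M.+1 <= Hn nu phi f M.+1.
  have hN : obs (names phi f M.+1) by apply: obs_names => //; exact: mphi.
  have := Hf_comp nu (fun z : {ffun 'I_M.+1 -> 'I_#|{: option 'I_(tnum (th := th) n)}|} => [ffun i => enum_val (z i)]) hN.
  congr (Hf nu _ <= _); apply/funext => p; apply/ffunP => i; rewrite !ffunE.
  by rewrite enum_rankK.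
apply: le_trans le; apply: le_trans (Hn_lower _).
have h1 : `|g * C| <= e * M.+1%:R.
  rewrite [e * _]mulrC -(ler_pdivrMr _ _ e0); apply: (le_trans (ltW (truncnS_gt _))).
  by rewrite ler_nat ltnW.
by have := ler_norm (g * C); move: h1; rewrite mulrBl mulrBr; lra.
Qed.

End LowerBound.

(** * Measures of maximal entropy *)

Section MaximalEntropy.
Context {d : nat} {R : realType} {th : rsubst d} {lam : R} {L : 'I_d.+1 -> R}.
Context {Hg : good th lam L}.
Local Notation tp := (theta_pow th).
Local Notation len := (len (lam := lam) (L := L)).
Local Notation phi := (phi (L := L)).
Local Notation type_uniform := (type_uniform (th := th) (L := L)).
Implicit Types nu : probability (Ysp d R) R.

Lemma H_joinE nu k (xi : 'I_k -> set (Ysp d R)) (f : Ysp d R -> 'I_k) n :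
  (forall p i, xi i p <-> f p = i) -> H_join L nu xi n = Hn nu phi f n.
Proof.
move=> h; apply: eq_bigr => w _; congr (entf (fine (nu _))).
apply/seteqP; split=> p /=.
  move=> hp; apply/ffunP => i; rewrite ffunE; apply/h.
  by have := hp i I; rewrite flow_preE.
by move=> <- i _; rewrite flow_preE /= ffunE; apply/h.
Qed.

Lemma partition_fun k (xi : 'I_k -> set (Ysp d R)) : is_partition xi ->
  exists f : Ysp d R -> 'I_k, obs f /\ forall p i, xi i p <-> f p = i.
Proof.
move=> [mxi dxi cxi]; have /choice[f hf] : forall p, exists i, xi i p.
  by move=> p; have : [set: Ysp d R] p by []; rewrite -cxi => -[i _ h]; exists i.
have e p i : xi i p <-> f p = i.
  split=> [h|<- //]; apply/eqP/negPn/negP => hne.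
  by have : (xi (f p) `&` xi i) p by []; rewrite (dxi _ _ hne).
exists f; split=> // i; have := mxi i; congr measurable; by apply/seteqP; split=> p /= /e.
Qed.

Lemma fun_partition k (f : Ysp d R -> 'I_k) : obs f -> is_partition (fun i => [set p | f p = i]).
Proof.
move=> hf; split=> [//|i j ij|].
  by apply/seteqP; split=> // p [/= e1 e2]; move: ij; rewrite -e1 e2 eqxx.
by apply/seteqP; split=> // p _; exists (f p).
Qed.

Lemma h_partE nu k (xi : 'I_k -> set (Ysp d R)) (f : Ysp d R -> 'I_k) :
  (forall p i, xi i p <-> f p = i) -> h_part L nu xi = limn (fun m => Hn nu phi f m.+1 / m.+1%:R).
Proof. by move=> h; rewrite /h_part; congr (limn _); apply/funext => m; rewrite (H_joinE _ _ h). Qed.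

Variable h : R.
Hypothesis hgrow : forall e, 0 < e -> exists N, forall n a, (N <= n)%N ->
  (h - e) * len n a <= lnN (R := R) (th := th) n a <= (h + e) * len n a.

Lemma ks_upper nu n : flow_invariant th L nu ->
  (ks_entropy L nu <= (h - deficit (th := th) (lam := lam) (L := L) nu n)%:E)%E.
Proof.
move=> Hnu; apply: ge_ereal_sup => _ [k [xi [hxi ->]]].
have [f [hf e]] := partition_fun hxi; rewrite (h_partE _ e) lee_fin.
exact: (entropy_upper (Hg := Hg)).
Qed.

Lemma ks_lower nu : flow_invariant th L nu -> type_uniform nu -> (h%:E <= ks_entropy L nu)%E.
Proof.
move=> Hnu TU; apply/lee_addgt0Pr => e e0.
have [N1 h1] := hgrow e0; have [c c0 hc] := Lmin_ex (Hg := Hg).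
have [N2 h2] := lamX_large (Hg := Hg) (2 / c).
pose n := maxn N1 N2; have {}h1 a := h1 n a (leq_maxl _ _); have {}h2 := h2 n (leq_maxr _ _).
have [b hb] := fin_argmax (fun a => len n a).
(* [entropy_lower] asks for a nonnegative rate; the truncation is harmless because [lnN] is
   nonnegative. *)
pose g := Num.max (h - e) 0.
have len1 a : 1 < len n a.
  apply: (@lt_le_trans _ _ (lam ^+ n * c)); last by rewrite /len ler_wpM2l // ltW // lamX_gt0.
  by move: h2; rewrite ler_pdivrMr //; lra.
have g0 : 0 <= g by rewrite le_max lexx orbT.
have hgN a : g * len n a <= lnN (R := R) (th := th) n a.
  have /andP[b1 _] := h1 a; rewrite /g; case: (leP (h - e) 0) => // _.
  by rewrite mul0r lnN_ge0.
have [k [f [hf hl]]] := entropy_lower (Hg := Hg) len1 hb g0 hgN Hnu TU.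
have : ((g)%:E <= ks_entropy L nu)%E.
  apply: (@le_trans _ _ (h_part L nu (fun i => [set p | f p = i]))%:E).
    by rewrite lee_fin (@h_partE _ _ _ f).
  by apply: ereal_sup_ubound; exists k, (fun i => [set p | f p = i]); split=> //; exact: fun_partition.
move=> hks; have : (h%:E <= (g + e)%:E)%E.
  by rewrite lee_fin -lerBlDr /g le_max lexx.
by move/le_trans; apply; rewrite EFinD leeD2r.
Qed.

End MaximalEntropy.

Section MaximalMeasures.
Context {d : nat} {R : realType} {th : rsubst d} {lam : R} {L : 'I_d.+1 -> R}.
Context {Hg : good th lam L}.
Implicit Types nu : probability (Ysp d R) R.

Lemma type_uniform_mme nu : flow_invariant th L nu -> type_uniform (th := th) (L := L) nu -> is_mme th L nu.
Proof.
move=> Hnu TU; split=> // nu' Hnu'; have [h [_ hgrow]] := growth_rate (Hg := Hg).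
apply: le_trans (ks_lower (Hg := Hg) hgrow Hnu TU).
apply: le_trans (ks_upper (Hg := Hg) hgrow 0 Hnu') _.
by rewrite lee_fin gerBl deficit_ge0.
Qed.

(** Comparison with [nu] gives [h <= h - deficit nu' n] for every [n], so no level has a deficit. *)
Lemma mme_type_uniform nu nu' : flow_invariant th L nu -> type_uniform (th := th) (L := L) nu ->
  is_mme th L nu' -> type_uniform (th := th) (L := L) nu'.
Proof.
move=> Hnu TU [Hnu' hmax] n a v v' hv hv'; have [h [_ hgrow]] := growth_rate (Hg := Hg).
apply: (deficit_uniform (Hg := Hg)) hv hv'.
have := ks_lower (Hg := Hg) hgrow Hnu TU; move/le_trans/(_ (hmax nu Hnu)).
by move/le_trans/(_ (ks_upper (Hg := Hg) hgrow n Hnu')); rewrite lee_fin; lra.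
Qed.

End MaximalMeasures.

(** * Lifts and shuffles *)

Lemma Ysp_determine (d : nat) (R : realType) (P P' : probability (Ysp d R) R) :
  (forall (A : set (Xsp d)) x, measurable A ->
     P [set p | A p.1 /\ x <= p.2] = P' [set p | A p.1 /\ x <= p.2]) ->
  forall B, measurable B -> P B = P' B.
Proof.
move=> h B mB.
have ms : measurable_fun setT (fun p : Ysp d R => p.2) by exact: (@measurable_snd _ _ (Xsp d) (measurableTypeR R)).
have mf (A : set (Xsp d)) : measurable A -> measurable [set p : Ysp d R | A p.1] by exact: measurable_fst_pre.
apply: (@measure_unique _ R (Ysp d R) [set A1 `*` A2 | A1 in measurable & A2 in measurable] (fun _ => setT)) => //.
- exact: measurable_prod_measurableType.
- move=> _ _ [X1 mX1 [X2 mX2 <-]] [Y1 mY1 [Y2 mY2 <-]].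
  by exists (X1 `&` Y1); [exact: measurableI|exists (X2 `&` Y2); [exact: measurableI|rewrite setXI]].
- by move=> _; exists setT => //; exists setT => //; rewrite setXTT.
- by rewrite bigcup_const.
- move=> _ [A mA [J mJ <-]].
  exact: (law_eq (mf A mA) (mf A mA) ms ms (fun x => h A x mA) mJ).
- by move=> _; apply: (@le_lt_trans _ _ (P setT)); [by []|rewrite probability_setT ltry].
Qed.

Lemma bigcup_finset (T : Type) (n : nat) (F : 'I_n -> set T) :
  \bigcup_(i in [set: 'I_n]) F i = \big[setU/set0]_(i < n) F i.
Proof.
rewrite -big_enum -bigcup_seq; apply/seteqP; split=> p [i _ h]; exists i => //=.
by rewrite mem_enum.
Qed.

Lemma overlap_shift (R : realType) (m t l : R) : l - Num.min (l - t + m) l = t - Num.min m t.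
Proof. case: leP => h1; case: leP => h2; lra. Qed.

Lemma overlap_length (R : realType) (x t l : R) : 0 <= t -> t <= l ->
  l - t - Num.min (Num.max 0 (x - t)) (l - t) + (t - Num.min (Num.max 0 x) t) = l - Num.min (Num.max 0 x) l.
Proof.
move=> t0 tl; case: (leP 0 x) => h1; case: (leP 0 (x - t)) => h2; do ?(case: leP => ?); lra.
Qed.

Section HullLift.
Context {d : nat} {R : realType} {th : rsubst d} {lam : R} {L : 'I_d.+1 -> R}.
Context {Hg : good th lam L}.
Local Notation X := (Xth th).
Local Notation Y := (Yset th L).
Local Notation flow := (flow (L := L)).
Variable mu : probability (Xsp d) R.
Hypothesis Hmu : in_M th mu.

Definition prodm : {measure set (Ysp d R) -> \bar R} := (mu \x (@lebesgue_measure R))%E.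

Definition letter_set (a : 'I_d.+1) : set (Xsp d) := [set x | X x /\ x 0 = a].

Lemma measurable_letter_set a : measurable (letter_set a).
Proof. by apply: measurableI; [exact: measurable_Xth|exact: measurable_config_at]. Qed.

Definition rect (A : set (Xsp d)) a u v : set (Ysp d R) :=
  [set p | [/\ A p.1, letter_set a p.1 & u <= p.2 < v]].

Lemma measurable_rect A a u v : measurable A -> measurable (rect A a u v).
Proof.
move=> mA; have -> : rect A a u v = [set p | (A `&` letter_set a) p.1] `&` [set p | p.2 \in `[u, v[].
  by apply/seteqP; split=> p /=; rewrite in_itv /=; [case|case=> -[]].
apply: measurableI; last exact: measurable_snd_itv.
by apply: measurable_fst_pre; apply: measurableI => //; exact: measurable_letter_set.
Qed.

Lemma prodm_rect A a u v : measurable A -> u <= v ->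
  prodm (rect A a u v) = (pr mu (A `&` letter_set a) * (v - u))%:E.
Proof.
move=> mA uv; have -> : rect A a u v = (A `&` letter_set a) `*` `[u, v[%classic.
  by apply/seteqP; split=> p /=; rewrite in_itv /=; [case|case=> -[]].
have mAl : measurable (A `&` letter_set a) by apply: measurableI => //; exact: measurable_letter_set.
have mI : measurable (`[u, v[%classic : set (measurableTypeR R)) by exact: measurable_itv.
rewrite (_ : prodm _ = mu (A `&` letter_set a) * lebesgue_measure `[u, v[%classic)%E; last first.
  exact: (@product_measure1E _ _ (Xsp d) (measurableTypeR R) R mu lebesgue_measure _ _ mAl mI).
rewrite prE // lebesgue_measure_itv /= lte_fin EFinM; case: ltP => // vu.
by rewrite (_ : v = u) ?subrr //; apply/le_anti; rewrite vu uv.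
Qed.

Lemma Yset_rect : Y = \bigcup_(a in [set: 'I_d.+1]) rect setT a 0 (L a).
Proof.
apply/seteqP; split=> p /=; first by move=> [hx hs]; exists (p.1 0).
by move=> [a _ [_ [hx e] hs]]; split=> //; rewrite e.
Qed.

Lemma rect_disj A B a b u v u' v' : a != b -> rect A a u v `&` rect B b u' v' = set0.
Proof.
move=> ab; apply/seteqP; split=> // p [[_ [_ e] _] [_ [_ e'] _]].
by move: ab; rewrite -e e' eqxx.
Qed.

Definition mass : R := fine (prodm Y).

Lemma prodm_fin (A : 'I_d.+1 -> set (Xsp d)) (u v : 'I_d.+1 -> R) : (forall a, measurable (A a)) -> (forall a, u a <= v a) ->
  prodm (\bigcup_(a in [set: 'I_d.+1]) rect (A a) a (u a) (v a)) =
  (\sum_a pr mu (A a `&` letter_set a) * (v a - u a))%:E.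
Proof.
move=> mA uv; rewrite bigcup_finset.
rewrite measure_semi_additive_ord.
- by rewrite -sumEFin; apply: eq_bigr => a _; exact: prodm_rect.
- by move=> a; exact: measurable_rect.
- by apply/trivIsetP => a b _ _ ab; exact: rect_disj.
- by apply: bigsetU_measurable => a _; exact: measurable_rect.
Qed.

Lemma massE : mass = \sum_a pr mu (letter_set a) * L a.
Proof.
rewrite /mass Yset_rect (prodm_fin (A := fun _ => setT) (u := fun _ => 0)) //=; last by move=> a; exact: (L_ge0 a).
by apply: eq_bigr => a _; rewrite setTI subr0.
Qed.

Lemma sum_letter_set (A : set (Xsp d)) : measurable A -> \sum_a pr mu (A `&` letter_set a) = pr mu (A `&` X).
Proof.
move=> mA; have mX : measurable (X : set (Xsp d)) by exact: measurable_Xth.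
rewrite (@pr_fibers _ _ _ _ _ (enum 'I_d.+1) (A `&` X) (fun x => x 0) (enum_uniq _)).
- rewrite big_enum; apply: eq_bigr => a _; congr pr; rewrite -setIA; congr (_ `&` _).
- by move=> x _; rewrite mem_enum.
- exact: measurableI.
- by move=> a; apply: measurableI; [exact: measurableI|exact: measurable_config_at].
Qed.

Lemma pr_full (A : set (Xsp d)) : measurable A -> pr mu (A `&` X) = pr mu A.
Proof.
have mX : measurable (X : set (Xsp d)) by exact: measurable_Xth.
move=> mA; rewrite [RHS](prDI mu mA mX) [X in _ = X + _](_ : _ = 0) ?add0r //.
apply: le_anti; rewrite pr_ge0 andbT.
have := prC mu mX; rewrite {2}/pr; case: Hmu => -> _; rewrite subrr => <-.
by apply: pr_le; [exact: measurableD|exact: measurableC|move=> p []].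
Qed.

Lemma mass_gt0 : 0 < mass.
Proof.
have [c c0 hc] := Lmin_ex (Hg := Hg); apply: lt_le_trans c0 _.
have -> : c = \sum_a pr mu (setT `&` letter_set a) * c.
  rewrite -mulr_suml sum_letter_set // setTI -[X in pr mu X]setTI pr_full //.
  by rewrite prT mul1r.
by rewrite massE; apply: ler_sum => a _; rewrite setTI ler_wpM2l // pr_ge0.
Qed.

Definition hull : set (Ysp d R) -> \bar R := hull_lift th L mu.

Let mY : measurable Y. Proof. exact: measurable_Yset. Qed.

Lemma massV_ge0 : 0 <= mass^-1.
Proof. by rewrite invr_ge0 ltW // mass_gt0. Qed.

Lemma hullE : hull = mscale (NngNum massV_ge0) (mrestr prodm mY).
Proof. by apply/funext => B; rewrite /hull /hull_lift /mscale /mrestr muleC. Qed.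

Let hull0 : hull set0 = 0%E. Proof. by rewrite hullE measure0. Qed.
Let hull_ge0 B : (0 <= hull B)%E. Proof. by rewrite hullE; exact: measure_ge0. Qed.
Let hull_additive : semi_sigma_additive hull.
Proof. by rewrite hullE; exact: measure_semi_sigma_additive. Qed.

HB.instance Definition _ := isMeasure.Build _ _ _ hull hull0 hull_ge0 hull_additive.

Let hullT : hull setT = 1%E.
Proof.
rewrite /hull /hull_lift setTI -/prodm -/mass.
have -> : prodm Y = mass%:E.
  by rewrite /mass Yset_rect (prodm_fin (A := fun _ => setT) (u := fun _ => 0)) //= => a; exact: (L_ge0 a).
by rewrite -EFinM divff // gt_eqF // mass_gt0.
Qed.

HB.instance Definition _ := Measure_isProbability.Build _ _ _ hull hullT.

Definition hullP : probability (Ysp d R) R := hull.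

Lemma hull_Y : hull Y = 1%E.
Proof. by rewrite -hullT /hull /hull_lift setIid setTI. Qed.

Lemma hull_fin (A : 'I_d.+1 -> set (Xsp d)) (u v : 'I_d.+1 -> R) : (forall a, measurable (A a)) ->
  (forall a, [/\ 0 <= u a, u a <= v a & v a <= L a]) ->
  pr hullP (\bigcup_(a in [set: 'I_d.+1]) rect (A a) a (u a) (v a)) =
  (\sum_a pr mu (A a `&` letter_set a) * (v a - u a)) / mass.
Proof.
move=> mA uv; rewrite /pr /hullP /= /hull /hull_lift setIidl.
  by rewrite -/prodm -/mass prodm_fin // => a; case: (uv a).
move=> p [a _ [_ [hx e] /andP[h1 h2]]]; have [u0 _ vL] := uv a; split=> //; rewrite e.
by apply/andP; split; lra.
Qed.

(** For [t] below every roof, a point either stays over its configuration or passes once to the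
    shifted one. The two parts of the preimage are unions of rectangles, and the shift invariance of
    [mu] matches the second with the missing part of the target. *)
Lemma hull_flow t (B : set (Ysp d R)) : 0 <= t -> (forall a, t <= L a) -> measurable B ->
  hullP [set p | B (flow p t)] = hullP B.
Proof.
move=> t0 tL; have mf := measurable_flow (Hg := Hg) t.
have mB' (B' : set (Ysp d R)) : measurable B' -> measurable [set p | B' (flow p t)].
  by move=> mB; have := mf measurableT B' mB; rewrite setTI.
have Yfull (B' : set (Ysp d R)) : measurable B' -> pr hullP (B' `&` Y) = pr hullP B'.
  move=> mB''; rewrite /pr; congr fine; rewrite /hullP /= /hull /hull_lift.
  by rewrite -setIA setIid.
pose P' : probability (Ysp d R) R := distribution hullP (mfun_Sub (mem_set mf)).
suff h : forall B', measurable B' -> P' B' = hullP B' by move=> mB; exact: (h B mB).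
apply: (@Ysp_determine d R P' hullP) => A x mA.
have mX : measurable (X : set (Xsp d)) by exact: measurable_Xth.
have mAx : measurable [set p : Ysp d R | A p.1 /\ x <= p.2].
  apply: measurableI; first exact: measurable_fst_pre.
  have := measurable_snd_itv (d := d) (R := R) `[x, +oo[.
  by congr measurable; apply/seteqP; split=> p /=; rewrite in_itv /= andbT.
have mS : measurable (@Defs.shift d @^-1` A : set (Xsp d)).
  have := @measurable_shf d 1 measurableT A mA; rewrite setTI.
  by congr measurable; apply/seteqP; split.
transitivity (hullP [set p | A (flow p t).1 /\ x <= (flow p t).2]); first by [].
rewrite !prE //; last exact: (mB' _ mAx).
congr (_%:E); rewrite -(Yfull _ (mB' _ mAx)) -(Yfull _ mAx).
(* The thresholds are clipped at 0, and below at the roof, so that every rectangle has ends in the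
   right order, as [hull_fin] requires. *)
pose m0 := Num.max 0 x; pose m1 := Num.max 0 (x - t).
have m00 : 0 <= m0 by rewrite le_max lexx.
have m10 : 0 <= m1 by rewrite le_max lexx.
have L0 a : 0 < L a by exact: L_gt0.
have eR : [set p : Ysp d R | A p.1 /\ x <= p.2] `&` Y =
    \bigcup_(a in [set: 'I_d.+1]) rect A a (Num.min m0 (L a)) (L a).
  apply/seteqP; split=> p /=.
    move=> [[hA hx] [hX /andP[h1 h2]]]; exists (p.1 0) => //; split=> //; rewrite h2 andbT.
    by rewrite ge_min ge_max h1 hx.
  move=> [a _ [hA [hX e] /andP[h1 h2]]]; rewrite /Yset /= e h2 andbT.
  by move: h1; rewrite ge_min [L a <= _]leNgt h2 orbF ge_max => /andP[].
pose R1 := \bigcup_(a in [set: 'I_d.+1]) rect A a (Num.min m1 (L a - t)) (L a - t).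
pose R2 := \bigcup_(a in [set: 'I_d.+1]) rect (@Defs.shift d @^-1` A) a (Num.min (L a - t + m0) (L a)) (L a).
have eL : [set p : Ysp d R | A (flow p t).1 /\ x <= (flow p t).2] `&` Y = R1 `|` R2.
  have fl1 p : Y p -> p.2 + t < L (p.1 0) -> flow p t = (p.1, p.2 + t).
    move=> [_ /andP[h1 h2]] h; apply: flow_eq; exists 0; split=> /=.
    - by apply/funext => i; rewrite /shiftn addr0.
    - by rewrite big_ord0 subr0.
    - by rewrite h andbT addr_ge0.
  have fl2 p : Y p -> L (p.1 0) <= p.2 + t -> flow p t = (Defs.shift p.1, p.2 + t - L (p.1 0)).
    move=> [_ /andP[h1 h2]] h; apply: flow_eq; exists 1; split=> //=.
    - by rewrite big_ord1.
    - by have := tL (Defs.shift p.1 0); rewrite subr_ge0 h /=; lra.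
  apply/seteqP; split=> p.
    move=> [[hA hx] hy]; have [hX /andP[h1 h2]] := hy; have [h|h] := ltP (p.2 + t) (L (p.1 0)).
      left; move: hA hx; rewrite fl1 //= => hA hx; exists (p.1 0) => //; split=> //.
      by apply/andP; split; [rewrite ge_min ge_max h1 lerBlDr hx|lra].
    right; move: hA hx; rewrite fl2 //= => hA hx; exists (p.1 0) => //; split=> //.
    rewrite h2 andbT ge_min; apply/orP; left.
    by rewrite -lerBrDl ge_max; apply/andP; split; lra.
  case=> -[a _ [hA [hX e] /andP[h1 h2]]].
    have h1' : m1 <= p.2 by move: h1; rewrite ge_min [L a - t <= _]leNgt h2 orbF.
    have hy : Y p by split=> //; rewrite e; apply/andP; split; [exact: le_trans m10 h1'|lra].
    split=> //=; rewrite fl1 ?e //=; [split=> //|lra].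
    by move: h1'; rewrite ge_max => /andP[_]; lra.
  have h1' : L a - t + m0 <= p.2 by move: h1; rewrite ge_min [L a <= _]leNgt h2 orbF.
  have ta := tL a.
  have hy : Y p by split=> //; rewrite e; apply/andP; split => //; lra.
  split=> //=; rewrite fl2 ?e //=; [split=> //|lra].
  by have : x <= m0 by [rewrite le_max lexx orbT]; lra.
have d12 : R1 `&` R2 = set0.
  apply/seteqP; split=> // p [[a _ [_ [_ e] /andP[_ h2]]] [b _ [_ [_ e'] /andP[h1 _]]]].
  move: h1; rewrite -e' e ge_min => /orP[|]; have := tL a; lra.
have b1 a : [/\ 0 <= Num.min m1 (L a - t), Num.min m1 (L a - t) <= L a - t & L a - t <= L a].
  by split; [rewrite le_min m10 subr_ge0 tL|rewrite ge_min lexx orbT|lra].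
have b2 a : [/\ 0 <= Num.min (L a - t + m0) (L a), Num.min (L a - t + m0) (L a) <= L a & L a <= L a].
  have := tL a; have := L0 a.
  by split; [rewrite le_min (ltW (L0 a)) andbT; lra|rewrite ge_min lexx orbT|].
have b3 a : [/\ 0 <= Num.min m0 (L a), Num.min m0 (L a) <= L a & L a <= L a].
  by split; [rewrite le_min m00 ltW|rewrite ge_min lexx orbT|].
have mR (A' : set (Xsp d)) u v : measurable A' -> measurable (\bigcup_(a in [set: 'I_d.+1]) rect A' a (u a) (v a)).
  by move=> mA'; rewrite bigcup_finset; apply: bigsetU_measurable => a _; exact: measurable_rect.
rewrite eL eR prU //; [|exact: mR|exact: mR].
rewrite (hull_fin (A := fun _ => A)) // (hull_fin (A := fun _ => @Defs.shift d @^-1` A)) // (hull_fin (A := fun _ => A)) //.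
rewrite -mulrDl; congr (_ / _).
pose l := t - Num.min m0 t.
have e2 a : L a - Num.min (L a - t + m0) (L a) = l.
  exact: overlap_shift.
have -> : \sum_a pr mu (@Defs.shift d @^-1` A `&` letter_set a) * (L a - Num.min (L a - t + m0) (L a)) =
    \sum_a pr mu (A `&` letter_set a) * l.
  under eq_bigr => a _ do rewrite e2.
  rewrite -!mulr_suml !sum_letter_set // !pr_full //; congr (_ * _).
  by rewrite /pr; case: Hmu => _ ->.
rewrite -big_split; apply: eq_bigr => a _ /=; rewrite -mulrDr; congr (_ * _).
exact: overlap_length.
Qed.

Lemma hull_flow_invariant : flow_invariant th L hullP.
Proof.
split=> [|t B mB]; first exact: hull_Y.
rewrite flow_preE; have [c c0 hc] := Lmin_ex (Hg := Hg).
have mB' t' (B' : set (Ysp d R)) : measurable B' -> measurable [set p | B' (flow p t')].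
  by move=> mB''; have := measurable_flow (Hg := Hg) t' measurableT mB''; rewrite setTI.
have pos t' B' : 0 <= t' -> measurable B' -> hullP [set p | B' (flow p t')] = hullP B'.
  (* A positive time is divided into [k] steps, each at most [c] and hence below every roof. *)
  move=> t'0 mB''; pose k := (Num.truncn (t' / c)).+1.
  have k0 : 0 < k%:R :> R by rewrite ltr0n.
  have -> : t' = k%:R * (t' / k%:R) by rewrite mulrC divfK // gt_eqF.
  have h0 : 0 <= t' / k%:R by rewrite divr_ge0 // ltW.
  have hL a : t' / k%:R <= L a.
    apply: le_trans (hc a); rewrite ler_pdivrMr // mulrC -ler_pdivrMr //.
    exact/ltW/truncnS_gt.
  move: (t' / k%:R) h0 hL => s h0 hL; move: k {k0} => k; elim: k => [|j IH]; last first.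
    rewrite -natr1 mulrDl mul1r -[RHS]IH.
    rewrite -(hull_flow h0 hL (mB' (j%:R * s) _ mB'')); congr (hullP _).
    by apply/seteqP; split=> p /=; rewrite -flowD addrC.
  rewrite mul0r; have eq0 (A : set (Ysp d R)) : hullP A = hullP (A `&` Y).
    by rewrite /hullP /= /hull /hull_lift -setIA setIid.
  rewrite eq0 [RHS]eq0; congr (hullP _); apply/seteqP; split=> p /= [h hy]; split=> //.
    by rewrite flow0 in h.
  by rewrite flow0.
have [t0|t0] := leP 0 t; first exact: pos.
rewrite -(pos (- t) [set p | B (flow p t)]); [|lra|exact: mB'].
have eq0 (A : set (Ysp d R)) : hullP A = hullP (A `&` Y).
  by rewrite /hullP /= /hull /hull_lift -setIA setIid.
rewrite eq0 [RHS]eq0; congr (hullP _); apply/seteqP; split=> p /= [h hy]; split=> //.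
  by rewrite -flowD addNr flow0 in h.
by rewrite -flowD addNr flow0.
Qed.

End HullLift.

(** * Shuffles and type-uniformity *)

Section Shuffle.
Context {d : nat} {R : realType} {th : rsubst d} {lam : R} {L : 'I_d.+1 -> R}.
Context {Hg : good th lam L}.
Local Notation tp := (theta_pow th).
Local Notation X := (Xth th).
Local Notation Y := (Yset th L).
Local Notation flow := (flow (L := L)).
Local Notation tile := (tile (R := R) (th := th)).
Local Notation tm := (tm (th := th) (L := L)).
Local Notation tlen := (tlen (th := th) (lam := lam) (L := L)).
Local Notation len := (len (lam := lam) (L := L)).
Local Notation fault := (fault (th := th) (lam := lam) (L := L)).
Local Notation tilet := ('I_d.+1 * word d)%type.
Implicit Types (p q : Ysp d R).

Lemma rdataP n p x t v : rdata th L n p x t v <->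
  Y p /\ exists z, [/\ aligned (th := th) n z x v, 0 <= t < Lw L (v 0) & flow_rel L (z, 0) t p].
Proof.
split=> [[hy hx hv ht [z [hc hf]]]|[hy [z [[hx hv hc] ht hf]]]].
  by split=> //; exists z; split=> //; split=> //; apply/concat_atP.
by split=> //; exists z; split=> //; apply/concat_atP.
Qed.

Lemma data_tile n z x v t p : aligned (th := th) n z x v -> 0 <= t < Lw L (v 0) ->
  flow_rel L (z, 0) t p -> [/\ Y p, tile n p = (x 0, v 0) & tm n p = t].
Proof.
move=> h ht hf; have hz := aligned_X (Hg := Hg) h.
have hy : Y ((z, 0) : Ysp d R) by split=> //=; rewrite lexx L_gt0.
have el : lab (th := th) n z = (x 0, v 0, 0%N) by apply/labP => //; exact: islab_aligned.
have e1 : tile n ((z, 0) : Ysp d R) = (x 0, v 0) by rewrite /tile /= el.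
have e2 : tm n ((z, 0) : Ysp d R) = 0 by rewrite /tm /tidx /= el /= take0 Lw_nil addr0.
have [|e3 e4] := @tile_move _ _ _ _ _ Hg n (z, 0) t hy.
  by rewrite e2 add0r -tile_Lw // e1.
rewrite -(flow_eq hf) e3 e4 e1 e2 add0r; split=> //; exact: flowY.
Qed.

Lemma data_ex n p : Y p -> exists z x t v,
  [/\ aligned (th := th) n z x v, 0 <= t < Lw L (v 0) & flow_rel L (z, 0) t p].
Proof.
move=> hy; have [hx hs] := hy; have := tile_islab (Hg := Hg) n hx.
rewrite [tile n p in X in X -> _]surjective_pairing.
set a := (tile n p).1; set w := (tile n p).2; set k := tidx _ _ => hl.
have [x [v [/= h ha hw hk]]] := hl.
exists (shf (- k%:Z) p.1), x, (tm n p), v; split=> //.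
  by rewrite hw tile_Lw //; exact: (tm_bounds (Hg := Hg)).
have h0 : islab (th := th) n (shf (- k%:Z) p.1) (a, w, 0%N).
  by rewrite -ha -hw; exact: islab_aligned.
have e := islab_Rsum (L := L) h0 (ltnW hk); rewrite subr0 take0 Lw_nil subr0 in e.
exists k%:Z; split; last exact: hs.
- by rewrite shiftnE shf_shf addrN shf0.
- by rewrite [X in _ = _ - X]e /= add0r /tm -/w -/k addrK.
Qed.

(** A shuffle of level [n] changes [v] but neither [x] nor [t]. Combining the level-[n] data with a
    level-[m] tile of [x] therefore computes the supertile of a point and that of its shuffle in the
    same way. *)
Lemma data_tile_add n m z x v t p (k : nat) x2 (W : int -> word d) : aligned (th := th) n z x v -> 0 <= t < Lw L (v 0) ->
  flow_rel L (z, 0) t p -> (k < size (W 0))%N -> aligned (th := th) m (shf (- k%:Z) x) x2 W ->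
  let ts := zip (seg x (- k%:Z) (size (W 0))) (seg v (- k%:Z) (size (W 0))) in
  [/\ tile (n + m) p = (x2 0, flatten (unzip2 ts)), subs (th := th) n m (tile (n + m) p) = ts &
      tm (n + m) p = Lw L (flatten (seg v (- k%:Z) k)) + t].
Proof.
move=> h ht hf hk h2 ts; set s := size (W 0) in hk ts *.
pose T0 := Lw L (flatten (seg v (- k%:Z) k)).
have h' := aligned_shf (- k%:Z) h; set z' := shf _ z in h'.
have eV : seg (shf (- k%:Z) v) 0 s = seg v (- k%:Z) s by rewrite seg_shf add0r.
have hj := aligned_join h' h2; rewrite /= in hj.
have ez : z = shf (size (flatten (seg v (- k%:Z) k)))%:Z z'.
  by rewrite /z' shf_shf; have := pos_seg v (- k%:Z) k; rewrite addNr pos0 [in X in shf X]addrC => <-; rewrite shf0.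
have hf' : flow_rel L (z', 0) T0 (z, 0).
  have e : Rsum L z' (size (flatten (seg v (- k%:Z) k)))%:Z = T0.
    rewrite RsumE -[X in isum _ X]add0r isum_seg isum0 add0r /z' seg_shf add0r.
    by case: h => _ _ hc; rewrite (cat_at_seg _ _ hc).
  exists (size (flatten (seg v (- k%:Z) k)))%:Z; split; [exact: ez| |by rewrite /= lexx L_gt0].
  by rewrite [X in _ = _ - X]e /= add0r subrr.
have T0ge : 0 <= T0 by exact: Lw_ge0.
have [vs ess] : exists vs, seg v (- k%:Z) s = seg v (- k%:Z) k ++ v 0 :: vs.
  exists (seg v 1 (s - k.+1)); rewrite -{1}(subnKC hk) -addn1 -addnA seg_cat addNr; congr (_ ++ _).
  by rewrite seg_cat /seg /= !addr0.
have [|hy e1 e2] := data_tile hj _ (flow_add hf' hf).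
  rewrite pos0 eV ess flatten_cat Lw_cat -/T0 /= Lw_cat.
  have := Lw_ge0 (Hg := Hg) (flatten vs).
  by move: ht => /andP[a1 a2] a3; apply/andP; split; lra.
rewrite pos0 eV in e1.
have u1 : unzip1 ts = seg x (- k%:Z) s by rewrite /ts unzip1_zip ?size_seg.
have u2 : unzip2 ts = seg v (- k%:Z) s by rewrite /ts unzip2_zip ?size_seg.
have st : subtiling (th := th) n m (x2 0) (flatten (unzip2 ts)) ts.
  split=> //; rewrite u1 ?u2.
    case: h2 => _ hW /(_ 0); rewrite pos0 seg_shf add0r -/s => ->; exact: hW.
  by apply: tiling_seg => i; case: h.
by rewrite e1 u2 e2; split=> //; rewrite -u2; exact: (subsE (T := (_, _)) st).
Qed.

Definition shufT a (alpha : word d -> word d) (U : tilet) : tilet :=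
  if U.1 == a then (U.1, alpha U.2) else U.

Definition shuf_tile n m a alpha (T : tilet) : tilet :=
  (T.1, flatten (unzip2 (map (shufT a alpha) (subs (th := th) n m T)))).

Section OneShuffle.
Variables (n : nat) (a : 'I_d.+1) (alpha : word d -> word d).
Hypothesis halpha : perm_of (tp n a) alpha.

Lemma shufT_mem U : U.2 \in tp n U.1 -> (shufT a alpha U).2 \in tp n (shufT a alpha U).1.
Proof.
rewrite /shufT; case: eqP => //= e; rewrite e => h.
by case: halpha => /(_ _ h).
Qed.

Lemma shufT_fst U : (shufT a alpha U).1 = U.1.
Proof. by rewrite /shufT; case: eqP. Qed.

Lemma shuffle_seg x v i k : map (shufT a alpha) (zip (seg x i k) (seg v i k)) =
  zip (seg x i k) (seg (fun i => if x i == a then alpha (v i) else v i) i k).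
Proof.
rewrite /seg; elim: (iota 0 k) => //= j s ->; congr (_ :: _).
by rewrite /shufT /=; case: eqP.
Qed.

Lemma Lw_seg x v w i k : (forall i, v i \in tp n (x i)) -> (forall i, w i \in tp n (x i)) ->
  Lw L (flatten (seg v i k)) = Lw L (flatten (seg w i k)).
Proof.
move=> hv hw; rewrite /seg; elim: (iota 0 k) => //= j s IH.
by rewrite !Lw_cat IH (tp_Lw (hv _)) (tp_Lw (hw _)).
Qed.

Lemma shuffle_data p q : shuffle_rel th L n a alpha p q -> exists z x t v z',
  [/\ aligned (th := th) n z x v, 0 <= t < Lw L (v 0), flow_rel L (z, 0) t p,
      aligned (th := th) n z' x (fun i => if x i == a then alpha (v i) else v i) &
      flow_rel L (z', 0) t q].
Proof.
move=> [x [t [v [z' [/rdataP[hy [z [h ht hf]]] /concat_atP hc hf']]]]].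
exists z, x, t, v, z'; split=> //; case: h => hx hv _; split=> // i.
by have := @shufT_mem (x i, v i) (hv i); rewrite /shufT /=; case: eqP.
Qed.

Lemma shuffle_tile p q m : shuffle_rel th L n a alpha p q ->
  [/\ Y q, tile (n + m) q = shuf_tile n m a alpha (tile (n + m) p) & tm (n + m) q = tm (n + m) p].
Proof.
move=> /shuffle_data[z [x [t [v [z' [h ht hf h' hf']]]]]].
set w := fun i => _ in h'; have [hx hv _] := h; have [_ hw _] := h'.
have ht' : 0 <= t < Lw L (w 0) by rewrite (tp_Lw (hw 0)) -(tp_Lw (hv 0)).
have [k [x2 [W [hk h2]]]] := aligned_ex (Hg := Hg) m hx.
have [e1 e2 e3] := data_tile_add h ht hf hk h2; have [e1' e2' e3'] := data_tile_add h' ht' hf' hk h2.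
have [hyq _ _] := data_tile h' ht' hf'; split=> //; last by rewrite e3 e3' (Lw_seg _ _ hv hw).
by rewrite /shuf_tile e2 e1 e1' /= shuffle_seg.
Qed.

Lemma shuffle_ex p : Y p -> exists q, shuffle_rel th L n a alpha p q.
Proof.
move=> hy; have [z [x [t [v [h ht hf]]]]] := data_ex n hy.
pose w i := if x i == a then alpha (v i) else v i; have [hx hv hc] := h.
have hw i : w i \in tp n (x i) by have := @shufT_mem (x i, v i) (hv i); rewrite /shufT /w /=; case: eqP.
have hs i : (0 < size (w i))%N by exact: (tp_size (hw i)).
have [z' hz'] := cat_at_exists hs; have [q hq] := flow_ex (Hg := Hg) (z', 0) t.
exists q, x, t, v, z'; split=> //; last exact/concat_atP.
by apply/rdataP; split=> //; exists z.
Qed.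

Lemma shuf_tile_subs m T : T.2 \in tp (n + m) T.1 ->
  subtiling (th := th) n m T.1 (shuf_tile n m a alpha T).2 (map (shufT a alpha) (subs (th := th) n m T)).
Proof.
move=> /subsP[h1 h2 h3]; have e : unzip1 (map (shufT a alpha) (subs (th := th) n m T)) = unzip1 (subs (th := th) n m T).
  by rewrite /unzip1 -map_comp; apply: eq_map => U /=; exact: shufT_fst.
split=> //; first by rewrite e.
apply: tiling_all => U /mapP[U' hU' ->]; apply: shufT_mem.
exact: tiling_all_inv h2 _ hU'.
Qed.

Lemma shuf_tile_mem m T : T \in tiles (th := th) (n + m) -> shuf_tile n m a alpha T \in tiles (th := th) (n + m).
Proof. by rewrite !mem_tiles => /shuf_tile_subs /subtiling_mem. Qed.

Variable beta : word d -> word d.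
Hypothesis ab : {in tp n a, cancel alpha beta}.

Lemma shuf_tileK m T : T \in tiles (th := th) (n + m) ->
  shuf_tile n m a beta (shuf_tile n m a alpha T) = T.
Proof.
rewrite mem_tiles => hT; have h := shuf_tile_subs hT; have hs := subsP hT.
rewrite /shuf_tile [X in _ = X]surjective_pairing; congr (_, _).
have -> : subs (th := th) n m (shuf_tile n m a alpha T) = map (shufT a alpha) (subs (th := th) n m T).
  exact: (subsE (T := shuf_tile n m a alpha T)).
have -> : map (shufT a beta) (map (shufT a alpha) (subs (th := th) n m T)) = subs (th := th) n m T.
  rewrite -map_comp -[RHS]map_id; apply/eq_in_map => U hU /=.
  have hU2 := subtiling_all hs hU; rewrite {2}/shufT; case: eqP => [e|/eqP/negbTE ne]; last by rewrite /shufT ne.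
  by rewrite /shufT /= e eqxx ab -e //; case: (U).
by case: hs.
Qed.

End OneShuffle.

Lemma perm_of_inv n a alpha : perm_of (tp n a) alpha -> exists beta,
  [/\ perm_of (tp n a) beta, {in tp n a, cancel alpha beta} & {in tp n a, cancel beta alpha}].
Proof.
move=> [h1 h2]; have hs : {subset tp n a <= map alpha (tp n a)}.
  have u : uniq (map alpha (tp n a)) by rewrite map_inj_in_uniq ?theta_pow_uniq.
  have sub : {subset map alpha (tp n a) <= tp n a} by move=> _ /mapP[v hv ->]; exact: h1.
  by have [|_ e v] := uniq_min_size u sub; rewrite ?size_map ?e.
have /choice[beta hb] : forall v, exists u, v \in tp n a -> u \in tp n a /\ alpha u = v.
  move=> v; have [/hs/mapP[u hu ->]|hv] := boolP (v \in tp n a); first by exists u.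
  by exists v.
exists beta; split.
- split=> [v /hb[] //|u v hu hv e].
  by have [_ <-] := hb u hu; have [_ <-] := hb v hv; rewrite e.
- move=> v hv; have [b1 b2] := hb _ (h1 _ hv); exact: h2.
- by move=> v /hb[].
Qed.

End Shuffle.

(** The product measure is the integral of the measures of sections, a supremum over simple
    functions from below, hence monotone on arbitrary sets. This is needed for images under
    shuffles. *)
Lemma product_measure_mono d1 d2 (T1 : measurableType d1) (T2 : measurableType d2) (R : realType)
    (m1 : {measure set T1 -> \bar R}) (m2 : {sigma_finite_measure set T2 -> \bar R}) (A B : set (T1 * T2)) :
  (forall X Z : set T2, X `<=` Z -> m2 X <= m2 Z)%E ->
  A `<=` B -> ((m1 \x m2) A <= (m1 \x m2) B)%E.
Proof.
move=> hm AB; rewrite /product_measure1.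
rewrite !ge0_integralTE //; apply: le_ereal_sup => _ [h hA <-]; exists h => // x.
apply: le_trans (hA x) _; apply: hm => y; rewrite /xsection /= !inE; exact: AB.
Qed.

Lemma lebesgue_mono (R : realType) (A B : set (measurableTypeR R)) : A `<=` B ->
  (lebesgue_measure A <= lebesgue_measure B)%E.
Proof.
by move=> AB; rewrite /lebesgue_measure /lebesgue_stieltjes_measure /measure_extension; apply: le_outer_measure.
Qed.

Lemma pr_eq_full dd (T : measurableType dd) (R : realType) (P : probability T R) (G A B : set T) :
  measurable G -> measurable A -> measurable B -> pr P G = 1 -> A `&` G = B `&` G -> pr P A = pr P B.
Proof.
move=> mG mA mB h e; have hG : pr P (~` G) = 0 by rewrite prC // h subrr.
have full C : measurable C -> pr P C = pr P (C `&` G).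
  move=> mC; rewrite (prDI P mC mG) [X in X + _](_ : _ = 0) ?add0r //.
  apply/le_anti; rewrite pr_ge0 andbT -hG; apply: pr_le; [exact: measurableD|exact: measurableC|by move=> p []].
by rewrite full // e -full.
Qed.

Section UniformityTypeUniform.
Context {d : nat} {R : realType} {th : rsubst d} {lam : R} {L : 'I_d.+1 -> R}.
Context {Hg : good th lam L}.
Local Notation tp := (theta_pow th).
Local Notation Y := (Yset th L).
Local Notation tile := (tile (R := R) (th := th)).
Local Notation tm := (tm (th := th) (L := L)).
Local Notation tlen := (tlen (th := th) (lam := lam) (L := L)).
Local Notation len := (len (lam := lam) (L := L)).
Local Notation fault := (fault (th := th) (lam := lam) (L := L)).
Local Notation tilet := ('I_d.+1 * word d)%type.
Implicit Types (p q : Ysp d R).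
Variable mu : probability (Xsp d) R.
Hypothesis Hmu : in_M th mu.
Local Notation P := (hullP (Hg := Hg) Hmu).

Lemma lift_mono (A B : set (Ysp d R)) : A `<=` B -> (hull_lift th L mu A <= hull_lift th L mu B)%E.
Proof.
move=> AB; apply: lee_wpmul2r; first by rewrite lee_fin; exact: (massV_ge0 (Hg := Hg) Hmu).
apply: product_measure_mono; first exact: lebesgue_mono.
by move=> p [/AB].
Qed.

(** The shuffle that exchanges [v] and [v'] sends a slice of the tile [v] into the same slice of
    [v']; an inclusion suffices, so measurability of the image does not enter. *)
Lemma uniformity_type_uniform : uniformity th L mu -> type_uniform (th := th) (L := L) P.
Proof.
move=> [_ hu] n a; suff h v v' : v \in tp n a -> v' \in tp n a ->
    wt (th := th) (L := L) P n (a, v) <= wt (th := th) (L := L) P n (a, v').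
  by move=> v v' hv hv'; apply/le_anti; rewrite !h.
move=> hv hv'; have [c c0 hc] := Lmin_ex (Hg := Hg).
pose alpha (w : word d) := if w == v then v' else if w == v' then v else w.
have ha : perm_of (tp n a) alpha.
  split=> [w hw|u w _ _]; first by rewrite /alpha; case: eqP => // _; case: eqP.
  rewrite /alpha; do ![case: eqP => //] => *; by subst.
have Pinv : flow_invariant th L P by exact: hull_flow_invariant.
have cl : c <= len n a.
  apply: le_trans (hc a) _; rewrite /len ler_peMl ?(L_ge0 a) //.
  by apply: exprn_ege1; exact/ltW/lam_gt1.
pose I w := icell (th := th) (L := L) n (a, w) 0 c.
have mI w : measurable (I w) by exact: measurable_icell.
have := hu n a alpha ha _ (mI v) => e.
have : (hull_lift th L mu (I v) <= hull_lift th L mu (I v'))%E.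
  rewrite -e; apply: lift_mono => q [p [[hy hT] ht] hs].
  have [z [x [t [u [z' [h1 h2 h3 h4 h5]]]]]] := shuffle_data ha hs.
  have [hyp eT et] := data_tile (Hg := Hg) h1 h2 h3.
  move: hT; rewrite /= eT => -[ex eu].
  have e4 : alpha (u 0) = v' by rewrite eu /alpha eqxx.
  have [|hyq eT' et'] := data_tile (Hg := Hg) h4 _ h5.
    by rewrite /= ex eqxx e4 (tp_Lw hv') -(tp_Lw hv) -eu.
  split; first by split=> //=; rewrite eT' /= ex eqxx e4.
  by move: ht; rewrite /= et et'.
rewrite -/(hull mu) -/(P _) !(prE P (mI _)) lee_fin.
have icl w : pr P (I w) = c / len n a * wt (th := th) (L := L) P n (a, w).
  by have := icell_law (Hg := Hg) Pinv (n := n) (T := (a, w)) (lexx 0) (ltW c0) cl; rewrite subr0.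
by rewrite !icl ler_pM2l // divr_gt0 // len_gt0.
Qed.

End UniformityTypeUniform.

Section TypeUniformUniformity.
Context {d : nat} {R : realType} {th : rsubst d} {lam : R} {L : 'I_d.+1 -> R}.
Context {Hg : good th lam L}.
Local Notation tp := (theta_pow th).
Local Notation Y := (Yset th L).
Local Notation tile := (tile (R := R) (th := th)).
Local Notation tm := (tm (th := th) (L := L)).
Local Notation tlen := (tlen (th := th) (lam := lam) (L := L)).
Local Notation len := (len (lam := lam) (L := L)).
Local Notation fault := (fault (th := th) (lam := lam) (L := L)).
Local Notation tilet := ('I_d.+1 * word d)%type.
Local Notation shuf_tile := (shuf_tile (th := th)).
Implicit Types (p q : Ysp d R).

Variables (n : nat) (a : 'I_d.+1).

(* The points of [Y] whose supertiles do not cover the whole line. *)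
Definition nonfull : set (Ysp d R) := \bigcup_(r in [set: nat]) \bigcap_(m in [set: nat]) fault (n + m) r%:R.

Lemma measurable_nonfull : measurable nonfull.
Proof.
apply: bigcupT_measurable => r; apply: bigcap_measurableType => m _; exact: measurable_fault.
Qed.

Definition generic : set (Ysp d R) := Y `\` nonfull.

Lemma measurable_generic : measurable generic.
Proof. by apply: measurableD; [exact: measurable_Yset|exact: measurable_nonfull]. Qed.

Lemma fault_mono N r r' : r <= r' -> fault N r `<=` fault N r'.
Proof. by move=> h p [h1|h1]; [left|right]; lra. Qed.

Lemma generic_level p r : generic p -> exists m, ~ fault (n + m) r p.
Proof.
move=> [_ hp]; apply: contrapT => /forallNP hno; apply: hp.
exists (Num.truncn `|r|).+1 => // m _; apply: contrapT => hf; apply: (hno m) => h; apply: hf.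
apply: fault_mono h; apply: le_trans (ler_norm r) _; exact/ltW/truncnS_gt.
Qed.

(** For every position, some supertile of a generic point covers it, and the height in the tile
    shows the second coordinate. *)
Lemma generic_eq p q : generic p -> Y q -> (forall m, tile (n + m) q = tile (n + m) p /\ tm (n + m) q = tm (n + m) p) -> q = p.
Proof.
move=> gp hq h; have [hp _] := gp; rewrite (surjective_pairing p) (surjective_pairing q); congr (_, _).
  apply/funext => i; have [m hm] := generic_level (Lsum (L := L) * (`|i|%N.+1)%:R) gp.
  have [e1 e2] := h m; have hm' : ~ fault (n + m) (Lsum (L := L) * (`|i|%N.+1)%:R) q.
    by move: hm; rewrite /fault /= /tlen e1 e2.
  by apply/(@letterF_ok _ _ _ _ _ Hg (n + m) i _ q hq hm'); rewrite e1 e2; apply/(@letterF_ok _ _ _ _ _ Hg (n + m) i _ p hp hm).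
have [e1 e2] := h 0%N; apply/le_anti/andP; split.
  by apply/(heightF_ok (Hg := Hg) (n + 0) _ hp); rewrite -e1 -e2; apply/(heightF_ok (Hg := Hg) (n + 0) _ hq).
by apply/(heightF_ok (Hg := Hg) (n + 0) _ hq); rewrite e1 e2; apply/(heightF_ok (Hg := Hg) (n + 0) _ hp).
Qed.

Lemma generic_tiles p q : generic p -> Y q ->
  (forall m, (tile (n + m) q).1 = (tile (n + m) p).1 /\ tm (n + m) q = tm (n + m) p) -> generic q.
Proof.
move=> [_ hp] hq h; split=> // -[r _ hr]; apply: hp; exists r => // m _.
have := hr m I; have [e1 e2] := h m; rewrite /fault /= /tlen e1 e2; exact.
Qed.

Section OneShuffle.
Variable alpha : word d -> word d.
Hypothesis ha : perm_of (tp n a) alpha.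

(** The shuffle relation turned into a total function: on generic points the image is unique by
    [shuffle_tile] and [generic_eq], and the remaining points are fixed, which keeps the function
    measurable. *)
Definition shuffle_fun p : Ysp d R := if `[< generic p >] then xget p [set q | shuffle_rel th L n a alpha p q] else p.

Lemma shuffle_funP p : generic p -> shuffle_rel th L n a alpha p (shuffle_fun p).
Proof.
move=> hp; rewrite /shuffle_fun (asboolT hp); case: xgetP => [q -> //|].
by have [q hq] := shuffle_ex (Hg := Hg) ha (proj1 hp); move/(_ q).
Qed.

Lemma shuffle_fun_tile p m : generic p ->
  [/\ Y (shuffle_fun p), tile (n + m) (shuffle_fun p) = shuf_tile n m a alpha (tile (n + m) p) &
      tm (n + m) (shuffle_fun p) = tm (n + m) p].
Proof. by move=> hp; apply: (shuffle_tile (Hg := Hg) ha); exact: shuffle_funP. Qed.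

Lemma shuffle_generic p q : generic p -> shuffle_rel th L n a alpha p q -> generic q.
Proof.
move=> hp hs; have [hq _ _] := shuffle_tile (Hg := Hg) ha 0 hs.
by apply: (generic_tiles hp) => // m; have [_ -> ->] := shuffle_tile (Hg := Hg) ha m hs.
Qed.

Lemma shuffle_fun_generic p : generic p -> generic (shuffle_fun p).
Proof. by move=> hp; apply: (shuffle_generic hp); exact: shuffle_funP. Qed.

Lemma shuffle_fault p N r : (n <= N)%N -> generic p -> fault N r (shuffle_fun p) <-> fault N r p.
Proof.
move=> /subnKC <- hp; have [_ e1 e2] := shuffle_fun_tile (N - n) hp.
by rewrite /fault /= /tlen e1 e2.
Qed.

Lemma measurable_split (f : Ysp d R -> Ysp d R) (B B' : set (Ysp d R)) : (forall p, ~ generic p -> f p = p) ->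
  measurable B -> measurable (generic `&` [set p | B (f p)]) -> measurable [set p | B (f p)].
Proof.
move=> hf mB mg; have -> : [set p | B (f p)] = (generic `&` [set p | B (f p)]) `|` (B `\` generic).
  apply/seteqP; split=> p /=.
    by move=> h; have [g|g] := pselect (generic p); [left|right; rewrite hf in h].
  by case=> [[]//|[h1 h2]]; rewrite hf.
by apply: measurableU => //; apply: measurableD => //; exact: measurable_generic.
Qed.

Lemma simple_shuf m E (F : tilet -> R -> bool) : simple E F -> simple E (fun T t => F (shuf_tile n m a alpha T) t).
Proof. by move=> h T t t'; exact: h. Qed.

(** A coordinate of the image of a generic point is read off from its shuffled supertile at any
    level where the point is not a fault. *)
Lemma measurable_shuffle : measurable_fun setT shuffle_fun.
Proof.
move=> _ B mB; rewrite setTI; move: B mB.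
have out p : ~ generic p -> shuffle_fun p = p by move=> h; rewrite /shuffle_fun asboolF.
apply: Ysp_sigma_ind => [B mB|F mF|i b|x].
- by rewrite preimage_setC; exact: measurableC.
- by rewrite preimage_bigcup; exact: bigcupT_measurable.
- have mb := measurable_fst_pre (R := R) (@measurable_config_at d i b).
  apply: (measurable_split set0 out mb).
  have -> : generic `&` [set p | (shuffle_fun p).1 i = b] = generic `&` \bigcup_(m in [set: nat])
    (cellset (th := th) (L := L) (n + m) (fun T t => letterF (th := th) (L := L) (n + m) i b (shuf_tile n m a alpha T) t) `\`
      fault (n + m) (Lsum (L := L) * (`|i|%N.+1)%:R)).
    apply/seteqP; split=> p [hp].
      move=> /= e; split=> //; have [m hm] := generic_level (Lsum (L := L) * (`|i|%N.+1)%:R) hp.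
      exists m => //; split=> //; have [hy e1 e2] := shuffle_fun_tile m hp.
      have hm' : ~ fault (n + m) (Lsum (L := L) * (`|i|%N.+1)%:R) (shuffle_fun p) by move/(shuffle_fault _ (leq_addr _ _) hp).
      by rewrite /cellset /= -e1 -e2; apply/(@letterF_ok _ _ _ _ _ Hg (n + m) i b _ hy hm').
    move=> [m _ [h hm]]; split=> //; have [hy e1 e2] := shuffle_fun_tile m hp.
    have hm' : ~ fault (n + m) (Lsum (L := L) * (`|i|%N.+1)%:R) (shuffle_fun p) by move/(shuffle_fault _ (leq_addr _ _) hp).
    by apply/(@letterF_ok _ _ _ _ _ Hg (n + m) i b _ hy hm'); rewrite e1 e2.
  apply: measurableI; first exact: measurable_generic.
  apply: bigcupT_measurable => m; apply: measurableD; last exact: measurable_fault.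
  apply: (@measurable_cellset _ _ _ _ _ Hg (n + m) _ _ (@simple_shuf m _ _ _)); exact: letterF_simple.
- have mx : measurable [set p : Ysp d R | x <= p.2].
    have := measurable_snd_itv (d := d) (R := R) `[x, +oo[.
    by congr measurable; apply/seteqP; split=> p /=; rewrite in_itv /= andbT.
  apply: (measurable_split set0 out mx).
  have -> : generic `&` [set p | x <= (shuffle_fun p).2] = generic `&`
     cellset (th := th) (L := L) (n + 0) (fun T t => heightF (th := th) (L := L) (n + 0) x (shuf_tile n 0 a alpha T) t).
    apply/seteqP; split=> p [hp] /= h; split=> //; have [hy e1 e2] := shuffle_fun_tile 0 hp.
      by rewrite /cellset /= -e1 -e2; apply/(heightF_ok (Hg := Hg) _ _ hy).
    by apply/(heightF_ok (Hg := Hg) (n + 0) _ hy); rewrite e1 e2.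
  apply: measurableI; first exact: measurable_generic.
  apply: (@measurable_cellset _ _ _ _ _ Hg (n + 0) _ _ (@simple_shuf 0%N _ _ _)); exact: heightF_simple.
Qed.

End OneShuffle.
End TypeUniformUniformity.

Section TypeUniformUniformity.
Context {d : nat} {R : realType} {th : rsubst d} {lam : R} {L : 'I_d.+1 -> R}.
Context {Hg : good th lam L}.
Local Notation tp := (theta_pow th).
Local Notation Y := (Yset th L).
Local Notation tile := (tile (R := R) (th := th)).
Local Notation tm := (tm (th := th) (L := L)).
Local Notation fault := (fault (th := th) (lam := lam) (L := L)).
Local Notation nonfull := (nonfull (th := th) (lam := lam) (L := L)).
Local Notation generic := (generic (th := th) (lam := lam) (L := L)).
Local Notation shuffle_fun := (shuffle_fun (th := th) (lam := lam) (L := L)).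
Local Notation tilet := ('I_d.+1 * word d)%type.
Local Notation shuf_tile := (shuf_tile (th := th)).
Implicit Types (p q : Ysp d R).

Section PushForward.
Variable P : probability (Ysp d R) R.
Hypothesis HP : flow_invariant th L P.

Lemma nonfull_null n : P (nonfull n) = 0%E.
Proof.
have mn : measurable (nonfull n) by exact: measurable_nonfull.
apply: measure_negligible => //; apply: negligible_bigcup => r.
have mr : measurable (\bigcap_(m in [set: nat]) fault (n + m) r%:R).
  by apply: bigcap_measurableType => m _; exact: measurable_fault.
suff e0 : P (\bigcap_(m in [set: nat]) fault (n + m) r%:R) = 0%E.
  by exists (\bigcap_(m in [set: nat]) fault (n + m) r%:R); split.
rewrite (prE P mr); congr (_%:E); apply/le_anti; rewrite pr_ge0 andbT; apply/ler_addgt0Pr => e e0; rewrite add0r.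
have [N hN] := fault_small (Hg := Hg) HP r%:R e0.
apply: le_trans (hN (n + N)%N (leq_addl _ _)); apply: pr_le => //; first exact: measurable_fault.
by move=> p; apply.
Qed.

Lemma generic_full n : pr P (generic n) = 1.
Proof.
have mY : measurable Y by exact: measurable_Yset.
have mn : measurable (nonfull n) by exact: measurable_nonfull.
have := prDI P mY mn; rewrite (flow_invariant_full HP) [X in _ + X](_ : _ = 0) ?addr0 //.
apply/le_anti; rewrite pr_ge0 andbT; apply: (@le_trans _ _ (pr P (nonfull n))).
  by apply: pr_le; [exact: measurableI|exact: mn|move=> p []].
by rewrite /pr nonfull_null.
Qed.

Variables (n : nat) (a : 'I_d.+1) (alpha : word d -> word d).
Hypothesis ha : perm_of (tp n a) alpha.
Hypothesis TU : type_uniform (th := th) (L := L) P.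

Lemma shuf_tiles_perm m : perm_eq (map (shuf_tile n m a alpha) (tiles (th := th) (n + m))) (tiles (th := th) (n + m)).
Proof.
have [beta [hb ab _]] := perm_of_inv ha.
have u : uniq (map (shuf_tile n m a alpha) (tiles (th := th) (n + m))).
  rewrite map_inj_in_uniq ?tiles_uniq // => T T' hT hT' e.
  by rewrite -(shuf_tileK (Hg := Hg) ha ab hT) e (shuf_tileK (Hg := Hg) ha ab hT').
apply: uniq_perm => //; first exact: tiles_uniq.
have sub : {subset map (shuf_tile n m a alpha) (tiles (th := th) (n + m)) <= tiles (th := th) (n + m)}.
  by move=> _ /mapP[T hT ->]; exact: shuf_tile_mem.
by have [|] := uniq_min_size u sub; rewrite ?size_map.
Qed.

Lemma shuffle_invariant B : measurable B -> pr P [set p | B (shuffle_fun n a alpha p)] = pr P B.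
Proof.
pose f := shuffle_fun n a alpha; have mf : measurable_fun setT f by exact: measurable_shuffle.
pose P' : probability (Ysp d R) R := distribution P (mfun_Sub (mem_set mf)).
have mG : measurable (generic n) by exact: measurable_generic.
have mY : measurable Y by exact: measurable_Yset.
have P'E C : pr P' C = pr P [set p | C (f p)] by [].
have mpre C : measurable C -> measurable [set p | C (f p)].
  by move=> mC; have := mf measurableT C mC; rewrite setTI.
have eqG C C' : measurable C -> measurable C' -> [set p | C (f p)] `&` generic n = C' `&` generic n -> pr P' C = pr P C'.
  move=> mC mC' e; rewrite P'E; apply: (pr_eq_full mG (mpre _ mC) mC' (generic_full n) e).
have Y1 : pr P' Y = 1.
  rewrite (eqG Y Y) ?(flow_invariant_full HP) //; apply/seteqP; split=> p [_ g]; split=> //; first by case: g.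
  by have [] := shuffle_fun_tile (Hg := Hg) ha 0 g.
have small r e : 0 < e -> exists N, forall k, (N <= k)%N -> pr P' (fault k r) <= e.
  move=> e0; have [N hN] := fault_small (Hg := Hg) HP r e0.
  exists (maxn N n) => k; rewrite geq_max => /andP[k1 k2].
  rewrite (eqG (fault k r) (fault k r)); [exact: hN|exact: measurable_fault|exact: measurable_fault|].
  by apply/seteqP; split=> p [h g]; split=> //; apply/(shuffle_fault (Hg := Hg) ha r k2 g).
move=> mB; rewrite -P'E.
apply: (cells_determine (Hg := Hg) Y1 (flow_invariant_full HP) small (fault_small (Hg := Hg) HP) (n0 := n)) => // k E F nk hF.
rewrite -(subnKC nk); move: (k - n)%N => {nk}m.
have hF' : simple E (fun T t => F (shuf_tile n m a alpha T) t) by move=> T t t'; exact: hF.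
have mF := measurable_cellset (Hg := Hg) (n + m) hF; have mF' := measurable_cellset (Hg := Hg) (n + m) hF'.
rewrite (eqG _ _ mF mF'); last first.
  apply/seteqP; split=> p [h g]; split=> //; move: h; rewrite /cellset /=;
    by have [_ -> ->] := shuffle_fun_tile (Hg := Hg) ha m g.
rewrite (cellset_fibers (Hg := Hg) _ HP hF') (cellset_fibers (Hg := Hg) _ HP hF).
rewrite -[RHS](perm_big _ (shuf_tiles_perm m)) /= big_map; apply: eq_big_seq => T hT.
rewrite /pr; congr fine; apply: cell_eq => //; last exact: (simple_measurable _ true hF).
have hT' := shuf_tile_mem ha hT; rewrite !mem_tiles in hT hT'.
by rewrite [T]surjective_pairing [shuf_tile _ _ _ _ _ in RHS]surjective_pairing; apply: TU; rewrite // -?surjective_pairing.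
Qed.

End PushForward.

Variable mu : probability (Xsp d) R.
Hypothesis Hmu : in_M th mu.
Local Notation P := (hullP (Hg := Hg) Hmu).

(** The image [S] of [B] lies between the measurable set [S1], the generic part of the preimage of
    [B] under the inverse shuffle, and the union of [S1] with the null set [nonfull n]. *)
Lemma type_uniform_uniformity : type_uniform (th := th) (L := L) P -> uniformity th L mu.
Proof.
move=> TU; split=> // n a alpha ha B mB; have HP := hull_flow_invariant (Hg := Hg) Hmu.
have [beta [hb ab ba]] := perm_of_inv ha.
set S := [set q | _]; pose S1 := generic n `&` [set q | B (shuffle_fun n a beta q)].
have mG : measurable (generic n) by exact: measurable_generic.
have mN : measurable (nonfull n) by exact: measurable_nonfull.
have mpre : measurable [set q | B (shuffle_fun n a beta q)].
  by have := measurable_shuffle (Hg := Hg) hb measurableT mB; rewrite setTI.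
have mS1 : measurable S1 by exact: measurableI.
have pS1 : pr P S1 = pr P B.
  rewrite -(shuffle_invariant HP hb TU mB).
  apply: (pr_eq_full mG mS1 mpre (generic_full HP n)).
  by rewrite /S1 [generic n `&` _]setIC -setIA setIid.
have S1S : S1 `<=` S.
  move=> q [g h]; exists (shuffle_fun n a beta q) => //; have gp := shuffle_fun_generic (Hg := Hg) hb g.
  have [q' hq'] := shuffle_ex (Hg := Hg) ha (proj1 gp); suff e : q' = q by rewrite e in hq'.
  have [hy' _ _] := shuffle_tile (Hg := Hg) ha 0 hq'; apply: (generic_eq (Hg := Hg) g hy') => m.
  have [_ -> ->] := shuffle_tile (Hg := Hg) ha m hq'; have [_ -> ->] := shuffle_fun_tile (Hg := Hg) hb m g.
  by rewrite (shuf_tileK (Hg := Hg) hb ba) //; apply: tile_tiles; case: g => [[]].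
have SS1 : S `<=` S1 `|` nonfull n.
  move=> q [p hB hs]; have [hyq _ _] := shuffle_tile (Hg := Hg) ha 0 hs.
  have [hn|hn] := pselect (nonfull n q); [by right|left].
  have gq : generic n q by [].
  have hyp : Y p by case: hs => [x [t [v [z' [[]]]]]].
  have gp : generic n p.
    by apply: (generic_tiles gq hyp) => m; have [_ -> ->] := shuffle_tile (Hg := Hg) ha m hs.
  split=> //=; suff -> : shuffle_fun n a beta q = p by [].
  have [hy' _ _] := shuffle_fun_tile (Hg := Hg) hb 0 gq; apply: (generic_eq (Hg := Hg) gp hy') => m.
  have [_ -> ->] := shuffle_fun_tile (Hg := Hg) hb m gq; have [_ -> ->] := shuffle_tile (Hg := Hg) ha m hs.
  by rewrite (shuf_tileK (Hg := Hg) ha ab) //; apply: tile_tiles; case: gp => [[]].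
have eB : hull_lift th L mu B = hull_lift th L mu S1.
  by rewrite -/(hull mu B) -/(hull mu S1) -/(P B) -/(P S1) !prE // pS1.
rewrite eB; apply/le_anti/andP; split; last exact: (lift_mono (Hg := Hg) Hmu).
apply: (le_trans (lift_mono (Hg := Hg) Hmu SS1)).
rewrite -/(hull mu _) -/(hull mu S1) -/(P _) -/(P S1) !prE //; last exact: measurableU.
rewrite lee_fin; apply: le_trans (prU_le P mS1 mN) _.
by rewrite [pr P (nonfull n)]/pr (nonfull_null HP n) addr0.
Qed.

End TypeUniformUniformity.

(** * Consistent type frequencies *)

Lemma ultra_limit (R : realType) (U : set_system nat) (u : nat -> R) : UltraFilter U ->
  (forall k, 0 <= u k <= 1) -> exists l, forall e, 0 < e -> U [set k | `|u k - l| <= e].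
Proof.
move=> UU hu; pose E := [set x | U [set k | x <= u k]].
have E0 : E 0 by apply: filterS filterT => k _; case/andP: (hu k).
have hE : has_sup E.
  split; first by exists 0.
  exists 1 => x hx; have [k hk] := filter_ex hx; apply: le_trans hk _.
  by case/andP: (hu k).
exists (sup E) => e e0; have [x hx h1] := sup_adherent e0 hE.
have h2 : U [set k | ~ (sup E + e <= u k)].
  have [h|//] := in_ultra_setVsetC [set k | sup E + e <= u k] UU.
  by have := sup_upper_bound hE h; rewrite gerDl leNgt e0.
apply: filterS (filterI hx h2) => k [/= a1 /negP]; rewrite -ltNge => a2.
by rewrite ler_distlC; apply/andP; split; lra.
Qed.

Section InverseTime.
Context {d : nat} {R : realType}.
Variable P : nat -> 'M[R]_d.+1.
Hypothesis P0 : forall n i j, 0 <= P n i j.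
Hypothesis P1 : forall n j, \sum_i P n i j = 1.

(* The relation between the level-[n] and level-[n + 1] type frequencies of a type-uniform measure when [P n = Q_n]. *)
Definition consistent (q : nat -> 'I_d.+1 -> R) :=
  [/\ forall n i, 0 <= q n i, forall n, \sum_i q n i = 1 &
      forall n i, q n i = \sum_j P n i j * q n.+1 j].

Local Notation M := (mx_prod_from P).

Lemma prod_ge0 n k i j : 0 <= M n k i j.
Proof.
by elim: k i j => [|k IH] i j //=; rewrite mxE; apply: sumr_ge0 => l _; rewrite mulr_ge0.
Qed.

Lemma prod_sum n k j : \sum_i M n k i j = 1.
Proof.
elim: k j => [|k IH] j //=; under eq_bigr => i _ do rewrite mxE.
rewrite exchange_big /=; under eq_bigr => l _ do rewrite -mulr_suml IH mul1r.
exact: P1.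
Qed.

Lemma prod_left n k : M n k.+1 = P n *m M n.+1 k.
Proof.
elim: k => [|k IH]; first by rewrite /= addn1.
rewrite -[LHS]/(M n k.+1 *m P (n + k.+2)%N) IH -mulmxA.
by have -> : (n + k.+2 = n.+1 + k.+1)%N by lia.
Qed.

Lemma consistent_prod q n k i : consistent q -> q n i = \sum_j M n k i j * q (n + k).+1 j.
Proof.
move=> [_ _ h]; elim: k => [|k IH]; first by rewrite addn0 h.
rewrite IH; under eq_bigr => j _ do rewrite h mulr_sumr.
rewrite exchange_big /=; apply: eq_bigr => j _; rewrite mxE mulr_suml addnS.
by apply: eq_bigr => l _; rewrite mulrA.
Qed.

(** [q n] is an average of the columns of the products that start at [n], with weights
    [q (n + k).+1]; the columns all tend to [pi]. *)
Lemma ergodic_consistent q q' n i : ergodic_inverse_time P -> consistent q -> consistent q' -> q n i = q' n i.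
Proof.
move=> /(_ n)[pi [_ _ hpi]]; suff h q0 : consistent q0 -> q0 n i = pi i by move=> /h -> /h ->.
move=> hq; have [q0_ge q0_sum _] := hq; apply/eqP; rewrite -subr_eq0 -normr_le0; apply/ler_addgt0Pr => e e0; rewrite add0r.
have hnear : \forall k \near \oo, forall j : 'I_d.+1, `|pi i - M n k i j| <= e.
  by apply: filter_forall => j; have /cvgrPdist_le/(_ e e0) := hpi i j.
have [k hk] := filter_ex hnear; rewrite (consistent_prod n k i hq).
have -> : \sum_j M n k i j * q0 (n + k).+1 j - pi i = \sum_j (M n k i j - pi i) * q0 (n + k).+1 j.
  by under [RHS]eq_bigr => j _ do rewrite mulrBl; rewrite sumrB -mulr_sumr q0_sum mulr1.
apply: le_trans (ler_norm_sum _ _ _) _; rewrite -[X in _ <= X]mulr1 -(q0_sum (n + k).+1) mulr_sumr.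
apply: ler_sum => j _; rewrite normrM [X in _ * X]ger0_norm //.
by apply: ler_wpM2r => //; rewrite distrC.
Qed.

(** The [j]-th columns of products with a common last index satisfy the recursion of [consistent].
    Limits along an ultrafilter of last indices in [n + S] exist at all levels simultaneously and
    inherit the recursion. *)
Lemma consistent_limit (S : set nat) n j : (forall N, exists2 k, (N <= k)%N & S k) ->
  exists q, consistent q /\ forall i e, 0 < e -> exists2 k, S k & `|M n k i j - q n i| <= e.
Proof.
move=> hS; have SF : ProperFilter (within S \oo).
  apply: Build_ProperFilter_ex => [B [N _ hB]].
  by have [k hk hSk] := hS N; exists k; exact: hB.
have [U [UU sU]] := @ultraFilterLemma nat (within S \oo) SF.
have hU N : U [set k | (N <= k)%N] by apply: sU; exists N.
have hUS : U S by apply: sU; exists 0%N => // k _.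
(* The product runs from index [m] to index [n + k] for every [m <= n + k]; for larger [m] the
   truncated subtraction gives a junk value that the limit ignores. *)
pose v m i k := M m (n + k - m)%N i j.
have v1 m i k : 0 <= v m i k <= 1.
  rewrite /v prod_ge0 /= -(prod_sum m (n + k - m) j) (bigD1 i) //= lerDl.
  by apply: sumr_ge0 => l _; exact: prod_ge0.
have /choice[q0 hq0] : forall m, exists f : 'I_d.+1 -> R, forall i e, 0 < e -> U [set k | `|v m i k - f i| <= e].
  move=> m; have /choice[f hf] : forall i, exists l, forall e, 0 < e -> U [set k | `|v m i k - l| <= e].
    by move=> i; exact: (ultra_limit UU (v1 m i)).
  by exists f.
have hq m e : 0 < e -> U [set k | forall i, `|v m i k - q0 m i| <= e].
  by move=> e0; apply: filter_forall => i; exact: hq0.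
exists q0; split; last first.
  move=> i e e0; have [k [h1 h2]] := filter_ex (filterI hUS (hq n e e0)); exists k => //.
  by have := h2 i; rewrite /v addKn.
have D0 : 0 < d.+1%:R :> R by rewrite ltr0n.
split=> [m i|m|m i].
- apply/ler_addgt0Pr => e e0; have [k hk] := filter_ex (hq m e e0).
  by have := hk i; have /andP[a _] := v1 m i k; rewrite ler_distlC => /andP[]; lra.
- apply/eqP; rewrite -subr_eq0 -normr_le0; apply/ler_addgt0Pr => e e0; rewrite add0r.
  have e1 : 0 < e / d.+1%:R by exact: divr_gt0.
  have [k hk] := filter_ex (hq m _ e1).
  rewrite -(prod_sum m (n + k - m) j) -sumrB; apply: le_trans (ler_norm_sum _ _ _) _.
  apply: (@le_trans _ _ (\sum_(i < d.+1) e / d.+1%:R)); first by apply: ler_sum => i _; rewrite distrC; exact: hk.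
  by rewrite sumr_const card_ord -(mulr_natr (e / _)) divfK // gt_eqF.
- apply/eqP; rewrite -subr_eq0 -normr_le0; apply/ler_addgt0Pr => e e0; rewrite add0r.
  have e2 : 0 < e / 2 by exact: divr_gt0.
  have e1 : 0 < e / 2 / d.+1%:R by exact: divr_gt0.
  have [k [[h1 h2] h3]] := filter_ex (filterI (filterI (hq m _ e2) (hq m.+1 _ e1)) (hU m.+1)).
  have ev : v m i k = \sum_l P m i l * v m.+1 l k.
    rewrite /v; have -> : (n + k - m = (n + k - m.+1).+1)%N by move: h3 => /=; lia.
    by rewrite prod_left mxE.
  have PL l : P m i l <= 1.
    by rewrite -(P1 m l) (bigD1 i) //= lerDl; apply: sumr_ge0.
  have a1 : `|v m i k - q0 m i| <= e / 2 by exact: h1.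
  have a2 : `|v m i k - \sum_l P m i l * q0 m.+1 l| <= e / 2.
    rewrite ev -sumrB; apply: le_trans (ler_norm_sum _ _ _) _.
    apply: (@le_trans _ _ (\sum_(l < d.+1) e / 2 / d.+1%:R)); last first.
      by rewrite sumr_const card_ord -(mulr_natr (e / 2 / _)) divfK // gt_eqF.
    apply: ler_sum => l _; rewrite -mulrBr normrM [X in X * _]ger0_norm //.
    by apply: le_trans (ler_piMl _ (PL l)) (h2 l).
  rewrite -(subrKA (v m i k)); apply: le_trans (ler_normD _ _) _.
  by rewrite distrC; lra.
Qed.

Lemma consistent_ex : exists q, consistent q.
Proof.
have [|q [hq _]] := @consistent_limit setT 0 ord0; last by exists q.
by move=> N; exists N.
Qed.

(** Otherwise some entry stays at distance [e] from [q n i] for infinitely many [k], and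
    [consistent_limit] along these [k] yields a second consistent sequence. *)
Lemma consistent_unique_ergodic : (forall q q' n i, consistent q -> consistent q' -> q n i = q' n i) ->
  ergodic_inverse_time P.
Proof.
move=> hu n; have [q hq] := consistent_ex; have [q0 q1 _] := hq.
exists (q n); split=> // i j; apply/cvgrPdist_lt => e e0; apply: contrapT => hn.
have [|q' [hq' h]] := @consistent_limit [set k | e <= `|q n i - M n k i j|] n j.
  move=> N; apply: contrapT => hN; apply: hn; exists N => // k /= hk.
  by rewrite ltNge; apply/negP => h; apply: hN; exists k.
have e2 : 0 < e / 2 by exact: divr_gt0.
have [k /= hk h1] := h i _ e2; rewrite -(hu q q' n i hq hq') distrC in h1.
by move: hk; rewrite leNgt => /negP; apply; lra.
Qed.

End InverseTime.

Section Consistency.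
Context {d : nat} {R : realType} {th : rsubst d} {lam : R} {L : 'I_d.+1 -> R}.
Context {Hg : good th lam L}.
Local Notation tp := (theta_pow th).
Local Notation len := (len (lam := lam) (L := L)).
Local Notation tilet := ('I_d.+1 * word d)%type.
Local Notation Q := (fun n => Qprod th lam L n).

Lemma perm_theta1 b : perm_eq (tp 1 b) (th b).
Proof.
apply: uniq_perm; [exact: theta_pow_uniq|by case: (good_rs (good := Hg) b)|exact: theta_pow1].
Qed.

Lemma QprodE n a b : Q n a b = len n a / len n.+1 b *
  \sum_(w <- tp 1 b) (count_mem a w)%:R * (size (word_img (tp n) w))%:R / (size (tp n.+1 b))%:R.
Proof.
have lb : L b != 0 by rewrite gt_eqF // L_gt0.
have l0 : lam != 0 by rewrite gt_eqF // lam_gt0.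
have ln : lam ^+ n != 0 by rewrite gt_eqF // lamX_gt0.
rewrite mxE /Mprob (perm_big _ (perm_theta1 b)) /=.
have -> : len n a / len n.+1 b = L a / (lam * L b).
  by rewrite /len exprS; field; rewrite lb l0 ln.
rewrite mulrAC; congr (_ * _); apply: eq_bigr => w _; rewrite /Pprod mulrC mulrA; congr (_ / _).
Qed.

Lemma Qprod_ge0 n a b : 0 <= Q n a b.
Proof.
rewrite QprodE mulr_ge0 //; first by rewrite divr_ge0 // ltW // len_gt0.
by apply: sumr_ge0 => w _; rewrite divr_ge0 // mulr_ge0.
Qed.

Lemma Qprod_sum n b : \sum_a Q n a b = 1.
Proof.
have lb : len n.+1 b != 0 by rewrite gt_eqF // len_gt0.
have Nb : (size (tp n.+1 b))%:R != 0 :> R by rewrite gt_eqF // N_gt0.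
under eq_bigr => a _ do rewrite QprodE mulr_sumr.
rewrite exchange_big /=.
transitivity (\sum_(w <- tp 1 b) (size (word_img (tp n) w))%:R / (size (tp n.+1 b))%:R : R); last first.
  rewrite -mulr_suml; under eq_bigr => w _ do rewrite size_word_img.
  by rewrite -natr_sum -size_tpD addn1 divff.
apply: eq_big_seq => w hw.
transitivity ((\sum_a len n a * (count_mem a w)%:R) / len n.+1 b * ((size (word_img (tp n) w))%:R / (size (tp n.+1 b))%:R)).
  by rewrite !mulr_suml; apply: eq_bigr => a _; field; rewrite lb Nb.
rewrite -[RHS]mul1r; congr (_ * _).
have -> : \sum_a len n a * (count_mem a w)%:R = len n.+1 b; last by rewrite divff.
under eq_bigr => a _ do rewrite /len -mulrA.
by rewrite -mulr_sumr -Lw_count (tp_Lw (hw : w \in tp 1 b)) /len expr1 exprSr mulrA.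
Qed.

Lemma count_types n a (s : seq tilet) : {in s, forall T, T.2 \in tp n T.1} ->
  (\sum_(v <- tp n a) count_mem (a, v) s)%N = count_mem a (unzip1 s).
Proof.
elim: s => [|T s IH] h; first by rewrite big1.
rewrite big_split /= IH => [|T' hT']; last by apply: h; rewrite in_cons hT' orbT.
congr (_ + _)%N; have hT := h T (mem_head _ _).
have [e|ne] := eqVneq T.1 a.
  rewrite -e (bigD1_seq T.2) ?theta_pow_uniq //= -surjective_pairing eqxx big1 // => v hv.
  by rewrite -pair_eqE /= eqxx /= eq_sym (negbTE hv).
by rewrite big1 // => v _; rewrite -pair_eqE /= (negbTE ne).
Qed.

(** If [V] is uniform on [tp n.+1 b], the word [w] of [tp 1 b] from which it is inflated is chosen
    with probability proportional to [size (word_img (tp n) w)]: this is where the productivity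
    weights come from. The rest is [wt_sub] for one level. *)
Lemma qt_consistent (nu : probability (Ysp d R) R) : flow_invariant th L nu ->
  type_uniform (th := th) (L := L) nu -> consistent Q (qt (th := th) (L := L) nu).
Proof.
move=> Hnu TU; split=> [n i|n|n a]; first exact: qt_ge0.
  by rewrite -(sum_wt (Hg := Hg) Hnu n) sum_tiles.
have l0 k b : len k b != 0 by rewrite gt_eqF // len_gt0.
rewrite {1}/qt; under eq_bigr => v _ do rewrite (wt_sub (Hg := Hg) Hnu n 1).
rewrite exchange_big addn1 /= sum_tiles; apply: eq_bigr => b _.
have Nb : (size (tp n.+1 b))%:R != 0 :> R by rewrite gt_eqF // N_gt0.
have wE V : V \in tp n.+1 b -> wt (th := th) (L := L) nu n.+1 (b, V) = qt (th := th) (L := L) nu n.+1 b / (size (tp n.+1 b))%:R.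
  move=> hV; rewrite /qt (eq_big_seq (fun _ => wt (th := th) (L := L) nu n.+1 (b, V))) => [|V' hV']; last exact: TU.
  by rewrite big_const_seq count_predT iter_addr_0 -(mulr_natr (wt _ _ _)) mulfK.
transitivity (\sum_(V <- tp n.+1 b) qt (th := th) (L := L) nu n.+1 b / (size (tp n.+1 b))%:R * (len n a / len n.+1 b) *
    (count_mem a (unzip1 (subs (th := th) n 1 (b, V))))%:R).
  apply: eq_big_seq => V hV; rewrite -(@count_types n); last first.
    by apply: (subtiling_all (n := n) (m := 1) (a := b) (V := V)); apply: (subsP (T := (b, V))); rewrite addn1.
  by rewrite natr_sum mulr_sumr; apply: eq_bigr => v _; rewrite wE //=; field; rewrite Nb l0.
rewrite -mulr_sumr -addn1 (sum_subs n 1 b (fun ts => (count_mem a (unzip1 ts))%:R)) addn1 QprodE.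
have -> : \sum_(w <- tp 1 b) \sum_(ts <- tilelists (th := th) n w) (count_mem a (unzip1 ts))%:R =
    \sum_(w <- tp 1 b) (count_mem a w)%:R * (size (word_img (tp n) w))%:R :> R.
  apply: eq_bigr => w _; rewrite (eq_big_seq (fun _ => (count_mem a w)%:R)) => [|ts].
    by rewrite big_const_seq count_predT iter_addr_0 size_tilelists size_word_img mulr_natr.
  by rewrite mem_tilelists => /andP[/eqP-> _].
rewrite -mulr_suml; field; rewrite Nb l0 //.
Qed.

End Consistency.

(** * Construction of a uniformity measure *)

Lemma cumul_ex (R : realType) (n : nat) (f : 'I_n -> R) (u : R) : (forall i, 0 <= f i) ->
  0 <= u < \sum_i f i -> exists a : 'I_n, \sum_(b < n | (b < a)%N) f b <= u < \sum_(b < n | (b < a)%N) f b + f a.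
Proof.
move=> f0 /andP[u0 u1]; have : exists k, u < \sum_(b < n | (b < k)%N) f b.
  by exists n; rewrite (eq_bigl xpredT) // => b; rewrite ltn_ord.
case/ex_minnP => -[|k] hk hmin; first by move: hk; rewrite big_pred0 // ltNge u0.
have kn : (k < n)%N.
  rewrite ltnNge; apply/negP => nk; have := hmin n; rewrite (eq_bigl xpredT) => [|b]; last by rewrite ltn_ord.
  by move=> /(_ u1); rewrite ltnNge nk.
exists (Ordinal kn) => /=; apply/andP; split.
  by rewrite leNgt; apply/negP => /hmin; rewrite ltnn.
move: hk; rewrite (bigD1 (Ordinal kn)) //= addrC; congr (_ < _ + _).
apply: eq_bigl => b; rewrite ltnS -val_eqE /=; case: (ltngtP b k) => //.
Qed.

Lemma cumul_uniq (R : realType) (n : nat) (f : 'I_n -> R) (u : R) (a a' : 'I_n) : (forall i, 0 <= f i) ->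
  \sum_(b < n | (b < a)%N) f b <= u < \sum_(b < n | (b < a)%N) f b + f a ->
  \sum_(b < n | (b < a')%N) f b <= u < \sum_(b < n | (b < a')%N) f b + f a' -> a = a'.
Proof.
move=> f0; have key (x y : 'I_n) : (x < y)%N -> \sum_(b < n | (b < x)%N) f b + f x <= \sum_(b < n | (b < y)%N) f b.
  move=> xy; rewrite [X in _ <= X](bigD1 x) //= [X in X <= _]addrC lerD2l.
  rewrite [X in X <= _]big_mkcond [X in _ <= X]big_mkcond /=; apply: ler_sum => b _.
  case: (ltnP b x) => bx; last by case: ifP.
  by rewrite (ltn_trans bx xy) /= -val_eqE /= (ltn_eqF bx).
move=> /andP[h1 h2] /andP[h3 h4]; apply/val_inj/eqP => /=; case: ltngtP => // /key h; exfalso.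
  by have := le_lt_trans (le_trans h h3) h2; rewrite ltxx.
by have := le_lt_trans (le_trans h h1) h4; rewrite ltxx.
Qed.

Section UnitInterval.
Variable R : realType.
Local Notation RT := (measurableTypeR R).

Let mI : measurable (`[0, 1[%classic : set RT). Proof. exact: measurable_itv. Qed.

Definition unif : set RT -> \bar R := mrestr (@lebesgue_measure R) mI.

HB.instance Definition _ := Measure.on unif.

Let unifT : unif setT = 1%E.
Proof. by rewrite /unif /mrestr setTI lebesgue_measure_itv /= lte_fin ltr01 oppr0 adde0. Qed.

HB.instance Definition _ := Measure_isProbability.Build _ _ _ unif unifT.

Definition unifP : probability RT R := unif.

Lemma unif_itv (a b : R) : 0 <= a -> a <= b -> b <= 1 -> unifP [set u | a <= u < b] = (b - a)%:E.
Proof.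
move=> a0 ab b1; rewrite /unifP /= /unif /mrestr.
have -> : [set u : RT | a <= u < b] `&` `[0, 1[%classic = `[a, b[%classic.
  apply/seteqP; split=> u /=; rewrite !in_itv /=; first by case.
  by move=> /andP[h1 h2]; rewrite h1 h2; split=> //; apply/andP; split; lra.
rewrite lebesgue_measure_itv /= lte_fin; case: ltP => // ba.
by rewrite (_ : b = a) ?subrr //; apply/le_anti; rewrite ab ba.
Qed.

End UnitInterval.

Section Extension.
Context {d : nat} {R : realType}.
Variable p : word d -> R.
Hypothesis p0 : forall w, 0 <= p w.
Hypothesis p1 : p [::] = 1.
Hypothesis pR : forall w, \sum_a p (rcons w a) = p w.
Hypothesis pL : forall w, \sum_a p (a :: w) = p w.

(** Letters are added alternately on the right and on the left, so that after [(2 * r).+1] steps the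
    window is centred, with radius [r]. *)
Definition extend n (w : word d) a := if odd n then a :: w else rcons w a.

Lemma sum_extend n w : \sum_a p (extend n w a) = p w.
Proof. by rewrite /extend; case: (odd n). Qed.

Lemma size_extend n w a : size (extend n w a) = (size w).+1.
Proof. by rewrite /extend; case: (odd n); rewrite ?size_rcons. Qed.

Lemma extend_inj n w a w' a' : extend n w a = extend n w' a' -> w = w' /\ a = a'.
Proof. by rewrite /extend; case: (odd n) => [[-> ->]|/rcons_inj[-> ->]]. Qed.

Definition lower n w (a : 'I_d.+1) : R := \sum_(b < d.+1 | (b < a)%N) p (extend n w b).

(* The window read off after [n] steps, and the left end of its interval. *)
Fixpoint digits n (u : R) : word d * R :=
  if n is n'.+1 then
    let: (w, l) := digits n' u in
    let a := odflt ord0 [pick a | l + lower n' w a <= u < l + lower n' w a + p (extend n' w a)] in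
    (extend n' w a, l + lower n' w a)
  else ([::], 0).

Lemma size_digits n u : size (digits n u).1 = n.
Proof.
elim: n => //= n; case: (digits n u) => w l /= <-.
by rewrite size_extend.
Qed.

(** The interval of a window is cut into consecutive intervals of lengths [p (extend n w a)], which
    fill it by [sum_extend]; hence the window [w] is read exactly on an interval of length [p w]. *)
Lemma digits_itv n w : size w = n -> exists l, [/\ 0 <= l, l + p w <= 1 &
  forall u, 0 <= u < 1 -> ((digits n u).1 = w <-> l <= u < l + p w) /\ ((digits n u).1 = w -> (digits n u).2 = l)].
Proof.
elim: n w => [|n IH] w hw.
  exists 0; rewrite (size0nil hw) p1 add0r; split=> // u hu; split=> //.
have [w' [a ew]] : exists w' a, w = extend n w' a.
  rewrite /extend; case: (odd n); first by case: w hw => // a w' _; exists w', a.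
  by case/lastP: w hw => // w' a _; exists w', a.
have hw' : size w' = n by move: hw; rewrite ew size_extend => -[].
have [l [l0 l1 hl]] := IH w' hw'; exists (l + lower n w' a).
have low0 : 0 <= lower n w' a by exact: sumr_ge0.
have lowp : lower n w' a + p w <= p w'.
  rewrite -(sum_extend n w') /lower ew [X in _ <= X](bigID (fun b : 'I_d.+1 => (b < a)%N)) /= lerD2l.
  by rewrite [X in _ <= X](bigD1 a) /= ?ltnn // lerDl sumr_ge0.
split=> [||u hu]; [by rewrite addr_ge0|by lra|].
have [h1 h2] := hl u hu; rewrite /=.
case e : (digits n u) => [w0 l'] /=; rewrite e /= in h1 h2.
have pickE : w0 = w' -> l' = l /\ (l + lower n w' (odflt ord0 [pick a0 | l' + lower n w0 a0 <= u < l' + lower n w0 a0 + p (extend n w0 a0)])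
    <= u < l + lower n w' (odflt ord0 [pick a0 | l' + lower n w0 a0 <= u < l' + lower n w0 a0 + p (extend n w0 a0)]) +
    p (extend n w' (odflt ord0 [pick a0 | l' + lower n w0 a0 <= u < l' + lower n w0 a0 + p (extend n w0 a0)]))).
  move=> e0; have el := h2 e0; split=> //; rewrite e0 el; case: pickP => [//|hno].
  move/h1: e0 => /andP[u1 u2].
  have [|b /andP[hb1 hb2]] := @cumul_ex R d.+1 (fun b => p (extend n w' b)) (u - l) (fun b => p0 _).
    by rewrite sum_extend; apply/andP; split; lra.
  by have /negP := negbT (hno b); case; rewrite /lower; apply/andP; split; lra.
split.
  split=> [|hu'].
    rewrite ew => /extend_inj[e0 ea]; have [el] := pickE e0.
    by rewrite ea -ew.
  have e0 : w0 = w' by apply/h1; move: hu' => /andP[a1 a2]; apply/andP; split; lra.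
  have [el hpick] := pickE e0; rewrite [in RHS]ew e0; congr extend; rewrite -e0.
  apply: (@cumul_uniq R d.+1 (fun b => p (extend n w' b)) (u - l)) => //.
    by move: hpick; rewrite /lower => /andP[a1 a2]; apply/andP; split; lra.
  by move: hu'; rewrite ew /lower => /andP[a1 a2]; apply/andP; split; lra.
by rewrite ew => /extend_inj[e0 ea]; have [el _] := pickE e0; rewrite ea el e0.
Qed.

Lemma digitsS n u : exists a, (digits n.+1 u).1 = extend n (digits n u).1 a.
Proof. by rewrite /=; case: (digits n u) => w l /=; eexists. Qed.

(** Between steps [n] and [m], exactly [m./2 - n./2] letters are added on the left, which shifts the
    index. *)
Lemma digits_coherent n m u k : (n <= m)%N -> (k < n)%N ->
  nth ord0 (digits m u).1 (k + (m./2 - n./2)) = nth ord0 (digits n u).1 k.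
Proof.
move=> /subnKC <- kn; elim: (m - n)%N => [|j IH]; first by rewrite addn0 subnn addn0.
rewrite addnS; have [a ->] := digitsS (n + j) u; rewrite -IH /extend.
have h1 : (n./2 <= (n + j)./2)%N by apply: half_leq; rewrite leq_addr.
have h2 : ((n + j)./2 - n./2 <= j)%N by lia.
case: ifP => ho.
  have -> : ((n + j).+1)./2 = (n + j)./2.+1 by rewrite -uphalfE uphalf_half ho.
  by rewrite subSn // addnS.
have -> : ((n + j).+1)./2 = (n + j)./2 by rewrite -uphalfE uphalf_half ho.
by rewrite nth_rcons size_digits; case: ltnP => //; lia.
Qed.

(** [digits_itv] describes the digits on [[0, 1[]; all other points, a null set for [unif], are sent
    to 0. *)
Definition clamp (u : R) : R := if 0 <= u < 1 then u else 0.

Definition extconf (u : R) : config d := fun i =>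
  nth ord0 (digits (2 * `|i|).+1 (clamp u)).1 (absz (i + `|i|%:Z)%R).

Lemma extconf_seg u (r : nat) : seg (extconf u) (- r%:Z) (2 * r).+1 = (digits (2 * r).+1 (clamp u)).1.
Proof.
apply: (@eq_from_nth _ ord0); first by rewrite size_seg size_digits.
move=> j; rewrite size_seg => hj; rewrite nth_seg // /extconf; set i := - r%:Z + j%:Z.
rewrite -(@digits_coherent (2 * `|i|).+1 (2 * r).+1); [congr nth; rewrite /i; lia|rewrite /i; lia|rewrite /i; lia].
Qed.

Lemma measurable_extconf_seg (r : nat) w : measurable [set u : measurableTypeR R | seg (extconf u) (- r%:Z) (2 * r).+1 = w].
Proof.
have [hw|hw] := eqVneq (size w) (2 * r).+1; last first.
  rewrite (_ : [set u | _] = set0); first exact: measurable0.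
  by apply/seteqP; split=> // u /= e; move: hw; rewrite -e size_seg eqxx.
have [l [l0 l1 h]] := digits_itv hw.
have mJ a b : measurable ([set u | a <= u < b] : set (measurableTypeR R)).
  by have := measurable_itv (R := R) `[a, b[; congr measurable; apply/seteqP; split=> u /=; rewrite in_itv.
have -> : [set u : measurableTypeR R | seg (extconf u) (- r%:Z) (2 * r).+1 = w] =
    ([set u | 0 <= u < 1] `&` [set u | l <= u < l + p w]) `|`
    ((~` [set u | 0 <= u < 1]) `&` [set u | (digits (2 * r).+1 0).1 = w]).
  apply/seteqP; split=> u /=; rewrite extconf_seg /clamp.
    by case: ifP => hu e; [left; split=> //; apply/(proj1 (h u hu))|right; split=> //].
  case=> [[hu hp]|[hu hp]]; first by rewrite hu; apply/(proj1 (h u hu)).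
  by rewrite ifF //; apply/negbTE/negP.
apply: measurableU; first exact: measurableI.
by apply: measurableI; [exact: measurableC|exact: measurable_prop].
Qed.

Lemma measurable_extconf : measurable_fun setT (extconf : measurableTypeR R -> Xsp d).
Proof.
apply: (@measurability _ _ _ (Xsp d) setT _ (cylinders (d := d))) => // _ [_ [i [a ->]] <-].
rewrite setTI; set r := `|i|%N.
have -> : extconf @^-1` [set x | x i = a] = \bigcup_(w in [set w : word d | nth ord0 w (absz (i + r%:Z)%R) = a])
    [set u : measurableTypeR R | seg (extconf u) (- r%:Z) (2 * r).+1 = w].
  have key u : nth ord0 (seg (extconf u) (- r%:Z) (2 * r).+1) (absz (i + r%:Z)%R) = extconf u i.
    by rewrite nth_seg; [congr (extconf u _); rewrite /r; lia|rewrite /r; lia].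
  apply/seteqP; split=> u /=; first by move=> e; exists (seg (extconf u) (- r%:Z) (2 * r).+1); rewrite //= key.
  by case=> w /= <- <-; rewrite key.
rewrite bigcup_mkcond; apply: countable_bigcupT_measurable => [|w]; first exact: countableP.
by case: ifP => _; [exact: measurable_extconf_seg|exact: measurable0].
Qed.

End Extension.

Section WindowDetermine.
Context {d : nat} {R : realType}.

Definition words_of (n : nat) : seq (word d) := map val (enum {: n.-tuple 'I_d.+1}).

Lemma mem_words_of n w : (w \in words_of n) = (size w == n).
Proof.
apply/mapP/idP => [[t _ ->]|hw]; first by rewrite size_tuple.
by exists (Tuple hw); rewrite ?mem_enum.
Qed.

Lemma words_of_uniq n : uniq (words_of n).
Proof. by rewrite map_inj_uniq ?enum_uniq //; exact: val_inj. Qed.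

Lemma pr_window (P : probability (Xsp d) R) (W : word d -> Prop) i n :
  pr P [set x | W (seg x i n)] = \sum_(w <- words_of n | `[< W w >]) pr P [set x | seg x i n = w].
Proof.
rewrite (@pr_fibers _ (Xsp d) R P _ (words_of n) _ (fun x : Xsp d => seg x i n)); last first.
- by move=> k; exact: (measurable_window (fun w => W w /\ w = k) i n).
- exact: measurable_window.
- by move=> x _; rewrite mem_words_of size_seg.
- exact: words_of_uniq.
rewrite [RHS]big_mkcond; apply: eq_bigr => w _; case: asboolP => hw.
  by congr pr; apply/seteqP; split=> x /=; [case|move=> e; rewrite e].
by rewrite -[RHS](pr0 P); congr pr; apply/seteqP; split=> x //= [+ e]; rewrite e.
Qed.

Lemma seg_sub (x : config d) (i : int) k n m : (k + m <= n)%N ->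
  seg x (i + k%:Z) m = take m (drop k (seg x i n)).
Proof.
move=> /subnKC <-; rewrite -addnA !seg_cat drop_size_cat ?size_seg // take_size_cat ?size_seg //.
Qed.

Lemma segS (x : config d) i n : seg x i n.+1 = x i :: seg x (i + 1) n.
Proof. by rewrite -[n.+1]add1n seg_cat /seg /= addr0. Qed.

Lemma window_determine (P P' : probability (Xsp d) R) :
  (forall (r : nat) w, pr P [set x | seg x (- r%:Z) (2 * r).+1 = w] =
                       pr P' [set x | seg x (- r%:Z) (2 * r).+1 = w]) ->
  forall B, measurable B -> P B = P' B.
Proof.
move=> h B mB; pose G : set (set (Xsp d)) := [set A | exists r W, A = [set x | W (seg x (- r%:Z) (2 * r).+1)]].
have mG : G `<=` measurable by move=> _ [r [W ->]]; exact: measurable_window.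
apply: (@measure_unique _ R (Xsp d) G (fun _ => setT)) => //.
- apply/seteqP; split.
    apply: smallest_sub; first exact: smallest_sigma_algebra.
    move=> _ [i [a ->]]; apply: sub_gen_smallest; exists (absz i), (fun w => nth ord0 w (absz (i + (absz i)%:Z)) = a).
    apply/seteqP; split=> x /=; rewrite nth_seg; try lia; by congr (x _ = a); lia.
  apply: smallest_sub; first exact: sigma_algebra_measurable.
  exact: mG.
- move=> _ _ [r [W ->]] [r' [W' ->]].
  exists (maxn r r'), (fun w => W (take (2 * r).+1 (drop (maxn r r' - r) w)) /\ W' (take (2 * r').+1 (drop (maxn r r' - r') w))).
  have e s (x : Xsp d) : (s <= maxn r r')%N -> take (2 * s).+1 (drop (maxn r r' - s) (seg x (- (maxn r r')%:Z) (2 * maxn r r').+1)) =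
      seg x (- s%:Z) (2 * s).+1.
    move=> hs; rewrite -seg_sub; last lia.
    by congr (seg x); lia.
  by apply/seteqP; split=> x /=; rewrite !e ?leq_maxl ?leq_maxr.
- by move=> _; exists 0%N, (fun _ => True); apply/seteqP; split.
- by rewrite bigcup_const.
- move=> _ [r [W ->]].
  have mW := @measurable_window d W (- r%:Z) (2 * r).+1.
  apply: etrans (prE P mW) _; apply: etrans (esym (prE P' mW)).
  by congr (_%:E); rewrite !pr_window; apply: eq_bigr => w _; exact: h.
- by move=> _; apply: (@le_lt_trans _ _ (P setT)); [by []|rewrite probability_setT ltry].
Qed.

End WindowDetermine.

Section ExtensionMeasure.
Context {d : nat} {R : realType}.
Variable p : word d -> R.
Hypothesis p0 : forall w, 0 <= p w.
Hypothesis p1 : p [::] = 1.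
Hypothesis pR : forall w, \sum_a p (rcons w a) = p w.
Hypothesis pL : forall w, \sum_a p (a :: w) = p w.

Definition ext : probability (Xsp d) R :=
  distribution (unifP R) (mfun_Sub (mem_set (measurable_extconf p0 p1 pR pL))).

Lemma ext_centered (r : nat) w : size w = (2 * r).+1 ->
  pr ext [set x | seg x (- r%:Z) (2 * r).+1 = w] = p w.
Proof.
move=> hw; have [l [l0 l1 h]] := digits_itv p0 p1 pR pL hw.
transitivity (pr (unifP R) [set u | l <= u < l + p w]); last first.
  rewrite /pr unif_itv //= ?lerDl //; lra.
rewrite /pr; congr fine; rewrite /unifP /= /ext /= /distribution /pushforward /=.
rewrite /unif /mrestr; congr lebesgue_measure.
apply/seteqP; split=> u /= [e hu]; split=> //; move: hu e; rewrite in_itv /= => hu.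
  by rewrite extconf_seg /clamp hu => /(proj1 (h u hu)).
by rewrite extconf_seg /clamp hu => /(proj1 (h u hu)).
Qed.

(** Induction on the number [m] of letters that the window lacks to be the centred one of radius
    [r]; a letter is added on the left while there is room, otherwise on the right. *)
Lemma ext_window (i : int) w : pr ext [set x | seg x i (size w) = w] = p w.
Proof.
have [r hr] : exists r, r = (absz i + size w)%N by eexists.
suff h m (i' : int) (w' : word d) : - r%:Z <= i' -> i' + (size w')%:Z <= r%:Z + 1 -> ((size w' + m)%N = (2 * r).+1)%N ->
    pr ext [set x | seg x i' (size w') = w'] = p w'.
  have := h ((2 * r).+1 - size w)%N i w; move: (size w) hr => n hr; apply; lia.
elim: m i' w' => [|m IH] i' w' h1 h2 h3.
  have -> : i' = - r%:Z by lia.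
  rewrite addn0 in h3; rewrite h3; exact: ext_centered.
have mW j n (v : word d) : measurable [set x : Xsp d | seg x j n = v] by exact: (measurable_window (fun u => u = v)).
have [hi|hi] := ltP (- r%:Z) i'.
  rewrite (@pr_fibers _ (Xsp d) R ext _ (index_enum 'I_d.+1) _ (fun x : Xsp d => x (i' - 1))) ?index_enum_uniq //; last first.
    by move=> a; apply: measurableI => //; exact: measurable_config_at.
  rewrite -pL; apply: eq_bigr => a _; rewrite -(IH (i' - 1) (a :: w')) /=; try lia.
  congr pr; apply/seteqP; split=> x /=; rewrite segS subrK.
    by move=> [-> ->].
  by move=> [-> ->].
rewrite (@pr_fibers _ (Xsp d) R ext _ (index_enum 'I_d.+1) _ (fun x : Xsp d => x (i' + (size w')%:Z))) ?index_enum_uniq //; last first.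
  by move=> a; apply: measurableI => //; exact: measurable_config_at.
rewrite -pR; apply: eq_bigr => a _; rewrite -(IH i' (rcons w' a)) ?size_rcons /=; try lia.
congr pr; apply/seteqP; split=> x /=; rewrite -[(size w').+1]addn1 seg_cat cats1.
  by move=> [e ea]; rewrite e /seg /= addr0 ea -cats1.
by rewrite -cats1 /seg /= addr0 !cats1 => /rcons_inj[].
Qed.

Lemma ext_shift (B : set (Xsp d)) : measurable B -> ext (Defs.shift (d := d) @^-1` B) = ext B.
Proof.
move=> mB; have ms : measurable_fun setT (shf 1 : Xsp d -> Xsp d) by exact: measurable_shf.
pose P' : probability (Xsp d) R := distribution ext (mfun_Sub (mem_set ms)).
suff h : forall B', measurable B' -> P' B' = ext B' by exact: (h B mB).
apply: window_determine => r w; have [hw|hw] := eqVneq (size w) (2 * r).+1.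
  rewrite -hw ext_window -(ext_window (- r%:Z + 1) w) hw /pr; congr fine.
  have e : [set x : Xsp d | seg x (- r%:Z + 1) (2 * r).+1 = w] = shf 1 @^-1` [set x | seg x (- r%:Z) (2 * r).+1 = w].
    by apply/seteqP; split=> x /=; rewrite seg_shf.
  by rewrite e.
rewrite (_ : [set x | _] = set0) ?pr0 //.
by apply/seteqP; split=> // x /= e; move: hw; rewrite -e size_seg eqxx.
Qed.

End ExtensionMeasure.

(** * Word frequencies in tiles *)

Section Occurrences.
Context {d : nat}.
Implicit Types (u V w : word d) (Q : pred (word d)).

(** Start positions range over [iota 0 (size V)] also for [l = 0], so the empty word occurs [size V]
    times and the counts stay superadditive under concatenation. *)
Definition occP (l : nat) Q V : nat :=
  count (fun j => (j + l <= size V)%N && Q (take l (drop j V))) (iota 0 (size V)).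

Definition occ w V : nat := occP (size w) (pred1 w) V.

Lemma occP_le l Q V : (occP l Q V <= size V)%N.
Proof. by rewrite -[X in (_ <= X)%N](size_iota 0) count_size. Qed.

Lemma occP_cat l Q u V : (occP l Q u + occP l Q V <= occP l Q (u ++ V))%N.
Proof.
rewrite /occP size_cat iotaD count_cat leq_add //.
  apply: sub_count => j /= /andP[h1 h2]; rewrite (leq_trans h1) ?leq_addr //=.
  rewrite drop_cat; case: ltnP => hj; first by rewrite takel_cat // size_drop leq_subRL ?(ltnW hj).
  have l0 : l = 0%N by lia.
  by move: h2; rewrite l0 !take0.
rewrite [(0 + size u)%N]addnC iotaDl count_map; apply: sub_count => j /= /andP[h1 h2].
rewrite -addnA leq_add2l h1 /=; move: h2; rewrite drop_cat ltnNge leq_addr /=.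
by rewrite addnC addnK.
Qed.

Lemma occP_flatten l Q (vs : seq (word d)) : (\sum_(v <- vs) occP l Q v <= occP l Q (flatten vs))%N.
Proof.
elim: vs => [|v vs IH]; first by rewrite big_nil.
by rewrite big_cons; apply: leq_trans (occP_cat _ _ _ _); rewrite leq_add2l.
Qed.

Lemma occ_nil V : occ [::] V = size V.
Proof.
rewrite /occ /occP -[RHS](size_iota 0) -[RHS]count_predT; apply: eq_in_count => j.
by rewrite mem_iota add0n addn0 take0 /= eqxx andbT => /ltnW.
Qed.

Lemma occ1 a V : occ [:: a] V = count_mem a V.
Proof.
rewrite /occ /occP -[in RHS](mkseq_nth ord0 V) /mkseq count_map; apply: eq_in_count => j.
rewrite mem_iota add0n /= => hj; rewrite addn1 hj (drop_nth ord0 hj) /= take0.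
by rewrite eqseq_cons andbT.
Qed.

Lemma count_sum (P : pred nat) Q (f : nat -> word d) (s : seq (word d)) (r : seq nat) : uniq s ->
  (forall j, P j -> f j \in s) ->
  count (fun j => P j && Q (f j)) r = (\sum_(w <- s | Q w) count (fun j => P j && (f j == w)) r)%N.
Proof.
move=> us fs; elim: r => [|j r IH] /=; first by rewrite big1.
rewrite big_split /= IH; congr (_ + _)%N; case: (boolP (P j)) => /= hj; last by rewrite big1.
rewrite big_mkcond (bigD1_seq (f j)) ?fs //= eqxx big1 ?addn0; first by case: (Q _).
by move=> w hw; rewrite eq_sym (negbTE hw) if_same.
Qed.

Lemma occP_sum l Q V : occP l Q V = (\sum_(w <- words_of l | Q w) occ w V)%N.
Proof.
rewrite /occP (@count_sum (fun j => (j + l <= size V)%N) Q (fun j => take l (drop j V)) (words_of l)).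
- rewrite big_seq_cond [RHS]big_seq_cond; apply: eq_bigr => w /andP[]; rewrite mem_words_of => /eqP e _.
  by rewrite /occ /occP e.
- exact: words_of_uniq.
- by move=> j hj; have hl : (l <= size (drop j V))%N; rewrite ?mem_words_of ?size_takel ?eqxx // size_drop; lia.
Qed.

Lemma sum_count (s : seq nat) (F : 'I_d.+1 -> pred nat) (P : pred nat) :
  {in s, forall j, (\sum_a F a j = P j)%N} -> (\sum_a count (F a) s = count P s)%N.
Proof.
move=> h; rewrite -[RHS]sum1_count [RHS]big_mkcond [RHS]big_seq /=.
transitivity (\sum_a \sum_(j <- s) F a j)%N.
  by apply: eq_bigr => a _; rewrite -sum1_count big_mkcond.
by rewrite exchange_big big_seq; apply: eq_bigr => j /h ->.
Qed.

Lemma sum_indicator (b : bool) (c : 'I_d.+1) : (\sum_(a : 'I_d.+1) (b && (c == a)) = b)%N.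
Proof.
rewrite (bigD1 c) //= eqxx andbT big1 ?addn0 // => a /negbTE.
by rewrite eq_sym => ->; rewrite andbF.
Qed.

(** Only an occurrence at the very end of [V] has no right extension. One error per tile disappears
    in the limit taken in [word_freq_sum]. *)
Lemma sum_occ_rcons w V : (\sum_a occ (rcons w a) V <= occ w V <= (\sum_a occ (rcons w a) V).+1)%N.
Proof.
have -> : (\sum_a occ (rcons w a) V)%N =
    count (fun j => (j + size w < size V)%N && (take (size w) (drop j V) == w)) (iota 0 (size V)).
  apply: sum_count => j; rewrite mem_iota add0n /= => hj.
  rewrite -(sum_indicator _ (nth ord0 V (j + size w))); apply: eq_bigr => a _; congr nat_of_bool.
  rewrite size_rcons addnS; case: ltnP => //= h.
  by rewrite (take_nth ord0) ?size_drop; [rewrite nth_drop eqseq_rcons|lia].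
apply/andP; split.
  by apply: sub_count => j /= /andP[/ltnW -> ->].
rewrite -addn1; apply: (@leq_trans (count (predU (fun j => (j + size w < size V)%N && (take (size w) (drop j V) == w))
    (pred1 (size V - size w)%N)) (iota 0 (size V)))).
  apply: sub_count => j /= /andP[h ->]; rewrite andbT; case: ltngtP h => //= h _.
  by apply/eqP; lia.
set P1 := fun _ => _; set P2 := pred1 _; set s := iota _ _.
have := count_predUI P1 P2 s; have : (count P2 s <= 1)%N by rewrite count_uniq_mem ?iota_uniq // leq_b1.
by move=> h1 h2; apply: leq_trans (leq_addr (count (predI P1 P2) s) _) _; rewrite h2 leq_add2l.
Qed.

Lemma sum_occ_cons w V : (\sum_a occ (a :: w) V <= (occ w V).+1)%N /\ (occ w V <= (\sum_a occ (a :: w) V).+1)%N.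
Proof.
pose f j := (j + size w <= size V)%N && (take (size w) (drop j V) == w).
have -> : (\sum_a occ (a :: w) V)%N = count f (iota 1 (size V)).
  rewrite -[1%N]addn0 iotaDl count_map; apply: sum_count => j; rewrite mem_iota add0n /= => hj.
  rewrite -(sum_indicator _ (nth ord0 V j)); apply: eq_bigr => a _; congr nat_of_bool.
  rewrite /f add1n addSn addnS (drop_nth ord0 hj) /= eqseq_cons.
  by rewrite -andbA; congr (_ && _); rewrite andbC.
(* Left extensions correspond to occurrences that do not start at 0; the term [f (size V)] is
   nonzero only for the empty word. *)
have h : (f 0%N + count f (iota 1 (size V)) = occ w V + f (size V))%N.
  transitivity (count f (iota 0 (size V).+1)); first by [].
  by rewrite -[(size V).+1]addn1 iotaD count_cat /= add0n addn0.
by have := leq_b1 (f 0%N); have := leq_b1 (f (size V)); move: h; lia.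
Qed.

End Occurrences.

Section Averages.
Context {d : nat} {R : realType} {th : rsubst d} {lam : R} {L : 'I_d.+1 -> R}.
Context {Hg : good th lam L}.
Local Notation tp := (theta_pow th).
Local Notation len := (len (lam := lam) (L := L)).
Local Notation tilet := ('I_d.+1 * word d)%type.
Local Notation Q := (fun n => Qprod th lam L n).
Local Notation tiles := (tiles (th := th)).
Local Notation subs := (subs (th := th)).
Variable q : nat -> 'I_d.+1 -> R.
Hypothesis Hq : consistent Q q.

Lemma q_ge0 n a : 0 <= q n a. Proof. by case: Hq. Qed.
Lemma q_sum n : \sum_a q n a = 1. Proof. by case: Hq. Qed.

(** [q 0 a / L a] is the number of letters [a] per unit length, so this is the mean length of a
    letter; it turns out to be the normalising mass of the lift ([mu_mass]). *)
Definition roof : R := (\sum_a q 0 a / L a)^-1.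

Lemma roof_gt0 : 0 < roof.
Proof.
rewrite invr_gt0; apply: lt_le_trans (_ : (Lsum (L := L))^-1 <= _); first by rewrite invr_gt0 Lsum_gt0.
rewrite -[X in X <= _]mul1r -(q_sum 0) mulr_suml; apply: ler_sum => a _.
by rewrite ler_wpM2l ?q_ge0 // lef_pV2 ?posrE ?Lsum_gt0 ?L_gt0 // L_le_sum.
Qed.

(* The frequency, per letter of a typical configuration, of each individual level-[n] tile of type [a]. *)
Definition freq n a : R := roof * q n a / (len n a * (size (tp n a))%:R).

Lemma freqE n a : freq n a = roof * q n a / (len n a * (size (tp n a))%:R).
Proof. by []. Qed.

Lemma freq_ge0 n a : 0 <= freq n a.
Proof. by rewrite divr_ge0 // mulr_ge0 ?q_ge0 ?(ltW roof_gt0) // ltW // len_gt0. Qed.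

(** The sum of [G] over the level-[n] tiles, per letter of the configuration. It is not normalised:
    [avg n (fun=> 1)] is the number of tiles per letter and tends to 0. *)
Definition avg n (G : tilet -> R) : R := \sum_(T <- tiles n) freq n T.1 * G T.

Lemma avg_def n G : avg n G = \sum_(T <- tiles n) freq n T.1 * G T.
Proof. by []. Qed.

Lemma avgE n G : avg n G = \sum_a freq n a * \sum_(v <- tp n a) G (a, v).
Proof. by rewrite /avg sum_tiles; apply: eq_bigr => a _; rewrite mulr_sumr. Qed.

Lemma sum_tilelists n w (G : tilet -> R) :
  \sum_(ts <- tilelists (th := th) n w) \sum_(S <- ts) G S =
  (size (word_img (tp n) w))%:R * \sum_(c <- w) (\sum_(v <- tp n c) G (c, v)) / (size (tp n c))%:R.
Proof.
rewrite size_word_img -size_tilelists; elim: w => [|c w IH]; first by rewrite /= big_seq1 !big_nil mulr0.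
have N0 : (size (tp n c))%:R != 0 :> R by rewrite gt_eqF // N_gt0.
rewrite sum_tilelists_cons.
transitivity (\sum_(v <- tp n c) ((size (tilelists (th := th) n w))%:R * G (c, v) + \sum_(ts <- tilelists (th := th) n w) \sum_(S <- ts) G S)).
  apply: eq_bigr => v _; under eq_bigr => ts _ do rewrite big_cons.
  by rewrite big_split /= big_const_seq count_predT iter_addr_0 mulr_natl.
rewrite big_split /= big_const_seq count_predT iter_addr_0 -mulr_sumr IH big_cons.
have -> : size (tilelists (th := th) n (c :: w)) = (size (tp n c) * size (tilelists (th := th) n w))%N.
  by rewrite !size_tilelists big_cons.
rewrite natrM -(mulr_natl (_ * _)); field; exact: N0.
Qed.

Lemma freq_step n a : freq n a = \sum_b freq n.+1 b *
  \sum_(w <- tp 1 b) (size (word_img (tp n) w))%:R * (count_mem a w)%:R / (size (tp n a))%:R.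
Proof.
have N0 k c : (size (tp k c))%:R != 0 :> R by rewrite gt_eqF // N_gt0.
have l0 k c : len k c != 0 by rewrite gt_eqF // len_gt0.
rewrite /freq; case: Hq => _ _ ->; rewrite mulr_sumr mulr_suml; apply: eq_bigr => b _; rewrite QprodE.
have -> : \sum_(w <- tp 1 b) (count_mem a w)%:R * (size (word_img (tp n) w))%:R / (size (tp n.+1 b))%:R =
   (\sum_(w <- tp 1 b) (count_mem a w)%:R * (size (word_img (tp n) w))%:R) / (size (tp n.+1 b))%:R :> R by rewrite mulr_suml.
have -> : \sum_(w <- tp 1 b) (size (word_img (tp n) w))%:R * (count_mem a w)%:R / (size (tp n a))%:R =
   (\sum_(w <- tp 1 b) (count_mem a w)%:R * (size (word_img (tp n) w))%:R) / (size (tp n a))%:R :> R.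
  by rewrite mulr_suml; apply: eq_bigr => w _; rewrite [(size (word_img _ _))%:R * _]mulrC.
by field; rewrite !N0 !l0.
Qed.

(** The working form of consistency: going through the subtiles of all level-[n + 1] tiles counts
    every level-[n] tile once. *)
Lemma avg_step n G : avg n.+1 (fun T => \sum_(S <- subs n 1 T) G S) = avg n G.
Proof.
rewrite !avgE; have h b : \sum_(V <- tp n.+1 b) \sum_(S <- subs n 1 (b, V)) G S =
    \sum_a (\sum_(w <- tp 1 b) (size (word_img (tp n) w))%:R * (count_mem a w)%:R / (size (tp n a))%:R) * \sum_(v <- tp n a) G (a, v).
  rewrite -addn1 (sum_subs (Hg := Hg) n 1 b (fun ts => \sum_(S <- ts) G S)).
  under eq_bigr => w _ do rewrite sum_tilelists.
  under [RHS]eq_bigr => a _ do rewrite mulr_suml.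
  rewrite exchange_big /=; apply: eq_bigr => w _.
  rewrite (@big_count_mem R _ w (index_enum 'I_d.+1)) ?index_enum_uniq //; last by move=> c _; rewrite mem_index_enum.
  rewrite mulr_sumr; apply: eq_bigr => a _; ring.
under eq_bigr => b _ do rewrite h mulr_sumr.
rewrite exchange_big /=; apply: eq_bigr => a _; rewrite (freq_step n a) mulr_suml.
by apply: eq_bigr => b _; rewrite mulrA.
Qed.

Lemma subs_comp n k b V : V \in tp (n + k.+1) b ->
  subs n k.+1 (b, V) = flatten [seq subs n k T | T <- subs (n + k) 1 (b, V)].
Proof.
move=> hV; apply: subsE => /=.
have hV' : V \in tp (n + k + 1) b by rewrite addn1 -addnS.
have hsub := subsP (T := (b, V)) hV'; have [h1 h2 h3] := hsub; rewrite /= in h1 h3.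
have hs := subtiling_all hsub; set ss := subs (n + k) 1 (b, V) in h1 h3 hs *.
have : [/\ unzip1 (flatten [seq subs n k T | T <- ss]) \in word_img (tp k) (unzip1 ss),
    tiling (tp n) (unzip1 (flatten [seq subs n k T | T <- ss])) (unzip2 (flatten [seq subs n k T | T <- ss])) &
    flatten (unzip2 ss) = flatten (unzip2 (flatten [seq subs n k T | T <- ss]))].
  elim: ss hs {h1 h2 h3 hsub} => [|T ss IH] hs; first by rewrite /= mem_seq1.
  have [g1 g2 g3] := subsP (hs T (mem_head _ _)).
  have [f1 f2 f3] := IH (fun T' hT' => hs T' (mem_behead (s := T :: ss) hT')).
  rewrite /= /unzip1 /unzip2 !map_cat; split.
  - by rewrite mem_undup; apply/allpairsP; exists (unzip1 (subs n k T), unzip1 (flatten [seq subs n k T0 | T0 <- ss])).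
  - by rewrite tiling_cat ?g2 // !size_map.
  - by rewrite flatten_cat -g3 -f3.
case=> f1 f2 f3; split=> //; last by rewrite h3.
by rewrite -[k.+1](addn1 k); apply/theta_powD; exists (unzip1 ss).
Qed.

Lemma avg_eq n G G' : {in tiles n, G =1 G'} -> avg n G = avg n G'.
Proof. by move=> h; apply: eq_big_seq => T /h ->. Qed.

Lemma avg_le n G G' : {in tiles n, forall T, G T <= G' T} -> avg n G <= avg n G'.
Proof.
by move=> h; rewrite /avg big_seq [X in _ <= X]big_seq; apply: ler_sum => T /h hT; rewrite ler_wpM2l // freq_ge0.
Qed.

Lemma avg_subs n k G : avg (n + k) (fun T => \sum_(S <- subs n k T) G S) = avg n G.
Proof.
elim: k => [|k IH].
  rewrite addn0; apply: avg_eq => -[a v]; rewrite mem_tiles => hv.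
  rewrite (@subsE _ _ _ _ _ _ n 0 (a, v) [:: (a, v)]) ?big_seq1 //.
  by rewrite /subtiling /= hv cats0 inE eqxx.
rewrite -IH -[RHS]avg_step -addnS; apply: avg_eq => -[b V]; rewrite mem_tiles => hV.
by rewrite subs_comp // big_flatten big_map.
Qed.

Lemma avg_sum n (I : Type) (r : seq I) (G : I -> tilet -> R) :
  avg n (fun T => \sum_(i <- r) G i T) = \sum_(i <- r) avg n (G i).
Proof. by rewrite /avg exchange_big /=; apply: eq_bigr => T _; rewrite mulr_sumr. Qed.

Lemma avgD n G G' : avg n (fun T => G T + G' T) = avg n G + avg n G'.
Proof. by rewrite /avg -big_split /=; apply: eq_bigr => T _; rewrite mulrDr. Qed.

Lemma avg_ge0 n G : {in tiles n, forall T, 0 <= G T} -> 0 <= avg n G.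
Proof. by move=> h; rewrite /avg big_seq; apply: sumr_ge0 => T /h hT; rewrite mulr_ge0 // freq_ge0. Qed.

Lemma avg0E (G : tilet -> R) : avg 0 G = \sum_a freq 0 a * G (a, [:: a]).
Proof. by rewrite avgE; apply: eq_bigr => a _; rewrite /= big_seq1. Qed.

Lemma freq0 a : freq 0 a = roof * q 0 a / L a.
Proof. by rewrite /freq /len expr0 mul1r /= mulr1. Qed.

Lemma sum_freq0 : \sum_a freq 0 a = 1.
Proof.
have r0 : roof != 0 by rewrite gt_eqF // roof_gt0.
under eq_bigr => a _ do rewrite freq0 -mulrA.
by rewrite -mulr_sumr /roof mulVf // -invr_eq0.
Qed.

Lemma avg_len n : avg n (fun T => len n T.1) = roof.
Proof.
rewrite avgE -[RHS]mulr1 -(q_sum n) mulr_sumr; apply: eq_bigr => a _.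
rewrite /= big_const_seq count_predT iter_addr_0 -(mulr_natr (len n a)) /freq.
by field; rewrite !gt_eqF ?N_gt0 ?len_gt0.
Qed.

Lemma avg_count n (F : word d -> nat) : (forall u v, F (u ++ v) = F u + F v)%N ->
  avg n (fun T => (F T.2)%:R) = \sum_a freq 0 a * (F [:: a])%:R.
Proof.
move=> hF; have F0 : F [::] = 0%N by have := hF [::] [::]; rewrite /=; lia.
have hfl (ts : seq tilet) : F (flatten (unzip2 ts)) = (\sum_(S <- ts) F S.2)%N.
  by elim: ts => [|T ts IH] /=; rewrite ?big_nil // big_cons hF IH.
rewrite -[RHS](avg0E (fun T => (F T.2)%:R)) -(avg_subs 0 n); apply: avg_eq => T; rewrite mem_tiles => hT.
by have [_ _ ->] := subsP (n := 0) (m := n) hT; rewrite hfl natr_sum.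
Qed.

Lemma avg1_small e : 0 < e -> exists N, forall n, (N <= n)%N -> avg n (fun=> 1) <= e.
Proof.
move=> e0; have [c c0 hc] := Lmin_ex (Hg := Hg).
have [N hN] := lamX_large (Hg := Hg) (roof / (c * e)); exists N => n /hN h.
have lc : lam ^+ n * c * avg n (fun=> 1) <= roof.
  rewrite -(avg_len n) /avg mulr_sumr; apply: ler_sum => T _; rewrite mulr1 mulrC ler_wpM2l ?freq_ge0 //.
  by rewrite /len ler_wpM2l ?hc // ltW // lamX_gt0.
have lc0 : 0 < lam ^+ n * c by rewrite mulr_gt0 ?lamX_gt0.
rewrite -(ler_pM2l lc0); apply: le_trans lc _.
by move: h; rewrite ler_pdivrMr ?mulr_gt0 // mulrA.
Qed.

End Averages.

Lemma pr_decreasing dd (T : measurableType dd) (R : realType) (P : probability T R) (F : nat -> set T) (c : R) :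
  (forall n, measurable (F n)) -> (forall n, F n.+1 `<=` F n) -> (forall n, c <= pr P (F n)) ->
  c <= pr P (\bigcap_n F n).
Proof.
move=> mF dF hc; have mI : measurable (\bigcap_n F n) by exact: bigcap_measurableType.
have h : P \o F @ \oo --> P (\bigcap_n F n).
  apply: nonincreasing_cvg_mu => //.
    by apply: (@le_lt_trans _ _ (P setT)); [apply: le_measure; rewrite ?inE|rewrite probability_setT ltry].
  by apply/nonincreasing_seqP => n; apply/subsetPset.
have h' : (pr P (F n)) @[n --> \oo] --> pr P (\bigcap_n F n).
  by apply: fine_cvg; rewrite -prE.
rewrite -(cvg_lim _ h') //; apply: limr_ge; first by apply/cvg_ex; eexists; exact: h'.
by near=> n.
Unshelve. all: by end_near.
Qed.

Section Frequencies.
Context {d : nat} {R : realType} {th : rsubst d} {lam : R} {L : 'I_d.+1 -> R}.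
Context {Hg : good th lam L}.
Local Notation tp := (theta_pow th).
Local Notation X := (Xth th).
Local Notation tilet := ('I_d.+1 * word d)%type.
Local Notation tiles := (tiles (th := th)).
Local Notation subs := (subs (th := th)).
Variable q : nat -> 'I_d.+1 -> R.
Hypothesis Hq : consistent (fun n => Qprod th lam L n) q.
Local Notation avg := (avg (th := th) (lam := lam) (L := L) q).
Local Notation freq := (freq (th := th) (lam := lam) (L := L) q).
Local Notation avgle := (avg_le (Hg := Hg) Hq).

(** Occurrences across tile boundaries are ignored, which makes the frequency increase with [n]. *)
Definition wfreq n w : R := avg n (fun T => (occ w T.2)%:R).

Lemma wfreq_mono w : {homo wfreq^~ w : n m / (n <= m)%N >-> n <= m}.
Proof.
move=> n m /subnKC <-; rewrite /wfreq -(avg_subs (Hg := Hg) Hq n (m - n)); apply: avgle => T; rewrite mem_tiles => hT.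
have [_ _ ->] := subsP hT; rewrite -natr_sum ler_nat.
by apply: leq_trans (occP_flatten _ _ _); rewrite big_map.
Qed.

Lemma wfreq_nil n : wfreq n [::] = 1.
Proof.
transitivity (avg n (fun T => (size T.2)%:R)); first by apply: avg_eq => T _; rewrite occ_nil.
rewrite (avg_count (Hg := Hg) Hq n (F := size) (@size_cat _)) -[RHS](sum_freq0 (Hg := Hg) Hq).
by apply: eq_bigr => a _; rewrite mulr1.
Qed.

Lemma wfreq_letter n a : wfreq n [:: a] = freq 0 a.
Proof.
rewrite /wfreq; transitivity (avg n (fun T => (count_mem a T.2)%:R)); first by apply: avg_eq => T _; rewrite occ1.
rewrite (avg_count (Hg := Hg) Hq n (F := count_mem a)) => [|u v]; last by rewrite count_cat.
rewrite (bigD1 a) //= eqxx mulr1 big1 ?addr0 // => b /negbTE ba.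
by rewrite ba mulr0.
Qed.

Lemma wfreq_ge0 n w : 0 <= wfreq n w.
Proof. by apply: (avg_ge0 (Hg := Hg) Hq) => T _. Qed.

Lemma wfreq_le1 n w : wfreq n w <= 1.
Proof. by rewrite -(wfreq_nil n); apply: avgle => T _; rewrite ler_nat occ_nil occP_le. Qed.

Definition word_freq w : R := limn (wfreq^~ w).

Lemma wfreq_cvg w : wfreq^~ w @ \oo --> word_freq w.
Proof.
apply: nondecreasing_is_cvgn; first exact: wfreq_mono.
by exists 1 => _ [n _ <-]; exact: wfreq_le1.
Qed.

Lemma wfreq_le n w : wfreq n w <= word_freq w.
Proof. by apply: nondecreasing_cvgn_le; [exact: wfreq_mono|apply/cvg_ex; exists (word_freq w); exact: wfreq_cvg]. Qed.

Lemma word_freq_ge0 w : 0 <= word_freq w.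
Proof. exact: le_trans (wfreq_ge0 0 w) (wfreq_le 0 w). Qed.

Lemma word_freq_cst w c : (forall n, wfreq n w = c) -> word_freq w = c.
Proof. by move=> h; apply: (@cvg_lim R) => //; under eq_fun => n do rewrite h; exact: cvg_cst. Qed.

Lemma word_freq_nil : word_freq [::] = 1.
Proof. by apply: word_freq_cst => n; exact: wfreq_nil. Qed.

Lemma word_freq_letter a : word_freq [:: a] = freq 0 a.
Proof. by apply: word_freq_cst => n; exact: wfreq_letter. Qed.

(** Inside a tile the extensions of [w] miss or add at most one occurrence, an error of at most
    [avg n (fun=> 1)], which tends to 0. This gives both Kolmogorov consistency conditions. *)
Lemma word_freq_sum w (ext : 'I_d.+1 -> word d) :
  (forall V, (\sum_a occ (ext a) V <= (occ w V).+1)%N /\ (occ w V <= (\sum_a occ (ext a) V).+1)%N) ->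
  \sum_a word_freq (ext a) = word_freq w.
Proof.
move=> h; apply/eqP; rewrite -subr_eq0 -normr_le0; apply/ler_addgt0Pr => e e0; rewrite add0r.
have c1 : (fun n => \sum_a wfreq n (ext a) - wfreq n w) @ \oo --> \sum_a word_freq (ext a) - word_freq w.
  by apply: cvgB; [apply: (cvg_big add_continuous) => a _|]; exact: wfreq_cvg.
have [N hN] := avg1_small (Hg := Hg) Hq e0.
rewrite -(cvg_lim _ (cvg_norm c1)) //; apply: limr_le.
  by apply/cvg_ex; eexists; exact: cvg_norm c1.
near=> n; have hn : avg n (fun=> 1) <= e by apply: hN; near: n; exact: nbhs_infty_ge.
apply: le_trans hn; rewrite /wfreq -avg_sum ler_distl lerBlDr -!avgD; apply/andP; split; apply: avgle => T _.
  by have [_ h2] := h T.2; rewrite -natr_sum natr1 ler_nat.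
by have [h1 _] := h T.2; rewrite -natr_sum natr1 ler_nat.
Unshelve. all: by end_near.
Qed.

Lemma word_freq_rcons w : \sum_a word_freq (rcons w a) = word_freq w.
Proof.
apply: word_freq_sum => V; have /andP[h1 h2] := sum_occ_rcons w V.
by split=> //; exact: leqW.
Qed.

Lemma word_freq_cons w : \sum_a word_freq (a :: w) = word_freq w.
Proof. by apply: word_freq_sum => V; exact: sum_occ_cons. Qed.

Lemma word_freq_legal w : word_freq w != 0 -> legal th w.
Proof.
move=> hw; apply: contrapT => nl; case/negP: hw; apply/eqP; apply: word_freq_cst => n.
rewrite /wfreq avg_def big_seq big1 // => -[a V]; rewrite mem_tiles /= => hV.
suff -> : occ w V = 0%N by rewrite mulr0.
apply/eqP; rewrite -leqn0 leqNgt -has_count; apply/hasP => -[j _ /= /andP[_ /eqP e]].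
apply: nl; exists n, a, V; split=> //; apply/infixP; exists (take j V), (drop (size w) (drop j V)).
by rewrite -[X in _ ++ X ++ _]e !cat_take_drop.
Qed.

Definition uniform_measure : probability (Xsp d) R := ext word_freq_ge0 word_freq_nil word_freq_rcons word_freq_cons.
Local Notation mu := uniform_measure.

Lemma mu_window i w : pr mu [set x | seg x i (size w) = w] = word_freq w.
Proof. exact: ext_window. Qed.

End Frequencies.

(** * The constructed measure is type-uniform *)

Section UniformMeasure.
Context {d : nat} {R : realType} {th : rsubst d} {lam : R} {L : 'I_d.+1 -> R}.
Context {Hg : good th lam L}.
Local Notation tp := (theta_pow th).
Local Notation X := (Xth th).
Local Notation Y := (Yset th L).
Local Notation len := (len (lam := lam) (L := L)).
Local Notation tilet := ('I_d.+1 * word d)%type.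
Local Notation tiles := (tiles (th := th)).
Local Notation subs := (subs (th := th)).

Lemma tile_realized n b V : V \in tp n b -> exists2 y, X y & islab (th := th) n y (b, V, 0%N).
Proof.
move=> hV; have [x hx x0] := letter_in_X (Hg := Hg) b.
have /choice[w hw] : forall i, exists w, w \in tp n (x i) by move=> i; exact: tp_mem.
pose v i := if i == 0 then V else w i.
have hv i : v i \in tp n (x i) by rewrite /v; case: eqP => // ->; rewrite x0.
have [y hy] := cat_at_exists (fun i => tp_size (hv i)).
have ha : aligned (th := th) n y x v by [].
by exists y; [exact: (aligned_X (Hg := Hg) ha)|have := islab_aligned (Hg := Hg) ha; rewrite x0].
Qed.

Definition offset (ts : seq tilet) i := size (flatten (unzip2 (take i ts))).

Lemma offset_lt ts i j : {in ts, forall T, (0 < size T.2)%N} -> (i < j)%N -> (j <= size ts)%N ->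
  (offset ts i + size (nth (ord0, [::]) ts i).2 <= offset ts j)%N.
Proof.
move=> hs ij js; have e : offset ts i.+1 = (offset ts i + size (nth (ord0, [::]) ts i).2)%N.
  rewrite /offset (take_nth (ord0, [::])) ?(leq_trans ij) // /unzip2 map_rcons -cats1 flatten_cat size_cat.
  by rewrite /= cats0.
rewrite -e /offset -(subnKC ij) takeD /unzip2 map_cat flatten_cat size_cat leq_addr //.
Qed.

Lemma subtile_label n k b V (y : config d) i : islab (th := th) (n + k) y (b, V, 0%N) -> V \in tp (n + k) b ->
  (i < size (subs n k (b, V)))%N ->
  islab (th := th) n (shf (offset (subs n k (b, V)) i)%:Z y) (nth (ord0, [::]) (subs n k (b, V)) i, 0%N).
Proof.
move=> hy hV hi; set ts := subs n k (b, V) in hi *.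
have hts : subtiling (th := th) n k b V ts := subsP (T := (b, V)) hV.
have hs : {in ts, forall T, (0 < size T.2)%N}.
  by move=> T /(subtiling_all hts); exact: tp_size.
have pos_i j : (j < size ts)%N -> (0 < size (nth (ord0, [::]) ts j).2)%N by move=> hj; apply: hs; rewrite mem_nth.
have eV : offset ts (size ts) = size V by rewrite /offset take_size; case: hts => _ _ ->.
have lt : (offset ts i < size V)%N.
  by rewrite -eV; apply: leq_trans (offset_lt hs hi (leqnn _)); rewrite -addn1 leq_add2l pos_i.
have h1 := islab_shift (i := (offset ts i)%:Z) hy (add0r _) lt.
have [ts' [i' [k' [h2 h3 h4 h5]]]] := subtiling_islab (ord0, [::]) h1.
have e : ts' = ts by exact: (subtiling_uniq h2 hts).
rewrite e in h3 h4 h5; have hk := islab_lt h5; rewrite /= in hk.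
have e4 : offset ts i = (offset ts i' + k')%N by exact: h4.
have ei : i = i'.
  apply/eqP; rewrite eqn_leq; apply/andP; split; rewrite leqNgt; apply/negP => h.
    by have := offset_lt hs h (ltnW hi); rewrite e4 leq_add2l leqNgt hk.
  have : (offset ts i < offset ts i')%N.
    by apply: leq_trans (offset_lt hs h (ltnW h3)); rewrite -addn1 leq_add2l pos_i.
  by rewrite e4 -[X in (_ < X)%N]addn0 ltn_add2l.
move: e4; rewrite -ei => /eqP; rewrite -[X in X == _]addn0 eqn_add2l => /eqP k0.
by move: h5; rewrite -ei -k0.
Qed.

(** A subtile [T] of [V] that starts at distance more than [r] from the ends is the centre of a
    window of a point labelled [T]; distinct subtiles give distinct windows, and at most [2 * r]
    subtiles are too close to an end. *)
Lemma count_windows n k (r : nat) b V T : V \in tp (n + k) b ->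
  (count_mem T (subs n k (b, V)) <=
   occP (2 * r).+1 (fun w => `[< exists y, labset (th := th) n (T, 0%N) y /\ seg y (- r%:Z) (2 * r).+1 = w >]) V + 2 * r)%N.
Proof.
move=> hV; set ts := subs n k (b, V); set Q := fun w => _.
have hts : subtiling (th := th) n k b V ts := subsP (T := (b, V)) hV.
have hs : {in ts, forall T, (0 < size T.2)%N}.
  by move=> T' /(subtiling_all hts); exact: tp_size.
have eV : offset ts (size ts) = size V by rewrite /offset take_size; case: hts => _ _ ->.
pose J := [seq offset ts i | i <- iota 0 (size ts) & nth (ord0, [::]) ts i == T].
pose K := iota 0 r ++ [seq (r + j)%N | j <- iota 0 (size V) & (j + (2 * r).+1 <= size V)%N && Q (take (2 * r).+1 (drop j V))] ++
  iota (size V - r) r.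
have offlt i j : (i < j)%N -> (j <= size ts)%N -> (offset ts i < offset ts j)%N.
  move=> ij js; apply: leq_trans (offset_lt hs ij js); rewrite -addn1 leq_add2l; apply: hs.
  by rewrite mem_nth // (leq_trans ij).
have sJ : size J = count_mem T ts.
  by rewrite size_map size_filter -[in RHS](mkseq_nth (ord0, [::]) ts) /mkseq count_map.
have sK : size K = (occP (2 * r).+1 Q V + 2 * r)%N.
  by rewrite !size_cat !size_iota size_map size_filter -/(occP _ Q V); lia.
rewrite -sJ -sK; apply: uniq_leq_size.
  rewrite map_inj_in_uniq ?filter_uniq ?iota_uniq // => i j.
  rewrite !mem_filter !mem_iota !add0n => /andP[_ hi] /andP[_ hj] e.
  by case: (ltngtP i j) => // h; have := offlt _ _ h (ltnW _); rewrite e ltnn => /(_ ltac:(assumption)).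
move=> o /mapP[i]; rewrite mem_filter mem_iota add0n /= => /andP[/eqP eT hi] -> {o}.
have hlt : (offset ts i < size V)%N by rewrite -eV; exact: offlt.
rewrite !mem_cat !mem_iota add0n; case: (ltnP (offset ts i) r) => //= h1.
case: (leqP (offset ts i + r.+1) (size V)) => h2; last first.
  apply/orP; right; apply/andP; split; first by rewrite leq_subLR -ltnS addnC -addnS.
  by rewrite subnK // (leq_trans h1 (ltnW hlt)).
apply/orP; left; apply/mapP; exists (offset ts i - r)%N; last by rewrite subnKC.
have hwin : (offset ts i - r + (2 * r).+1 <= size V)%N.
  by rewrite (_ : _ + _ = offset ts i + r.+1)%N //; move: (offset ts i) h1 => o; lia.
rewrite mem_filter mem_iota add0n hwin (leq_ltn_trans (leq_subr _ _) hlt) /= andbT.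
apply/asboolP; have [y hX hy] := tile_realized hV.
exists (shf (offset ts i)%:Z y); split.
  split; first exact: Xth_shf.
  by apply: lab_eq; [exact: Xth_shf|rewrite -eT; exact: subtile_label].
have <- : seg y 0 (size V) = V by have := islab_seg hy; rewrite /= oppr0.
rewrite seg_shf -seg_sub //.
by congr (seg y); move: (offset ts i) h1 => o; lia.
Qed.

End UniformMeasure.

Section UniformMeasureProps.
Context {d : nat} {R : realType} {th : rsubst d} {lam : R} {L : 'I_d.+1 -> R}.
Context {Hg : good th lam L}.
Local Notation tp := (theta_pow th).
Local Notation X := (Xth th).
Local Notation Y := (Yset th L).
Local Notation len := (len (lam := lam) (L := L)).
Local Notation tilet := ('I_d.+1 * word d)%type.
Local Notation tiles := (tiles (th := th)).
Local Notation subs := (subs (th := th)).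
Variable q : nat -> 'I_d.+1 -> R.
Hypothesis Hq : consistent (fun n => Qprod th lam L n) q.
Local Notation avg := (avg (th := th) (lam := lam) (L := L) q).
Local Notation freq := (freq (th := th) (lam := lam) (L := L) q).
Local Notation mu := (uniform_measure (Hg := Hg) Hq).
Local Notation word_freq := (word_freq (th := th) (lam := lam) (L := L) q).

Lemma mu_windows (W : word d -> Prop) i n :
  pr mu [set x | W (seg x i n)] = \sum_(w <- words_of n | `[< W w >]) word_freq w.
Proof.
rewrite pr_window big_seq_cond [RHS]big_seq_cond; apply: eq_bigr => w /andP[].
by rewrite mem_words_of => /eqP <- _; exact: mu_window.
Qed.

Lemma mu_X : pr mu (X : set (Xsp d)) = 1.
Proof.
pose F (r : nat) : set (Xsp d) := [set x | legal th (seg x (- r%:Z) (2 * r).+1)].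
have mF r : measurable (F r) by exact: measurable_window.
have FX : \bigcap_r F r `<=` X.
  move=> x hx i m; apply: (legal_infix (w := seg x (- (absz i + m)%N%:Z) (2 * (absz i + m)).+1)); last exact: (hx _ I).
  by apply: infix_seg; lia.
have mX : measurable (X : set (Xsp d)) by exact: measurable_Xth.
have mI : measurable (\bigcap_r F r) by exact: bigcap_measurableType.
have h := pr_le mu mI mX FX; apply/le_anti; rewrite pr_le1 //=; apply: le_trans h.
apply: pr_decreasing => // [r x|r].
  by apply: legal_infix; apply: infix_seg; lia.
rewrite -[F r]setCK prC ?mu_windows; last exact: measurableC.
have -> : ~` F r = [set x | ~ legal th (seg x (- r%:Z) (2 * r).+1)] by [].
rewrite (mu_windows (fun w => ~ legal th w)) big1 ?subr0 // => w /asboolP nl.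
by apply/eqP; apply: contraPT nl => h; apply; exact: (word_freq_legal h).
Qed.

Lemma mu_in_M : in_M th mu.
Proof.
split; last by move=> B mB; exact: ext_shift.
by apply: etrans (prE mu (measurable_Xth th)) _; rewrite mu_X.
Qed.

(** [labset] is a decreasing intersection of window events, and by [count_windows] each of these is
    at least as frequent as the tile, up to a bounded error per supertile. Only this inequality is
    proved directly; equality comes from the total mass in [mu_wt]. *)
Lemma mu_labset n a v : v \in tp n a -> freq n a <= pr mu (labset (th := th) n (a, v, 0%N)).
Proof.
move=> hv; have mW r : measurable (labwin (th := th) n (a, v, 0%N) r) by exact: measurable_labwin.
rewrite labsetE setIC (pr_full mu_in_M); last exact: bigcap_measurableType.
apply: pr_decreasing => // [r x [y [h1 h2]]|r].
  exists y; split=> //; apply: seg_agree => j hj; apply: (seg_eq h2); lia.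
rewrite (mu_windows (fun w => exists y, labset (th := th) n (a, v, 0%N) y /\ seg y (- r%:Z) (2 * r).+1 = w)).
apply/ler_addgt0Pr => e e0; have e1 : 0 < e / (2 * r).+1%:R by rewrite divr_gt0.
have [N hN] := avg1_small (Hg := Hg) Hq e1; have {}hN := hN _ (leq_addl n N).
pose W' w := `[< exists y, labset (th := th) n (a, v, 0%N) y /\ seg y (- r%:Z) (2 * r).+1 = w >].
have h1 : freq n a = avg (n + N) (fun T => (count_mem (a, v) (subs n N T))%:R).
  transitivity (avg (n + N) (fun T => \sum_(S <- subs n N T) (S == (a, v))%:R)).
    rewrite (avg_subs (Hg := Hg) Hq) avg_def (bigD1_seq (a, v)) ?tiles_uniq ?mem_tiles //= eqxx mulr1.
    by rewrite big1 ?addr0 // => T /negbTE ->; rewrite mulr0.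
  by apply: avg_eq => T _; rewrite -sum1_count natr_sum [RHS]big_mkcond; apply: eq_bigr => S _ /=; case: (S == (a, v)).
have h2 : avg (n + N) (fun T => (occP (2 * r).+1 W' T.2)%:R) <= \sum_(w <- words_of (2 * r).+1 | W' w) word_freq w.
  apply: (@le_trans _ _ (\sum_(w <- words_of (2 * r).+1 | W' w) wfreq (th := th) (lam := lam) (L := L) q (n + N) w)).
    rewrite -[X in _ <= X]big_filter /wfreq -avg_sum; apply: (avg_le (Hg := Hg) Hq) => T _.
    by rewrite occP_sum natr_sum big_filter.
  by apply: ler_sum => w _; exact: (wfreq_le (Hg := Hg) Hq).
rewrite h1; apply: le_trans (lerD h2 (lexx e)).
apply: (@le_trans _ _ (avg (n + N) (fun T => (occP (2 * r).+1 W' T.2)%:R + (2 * r).+1%:R))).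
  apply: (avg_le (Hg := Hg) Hq) => -[b V]; rewrite mem_tiles => hV; rewrite -natrD ler_nat.
  by apply: leq_trans (count_windows (Hg := Hg) r (a, v) hV) _; rewrite leq_add2l.
rewrite avgD lerD2l; have -> : avg (n + N) (fun=> (2 * r).+1%:R) = (2 * r).+1%:R * avg (n + N) (fun=> 1).
  by rewrite avg_def mulr_sumr; apply: eq_bigr => T _; rewrite mulr1 mulrC.
by rewrite mulrC -ler_pdivlMr.
Qed.

Lemma mu_mass : mass (th := th) (L := L) mu = roof (L := L) q.
Proof.
have mX : measurable (X : set (Xsp d)) by exact: measurable_Xth.
rewrite massE -[RHS]mulr1 -(q_sum Hq 0) mulr_sumr; apply: eq_bigr => a _.
have -> : pr mu (letter_set (th := th) a) = freq 0 a.
  rewrite /letter_set (_ : [set x | _] = [set x | x 0 = a] `&` X); last by apply/seteqP; split=> x [].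
  rewrite (pr_full mu_in_M); last exact: measurable_config_at.
  rewrite -(word_freq_letter (Hg := Hg) Hq) -(mu_window (Hg := Hg) Hq 0 [:: a]); congr pr.
  by apply/seteqP; split=> x /=; rewrite /seg /= addr0; [move=> ->|case].
by rewrite freq0; field; rewrite gt_eqF // L_gt0.
Qed.

Local Notation P := (hullP (Hg := Hg) mu_in_M).
Local Notation wt := (wt (th := th) (L := L)).

Lemma mu_wt_ge n a v : v \in tp n a -> q n a / (size (tp n a))%:R <= wt P n (a, v).
Proof.
move=> hv; have [c c0 hc] := Lmin_ex (Hg := Hg).
have Pinv : flow_invariant th L P by exact: hull_flow_invariant.
have cl : c <= len n a.
  apply: le_trans (hc a) _; rewrite ler_peMl ?(L_ge0 a) //.
  by apply: exprn_ege1; exact/ltW/lam_gt1.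
have mA : measurable (labset (th := th) n (a, v, 0%N)) by exact: measurable_labset.
have mX : measurable (X : set (Xsp d)) by exact: measurable_Xth.
(* Below height [c], which no letter undercuts, a point of the tile lies over its first letter, so
   the slice is the set of index-0 labels times an interval. *)
have e : pr P (icell (th := th) (L := L) n (a, v) 0 c) = pr mu (labset (th := th) n (a, v, 0%N)) * c / mass (th := th) (L := L) mu.
  rewrite -(pr_full mu_in_M mA) -(sum_letter_set mu mA) mulr_suml.
  have := hull_fin (Hg := Hg) mu_in_M (A := fun _ => labset (th := th) n (a, v, 0%N)) (u := fun _ => 0) (v := fun _ => c) (fun _ => mA).
  under eq_bigr => b _ do rewrite subr0.
  move=> <-; last by move=> b; split=> //; exact: ltW.
  congr pr; apply/seteqP; split=> p /=.
    move=> [[[hX hs] hT] /andP[h1 h2]].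
    have ek : tidx (th := th) n p = 0%N.
      apply/eqP; rewrite -leqn0 leqNgt; apply/negP => k0; have hk := tidx_lt (Hg := Hg) n hX.
      move: h2; rewrite /tm ltNge => /negP; apply.
      have [hs0 _] := andP hs; rewrite -[c]add0r lerD //; move: k0 hk; rewrite hT /=.
      case: (tidx _ _) => // k _; case: (v) => //= b u _; rewrite Lw_cons.
      by apply: le_trans (hc b) _; rewrite lerDl Lw_ge0.
    have e2 : tm (th := th) (L := L) n p = p.2 by rewrite /tm ek take0 Lw_nil addr0.
    exists (p.1 0) => //; split=> //; last by rewrite -e2 h1.
    by split=> //; rewrite labE hT ek.
  move=> [b _ [[hX hl] [_ eb] /andP[h1 h2]]].
  have hT : tile (th := th) n p = (a, v) by rewrite /tile hl.
  have e2 : tm (th := th) (L := L) n p = p.2 by rewrite /tm /tidx hl take0 Lw_nil addr0.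
  split; last by rewrite /= e2 h1.
  by split=> //; split=> //; rewrite h1 (lt_le_trans h2 (hc _)).
have Nn : (size (tp n a))%:R != 0 :> R by rewrite gt_eqF // N_gt0.
have ln : 0 < len n a by exact: len_gt0.
have r0 := roof_gt0 (Hg := Hg) Hq.
have := icell_law (Hg := Hg) Pinv (n := n) (T := (a, v)) (lexx 0) (ltW c0) cl; rewrite subr0 e mu_mass /= => e'.
have -> : wt P n (a, v) = len n a / roof (L := L) q * pr mu (labset (th := th) n (a, v, 0%N)).
  have cl0 : c / len n a != 0 by rewrite gt_eqF // divr_gt0.
  by apply: (mulfI cl0); rewrite -e'; field; rewrite !gt_eqF.
apply: le_trans (ler_wpM2l (ltW (divr_gt0 ln r0)) (mu_labset hv)).
by rewrite freqE le_eqVlt; apply/orP; left; apply/eqP; field; rewrite !gt_eqF // N_gt0.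
Qed.

(** Both sides of [mu_wt_ge] sum to 1 over all tiles, so each inequality is an equality. *)
Lemma mu_wt n a v : v \in tp n a -> wt P n (a, v) = q n a / (size (tp n a))%:R.
Proof.
move=> hv; have Pinv : flow_invariant th L P by exact: hull_flow_invariant.
have hge T : T \in tiles n -> 0 <= wt P n T - q n T.1 / (size (tp n T.1))%:R.
  by case: T => b w; rewrite mem_tiles subr_ge0 => /mu_wt_ge.
have h0 : \sum_(T <- tiles n | T \in tiles n) (wt P n T - q n T.1 / (size (tp n T.1))%:R) == 0.
  rewrite -big_seq sumrB (sum_wt (Hg := Hg) Pinv) sum_tiles subr_eq0; apply/eqP; rewrite -[LHS](q_sum Hq n); apply: eq_bigr => b _.
  by rewrite /= big_const_seq count_predT iter_addr_0 -(mulr_natr (q n b / _)) divfK // gt_eqF // N_gt0.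
move: h0; rewrite psumr_eq0 => [/allP/(_ (a, v))|T]; last exact: hge.
by rewrite mem_tiles => /(_ hv) /=; rewrite hv subr_eq0 => /eqP.
Qed.

Lemma mu_type_uniform : type_uniform (th := th) (L := L) P.
Proof. by move=> n a v v' hv hv'; rewrite !mu_wt. Qed.

Lemma mu_qt n a : qt (th := th) (L := L) P n a = q n a.
Proof.
rewrite /qt (eq_big_seq (fun=> q n a / (size (tp n a))%:R)) => [|v]; last exact: mu_wt.
by rewrite big_const_seq count_predT iter_addr_0 -(mulr_natr (q n a / _)) divfK // gt_eqF // N_gt0.
Qed.

Lemma mu_uniformity : uniformity th L mu.
Proof. exact: type_uniform_uniformity mu_type_uniform. Qed.

End UniformMeasureProps.

(** * Uniqueness *)

Section UniformityMeasures.
Context {d : nat} {R : realType} {th : rsubst d} {lam : R} {L : 'I_d.+1 -> R}.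
Context {Hg : good th lam L}.
Local Notation tp := (theta_pow th).
Local Notation X := (Xth th).
Local Notation Q := (fun n => Qprod th lam L n).
Local Notation qt := (qt (th := th) (L := L)).
Local Notation TU := (type_uniform (th := th) (L := L)).

Lemma qt_determine (nu nu' : probability (Ysp d R) R) :
  flow_invariant th L nu -> flow_invariant th L nu' -> TU nu -> TU nu' ->
  (forall n a, qt nu n a = qt nu' n a) -> forall B, measurable B -> nu B = nu' B.
Proof.
move=> h h' u u' e; apply: (wt_determine (Hg := Hg) h h') => n [a v].
have [hv|hv] := boolP (v \in tp n a); last by rewrite !(wt_out (Hg := Hg)).
have wE nu0 : TU nu0 -> qt nu0 n a = (size (tp n a))%:R * wt (th := th) (L := L) nu0 n (a, v).
  move=> u0; transitivity (\sum_(w <- tp n a) wt (th := th) (L := L) nu0 n (a, w)); first by [].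
  rewrite (eq_big_seq (fun=> wt (th := th) (L := L) nu0 n (a, v))) => [|w hw]; last exact: u0.
  by rewrite big_const_seq count_predT iter_addr_0 mulr_natl.
have Nn : (size (tp n a))%:R != 0 :> R by rewrite gt_eqF // N_gt0.
by apply: (mulfI Nn); rewrite -!wE.
Qed.

Lemma qt_ext (nu nu' : probability (Ysp d R) R) n a :
  (forall B, measurable B -> nu B = nu' B) -> qt nu n a = qt nu' n a.
Proof.
move=> e; have ew v : wt (th := th) (L := L) nu n (a, v) = wt (th := th) (L := L) nu' n (a, v).
  have mc : measurable (cell (th := th) (L := L) n (a, v) setT) by exact: (measurable_cell (Hg := Hg)).
  by have := e _ mc => h; rewrite /wt /pr h.
transitivity (\sum_(w <- tp n a) wt (th := th) (L := L) nu n (a, w)); first by [].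
by apply: eq_bigr => v _; rewrite ew.
Qed.

(** The slab of height [c] over [A], below every roof, has lifted measure [mu A * c] divided by the
    mass; taking the whole space for [A] shows that the masses agree. *)
Lemma hull_inj (mu mu' : probability (Xsp d) R) (Hmu : in_M th mu) (Hmu' : in_M th mu') :
  (forall B, measurable B -> hullP (Hg := Hg) Hmu B = hullP (Hg := Hg) Hmu' B) -> forall B, measurable B -> mu B = mu' B.
Proof.
move=> h; have [c c0 hc] := Lmin_ex (Hg := Hg).
have hA (mu0 : probability (Xsp d) R) (H0 : in_M th mu0) A : measurable A ->
    pr (hullP (Hg := Hg) H0) (\bigcup_(a in [set: 'I_d.+1]) rect (th := th) A a 0 c) = pr mu0 A * c / mass (th := th) (L := L) mu0.
  move=> mA; rewrite -(pr_full H0 mA) -(sum_letter_set mu0 mA) mulr_suml.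
  rewrite (hull_fin (Hg := Hg) H0 (A := fun _ => A) (u := fun _ => 0) (v := fun _ => c) (fun _ => mA)).
    by under eq_bigr => b _ do rewrite subr0.
  by move=> b; split=> //; exact: ltW.
have he A : measurable A -> pr mu A * c / mass (th := th) (L := L) mu = pr mu' A * c / mass (th := th) (L := L) mu'.
  move=> mA; rewrite -!hA // /pr h //.
  by apply: fin_bigcup_measurable => // a _; exact: measurable_rect.
have em : mass (th := th) (L := L) mu = mass (th := th) (L := L) mu'.
  have := he _ measurableT; rewrite !prT !mul1r => /(mulfI (lt0r_neq0 c0)).
  exact: invr_inj.
move=> B mB; apply: etrans (prE mu mB) _; apply: etrans (esym (prE mu' mB)); congr (_%:E).
have := he B mB; rewrite em => /(mulIf (invr_neq0 (lt0r_neq0 (mass_gt0 (Hg := Hg) Hmu')))).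
exact: (mulIf (lt0r_neq0 c0)).
Qed.

Lemma hull_lift_eq (mu mu' : probability (Xsp d) R) : (forall B, measurable B -> mu B = mu' B) ->
  forall B, measurable B -> hull_lift th L mu B = hull_lift th L mu' B.
Proof.
move=> h; have e (B : set (Ysp d R)) : measurable B ->
    (mu \x (@lebesgue_measure R))%E B = (mu' \x (@lebesgue_measure R))%E B.
  apply: product_measure_unique => A1 A2 m1 m2.
  apply: etrans (@product_measure1E _ _ (Xsp d) (measurableTypeR R) R mu' lebesgue_measure _ _ m1 m2) _.
  by congr (_ * _)%E; exact/esym/h.
have mY : measurable (Yset th L : set (Ysp d R)) by exact: measurable_Yset.
by move=> B mB; rewrite /hull_lift !e //; exact: measurableI.
Qed.

Lemma unique_uniformity_consistent : unique_uniformity th L ->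
  forall q q' n i, consistent Q q -> consistent Q q' -> q n i = q' n i.
Proof.
move=> [mu0 [_ hu]] q q' n i hq hq'.
have e := hull_lift_eq (fun B mB => etrans (hu _ (mu_uniformity (Hg := Hg) hq) B mB) (esym (hu _ (mu_uniformity (Hg := Hg) hq') B mB))).
apply: etrans (esym (mu_qt (Hg := Hg) hq n i)) _; apply: etrans _ (mu_qt (Hg := Hg) hq' n i).
exact: (qt_ext (nu := hullP (Hg := Hg) (mu_in_M (Hg := Hg) hq)) (nu' := hullP (Hg := Hg) (mu_in_M (Hg := Hg) hq')) n i e).
Qed.

Lemma uniformity_unique_measure (mu mu' : probability (Xsp d) R) :
  (forall q q' n i, consistent Q q -> consistent Q q' -> q n i = q' n i) ->
  uniformity th L mu -> uniformity th L mu' -> forall B, measurable B -> mu B = mu' B.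
Proof.
move=> hc hmu hmu'; have M := proj1 hmu; have M' := proj1 hmu'.
apply: (hull_inj (Hmu := M) (Hmu' := M')).
have u := uniformity_type_uniform (Hg := Hg) M hmu; have u' := uniformity_type_uniform (Hg := Hg) M' hmu'.
have f := hull_flow_invariant (Hg := Hg) M; have f' := hull_flow_invariant (Hg := Hg) M'.
apply: qt_determine => // n a; apply: hc; exact: qt_consistent.
Qed.

Lemma unique_uniformity_ergodic : unique_uniformity th L <-> ergodic_inverse_time Q.
Proof.
split=> [/unique_uniformity_consistent hu|he].
  by apply: consistent_unique_ergodic => //; [exact: Qprod_ge0|exact: Qprod_sum].
have hc q q' n i (h : consistent Q q) (h' : consistent Q q') := ergodic_consistent n i he h h'.
have [q hq] := consistent_ex (P := Q) (Qprod_ge0 (Hg := Hg)) (Qprod_sum (Hg := Hg)).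
exists (uniform_measure (Hg := Hg) hq); split=> [|mu' hmu'].
  exact: mu_uniformity.
by apply: uniformity_unique_measure => //; exact: mu_uniformity.
Qed.

Lemma mme_unique (mu : probability (Xsp d) R) :
  (forall q q' n i, consistent Q q -> consistent Q q' -> q n i = q' n i) -> uniformity th L mu ->
  intrinsically_ergodic th L /\
  forall nu : probability (Ysp d R) R, is_mme th L nu ->
    forall B : set (Ysp d R), measurable B -> nu B = hull_lift th L mu B.
Proof.
move=> hc hmu; have M := proj1 hmu; have u := uniformity_type_uniform (Hg := Hg) M hmu.
have f := hull_flow_invariant (Hg := Hg) M.
have h (nu : probability (Ysp d R) R) : is_mme th L nu ->
    forall B, measurable B -> nu B = hullP (Hg := Hg) M B.
  move=> hnu; have fnu : flow_invariant th L nu by case: hnu.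
  have unu := mme_type_uniform (Hg := Hg) f u hnu.
  by apply: qt_determine => // n a; apply: hc; exact: qt_consistent.
split=> //; exists (hullP (Hg := Hg) M); split=> //; exact: type_uniform_mme.
Qed.

End UniformityMeasures.

Theorem theoremC (d : nat) (R : realType) (th : rsubst d) (lam : R) (L : 'I_d.+1 -> R) :
  is_rsubst th -> primitive_rs th -> geom_compat th lam L -> recognisable th ->
  (unique_uniformity th L <-> ergodic_inverse_time (fun n => Qprod th lam L n)) /\
  (forall mu_u : probability (Xsp d) R,
     uniformity th L mu_u ->
     (forall mu', uniformity th L mu' ->
        forall B : set (Xsp d), measurable B -> mu' B = mu_u B) ->
     intrinsically_ergodic th L /\
     forall nu : probability (Ysp d R) R, is_mme th L nu ->
       forall B : set (Ysp d R), measurable B -> nu B = hull_lift th L mu_u B).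
Proof.
move=> h1 h2 h3 h4; have Hg := Good h1 h2 h3 h4; split; first exact: unique_uniformity_ergodic.
move=> mu_u hmu hu; apply: mme_unique => //.
by apply: unique_uniformity_consistent; exists mu_u.
Qed.
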